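(* Let $\Omega\subset\mathbb{R}^N$ be a smooth bounded connected open set. For every Borel function $V:\Omega\to[0,+\infty]$, let $Z\subset\Omega$ be the universal zero-set associated to $-\Delta+V$. Then the Sobolev-open set $\Omega\setminus Z$ can be uniquely decomposed (up to relabeling) as a finite or countably infinite union of pairwise disjoint non-empty sets $(D_j)_{j\in J}$, each of which is both Sobolev-open and Sobolev-connected. Moreover, for every nonnegative $f\in L^\infty(\Omega)$ and every $w\in W_0^{1,2}(\Omega)\cap L^\infty(\Omega)$ such that $Vw\in L^1(\Omega)$ and $-\Delta w+Vw=f$ in the sense of distributions in $\Omega$, one has in each component $D_j$: either $\widehat{w}>0$ everywhere in $D_j$, or $\widehat{w}=0$ everywhere in $D_j$.
   Context: Products $Vw$ use the convention $0\cdot\infty=0$. Precise representative: a point $x\in\Omega$ is a Lebesgue point of $v\in L^1(\Omega)$ if there is $c\in\mathbb{R}$ with $\lim_{r\to0}\frac{1}{|B_r|}\int_{B_r(x)}|v-c|=0$; then $\widehat v(x):=c$. For $w$ as in the statement every point of $\Omega$ is a Lebesgue point of $w$. Universal zero-set: $Z$ is the set of points $x\in\Omega$ such that $\widehat w(x)=0$ for every $w\in W_0^{1,2}(\Omega)\cap L^\infty(\Omega)$ with $Vw\in L^1(\Omega)$ that satisfies $-\Delta w+Vw=f$ in the sense of distributions in $\Omega$ for some nonnegative $f\in L^\infty(\Omega)$. A set $O\subset\Omega$ is Sobolev-open if there exists a nonnegative $\xi\in W_0^{1,2}(\Omega)$ such that every point of $\Omega$ is a Lebesgue point of $\xi$ and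 $O=\{x\in\Omega:\widehat\xi(x)>0\}$. A set $D\subset\Omega$ is Sobolev-connected if for all disjoint Sobolev-open sets $A,B\subset\Omega$ with $D\subset A\cup B$ one has $D\subset A$ or $D\subset B$. *)

(* Defs.v *)
From HB Require Import structures.
From mathcomp Require Import all_boot all_order all_algebra.
From mathcomp Require Import all_classical all_reals all_analysis measurable_realfun.
Import Order.TTheory GRing.Theory Num.Theory.
Import numFieldNormedType.Exports.

Set Implicit Arguments.
Unset Strict Implicit.
Unset Printing Implicit Defensive.

Local Open Scope classical_set_scope.
Local Open Scope ring_scope.

Section borel_rV.
Variables (R : realType) (n : nat).

HB.instance Definition _ := @isMeasurable.Build (sigma_display (@open 'rV[R]_n))
  'rV[R]_n <<s @open 'rV[R]_n >>
  (@sigma_algebra0 _ setT (@open 'rV[R]_n)) (@sigma_algebraC _ (@open 'rV[R]_n))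
  (@sigma_algebra_bigcup _ setT (@open 'rV[R]_n)).

Lemma open_measurable_rV (U : set 'rV[R]_n) : open U -> measurable U.
Proof. exact: sub_sigma_algebra. Qed.

Lemma continuous_measurable_rV (f : 'rV[R]_n -> R) :
  continuous f -> measurable_fun setT f.
Proof.
move=> cf; apply: (measurability _ (RGenOpens.measurableE R)).
move=> _ [_ [a [b ->] <-]]; rewrite setTI.
apply: open_measurable_rV; move/continuousP: cf; apply.
exact: interval_open.
Qed.

Lemma measurable_coord (i : 'I_n) :
  measurable_fun setT (fun x : 'rV[R]_n => x 0 i).
Proof. by apply: continuous_measurable_rV; exact: coord_continuous. Qed.

Lemma open_rV_bigcup_ball (U : set 'rV[R]_n) : open U ->
  U = \bigcup_(p in [set p : 'rV[rat]_n * nat |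
        ball (map_mx ratr p.1 : 'rV[R]_n) (p.2.+1%:R^-1) `<=` U])
      ball (map_mx ratr p.1 : 'rV[R]_n) (p.2.+1%:R^-1).
Proof.
move=> oU; apply/seteqP; split => [x Ux|x [p pU px]]; last exact: pU.
have /nbhs_ballP[e /= e0 eU] : nbhs x U by exact: open_nbhs_nbhs.
have [k ke] : exists k : nat, k.+1%:R^-1 < e / 2.
  exists (Num.truncn (2 / e)); rewrite invf_plt ?posrE ?divr_gt0// invf_div.
  by rewrite truncnS_gt.
have k0 : 0 < k.+1%:R^-1 :> R by rewrite invr_gt0.
have H (i : 'I_n) : exists q : rat, `|x 0 i - ratr q| < k.+1%:R^-1.
  have /rat_in_itvoo[q] : x 0 i - k.+1%:R^-1 < x 0 i + k.+1%:R^-1.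
    by rewrite ltrBlDr -addrA ltrDl addr_gt0.
  rewrite in_itv /= => /andP[q1 q2]; exists q.
  by rewrite ltr_distlC q1.
pose q : 'rV[rat]_n := \row_i projT1 (cid (H i)).
have xq : ball (map_mx ratr q : 'rV[R]_n) k.+1%:R^-1 x.
  split => // i j; rewrite !mxE (ord1 i) /ball/= distrC.
  exact: (projT2 (cid (H j))).
exists (q, k) => //= y qy; apply: eU.
rewrite (splitr e); apply: (@ball_triangle _ _ (map_mx ratr q : 'rV[R]_n)).
  by apply/ball_sym; apply: le_ball xq; exact/ltW.
by apply: le_ball qy; exact/ltW.
Qed.

Lemma measurable_fun_rV d (T : measurableType d) (f : T -> 'rV[R]_n) :
  (forall i, measurable_fun setT (fun t => f t 0 i)) -> measurable_fun setT f.
Proof.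
move=> mf; apply: (measurability _ (erefl <<s @open 'rV[R]_n >>)).
move=> _ [U oU <-]; rewrite setTI (open_rV_bigcup_ball oU).
rewrite preimage_bigcup bigcup_mkcond; apply: countable_bigcupT_measurable => //.
move=> [q k]; case: ifPn => // _ /=.
rewrite (_ : _ @^-1` _ = \bigcap_(i in [set: 'I_n])
    ((fun t => f t 0 i) @^-1` ball (ratr (q 0 i) : R) k.+1%:R^-1)).
  apply: fin_bigcap_measurable => [|i _]; first exact: finite_finset.
  rewrite -[X in measurable X]setTI.
  by apply: mf => //; apply: open_measurable; exact: ball_open.
apply/seteqP; split => [t [_ /= h] i _|t h].
  by have := h 0 i; rewrite mxE.
by split => [|i j]; rewrite ?invr_gt0// mxE (ord1 i); exact: h.
Qed.

End borel_rV.

Section lebesgue_rV.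
Variable R : realType.

Definition rV_cons n (p : R * 'rV[R]_n) : 'rV[R]_n.+1 :=
  \row_i oapp (p.2 0) p.1 (unlift ord0 i).

Lemma measurable_rV_cons n : measurable_fun setT (@rV_cons n).
Proof.
apply: measurable_fun_rV => i; case: (unliftP ord0 i) => [j|] ->.
  rewrite [X in measurable_fun _ X](_ : _ = (fun x : 'rV[R]_n => x 0 j) \o snd).
    exact: measurableT_comp (measurable_coord j) measurable_snd.
  by apply/funext => p; rewrite mxE liftK.
rewrite [X in measurable_fun _ X](_ : _ = fst); first exact: measurable_fst.
by apply/funext => p; rewrite mxE unlift_none.
Qed.

Let rV_uncons n (x : 'rV[R]_n.+1) : R * 'rV[R]_n :=
  (x 0 ord0, \row_i x 0 (lift ord0 i)).

Let measurable_rV_uncons n : measurable_fun setT (@rV_uncons n).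
Proof.
apply/measurable_fun_pair; first exact: measurable_coord.
apply: measurable_fun_rV => i.
rewrite [X in measurable_fun _ X](_ : _ = fun x : 'rV[R]_n.+1 => x 0 (lift ord0 i)).
  exact: measurable_coord.
by apply/funext => x; rewrite mxE.
Qed.

Let rV_consK n : cancel (@rV_cons n) (@rV_uncons n).
Proof.
move=> [a x]; rewrite /rV_uncons /rV_cons mxE unlift_none; congr pair.
by apply/rowP => i; rewrite !mxE liftK.
Qed.

Section step.
Variables (n : nat) (mu : {sigma_finite_measure set 'rV[R]_n -> \bar R}).

Definition lebesgue_step : set 'rV[R]_n.+1 -> \bar R :=
  pushforward (@lebesgue_measure R \x mu)%E (@rV_cons n).

Let m0 : {measure set _ -> \bar R} :=
  measure_function_pushforward__canonical__measure_function_Measure (@lebesgue_measure R \x mu)%E (@measurable_rV_cons n).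

HB.instance Definition _ := isMeasure.Build _ _ _ lebesgue_step
  (measure0 m0) (measure_ge0 m0) (@measure_semi_sigma_additive _ _ _ m0).

Let lebesgue_step_sigma_finite : sigma_finite setT lebesgue_step.
Proof.
have /sigma_finiteP[F [TF ndF Foo]] := sigma_finiteT (@lebesgue_measure R).
have /sigma_finiteP[G [TG ndG Goo]] := sigma_finiteT mu.
exists (fun k => @rV_uncons n @^-1` (F k `*` G k)).
  apply/seteqP; split => // x _.
  have [i _ Fi] : (\bigcup_i F i) (x 0 ord0) by rewrite -TF.
  have [j _ Gj] : (\bigcup_i G i) (rV_uncons x).2 by rewrite -TG.
  exists (maxn i j) => //; split.
    by move: Fi; exact/subsetPset/ndF/leq_maxl.
  by move: Gj; exact/subsetPset/ndG/leq_maxr.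
move=> k; have [? ?] := Foo k; have [? ?] := Goo k; split.
  rewrite -[X in measurable X]setTI.
  by apply: measurable_rV_uncons => //; exact: measurableX.
rewrite /lebesgue_step /pushforward (_ : _ @^-1` _ = F k `*` G k).
  by rewrite product_measure1E// lte_mul_pinfty// ge0_fin_numE.
rewrite -comp_preimage (_ : _ \o _ = id) ?preimage_id//.
by apply/funext => p; exact: rV_consK.
Qed.

HB.instance Definition _ := Measure_isSigmaFinite.Build _ _ _ lebesgue_step
  lebesgue_step_sigma_finite.

End step.

(* Lebesgue measure on R^n: a point mass on R^0, then the product with the
   one-dimensional Lebesgue measure, transported along R x R^n = R^(n+1) *)
Fixpoint lebesgue n : {sigma_finite_measure set 'rV[R]_n -> \bar R} :=
  match n with
  | 0 => \d_(0 : 'rV[R]_0)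
  | k.+1 => lebesgue_step (lebesgue k)
  end.

Lemma lebesgue_box n (A : 'I_n -> set R) : (forall i, measurable (A i)) ->
  lebesgue n [set x : 'rV[R]_n | forall i, A i (x 0 i)] =
  (\prod_(i < n) lebesgue_measure (A i))%E.
Proof.
elim: n A => [|n IH] A mA /=.
  by rewrite big_ord0 diracE mem_set// => -[].
have mA' : measurable [set x : 'rV[R]_n | forall i, A (lift ord0 i) (x 0 i)].
  rewrite [X in measurable X](_ : _ = \bigcap_(i in [set: 'I_n])
      ((fun x : 'rV[R]_n => x 0 i) @^-1` A (lift ord0 i))).
    apply: fin_bigcap_measurable => [|i _]; first exact: finite_finset.
    by rewrite -[X in measurable X]setTI; exact: measurable_coord.
  by apply/seteqP; split => [x h i _|x h i]; exact: h.
rewrite big_ord_recl /lebesgue_step /pushforward.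
rewrite (_ : _ @^-1` _ =
    A ord0 `*` [set x : 'rV[R]_n | forall i, A (lift ord0 i) (x 0 i)]).
  by rewrite product_measure1E//; [rewrite (IH (fun i => A (lift ord0 i)))|exact: mA].
apply/seteqP; split => [p /= h|p [/= h0 h] i]; last first.
  by rewrite mxE; case: unliftP => [j ->|->]//=; exact: h.
split => [|i]; first by have := h ord0; rewrite mxE unlift_none.
by have := h (lift ord0 i); rewrite mxE liftK.
Qed.

End lebesgue_rV.

Section calculus.
Variables (R : realType) (n : nat).
Implicit Types (f u v w : 'rV[R]_n -> R) (O : set 'rV[R]_n).

Definition partial (i : 'I_n) f : 'rV[R]_n -> R := 'D_(delta_mx 0 i) f.

Definition laplacian f : 'rV[R]_n -> R :=
  fun x => \sum_i partial i (partial i f) x.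

Fixpoint Ck k f : Prop :=
  continuous f /\
  match k with
  | 0 => True
  | k'.+1 => forall i, (forall x, derivable f x (delta_mx 0 i)) /\
                       Ck k' (partial i f)
  end.

Definition smooth f := forall k, Ck k f.

Definition test_function O f := smooth f /\
  exists K, [/\ compact K, K `<=` O & forall x, ~ K x -> f x = 0].

(* the library's [ball] on 'rV is the ball of the sup norm *)
Definition eball (x : 'rV[R]_n) (r : R) : set 'rV[R]_n :=
  [set y | Num.sqrt (\sum_i (y 0 i - x 0 i) ^+ 2) < r].

End calculus.

(* The boundary of O is locally, after relabelling and reorienting the
   coordinate axes, the graph of a C^oo function g of N - 1 variables, with O
   on one side of it *)
Definition smooth_boundary (R : realType) (n : nat) (O : set 'rV[R]_n.+1) :=
  forall x, (closure O `\` O°) x ->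
  exists (r : R) (i : 'I_n.+1) (s : bool) (g : 'rV[R]_n -> R),
  [/\ 0 < r, smooth g &
    O `&` eball x r = [set y | g (col' i y) < (-1) ^+ s * y 0 i] `&` eball x r].

Section schroedinger.
Variables (R : realType) (n : nat).
Local Notation mu := (lebesgue R n).
Implicit Types (O A B D : set 'rV[R]_n) (V : 'rV[R]_n -> \bar R).
Implicit Types (u v w f : 'rV[R]_n -> R) (g : 'I_n -> 'rV[R]_n -> R).

(* Functions on O are represented by functions on R^n whose values outside O
   are never used; every a.e. class has a Borel measurable representative *)
Definition ae_nonneg O f := {ae mu, forall x, O x -> 0 <= f x}.

Definition L2 O u := measurable_fun O u /\
  mu.-integrable O (fun x => (u x ^+ 2)%:E).

Definition Linfty O u := measurable_fun O u /\
  exists M : R, {ae mu, forall x, O x -> `|u x| <= M}.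

Definition weak_gradient O u g := forall i (phi : 'rV[R]_n -> R),
  test_function O phi ->
  (\int[mu]_(x in O) (u x * partial i phi x)%:E =
   - \int[mu]_(x in O) (g i x * phi x)%:E)%E.

Definition W12 O u g :=
  [/\ L2 O u, forall i, L2 O (g i) & weak_gradient O u g].

(* W_0^{1,2}(O): the closure of the test functions in W^{1,2}(O) *)
Definition W012 O u := exists g, W12 O u g /\
  exists phi : nat -> 'rV[R]_n -> R, (forall k, test_function O (phi k)) /\
    (\int[mu]_(x in O) ((u x - phi k x) ^+ 2 +
       \sum_i (g i x - partial i (phi k) x) ^+ 2)%:E)%E @[k --> \oo] --> 0%E.

(* x is a Lebesgue point of v and the precise representative of v at x is c *)
Definition precise_value v (x : 'rV[R]_n) (c : R) :=
  ((mu (eball x r))^-1 * \int[mu]_(y in eball x r) `|v y - c|%:E)%E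
    @[r --> 0^'+] --> 0%E.

Definition lebesgue_point v x := exists c, precise_value v x c.

Definition precise_pos v x := exists2 c, 0 < c & precise_value v x c.

(* - Delta w + V w = f in the sense of distributions in O; V w is the extended
   real product, for which 0 * +oo = 0 *)
Definition distributional_solution O V w f := forall phi : 'rV[R]_n -> R,
  test_function O phi ->
  (\int[mu]_(x in O) (- (w x * laplacian phi x))%:E +
   \int[mu]_(x in O) (V x * (w x)%:E * (phi x)%:E) =
   \int[mu]_(x in O) (f x * phi x)%:E)%E.

Definition schroedinger_solution O V f w :=
  [/\ W012 O w, Linfty O w, mu.-integrable O (fun x => V x * (w x)%:E)%E &
      distributional_solution O V w f].

Definition universal_zero_set O V : set 'rV[R]_n := [set x | O x /\
  forall w f, Linfty O f -> ae_nonneg O f -> schroedinger_solution O V f w ->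
    precise_value w x 0].

Definition sobolev_open O A := exists xi,
  [/\ W012 O xi, ae_nonneg O xi, forall x, O x -> lebesgue_point xi x &
      A = [set x | O x /\ precise_pos xi x]].

Definition sobolev_connected O D := D `<=` O /\
  forall A B, sobolev_open O A -> sobolev_open O B -> A `&` B = set0 ->
    D `<=` A `|` B -> D `<=` A \/ D `<=` B.

(* A decomposition is given as the countable set of its pieces; as these are
   non-empty and disjoint, this is an indexed family up to relabelling. *)
Definition sobolev_decomposition O A (C : set (set 'rV[R]_n)) :=
  [/\ countable C, trivIset C id, \bigcup_(D in C) D = A &
      forall D, C D -> [/\ D !=set0, sobolev_open O D & sobolev_connected O D]].

End schroedinger.

(* Main.v *)
(* Mollify with compactly supported radial kernels [rho t] of scale [t] whose
   derivative in [t] is a Laplacian. For a function [u >= 0] of W_0^{1,2} with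
   [Delta u >= - M], an [M]-subsolution, the mollification of [u] at [x] plus a
   multiple of [t^2] is then nondecreasing in [t]. Hence every point of the
   domain is a Lebesgue point of [u], the precise representative of [u] is upper
   semicontinuous, and decreasing limits of [M]-subsolutions commute with taking
   precise representatives.

   A weighted series of solutions gives a solution [w0] whose support is maximal
   up to null sets. For two solutions [w] and [w'], the functions [(w - k w')^+]
   are [M]-subsolutions by Kato's inequality, and they decrease to [w 1_{w' = 0}]
   both almost everywhere and for precise representatives. With [w' = w0] this
   shows that the complement of [Z] is the set where the precise representative
   of [w0] is positive; exchanging the roles, the part of this set where that of
   [w] vanishes is Sobolev-open.

   The decomposition rests on a splitting property: if the positivity set of an
   [M]-subsolution [u] is covered by two disjoint Sobolev-open sets [A] and [B],
   then [u 1_A] is an [M]-subsolution. Indeed [u] coincides with the energy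
   minimiser below it among the functions dominated by a multiple of
   [zeta = xi + eta], where [xi] and [eta] define [A] and [B], because the
   nonnegative functional [M + Delta u] does not see the points where the precise
   representative of [zeta] vanishes. The component of a point [x] is the smallest
   of the pieces that contain [x], found by minimising the integral of [u 1_A].
   Distinct components are disjoint and have positive measure, so there are
   countably many of them; since countable unions of Sobolev-open sets are
   Sobolev-open, the decomposition is unique. *)
Require Import Defs.
From mathcomp Require Import all_boot all_order all_algebra.
From mathcomp Require Import all_classical all_reals all_analysis measurable_realfun.
From mathcomp Require Import ring lra.
Import Order.TTheory GRing.Theory Num.Theory.
Import numFieldNormedType.Exports.

Set Implicit Arguments.
Unset Strict Implicit.
Unset Printing Implicit Defensive.

Local Open Scope classical_set_scope.
Local Open Scope ring_scope.

(** * Integrable and square-integrable functions *)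

(** The sets of the theorem are defined by precise representatives at every point, while W_0^{1,2}
    sees functions only up to null sets. Relations are therefore proved almost everywhere and
    carried to every point by averages; the one passage to the limit that averages alone do not give
    is the one-sided continuity of representatives along sequences of subsolutions. [M + Delta u]
    should be a measure that ignores sets of zero capacity, but neither measure nor capacity is
    constructed. It is used only as a positive linear functional, evaluated on mollifications; these
    converge at every point of the domain, and a bounded convergence theorem for positive
    functionals takes the place of integration theory. Functions dominated by a multiple of [zeta]
    matter because, [xi] and [eta] having disjoint supports, multiplying such a function by the
    indicator of [xi > 0] amounts to taking its minimum with a multiple of [xi], which stays in
    W_0^{1,2}; for a general function the product could jump. This class is convex but not closed,
    so the minimiser is known only as a limit. *)

Lemma norm_lt_sqr (R : realType) (x e : R) : 0 < e -> x ^+ 2 < e ^+ 2 -> `|x| < e.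
Proof.
by move=> e0; rewrite -real_normK ?num_real// ltr_pXn2r// ?nnegrE// ltW.
Qed.

Lemma norm_le_sqr (R : realType) (x e : R) : 0 <= e -> x ^+ 2 <= e ^+ 2 -> `|x| <= e.
Proof. by move=> e0; rewrite -real_normK ?num_real// ler_pXn2r// nnegrE. Qed.

Lemma eq_rcvg (R : realType) (T : Type) (F : set_system T) (f g : T -> R) (a : R) :
  (forall x, f x = g x) -> f x @[x --> F] --> a -> g x @[x --> F] --> a.
Proof. by move=> /funext ->. Qed.

(** Subsequences are encoded throughout by [k <= s k], which is what choosing an index beyond each
    [k] provides and which already sends [s k] to infinity. *)
Lemma rcvg_sub (R : realType) (f : nat -> R) (s : nat -> nat) (a : R) :
  (forall k, (k <= s k)%N) -> f k @[k --> \oo] --> a -> f (s k) @[k --> \oo] --> a.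
Proof.
move=> hs fa; apply/cvgrPdist_lt => e e0.
move/cvgrPdist_lt : fa => /(_ _ e0)[K _ hK]; exists K => // k /= Kk.
by apply: hK; exact: leq_trans (hs k).
Qed.

Section real_limits.
Context (R : realType) (T : Type) (F : set_system T) {FF : Filter F}.
Implicit Types (f g : T -> R) (a b c : R).

Lemma rcvgD f g a b c : f x @[x --> F] --> a -> g x @[x --> F] --> b ->
  a + b = c -> f x + g x @[x --> F] --> c.
Proof. by move=> hf hg <-; exact: (cvgD hf hg). Qed.

Lemma rcvgB f g a b c : f x @[x --> F] --> a -> g x @[x --> F] --> b ->
  a - b = c -> f x - g x @[x --> F] --> c.
Proof. by move=> hf hg <-; exact: (cvgB hf hg). Qed.

Lemma rcvgM f g a b c : f x @[x --> F] --> a -> g x @[x --> F] --> b ->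
  a * b = c -> f x * g x @[x --> F] --> c.
Proof. by move=> hf hg <-; exact: (cvgM hf hg). Qed.

Lemma rcvgZ k f a c : f x @[x --> F] --> a -> k * a = c ->
  k * f x @[x --> F] --> c.
Proof. by move=> hf; apply: rcvgM => //; exact: cvg_cst. Qed.

Lemma rcvg_sum (J : Type) (s : seq J) (f : J -> T -> R) (a : J -> R) :
  (forall j, f j x @[x --> F] --> a j) ->
  \sum_(j <- s) f j x @[x --> F] --> \sum_(j <- s) a j.
Proof.
move=> h; elim: s => [|j s ih].
  by rewrite big_nil; under eq_fun do rewrite big_nil; exact: cvg_cst.
by rewrite big_cons; under eq_fun do rewrite big_cons; apply: rcvgD (h j) ih _.
Qed.

Lemma rcvg0_le f g : (\forall x \near F, `|f x| <= g x) ->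
  g x @[x --> F] --> (0 : R) -> f x @[x --> F] --> (0 : R).
Proof.
move=> fg g0; apply/cvgr0Pnorm_lt => e e0.
move/cvgr0Pnorm_lt : g0 => /(_ _ e0); apply: filterS2 fg => x h.
by apply: le_lt_trans; apply: le_trans h (ler_norm _).
Qed.

End real_limits.

Section positive_part.
Variable R : realType.
Implicit Types a b c d : R.

Lemma max0E a : Num.max a 0 = if 0 < a then a else 0.
Proof. by rewrite /Num.max; case: ltgtP => // ->. Qed.

Lemma max0_sub a : a = Num.max a 0 - Num.max (-1 * a) 0.
Proof. by rewrite !max0E mulN1r oppr_gt0; case: (ltgtP 0 a) => [_|_|<-]; rewrite ?subr0 ?sub0r ?opprK ?oppr0. Qed.

Lemma max0_lip a b : `|Num.max a 0 - Num.max b 0| <= `|a - b|.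
Proof.
rewrite !max0E; case: ltP => ha; case: ltP => hb; rewrite ?subrr ?normr0 ?subr0 ?sub0r//.
  by rewrite !ger0_norm; lra.
by rewrite normrN distrC !ger0_norm; lra.
Qed.

Lemma minE_max0 a b : Num.min a b = a - Num.max (a - b) 0.
Proof. by rewrite max0E subr_gt0 /Num.min; case: ltgtP => [_|_|->]; rewrite ?subr0// subKr. Qed.

End positive_part.

Section l1_l2.
Context d (T : measurableType d) (R : realType).
Variable mu : {measure set T -> \bar R}.
Implicit Types f g u v : T -> R.

Definition l1 f := mu.-integrable setT (EFin \o f).

Lemma l1_meas f : l1 f -> measurable_fun setT f.
Proof. by move=> /(measurable_int mu)/measurable_EFinP. Qed.

Lemma l1D f g : l1 f -> l1 g -> l1 (fun x => f x + g x).
Proof. by move=> hf hg; apply: (integrableD measurableT hf hg). Qed.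

Lemma l1B f g : l1 f -> l1 g -> l1 (fun x => f x - g x).
Proof. by move=> hf hg; apply: (integrableB measurableT hf hg). Qed.

Lemma l1Z (c : R) f : l1 f -> l1 (fun x => c * f x).
Proof. by move=> hf; apply: (integrableZl measurableT c hf). Qed.

Lemma l1N f : l1 f -> l1 (fun x => - f x).
Proof. by move=> hf; apply: (integrableN hf). Qed.

Lemma l1_le f g : measurable_fun setT f -> l1 g ->
  {ae mu, forall x, `|f x| <= `|g x|} -> l1 f.
Proof.
move=> mf hg fg; apply/integrableP; split; first exact/measurable_EFinP.
have /integrableP[_] := hg; apply: le_lt_trans.
apply: ae_ge0_le_integral => //.
- by do 2 apply: measurableT_comp => //.
- by do 2 apply: measurableT_comp => //; exact: l1_meas.
- by apply: filterS fg => x h _ /=; rewrite lee_fin.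
Qed.

Lemma l1_norm f : l1 f -> l1 (fun x => `|f x|).
Proof.
move=> hf; apply: (l1_le _ hf); last by apply: aeW => x /=; rewrite normr_id.
by apply: measurableT_comp => //; exact: l1_meas.
Qed.

Lemma l10 : l1 (fun=> 0).
Proof. exact: integrable0. Qed.

Lemma l1_sum (J : Type) (s : seq J) (F : J -> T -> R) :
  (forall j, l1 (F j)) -> l1 (fun x => \sum_(j <- s) F j x).
Proof.
move=> hF; elim: s => [|j s ih].
  by under eq_fun do rewrite big_nil; exact: l10.
by under eq_fun do rewrite big_cons; exact: l1D.
Qed.

Lemma integrD f g : l1 f -> l1 g ->
  \int[mu]_x (f x + g x) = \int[mu]_x f x + \int[mu]_x g x.
Proof. by move=> hf hg; exact: RintegralD. Qed.

Lemma integrB f g : l1 f -> l1 g ->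
  \int[mu]_x (f x - g x) = \int[mu]_x f x - \int[mu]_x g x.
Proof. by move=> hf hg; exact: RintegralB. Qed.

Lemma integrZ (c : R) f : l1 f -> \int[mu]_x (c * f x) = c * \int[mu]_x f x.
Proof. by move=> hf; exact: RintegralZl. Qed.

Lemma integr0 : \int[mu]_x (0 : R) = 0.
Proof. by rewrite /Rintegral integral0. Qed.

Lemma integrN f : l1 f -> \int[mu]_x (- f x) = - \int[mu]_x f x.
Proof.
by move=> hf; under eq_Rintegral do rewrite -mulN1r; rewrite integrZ// mulN1r.
Qed.

Lemma integr_sum (J : Type) (s : seq J) (F : J -> T -> R) :
  (forall j, l1 (F j)) ->
  \int[mu]_x (\sum_(j <- s) F j x) = \sum_(j <- s) \int[mu]_x F j x.
Proof.
move=> hF; elim: s => [|j s ih].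
  by under eq_Rintegral do rewrite big_nil; rewrite big_nil integr0.
under eq_Rintegral do rewrite big_cons.
by rewrite integrD// ?ih ?big_cons//; exact: l1_sum.
Qed.

Lemma integrE f : l1 f -> (\int[mu]_x f x)%:E = (\int[mu]_x (f x)%:E)%E.
Proof. by move=> hf; rewrite fineK//; exact: integrable_fin_num. Qed.

Lemma integr_ae_eq f g : measurable_fun setT f -> measurable_fun setT g ->
  {ae mu, forall x, f x = g x} -> \int[mu]_x f x = \int[mu]_x g x.
Proof.
move=> mf mg fg; congr fine; apply: ae_eq_integral => //; try exact/measurable_EFinP.
by apply: filterS fg => x -> _.
Qed.

Lemma l1_ae_eq f g : measurable_fun setT g -> {ae mu, forall x, f x = g x} ->
  l1 f -> l1 g.
Proof. by move=> mg fg hf; apply: (l1_le mg hf); apply: filterS fg => x ->. Qed.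

(** Replacing [g] by the maximum of [f] and [g] turns the almost everywhere inequality into an
    everywhere one. *)
Lemma integr_le f g : l1 f -> l1 g -> {ae mu, forall x, f x <= g x} ->
  \int[mu]_x f x <= \int[mu]_x g x.
Proof.
move=> hf hg fg.
have mh : measurable_fun setT (fun x => Num.max (f x) (g x)).
  by apply: measurable_maxr; exact: l1_meas.
have e : {ae mu, forall x, g x = Num.max (f x) (g x)}.
  by apply: filterS fg => x h; rewrite (max_idPr h).
rewrite (integr_ae_eq (l1_meas hg) mh e); apply: le_Rintegral => //.
  exact: (l1_ae_eq mh e).
by move=> x _; rewrite le_max lexx.
Qed.

Lemma integr_ge0 f : (forall x, 0 <= f x) -> 0 <= \int[mu]_x f x.
Proof. by move=> h; apply: Rintegral_ge0 => x _. Qed.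

Lemma integr_norm f : l1 f -> `|\int[mu]_x f x| <= \int[mu]_x `|f x|.
Proof. by move=> hf; apply: le_normr_Rintegral. Qed.

Lemma integr_eq0 f : l1 f -> {ae mu, forall x, 0 <= f x} ->
  \int[mu]_x f x <= 0 -> {ae mu, forall x, f x = 0}.
Proof.
move=> hf f0 If.
have hn := l1_norm hf; have en : {ae mu, forall x, f x = `|f x|}.
  by apply: filterS f0 => x h; rewrite ger0_norm.
have {}If : \int[mu]_x `|f x| = 0.
  rewrite -(integr_ae_eq (l1_meas hf) (l1_meas hn) en).
  apply/eqP; rewrite eq_le If/=.
  by rewrite (integr_ae_eq (l1_meas hf) (l1_meas hn) en) integr_ge0.
have := integrE hn; rewrite If => /esym/eqP.
have -> : (\int[mu]_x `|f x|%:E = \int[mu]_x `|(EFin \o f) x|)%E by [].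
have mf : measurable_fun setT (EFin \o f) by apply/measurable_EFinP; exact: l1_meas.
move=> /eqP /(ae_eq_integral_abs mu measurableT mf).
by apply: filterS => x /(_ Logic.I) [].
Qed.

Lemma integr_dct (F : nat -> T -> R) f g :
  (forall k, measurable_fun setT (F k)) -> measurable_fun setT f -> l1 g ->
  {ae mu, forall x, F k x @[k --> \oo] --> f x} ->
  (forall k, {ae mu, forall x, `|F k x| <= g x}) ->
  l1 f /\ \int[mu]_x F k x @[k --> \oo] --> \int[mu]_x f x.
Proof.
move=> mF mf hg Ff Fg.
have hF k : l1 (F k).
  by apply: (l1_le _ hg) => //; apply: filterS (Fg k) => x h; exact: le_trans h (ler_norm _).
have [] := @dominated_convergence _ T R mu setT measurableT (fun k => EFin \o F k)
  (EFin \o f) (EFin \o g).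
- by move=> k; exact/measurable_EFinP.
- exact/measurable_EFinP.
- by apply: filterS Ff => x h _ /=; apply: cvg_EFin => //; exact: nearW.
- exact: hg.
- by apply: filterS (ae_foralln Fg) => x h k _; rewrite lee_fin.
move=> hf _ h; split => //.
apply: fine_cvg; rewrite fineK; last exact: (integrable_fin_num measurableT hf).
exact: h.
Qed.

Definition l2 f := measurable_fun setT f /\ l1 (fun x => f x ^+ 2).

Lemma l2M f g : l2 f -> l2 g -> l1 (fun x => f x * g x).
Proof.
move=> [mf hf] [mg hg]; apply: (l1_le _ (l1D hf hg)).
  exact: measurable_funM.
apply: aeW => x; rewrite [leRHS]ger0_norm ?addr_ge0 ?sqr_ge0//.
by rewrite normrM -(real_normK (num_real (f x))) -(real_normK (num_real (g x))); nra.
Qed.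

Lemma l2D f g : l2 f -> l2 g -> l2 (fun x => f x + g x).
Proof.
move=> hf hg; have h := l2M hf hg; move: hf hg => [mf hf] [mg hg]; split.
  exact: measurable_funD.
rewrite (_ : (fun x => _) = (fun x => f x ^+ 2 + g x ^+ 2 + 2 * (f x * g x))).
  by apply: l1D; [exact: l1D|exact: l1Z].
by apply/funext => x; ring.
Qed.

Lemma l2Z (c : R) f : l2 f -> l2 (fun x => c * f x).
Proof.
move=> [mf hf]; split; first exact: measurable_funM.
by under eq_fun do rewrite exprMn; exact: l1Z.
Qed.

Lemma l2N f : l2 f -> l2 (fun x => - f x).
Proof. by move=> /(l2Z (-1)); under eq_fun do rewrite mulN1r. Qed.

Lemma l2B f g : l2 f -> l2 g -> l2 (fun x => f x - g x).
Proof. by move=> hf /l2N; exact: l2D. Qed.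

Lemma l20 : l2 (fun=> 0).
Proof. by split=> //; under eq_fun do rewrite expr0n; exact: l10. Qed.

Lemma l2_le f g : measurable_fun setT f -> l2 g ->
  {ae mu, forall x, `|f x| <= `|g x|} -> l2 f.
Proof.
move=> mf [mg hg] fg; split => //; apply: (l1_le _ hg).
  exact: measurable_funX.
by apply: filterS fg => x h; rewrite !normrX lerXn2r ?nnegrE.
Qed.

Lemma l2_norm f : l2 f -> l2 (fun x => `|f x|).
Proof.
move=> hf; apply: (l2_le _ hf); last by apply: aeW => x; rewrite normr_id.
by apply: measurableT_comp => //; case: hf.
Qed.

Lemma l2_ae_eq f g : measurable_fun setT g -> {ae mu, forall x, f x = g x} ->
  l2 f -> l2 g.
Proof. by move=> mg fg hf; apply: (l2_le mg hf); apply: filterS fg => x ->. Qed.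

(** The quadratic form [key] takes the value [a * (a * b - c ^+ 2)] at [(- c, a)]. If [a = 0] it is
    affine in [s] for [t = 1], and takes the value [-1] unless [c = 0]. *)
Lemma cauchy_schwarz f g : l2 f -> l2 g ->
  (\int[mu]_x (f x * g x)) ^+ 2 <=
  \int[mu]_x (f x ^+ 2) * \int[mu]_x (g x ^+ 2).
Proof.
move=> hf hg; set a := \int[mu]_x (f x ^+ 2); set b := \int[mu]_x (g x ^+ 2).
set c := \int[mu]_x (f x * g x).
have key (s t : R) : 0 <= s ^+ 2 * a + 2 * s * t * c + t ^+ 2 * b.
  have h1 : l1 (fun x => s ^+ 2 * f x ^+ 2) by apply: l1Z; case: hf.
  have h2 : l1 (fun x => (2 * s * t) * (f x * g x)) by apply: l1Z; exact: l2M.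
  have h3 : l1 (fun x => t ^+ 2 * g x ^+ 2) by apply: l1Z; case: hg.
  rewrite -(integrZ _ hf.2) -(integrZ _ (l2M hf hg)) -(integrZ _ hg.2).
  rewrite -integrD// -integrD//; last exact: l1D.
  apply: integr_ge0 => x.
  by rewrite (_ : _ + _ = (s * f x + t * g x) ^+ 2) ?sqr_ge0//; ring.
have a0 : 0 <= a by apply: integr_ge0 => x; exact: sqr_ge0.
have b0 : 0 <= b by apply: integr_ge0 => x; exact: sqr_ge0.
move: a0; rewrite le_eqVlt => /predU1P[a0|a0].
  have [->|c0] := eqVneq c 0; first by rewrite -a0 expr0n mul0r.
  have := key (- (b + 1) / (2 * c)) 1; rewrite -a0 !mulr0 mulr1 expr1n mul1r.
  rewrite (_ : 2 * _ * c = - (b + 1)); first lra.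
  by field.
have : 0 <= a * (a * b - c ^+ 2).
  by apply: le_trans (key (- c) a) _; rewrite le_eqVlt; apply/orP; left; apply/eqP; ring.
by rewrite pmulr_rge0// subr_ge0.
Qed.

Definition l2cvg (F : nat -> T -> R) f :=
  \int[mu]_x ((F k x - f x) ^+ 2) @[k --> \oo] --> (0 : R).

Lemma l2cvg_dot (F G : nat -> T -> R) f g :
  (forall k, l2 (F k)) -> (forall k, l2 (G k)) -> l2 f -> l2 g ->
  l2cvg F f -> l2cvg G g ->
  \int[mu]_x (F k x * G k x) @[k --> \oo] --> \int[mu]_x (f x * g x).
Proof.
move=> hF hG hf hg Ff Gg.
have E k : \int[mu]_x (F k x * G k x) = \int[mu]_x (f x * g x) +
   (\int[mu]_x ((F k x - f x) * g x) + \int[mu]_x (f x * (G k x - g x)) +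
   \int[mu]_x ((F k x - f x) * (G k x - g x))).
  have hFf := l2B (hF k) hf; have hGg := l2B (hG k) hg.
  rewrite -!integrD//; try (repeat apply: l1D); try exact: l2M.
  by apply: eq_Rintegral => x _; ring.
under eq_fun do rewrite E.
have aux (v w : nat -> T -> R) : (forall k, l2 (v k)) ->
    (forall k, l2 (w k)) ->
    \int[mu]_x (v k x ^+ 2) * \int[mu]_x (w k x ^+ 2) @[k --> \oo] --> (0 : R) ->
    \int[mu]_x (v k x * w k x) @[k --> \oo] --> (0 : R).
  move=> hv hw h0; apply/cvgr0Pnorm_lt => e e0.
  have e20 : 0 < e ^+ 2 by rewrite exprn_gt0.
  move/cvgr0Pnorm_lt : h0 => /(_ _ e20).
  apply: filterS => k h.
  apply: norm_lt_sqr => //; apply: le_lt_trans (cauchy_schwarz (hv k) (hw k)) _.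
  by apply: le_lt_trans h; exact: ler_norm.
have H : (\int[mu]_x ((F k x - f x) * g x) + \int[mu]_x (f x * (G k x - g x)) +
   \int[mu]_x ((F k x - f x) * (G k x - g x))) @[k --> \oo] --> 0 + 0 + 0.
  apply: cvgD; [apply: cvgD|]; apply: aux => //; try (by move=> k; exact: l2B).
  - by apply: (rcvgM Ff (cvg_cst _)); rewrite mul0r.
  - by apply: (rcvgZ Gg); rewrite mulr0.
  - by apply: (rcvgM Ff Gg); rewrite mulr0.
by apply: (rcvgD (cvg_cst _) H); rewrite !addr0.
Qed.

Lemma l2cvg_cst f : l2cvg (fun=> f) f.
Proof.
rewrite /l2cvg; under eq_fun do under eq_Rintegral do rewrite subrr expr0n.
by under eq_fun do rewrite integr0; exact: cvg_cst.
Qed.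

Lemma l2cvg_sq0 (F : nat -> T -> R) f (G : nat -> R) :
  (forall k, \int[mu]_x ((F k x - f x) ^+ 2) <= G k) -> G k @[k --> \oo] --> 0 ->
  l2cvg F f.
Proof.
move=> FG G0; apply: (@squeeze_cvgr _ _ _ _ (fun=> 0) _ _ _ _ _ G0).
  by apply: nearW => k; rewrite FG andbT integr_ge0// => x; exact: sqr_ge0.
exact: cvg_cst.
Qed.

Lemma l2cvgD (F G : nat -> T -> R) f g :
  (forall k, l2 (F k)) -> (forall k, l2 (G k)) -> l2 f -> l2 g ->
  l2cvg F f -> l2cvg G g ->
  l2cvg (fun k x => F k x + G k x) (fun x => f x + g x).
Proof.
move=> hF hG hf hg Ff Gg.
apply: (@l2cvg_sq0 _ _ (fun k => 2 * \int[mu]_x ((F k x - f x) ^+ 2) +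
   2 * \int[mu]_x ((G k x - g x) ^+ 2))).
  move=> k; have [hFf1 hFf] := l2B (hF k) hf; have [hGg1 hGg] := l2B (hG k) hg.
  rewrite -!integrZ// -integrD//; try exact: l1Z.
  apply: integr_le.
  - by have [] := l2B (l2D (hF k) (hG k)) (l2D hf hg).
  - by apply: l1D; exact: l1Z.
  - apply: aeW => x; rewrite -subr_ge0.
    rewrite (_ : _ - _ = ((F k x - f x) - (G k x - g x)) ^+ 2) ?sqr_ge0//; ring.
by apply: (rcvgD (rcvgZ Ff (erefl _)) (rcvgZ Gg (erefl _))); rewrite !mulr0 addr0.
Qed.

Lemma l2cvgZ (c : R) (F : nat -> T -> R) f :
  (forall k, l2 (F k)) -> l2 f -> l2cvg F f ->
  l2cvg (fun k x => c * F k x) (fun x => c * f x).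
Proof.
move=> hF hf Ff.
apply: (@l2cvg_sq0 _ _ (fun k => c ^+ 2 * \int[mu]_x ((F k x - f x) ^+ 2))).
  move=> k; have [hFf1 hFf] := l2B (hF k) hf.
  rewrite -!integrZ//; under eq_Rintegral do rewrite -mulrBr exprMn.
  exact: lexx.
by apply: (rcvgZ Ff); rewrite mulr0.
Qed.

Lemma l2cvg_dct (F : nat -> T -> R) f g :
  (forall k, measurable_fun setT (F k)) -> measurable_fun setT f -> l2 g ->
  {ae mu, forall x, F k x @[k --> \oo] --> f x} ->
  (forall k, {ae mu, forall x, `|F k x| <= g x}) ->
  l2 f /\ l2cvg F f.
Proof.
move=> mF mf hg Ff Fg.
have fg : {ae mu, forall x, `|f x| <= g x}.
  apply: filterS2 Ff (ae_foralln Fg) => x h1 h2.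
  have h3 : `|F k x| @[k --> \oo] --> `|f x| by exact: cvg_norm.
  by rewrite -(cvg_lim _ h3)//; apply: limr_le; [apply/cvg_ex; eexists; exact: h3|exact: nearW].
have hf : l2 f.
  by apply: (l2_le mf hg); apply: filterS fg => x h; exact: le_trans h (ler_norm _).
split => //; rewrite /l2cvg -integr0.
have [//|||||//] := @integr_dct (fun k x => (F k x - f x) ^+ 2) (fun=> 0)
  (fun x => 4 * g x ^+ 2).
- by move=> k; apply: measurable_funX; exact: measurable_funB.
- exact: measurable_cst.
- by apply: l1Z; case: hg.
- apply: filterS Ff => x h; have h1 : F k x - f x @[k --> \oo] --> 0 by apply: (rcvgB h (cvg_cst _)); rewrite subrr.
  by apply: (rcvgM h1 h1); rewrite mulr0.
- move=> k; apply: filterS2 fg (Fg k) => x h1 h2.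
  rewrite normrX; have : `|F k x - f x| <= 2 * g x.
    by apply: (le_trans (ler_normB _ _)); lra.
  by have := normr_ge0 (F k x - f x); nra.
Qed.

Lemma l2_bM (a b : T -> R) (C : R) : measurable_fun setT a ->
  (forall x, `|a x| <= C) -> l2 b -> l2 (fun x => a x * b x).
Proof.
move=> ma aC hb; apply: (l2_le _ (l2Z C hb)).
  by apply: measurable_funM => //; case: hb.
apply: aeW => x; rewrite !normrM ler_wpM2r//.
by apply: le_trans (aC x) (ler_norm _).
Qed.

(** The difference is [a_ * (b_ - b) + (a_ - a) * b]; the uniform bound settles the first term and
    dominated convergence the second. Convergence of [a_] is asked only where [b] is nonzero,
    because for indicators of positivity sets it fails where the limit function vanishes, and there
    its gradient [b] vanishes too. *)
Lemma l2cvg_bM (a_ b_ : nat -> T -> R) (a b : T -> R) (C : R) :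
  (forall k, measurable_fun setT (a_ k)) -> measurable_fun setT a ->
  (forall k x, `|a_ k x| <= C) -> (forall x, `|a x| <= C) ->
  {ae mu, forall x, b x <> 0 -> a_ k x @[k --> \oo] --> a x} ->
  (forall k, l2 (b_ k)) -> l2 b -> l2cvg b_ b ->
  l2cvg (fun k x => a_ k x * b_ k x) (fun x => a x * b x).
Proof.
move=> ma_ ma aC_ aC a_a hb_ hb bb.
have h1 : l2cvg (fun k x => a_ k x * (b_ k x - b x)) (fun=> 0).
  apply: (@l2cvg_sq0 _ _ (fun k => C ^+ 2 * \int[mu]_x ((b_ k x - b x) ^+ 2))).
    move=> k; have hbb := l2B (hb_ k) hb; rewrite -integrZ; last by case: hbb.
    have [_ h] := l2_bM (ma_ k) (aC_ k) hbb.
    under eq_Rintegral do rewrite subr0.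
    apply: integr_le => //; first by apply: l1Z; case: hbb.
    apply: aeW => x; rewrite exprMn ler_wpM2r ?sqr_ge0//.
    rewrite -[leLHS]real_normK ?num_real// ler_pXn2r ?nnegrE//.
    exact: le_trans (normr_ge0 _) (aC x).
  by apply: (rcvgZ bb); rewrite mulr0.
have [_ h2] : l2 (fun=> 0 : R) /\ l2cvg (fun k x => (a_ k x - a x) * b x) (fun=> 0).
  apply: (@l2cvg_dct _ _ (fun x => (2 * C) * `|b x|)).
  - move=> k; apply: measurable_funM; first exact: measurable_funB.
    by case: hb.
  - exact: measurable_cst.
  - exact/l2Z/l2_norm.
  - apply: filterS a_a => x h; have [b0|/eqP b0] := eqVneq (b x) 0.
      by under eq_fun do rewrite b0 mulr0; exact: cvg_cst.
    have h1' : a_ k x - a x @[k --> \oo] --> 0.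
      by apply: (rcvgB (h b0) (cvg_cst _)); rewrite subrr.
    by apply: (rcvgM h1' (cvg_cst _)); rewrite mul0r.
  - move=> k; apply: aeW => x; rewrite normrM ler_wpM2r//.
    apply: le_trans (ler_normB _ _) _; have := aC_ k x; have := aC x; lra.
have hk k : l2 (fun x => a_ k x * (b_ k x - b x)) by apply: (l2_bM (C := C)) => //; exact: l2B.
have hk' k : l2 (fun x => (a_ k x - a x) * b x).
  apply: (l2_bM (C := 2 * C)) => //; first exact: measurable_funB.
  move=> x; apply: le_trans (ler_normB _ _) _; have := aC_ k x; have := aC x; lra.
have h3 := l2cvgD hk hk' l20 l20 h1 h2.
apply: eq_rcvg h3 => k; apply: eq_Rintegral => x _; congr (_ ^+ 2); ring.
Qed.

Lemma l2cvg_ae_eq (F G : nat -> T -> R) f g : (forall k, l2 (F k)) -> l2 f ->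
  (forall k, measurable_fun setT (G k)) -> measurable_fun setT g ->
  (forall k, {ae mu, forall x, F k x = G k x}) -> {ae mu, forall x, f x = g x} ->
  l2cvg F f -> l2cvg G g.
Proof.
move=> hF hf mG mg FG fg; apply: eq_rcvg => k.
apply: integr_ae_eq.
- by apply: measurable_funX; apply: measurable_funB; [have [] := hF k|case: hf].
- by apply: measurable_funX; exact: measurable_funB.
- by apply: filterS2 (FG k) fg => x -> ->.
Qed.

Lemma l2cvg_sub (F : nat -> T -> R) f (s : nat -> nat) : (forall k, (k <= s k)%N) ->
  l2cvg F f -> l2cvg (fun k => F (s k)) f.
Proof.
exact: rcvg_sub.
Qed.

(* Borel-Cantelli: the functions [F k] are summable at almost every point. *)
Lemma ae_cvg0_of_integr_le (F : nat -> T -> R) : (forall k, l1 (F k)) ->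
  (forall k x, 0 <= F k x) -> (forall k, \int[mu]_x F k x <= (2^-1) ^+ k) ->
  {ae mu, forall x, F k x @[k --> \oo] --> 0}.
Proof.
move=> hF F0 IF.
have mF k : measurable_fun setT (EFin \o F k) by exact: (measurable_int mu (hF k)).
have h : (\int[mu]_x (\sum_(k <oo) (F k x)%:E) < +oo)%E.
  rewrite integral_nneseries//; last by move=> k x _; rewrite lee_fin.
  apply: (@le_lt_trans _ _ (\sum_(k <oo) ((1 : R) / (2 ^ k.+1)%:R * 2)%:E)%E).
    apply: lee_nneseries => [k _ _|k _]; first by apply: integral_ge0 => x _; rewrite lee_fin.
    rewrite -integrE// lee_fin; apply: (le_trans (IF k)).
    by rewrite exprVn expnS natrM mul1r invfM mulrAC mulVf ?mul1r ?natrX ?lexx// pnatr_eq0.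
  under eq_eseriesr do rewrite EFinM muleC.
  rewrite nneseriesZl; last by move=> k _; rewrite lee_fin divr_ge0.
  have h := @epsilon_trick0 R 1 xpredT ler01.
  apply: (@le_lt_trans _ _ (2%:E * 1%:E)%E).
    by apply: lee_pmul => //; apply: nneseries_ge0 => k _ _; rewrite lee_fin divr_ge0.
  by rewrite -EFinM ltry.
have mS : measurable_fun setT (fun x => \sum_(k <oo) (F k x)%:E)%E.
  by apply: ge0_emeasurable_sum => [k x _ _|k _]; [rewrite lee_fin|exact: mF].
have hS : mu.-integrable setT (fun x => \sum_(k <oo) (F k x)%:E)%E.
  apply/integrableP; split => //.
  under eq_integral => x _.
    rewrite gee0_abs; last by apply: nneseries_ge0 => k _ _; rewrite lee_fin.
    over.
  exact: h.
apply: filterS (integrable_ae measurableT hS) => x /(_ Logic.I) hx.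
apply: cvg_series_cvg_0; apply: (@nondecreasing_is_cvgn R (series (F ^~ x))).
  by apply: nondecreasing_series => k _ _.
exists (fine (\sum_(k <oo) (F k x)%:E)%E) => _ [k _ <-].
rewrite -lee_fin fineK// /series/= -sumEFin.
by apply: nneseries_lim_ge => j _; rewrite lee_fin.
Qed.

Lemma l2cvg_ae (F : nat -> T -> R) f : (forall k, l2 (F k)) -> l2 f ->
  l2cvg F f ->
  exists2 s : nat -> nat, (forall k, (k <= s k)%N) &
    {ae mu, forall x, F (s k) x @[k --> \oo] --> f x}.
Proof.
move=> hF hf Ff.
have H k : exists m, (k <= m)%N /\
    \int[mu]_x ((F m x - f x) ^+ 2) <= (2^-1) ^+ k.
  have e0 : 0 < (2^-1 : R) ^+ k by rewrite exprn_gt0.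
  move/cvgr0Pnorm_lt : Ff => /(_ _ e0) [m _ h]; exists (maxn k m).
  rewrite leq_maxl; split => //; apply: le_trans (ler_norm _) _.
  by apply/ltW/h => /=; exact: leq_maxr.
have [s hs] := choice H; exists s; first by move=> k; have [] := hs k.
have := @ae_cvg0_of_integr_le (fun k x => (F (s k) x - f x) ^+ 2).
have h1 k : l1 (fun x => (F (s k) x - f x) ^+ 2) by have [] := l2B (hF (s k)) hf.
move=> /(_ h1 (fun k x => sqr_ge0 _) (fun k => (hs k).2)).
apply: filterS => x h; apply/cvgrPdist_lt => e e0.
have e20 : 0 < e ^+ 2 by rewrite exprn_gt0.
move/cvgr0Pnorm_lt : h => /(_ _ e20); apply: filterS => k.
rewrite normrX distrC real_normK ?num_real// => h.
exact: norm_lt_sqr.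
Qed.

Lemma fatou_sq (F : nat -> T -> R) f (c : R) : (forall k, l2 (F k)) ->
  measurable_fun setT f -> {ae mu, forall x, F k x @[k --> \oo] --> f x} ->
  (\forall k \near \oo, \int[mu]_x (F k x ^+ 2) <= c) ->
  l2 f /\ \int[mu]_x (f x ^+ 2) <= c.
Proof.
move=> hF mf Ff Fc.
have mF2 k : measurable_fun setT (fun x => (F k x ^+ 2)%:E).
  by apply/measurable_EFinP; apply: measurable_funX; have [] := hF k.
have := @fatou _ T R mu setT measurableT (fun k x => (F k x ^+ 2)%:E) mF2
  (fun k x _ => sqr_ge0 _).
have -> : (\int[mu]_x limn_einf (fun k => (F k x ^+ 2)%:E) =
           \int[mu]_x (f x ^+ 2)%:E)%E.
  apply: ae_eq_integral => //.
  - rewrite /limn_einf; apply: measurableT_comp => //; apply: measurable_fun_limn_esup => k; exact: measurableT_comp.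
  - by apply/measurable_EFinP; exact: measurable_funX.
  - apply: filterS Ff => x h _.
    have h2 : (F k x ^+ 2)%:E @[k --> \oo] --> (f x ^+ 2)%:E.
      by apply: cvg_EFin; [exact: nearW|exact: (cvgM h h)].
    by rewrite is_cvg_limn_einfE ?(cvg_lim _ h2)//; apply/cvg_ex; eexists; exact: h2.
move=> h; have {}h : (\int[mu]_x (f x ^+ 2)%:E <= c%:E)%E.
  apply: (le_trans h); rewrite limn_einf_lim; apply: lime_le; first exact: is_cvg_einfs.
  case: Fc => K _ hK; apply: nearW => k.
  apply: (@le_trans _ _ (\int[mu]_x (F (maxn k K) x ^+ 2)%:E)%E).
    by apply: ereal_inf_lbound; exists (maxn k K) => //=; exact: leq_maxl.
  by rewrite -integrE ?lee_fin; [apply: hK; exact: leq_maxr|have [] := hF (maxn k K)].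
have hf : l2 f.
  split => //; apply/integrableP; split.
    by apply/measurable_EFinP; exact: measurable_funX.
  under eq_integral do rewrite /= ger0_norm ?sqr_ge0//.
  exact: le_lt_trans h (ltry _).
by split => //; rewrite -lee_fin integrE//; case: hf.
Qed.

(** Along a subsequence with squared increments of integral at most [4^-1 ^+ k], the weighted
    squares [D] have integral at most [2^-1 ^+ k] and tend to [0] almost everywhere, so the
    increments decay geometrically. Fatou's lemma then shows that the whole sequence converges in
    L^2. *)
Lemma l2_complete (F : nat -> T -> R) : (forall k, l2 (F k)) ->
  (forall e, 0 < e -> exists K, forall i j, (K <= i)%N -> (K <= j)%N ->
     \int[mu]_x ((F i x - F j x) ^+ 2) <= e) ->
  exists2 f, l2 f & l2cvg F f.
Proof.
move=> hF hC.
have H k : exists m, forall i j, (m <= i)%N -> (m <= j)%N ->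
     \int[mu]_x ((F i x - F j x) ^+ 2) <= (4^-1) ^+ k.
  by apply: hC; rewrite exprn_gt0.
have [m hm] := choice H.
(* Summing makes [s] nondecreasing and larger than [m k]; the [+ 1] makes it larger than [k]. *)
pose s k := (\sum_(i < k.+1) (m i + 1))%N.
have sS k : (s k <= s k.+1)%N by rewrite /s [leqRHS]big_ord_recr leq_addr.
have ms k : (m k <= s k)%N.
  by rewrite /s big_ord_recr/= addnA; apply: leq_trans (leq_addr _ _); rewrite leq_addl.
have ks k : (k <= s k)%N.
  rewrite /s; apply: (@leq_trans (\sum_(i < k.+1) 1)).
    by rewrite sum1_card card_ord.
  by apply: leq_sum => i _; rewrite leq_addl.
pose D k x := 2 ^+ k * (F (s k.+1) x - F (s k) x) ^+ 2.
have hD k : l1 (D k) by apply: l1Z; have [] := l2B (hF (s k.+1)) (hF (s k)).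
have D0 k x : 0 <= D k x by apply: mulr_ge0; [exact: exprn_ge0|exact: sqr_ge0].
have ID k : \int[mu]_x D k x <= (2^-1) ^+ k.
  rewrite integrZ; last by have [] := l2B (hF (s k.+1)) (hF (s k)).
  have := hm k _ _ (leq_trans (ms k) (sS k)) (ms k).
  move=> /(ler_wpM2l (exprn_ge0 k (ler0n R 2))) /le_trans; apply.
  rewrite -exprMn (_ : 2 * 4^-1 = 2^-1 :> R)//; by field.
have aeC : {ae mu, forall x, cvgn (fun k => F (s k) x)}.
  apply: filterS (ae_cvg0_of_integr_le hD D0 ID) => x h.
  (* A ratio [q < 1] with [2 * q ^+ 2 >= 1] is wanted, so that boundedness of [D] passes to the
     increments; [3 / 4] gives [9 / 8]. *)
  have [r r0 hr] : exists2 r : R, 0 < r & forall k, `|F (s k.+1) x - F (s k) x| <= r * (3/4) ^+ k.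
    have cD : cvgn (D ^~ x) by apply/cvg_ex; exists 0; exact: h.
    have [M [_ hM]] := cvg_seq_bounded cD.
    have {}hM k : D k x <= `|M| + 1.
      apply: le_trans (ler_norm _) _; apply: (hM (`|M| + 1)) => //.
      by rewrite (le_lt_trans (ler_norm _))// ltrDl.
    exists (`|M| + 1) => [|k]; first by rewrite ltr_wpDl.
    have h1 := hM k; rewrite /D in h1.
    set y := F _ x - F _ x in h1 *.
    have M1 : 1 <= `|M| + 1 by rewrite lerDr.
    have p0 : 0 <= (3 / 4 : R) ^+ k by rewrite exprn_ge0//; lra.
    have r0 : 0 <= (`|M| + 1) * (3 / 4 : R) ^+ k by rewrite mulr_ge0// (le_trans _ M1).
    rewrite -(@ler_pXn2r _ 2) ?nnegrE// real_normK ?num_real//.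
    rewrite -(@ler_pM2l _ (2 ^+ k)) ?exprn_gt0//.
    apply: (le_trans h1); rewrite exprMn mulrCA -exprM mulnC exprM -exprMn.
    have : 1 <= (2 * (3 / 4) ^+ 2 : R) ^+ k by rewrite exprn_ege1//; lra.
    move: (_ ^+ k) => q q1; nra.
  pose D1 k := F (s k.+1) x - F (s k) x.
  have cd : cvgn (series D1).
    apply: normed_cvg; apply: (@series_le_cvg _ _ (fun k => r * (3/4) ^+ k)) => //.
    - by move=> k; exact: normr_ge0.
    - by move=> k; rewrite mulr_ge0 ?exprn_ge0 ?ltW//; lra.
    - apply: is_cvg_geometric_series; rewrite ger0_norm; lra.
  suff -> : (fun k => F (s k) x) = (fun k => F (s 0) x + series D1 k).
    by apply: is_cvgD => //; exact: is_cvg_cst.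
  apply/funext => k; rewrite /series/= telescope_sumr// addrC subrK.
  by [].
(* The upper limit is defined and measurable everywhere, including where the sequence diverges. *)
pose f x := fine (limn_esup (fun k => (F (s k) x)%:E)).
have mf : measurable_fun setT f.
  apply: measurableT_comp => //; apply: measurable_fun_limn_esup => k.
  by apply/measurable_EFinP; have [] := hF (s k).
have Ff : {ae mu, forall x, F (s k) x @[k --> \oo] --> f x}.
  apply: filterS aeC => x /cvg_ex[l hl].
  have h2 : (F (s k) x)%:E @[k --> \oo] --> l%:E by apply: cvg_EFin => //; exact: nearW.
  by rewrite /f (cvg_limn_einf_sup h2).2.
have key j (c : R) : (exists K, forall i, (K <= i)%N -> \int[mu]_x ((F i x - F j x) ^+ 2) <= c) ->
    l2 (fun x => f x - F j x) /\ \int[mu]_x ((f x - F j x) ^+ 2) <= c.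
  move=> [K hK]; apply: (@fatou_sq (fun k x => F (s k) x - F j x)).
  - by move=> k; exact: l2B.
  - by apply: measurable_funB => //; have [] := hF j.
  - by apply: filterS Ff => x h; apply: cvgB => //; exact: cvg_cst.
  - by exists K => // k /= Kk; apply: hK; exact: leq_trans Kk (ks k).
have hf : l2 f.
  have [|h _] := key (m 0) ((4^-1) ^+ 0).
    by exists (m 0) => i h; exact: hm.
  have := l2D h (hF (m 0)); congr (l2 _); apply/funext => x; ring.
exists f => //; apply/cvgr0Pnorm_lt => e e0.
have e20 : 0 < e / 2 by rewrite divr_gt0.
have [K hK] := hC _ e20; exists K => // j /= Kj.
have [|_ h] := key j (e / 2); first by exists K => i Ki; exact: hK.
rewrite ger0_norm; last by apply: integr_ge0 => x; exact: sqr_ge0.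
apply: (@le_lt_trans _ _ (e / 2)); last by lra.
by under eq_Rintegral do rewrite -sqrrN opprB.
Qed.

End l1_l2.

(** * Smooth functions *)

Section is_derive_pointwise.
Context (R : realType) (V : normedModType R).
Implicit Types (f g : V -> R) (x v : V) (a b c : R).

Lemma is_derD f g x v a b c : is_derive x v f a -> is_derive x v g b ->
  a + b = c -> is_derive x v (fun y => f y + g y) c.
Proof. by move=> hf hg <-; exact: is_deriveD. Qed.

Lemma is_derB f g x v a b c : is_derive x v f a -> is_derive x v g b ->
  a - b = c -> is_derive x v (fun y => f y - g y) c.
Proof. by move=> hf hg <-; exact: is_deriveB. Qed.

Lemma is_derM f g x v a b c : is_derive x v f a -> is_derive x v g b ->
  f x * b + g x * a = c -> is_derive x v (fun y => f y * g y) c.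
Proof. by move=> hf hg <-; exact: is_deriveM. Qed.

Lemma is_derC x v c : is_derive x v (fun=> c) 0.
Proof. exact: is_derive_cst. Qed.

Lemma is_derZ k f x v a c : is_derive x v f a ->
  k * a = c -> is_derive x v (fun y => k * f y) c.
Proof. by move=> hf <-; apply: (is_derM (is_derC x v k) hf); rewrite mulr0 addr0. Qed.

End is_derive_pointwise.

(** * Smooth cut-off functions of one variable *)

Section gexp.
Variable R : realType.
Implicit Types (s : R) (m : nat).

(** The flat functions [s ^- m * exp (- 1 / s)], extended by [0]. The family is closed under
    differentiation up to linear combinations, so smoothness follows by induction with no formula
    for higher derivatives. *)
Definition gexp m s : R := if 0 < s then s ^- m * expR (- s^-1) else 0.

Lemma gexp_le0 m s : s <= 0 -> gexp m s = 0.
Proof. by rewrite /gexp ltNge => ->. Qed.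

Lemma gexp_ge0 m s : 0 <= gexp m s.
Proof.
rewrite /gexp; case: ifPn => // s0.
by rewrite mulr_ge0 ?expR_ge0// invr_ge0 exprn_ge0// ltW.
Qed.

Lemma gexp_ub m s : 0 <= s -> gexp m s <= m.+1`!%:R * s.
Proof.
rewrite /gexp; case: ifPn => [s0 _|_ s0]; last by rewrite mulr_ge0.
rewrite expRN ler_pdivrMr ?expR_gt0//.
have s10 : 0 <= s^-1 by rewrite invr_ge0 ltW.
have h := expR_ge1Dxn m s10.
have h1 : s^-1 ^+ m.+1 <= m.+1`!%:R * expR s^-1.
  rewrite mulrC -ler_pdivrMr ?ltr0n ?fact_gt0//.
  by apply: le_trans h; rewrite lerDr.
apply: (@le_trans _ _ (s * s^-1 ^+ m.+1)).
  by rewrite exprS mulrA mulfV ?gt_eqF// mul1r exprVn.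
by rewrite mulrAC [leLHS]mulrC ler_pM2r.
Qed.

Lemma gexpS m s : gexp m.+1 s = s^-1 * gexp m s.
Proof.
rewrite /gexp; case: ifPn => [s0|_]; last by rewrite mulr0.
by rewrite exprS invfM mulrA.
Qed.

Lemma gexp0_le1 s : gexp 0 s <= 1.
Proof.
rewrite /gexp; case: ifPn => // s0; rewrite expr0 invr1 mul1r expR_le1.
by rewrite oppr_le0 invr_ge0 ltW.
Qed.

Lemma gexp_le m s : gexp m s <= m`!%:R.
Proof.
have [s0|s0] := leP s 0; first by rewrite gexp_le0.
case: m => [|m]; first by rewrite fact0 gexp0_le1.
have h := gexp_ub m (ltW s0).
by rewrite gexpS ler_pdivrMl// mulrC.
Qed.

Lemma gexp2_ge s : 4^-1 <= s -> s <= 1 -> expR (-4) <= gexp 2 s.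
Proof.
move=> s4 s1; have s0 : 0 < s by apply: lt_le_trans s4; rewrite invr_gt0.
rewrite /gexp s0 -[leLHS]mul1r; apply: ler_pM; rewrite ?expR_ge0//.
  by rewrite invf_ge1 ?exprn_gt0// exprn_ile1// ltW.
by rewrite ler_expR lerN2 -[leRHS]invrK lef_pV2// posrE.
Qed.

Lemma is_derive_gexp m s :
  is_derive s (1 : R) (gexp m) (gexp m.+2 s - m%:R * gexp m.+1 s).
Proof.
have [s0|s0|->] := ltgtP s 0.
- rewrite !gexp_le0 ?ltW// mulr0 subr0.
  apply: (near_eq_is_derive _ (is_derC s (1 : R) 0)).
  near=> t; rewrite gexp_le0//; apply: ltW.
  by near: t; exact: lt_nbhsl.
- apply: (near_eq_is_derive (f := fun t : R => t ^- m * expR (- t^-1) : R)).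
    near=> t; rewrite /gexp ifT//.
    by near: t; exact: lt_nbhsr.
  have s'0 : s != 0 by rewrite gt_eqF.
  have d1 : is_derive s (1 : R) (fun t : R => t^-1) (- s ^- 2).
    by have := is_deriveV s'0 (is_derive_id s (1 : R)); rewrite /GRing.scale/= mulr1.
  have d2 : is_derive s (1 : R) (fun t : R => t ^- m) (- m%:R * s ^- m.+1).
    have := is_deriveX m d1; rewrite (_ : _ ^+ m = (fun t : R => t ^- m)).
      move=> h; apply: (is_derive_eq h).
      rewrite /GRing.scale/= -!exprVn.
      case: m {h} => [|m]; first by rewrite !mul0r oppr0 mul0r.
      by rewrite /= mulNr !exprS; ring.
    by apply/funext => t; rewrite fctE exprVn.
  have d3 : is_derive s (1 : R) (fun t : R => expR (- t^-1)) (expR (- s^-1) * s ^- 2).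
    apply: (@is_derive1_comp _ expR (fun t : R => - t^-1)).
    by have := is_deriveN d1; rewrite opprK.
  apply: (is_derM d2 d3); rewrite /gexp s0.
  by rewrite -!exprVn !exprS; ring.
- rewrite !gexp_le0// mulr0 subr0.
  (* The difference quotient at [0] is [gexp m.+1], which [gexp_ub] bounds by a multiple of
     [|h|]. *)
  have h : h^-1 * gexp m h @[h --> 0^'] --> (0 : R).
    apply: (@rcvg0_le _ _ _ _ _ (fun h => (m.+2)`!%:R * `|h|)).
      near=> h; rewrite -gexpS ger0_norm ?gexp_ge0//.
      have [h0|h0] := leP 0 h; first by rewrite ger0_norm// gexp_ub.
      by rewrite (gexp_le0 _ (ltW h0)) mulr_ge0.
    apply: (rcvgZ (a := 0)); last by rewrite mulr0.
    apply/cvgr0Pnorm_lt => e e0; near=> t; rewrite normr_id.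
    by near: t; apply: dnbhs0_lt.
  apply: DeriveDef.
    apply/cvg_ex; exists 0; rewrite gexp_le0//.
    move: h; apply: cvg_trans; apply: near_eq_cvg; near=> h.
    by rewrite /= /GRing.scale/= mulr1 addr0 subr0.
  rewrite /derive gexp_le0//; apply/cvg_lim => //.
  move: h; apply: cvg_trans; apply: near_eq_cvg; near=> h.
  by rewrite /= /GRing.scale/= mulr1 addr0 subr0.
Unshelve. all: end_near. Qed.

End gexp.

Section cutoff.
Variable R : realType.
Implicit Types (s eps : R).

(** For [s > 0] this is [s * exp (- eps / s)]: a smooth function between [0] and the positive part,
    vanishing for [s <= 0], whose derivative is bounded by [2] uniformly in [eps]. *)
Definition pospart_approx eps s : R := s * gexp 0 (eps^-1 * s).
Definition dpospart_approx eps s : R := gexp 0 (eps^-1 * s) + gexp 1 (eps^-1 * s).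

Lemma is_derive_gexpZ eps m s : is_derive s (1 : R) (fun t => gexp m (eps^-1 * t))
  (eps^-1 * (gexp m.+2 (eps^-1 * s) - m%:R * gexp m.+1 (eps^-1 * s))).
Proof.
rewrite mulrC; apply: (@is_derive1_comp _ (gexp m) (fun t : R => eps^-1 * t)).
  exact: is_derive_gexp.
by apply: (is_derZ (is_derive_id _ _)); rewrite mulr1.
Qed.

Lemma is_derive_pospart_approx eps s : 0 < eps ->
  is_derive s (1 : R) (pospart_approx eps) (dpospart_approx eps s).
Proof.
move=> e0; apply: (is_derM (is_derive_id s (1 : R)) (is_derive_gexpZ _ _ _)).
rewrite mul0r subr0 mulr1 addrC mulrA; congr (_ + _).
have [->|s0] := eqVneq s 0; first by rewrite !mul0r mulr0 gexp_le0.
rewrite gexpS; move: (gexp 1 _) => z.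
by field; rewrite s0 gt_eqF.
Qed.

Lemma continuous_gexp m : continuous (@gexp R m).
Proof.
move=> s; apply: differentiable_continuous; apply/derivable1_diffP.
by have [] := is_derive_gexp m s.
Qed.

Lemma cvg_gexp0 (e : nat -> R) s : (forall k, 0 < e k) -> e k @[k --> \oo] --> 0 ->
  gexp 0 ((e k)^-1 * s) @[k --> \oo] --> ((0 < s)%R%:R : R).
Proof.
move=> e0 ec; have [s0|s0] := ltP 0 s; last first.
  under eq_fun do rewrite gexp_le0 ?pmulr_rle0 ?invr_gt0//.
  exact: cvg_cst.
have h : expR (- (e k * s^-1)) @[k --> \oo] --> (1 : R).
  have h0 : - (e k * s^-1) @[k --> \oo] --> (0 : R).
    apply: (@rcvg0_le _ _ _ _ _ (fun k => e k * s^-1)).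
      by apply: nearW => k; rewrite normrN ger0_norm// mulr_ge0 ?invr_ge0//; exact: ltW.
    by apply: (rcvgM ec (cvg_cst _)); rewrite mul0r.
  rewrite -expR0; apply: (cvg_comp _ _ h0); exact: continuous_expR.
rewrite (_ : (fun k => gexp 0 _) = (fun k => expR (- (e k / s))))//.
by apply/funext => k; rewrite /gexp pmulr_rgt0 ?invr_gt0// s0 expr0 invr1 mul1r invfM invrK.
Qed.

Lemma cvg_gexp1 (e : nat -> R) s : (forall k, 0 < e k) -> e k @[k --> \oo] --> 0 ->
  gexp 1 ((e k)^-1 * s) @[k --> \oo] --> (0 : R).
Proof.
move=> e0 ec; have [s0|s0] := ltP 0 s; last first.
  under eq_fun do rewrite gexp_le0 ?pmulr_rle0 ?invr_gt0//.
  exact: cvg_cst.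
under eq_fun do rewrite gexpS invfM invrK.
have ec' : e k * s^-1 @[k --> \oo] --> 0 by apply: (rcvgM ec (cvg_cst _)); rewrite mul0r.
by apply: (rcvgM ec' (cvg_gexp0 (s := s) e0 ec)); rewrite mul0r.
Qed.

Lemma cvg_pospart_approx (e : nat -> R) s : (forall k, 0 < e k) -> e k @[k --> \oo] --> 0 ->
  pospart_approx (e k) s @[k --> \oo] --> Num.max s 0.
Proof.
move=> e0 ec; apply: (rcvgZ (cvg_gexp0 (s := s) e0 ec)).
by rewrite maxEle; case: leP => s0; rewrite ?mulr0 ?mulr1.
Qed.

Lemma cvg_dpospart_approx (e : nat -> R) s : (forall k, 0 < e k) -> e k @[k --> \oo] --> 0 ->
  dpospart_approx (e k) s @[k --> \oo] --> ((0 < s)%R%:R : R).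
Proof.
by move=> e0 ec; apply: (rcvgD (cvg_gexp0 (s := s) e0 ec) (cvg_gexp1 s e0 ec)); rewrite addr0.
Qed.

Lemma pospart_approx_ge0 eps s : 0 < eps -> 0 <= pospart_approx eps s.
Proof.
move=> e0; have [s0|s0] := leP 0 s; first by rewrite mulr_ge0 ?gexp_ge0.
by rewrite /pospart_approx gexp_le0 ?mulr0// pmulr_rle0 ?invr_gt0// ltW.
Qed.

Lemma pospart_approx_norm eps s : `|pospart_approx eps s| <= `|s|.
Proof.
by rewrite normrM ler_piMr// ger0_norm ?gexp_ge0// gexp0_le1.
Qed.

Lemma dpospart_approx_norm eps s : `|dpospart_approx eps s| <= 2.
Proof.
rewrite ger0_norm ?addr_ge0 ?gexp_ge0//.
have h0 : gexp 0 (eps^-1 * s) <= 1 := gexp_le 0 _.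
have h1 : gexp 1 (eps^-1 * s) <= 1 := gexp_le 1 _.
by rewrite /dpospart_approx; lra.
Qed.

Lemma gexpZ_norm eps s : 0 < eps -> `|gexp 0 (eps^-1 * s)| <= eps^-1 * `|s|.
Proof.
move=> e0; rewrite ger0_norm ?gexp_ge0//.
have [s0|s0] := leP 0 s; last by rewrite gexp_le0 ?mulr_ge0 ?invr_ge0 ?pmulr_rle0 ?invr_gt0// ltW.
have s1 : 0 <= eps^-1 * s by rewrite mulr_ge0// invr_ge0 ltW.
by rewrite ger0_norm//; have := gexp_ub 0 s1; rewrite mul1r.
Qed.

End cutoff.

(** * Functions of class C^k of several variables *)

Section smooth.
Variables (R : realType) (n : nat).
Implicit Types (f g : 'rV[R]_n -> R) (i : 'I_n).

Lemma is_derive_line f x (v : 'rV[R]_n) (l : R) : is_derive x v f l <->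
  is_derive (0 : R) (1 : R) (fun h : R => f (h *: v + x)) l.
Proof.
have E : (fun h : R => h^-1 *: ((f \o shift x) (h *: v) - f x)) =
  (fun h : R => h^-1 *: (((fun h : R => f (h *: v + x)) \o shift 0) (h *: (1 : R)) -
     (fun h : R => f (h *: v + x)) 0)).
  by apply/funext => h /=; rewrite addr0 scale0r add0r /GRing.scale/= mulr1.
split=> -[h1 h2]; split.
- by rewrite /derivable -E.
- by rewrite /derive -E.
- by rewrite /derivable E.
- by rewrite /derive E.
Qed.

Lemma is_derive_comp_line (F : R -> R) f x v (df dF : R) :
  is_derive x v f df -> is_derive (f x) (1 : R) F dF ->
  is_derive x v (F \o f) (dF * df).
Proof.
move=> /is_derive_line h1 h2; apply/is_derive_line.
apply: (@is_derive1_comp _ F (fun h => f (h *: v + x))) => //.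
by rewrite scale0r add0r.
Qed.

Lemma Ck_cont k f : Ck k f -> continuous f.
Proof. by case: k => [[]|k []]. Qed.

Lemma CkS k f : Ck k.+1 f -> Ck k f.
Proof.
elim: k f => [f [h _]//|k ih f [h1 h2]]; split => // i.
by have [h3 /ih h4] := h2 i.
Qed.

(** This form lets a derivative be exhibited rather than computed as a [partial]; all the closure
    properties below go through it. *)
Lemma CkP k f : Ck k.+1 f <-> continuous f /\
  forall i, exists2 g, forall x, is_derive x (delta_mx 0 i) f (g x) & Ck k g.
Proof.
split => [[cf h]|[cf h]]; split => // i.
  have [h1 h2] := h i; exists (partial i f); last exact: h2.
  by move=> x; apply: DeriveDef; [exact: h1|].
have [g hg kg] := h i; split; first by move=> x; have [] := hg x.
suff -> : partial i f = g by [].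
by apply/funext => x; rewrite /partial; have [_] := hg x.
Qed.

Lemma Ck_cst k (c : R) : Ck k (fun _ : 'rV[R]_n => c).
Proof.
elim: k c => [|k ih] c; first by split => //; exact: cst_continuous.
apply/CkP; split; first exact: cst_continuous.
by move=> i; exists (fun=> 0) => // x; exact: is_derive_cst.
Qed.

Lemma CkD k f g : Ck k f -> Ck k g -> Ck k (fun x => f x + g x).
Proof.
elim: k f g => [f g [cf _] [cg _]|k ih f g].
  by split => // x; apply: (rcvgD (cf x) (cg x)).
move=> /CkP[cf hf] /CkP[cg hg]; apply/CkP; split.
  by move=> x; apply: (rcvgD (cf x) (cg x)).
move=> i; have [df h1 h2] := hf i; have [dg h3 h4] := hg i.
exists (fun x => df x + dg x); last exact: ih.
by move=> x; exact: (is_derD (h1 x) (h3 x)).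
Qed.

Lemma CkM k f g : Ck k f -> Ck k g -> Ck k (fun x => f x * g x).
Proof.
elim: k f g => [f g [cf _] [cg _]|k ih f g hkf hkg].
  by split => // x; apply: (rcvgM (cf x) (cg x)).
have /CkP[cf hf] := hkf; have /CkP[cg hg] := hkg; apply/CkP; split.
  by move=> x; apply: (rcvgM (cf x) (cg x)).
move=> i; have [df h1 h2] := hf i; have [dg h3 h4] := hg i.
exists (fun x => f x * dg x + g x * df x).
  by move=> x; exact: (is_derM (h1 x) (h3 x)).
by apply: CkD; apply: ih => //; exact: CkS.
Qed.

Lemma CkZ k (c : R) f : Ck k f -> Ck k (fun x => c * f x).
Proof. by move=> hf; apply: CkM => //; exact: Ck_cst. Qed.

Lemma CkB k f g : Ck k f -> Ck k g -> Ck k (fun x => f x - g x).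
Proof.
move=> hf hg; have := CkD hf (CkZ (-1) hg).
by congr (Ck k _); apply/funext => x; rewrite mulN1r.
Qed.

Lemma Ck_sum k (J : Type) (s : seq J) (F : J -> 'rV[R]_n -> R) :
  (forall j, Ck k (F j)) -> Ck k (fun x => \sum_(j <- s) F j x).
Proof.
move=> hF; elim: s => [|j s ih].
  by under eq_fun do rewrite big_nil; exact: Ck_cst.
by under eq_fun do rewrite big_cons; exact: CkD.
Qed.

Lemma is_derive_coord (j : 'I_n) x v :
  is_derive x v (fun y : 'rV[R]_n => y 0 j) (v 0 j).
Proof.
apply/is_derive_line.
rewrite (_ : (fun h => _) = (fun h : R => h * v 0 j + x 0 j)); last first.
  by apply/funext => h; rewrite !mxE.
apply: (is_derD _ (is_derC _ _ _) (addr0 _)).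
apply: (is_derM (is_derive_id _ _) (is_derC _ _ _)).
by rewrite mulr0 add0r mulr1.
Qed.

Lemma Ck_coord k (j : 'I_n) : Ck k (fun y : 'rV[R]_n => y 0 j).
Proof.
case: k => [|k]; first by split=> //; exact: coord_continuous.
apply/CkP; split; first exact: coord_continuous.
move=> i; exists (fun=> (delta_mx 0 i : 'rV[R]_n) 0 j); last exact: Ck_cst.
by move=> x; exact: is_derive_coord.
Qed.

Lemma Ck_gexp k m f : Ck k f -> Ck k (gexp m \o f).
Proof.
have cc p h : continuous h -> continuous (gexp p \o h :> 'rV[R]_n -> R).
  by move=> ch x; apply: continuous_comp; [exact: ch|exact: continuous_gexp].
elim: k m f => [m f [cf _]|k ih m f hf]; first by split => //; exact: cc.
have /CkP[cf h] := hf; apply/CkP; split; first exact: cc.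
move=> i; have [df h1 h2] := h i.
exists (fun x => ((gexp m.+2 \o f) x - m%:R * (gexp m.+1 \o f) x) * df x).
  by move=> x; apply: is_derive_comp_line => //; exact: is_derive_gexp.
apply: CkM => //; apply: CkB; last apply: CkZ; apply: ih; exact: CkS.
Qed.

Lemma is_derive_affine f x v (c : R) (a : 'rV[R]_n) l : is_derive (c *: x + a) v f l ->
  is_derive x v (fun y => f (c *: y + a)) (c * l).
Proof.
move=> /is_derive_line h; apply/is_derive_line.
rewrite (_ : (fun h0 => _) = (fun h => f (h *: v + (c *: x + a))) \o (fun h => c * h)).
  rewrite mulrC; apply: (@is_derive1_comp _ _ (fun h => c * h)).
    by rewrite mulr0.
  by apply: (is_derZ (is_derive_id _ _)); rewrite mulr1.
by apply/funext => t /=; rewrite scalerDr scalerA addrA.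
Qed.

Lemma Ck_affine k f (c : R) (a : 'rV[R]_n) : Ck k f -> Ck k (fun y => f (c *: y + a)).
Proof.
have cc (h : 'rV[R]_n -> R) : continuous h -> continuous (fun y : 'rV[R]_n => h (c *: y + a)).
  move=> ch x; apply: (@continuous_comp _ _ _ (fun y : 'rV[R]_n => c *: y + a) h); last exact: ch.
  have h1 : c *: y @[y --> x] --> c *: x by exact: scaler_continuous.
  exact: (cvgD h1 (cvg_cst a)).
elim: k f => [f [cf _]|k ih f]; first by split => //; exact: cc.
move=> /CkP[cf h]; apply/CkP; split; first exact: cc.
move=> i; have [df h1 h2] := h i; exists (fun y => c * df (c *: y + a)).
  by move=> x; exact: is_derive_affine.
by apply: CkZ; exact: ih.
Qed.

Lemma continuous_bounded_compact (f : 'rV[R]_n -> R) K : continuous f -> compact K ->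
  exists2 M : R, 0 < M & forall x, K x -> `|f x| <= M.
Proof.
move=> cf cK.
have /compact_bounded[M [_ hM]] : compact (f @` K).
  by apply: continuous_compact => //; exact: continuous_subspaceT.
exists (`|M| + 1) => [|x Kx]; first by rewrite ltr_wpDl.
by apply: (hM (`|M| + 1)); [rewrite (le_lt_trans (ler_norm _))// ltrDl|exists x].
Qed.

Lemma smooth_partial f i : smooth f -> smooth (partial i f).
Proof. by move=> h k; have [_ /(_ i)[]] := h k.+1. Qed.

Lemma smooth_derive f i x : smooth f -> is_derive x (delta_mx 0 i) f (partial i f x).
Proof. by move=> h; have [_ /(_ i)[+ _]] := h 1 => /(_ x) h1; exact: DeriveDef. Qed.

Lemma smooth_cont f : smooth f -> continuous f.
Proof. by move=> h; exact: Ck_cont (h 0). Qed.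

Lemma partialE i f g : (forall x, is_derive x (delta_mx 0 i) f (g x)) ->
  partial i f = g.
Proof. by move=> h; apply/funext => x; rewrite /partial; have [_] := h x. Qed.

End smooth.

(** * Lebesgue measure on row vectors *)

Section lebesgue_rV_theory.
Variable R : realType.

Implicit Types (B M : R).

Definition box n (B : R) : set 'rV[R]_n := [set x | forall i, `|x 0 i| <= B].

Lemma boxE n B : @box n B = [set x | forall i, `[- B, B]%classic (x 0 i)].
Proof.
apply/seteqP; split => x h i; have := h i; rewrite /= in_itv/= ler_norml//.
Qed.

Lemma measurable_box n B : measurable (@box n B).
Proof.
rewrite boxE [X in measurable X](_ : _ = \bigcap_(i in [set: 'I_n])
    ((fun x : 'rV[R]_n => x 0 i) @^-1` `[- B, B]%classic)).
  apply: fin_bigcap_measurable => [|i _]; first exact: finite_finset.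
  by rewrite -[X in measurable X]setTI; exact: measurable_coord.
by apply/seteqP; split => [x h i _|x h i]; exact: h.
Qed.

Lemma lebesgue_cube n (x : 'rV[R]_n) (r : R) : 0 <= r ->
  lebesgue R n [set y | forall i, `[x 0 i - r, x 0 i + r]%classic (y 0 i)] = ((2 * r) ^+ n)%:E.
Proof.
move=> r0; rewrite (lebesgue_box (A := fun i => `[x 0 i - r, x 0 i + r]%classic))//.
rewrite (eq_bigr (fun=> (2 * r)%:E)).
  by rewrite prodEFin prodr_const card_ord.
move=> i _; rewrite lebesgue_measure_itv/= lte_fin.
case: ltP => h; first by rewrite -EFinD; congr EFin; ring.
have -> : r = 0 by apply/eqP; rewrite eq_le r0 andbT; move: h; lra.
by rewrite mulr0.
Qed.

Lemma lebesgue_boxE n (B : R) : 0 <= B -> lebesgue R n (box B) = ((2 * B) ^+ n)%:E.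
Proof.
move=> B0; rewrite -(lebesgue_cube (0 : 'rV[R]_n) B0) boxE.
by congr (lebesgue R n _); apply/seteqP; split => x h i; have := h i; rewrite mxE !add0r.
Qed.

Lemma l1_box n B : l1 (lebesgue R n) (\1_(box B)).
Proof.
have mB := @measurable_box n B.
apply/integrableP; split; first exact/measurable_EFinP.
under eq_integral do rewrite /= ger0_norm//.
rewrite integral_indic// setIT.
have [B0|B0] := leP 0 B; first by apply: (@le_lt_trans _ _ (((2 * B) ^+ n)%:E)); [rewrite -(lebesgue_boxE n B0)|rewrite ltry].
(* For [B < 0] the box is empty in positive dimension, but in dimension [0] it is the whole
   one-point space. *)
case: n mB => [|n] mB.
  by rewrite (_ : box B = setT) ?diracE//=; [rewrite ltry|apply/seteqP; split => // x _ []].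
rewrite (_ : box B = set0) ?measure0// -subset0 => x /(_ ord0) /=.
by rewrite leNgt (lt_le_trans B0).
Qed.

Lemma l1_bounded n (f : 'rV[R]_n -> R) B M : measurable_fun setT f ->
  (forall x, `|f x| <= M) -> (forall x, ~ box B x -> f x = 0) ->
  l1 (lebesgue R n) f.
Proof.
move=> mf fM fB; apply: (l1_le mf (l1Z M (l1_box n B))); apply: aeW => x.
have [Bx|nBx] := pselect (box B x); last by rewrite fB// normr0.
by rewrite indicE mem_set// mulr1; apply: le_trans (fM x) (ler_norm _).
Qed.

Local Notation prodm n := (@lebesgue_measure R \x lebesgue R n)%E.

Let mcons n : measurable_fun [set: (measurableTypeR R * 'rV[R]_n)%type] (@rV_cons R n)
  := @measurable_rV_cons R n.

Lemma integrable_rV_cons n (f : 'rV[R]_n.+1 -> R) : l1 (lebesgue R n.+1) f ->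
  (prodm n).-integrable setT ((EFin \o f) \o @rV_cons R n).
Proof.
move=> /integrableP[mf hf]; apply/integrableP; split.
  exact: measurableT_comp mf (@measurable_rV_cons R n).
apply: le_lt_trans hf.
have e := @ge0_integral_pushforward _ _ _ _ R _ (@mcons n) (prodm n) setT
  (fun x => `|(EFin \o f) x|%E) measurableT _ _.
rewrite -[leLHS]e//.
by apply: measurableT_comp.
Qed.

Lemma lebesgue_fubini12 n (f : 'rV[R]_n.+1 -> R) : l1 (lebesgue R n.+1) f ->
  (\int[lebesgue R n.+1]_x (f x)%:E =
   \int[lebesgue_measure]_a \int[lebesgue R n]_x (f (rV_cons (a, x)))%:E)%E.
Proof.
move=> hf; have h1 := integrable_rV_cons hf.
rewrite [RHS](integral12_prod_meas1 h1).
have [mf _] := integrableP _ _ _ hf.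
have e := integral_pushforward (@mcons n) mf h1 measurableT.
refine (eq_trans _ (eq_trans e _)).
  reflexivity.
reflexivity.
Qed.

Lemma lebesgue_fubini21 n (f : 'rV[R]_n.+1 -> R) : l1 (lebesgue R n.+1) f ->
  (\int[lebesgue R n.+1]_x (f x)%:E =
   \int[lebesgue R n]_x \int[lebesgue_measure]_a (f (rV_cons (a, x)))%:E)%E.
Proof.
move=> hf; have h1 := integrable_rV_cons hf.
rewrite [RHS](integral21_prod_meas1 h1).
have [mf _] := integrableP _ _ _ hf.
have e := integral_pushforward (@mcons n) mf h1 measurableT.
refine (eq_trans _ (eq_trans e _)).
  reflexivity.
reflexivity.
Qed.

Lemma integral_deriv_eq0 (h g : R -> R) (B : R) : continuous g ->
  (forall a, is_derive a (1 : R) h (g a)) ->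
  (forall a, B < `|a| -> h a = 0) -> (forall a, B < `|a| -> g a = 0) ->
  (\int[lebesgue_measure]_a (g a)%:E = 0)%E.
Proof.
move=> cg dh h0 g0; pose C : R := `|B| + 1.
have BC : B < C by rewrite (le_lt_trans (ler_norm _))// ltrDl.
have C0 : 0 < C by rewrite ltr_wpDl.
transitivity (\int[lebesgue_measure]_(a in `[(- C)%R, C]) (g a)%:E)%E.
  rewrite [RHS]integral_mkcond; apply: eq_integral => a _; rewrite patchE.
  case: ifPn => //; rewrite notin_setE/= in_itv/= -ler_norml => /negP.
  by rewrite -ltNge => aC; rewrite g0// (lt_trans BC).
have ch : continuous h.
  move=> a; apply: differentiable_continuous; apply/derivable1_diffP.
  by have [] := dh a.
rewrite (@continuous_FTC2 _ g h).
- by rewrite !h0 ?subee// ?normrN gtr0_norm.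
- by rewrite gtrN.
- exact: continuous_subspaceT.
- split.
  + by move=> a _; have [] := dh a.
  + by apply: cvg_at_right_filter; exact: ch.
  + by apply: cvg_at_left_filter; exact: ch.
- by move=> a _; rewrite derive1E; have [_] := dh a.
Qed.

Lemma rV_cons_lift n (a : R) (x : 'rV[R]_n) (i : 'I_n) (h : R) :
  rV_cons (a, h *: delta_mx 0 i + x) = h *: delta_mx 0 (lift ord0 i) + rV_cons (a, x).
Proof.
apply/rowP => j; rewrite !mxE/=; case: (unliftP ord0 j) => [k ->|->] /=.
  by rewrite !mxE !eqxx/= (inj_eq lift_inj).
by rewrite mulr0 add0r.
Qed.

Lemma rV_cons_ord0 n (a : R) (x : 'rV[R]_n) (h : R) :
  rV_cons (h + a, x) = h *: delta_mx 0 ord0 + rV_cons (a, x).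
Proof.
apply/rowP => j; rewrite !mxE/=; case: (unliftP ord0 j) => [k ->|->] /=.
  by rewrite mulr0 add0r.
by rewrite mulr1.
Qed.

(* Hypotheses on lines only, so that they are inherited by the slices of f. *)
Lemma integral_partial_eq0 n (f g : 'rV[R]_n -> R) (i : 'I_n) B M :
  measurable_fun setT g -> (forall x, `|g x| <= M) ->
  (forall x, is_derive x (delta_mx 0 i) f (g x)) ->
  (forall x, continuous (fun h : R => g (h *: delta_mx 0 i + x))) ->
  (forall x, ~ box B x -> f x = 0) -> (forall x, ~ box B x -> g x = 0) ->
  (\int[lebesgue R n]_x (g x)%:E = 0)%E.
Proof.
elim: n f g i => [|n ih] f g i; first by case: i.
move=> mg gM df cg fB gB.
have l1g : l1 (lebesgue R n.+1) g by exact: (l1_bounded mg gM gB).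
have nbox a x : (exists j, B < `|rV_cons (a, x) 0 j|) -> ~ @box n.+1 B (rV_cons (a, x)).
  by move=> [j hj] /(_ j); rewrite leNgt hj.
case: (unliftP ord0 i) df cg => [j|] -> df cg.
  rewrite lebesgue_fubini12//; apply: integral0_eq => a _.
  apply: (ih (fun x => f (rV_cons (a, x))) _ j).
  - apply: (measurableT_comp mg); apply: (measurableT_comp (@measurable_rV_cons R n)).
    exact: measurable_pair1.
  - by move=> x; exact: gM.
  - move=> x; have /is_derive_line := df (rV_cons (a, x)) => h.
    apply/is_derive_line.
    rewrite (_ : (fun t => _) = (fun t => f (t *: delta_mx 0 (lift ord0 j) + rV_cons (a, x))))//.
    by apply/funext => t; rewrite rV_cons_lift.
  - move=> x; have := cg (rV_cons (a, x)).
    rewrite (_ : (fun t : R => g (rV_cons (a, t *: delta_mx 0 j + x))) =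
      (fun t => g (t *: delta_mx 0 (lift ord0 j) + rV_cons (a, x))))//.
    by apply/funext => t; rewrite rV_cons_lift.
  - move=> x nB; apply: fB => nB2; apply: nB => k.
    by have := nB2 (lift ord0 k); rewrite mxE liftK.
  - move=> x nB; apply: gB => nB2; apply: nB => k.
    by have := nB2 (lift ord0 k); rewrite mxE liftK.
rewrite lebesgue_fubini21//; apply: integral0_eq => x _.
have out a : B < `|a| -> ~ @box n.+1 B (rV_cons (a, x)).
  by move=> aB; apply: nbox; exists ord0; rewrite mxE unlift_none.
apply: (@integral_deriv_eq0 (fun a => f (rV_cons (a, x))) _ B).
- rewrite (_ : (fun a => _) = (fun a => g (a *: delta_mx 0 ord0 + rV_cons (0, x))))//.
  by apply/funext => a; rewrite -rV_cons_ord0 addr0.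
- move=> a; have /is_derive_line h := df (rV_cons (a, x)).
  rewrite (_ : (fun t => _) = (fun t => f (t *: delta_mx 0 ord0 + rV_cons (a, x))) \o (fun t => t - a)).
    rewrite -[g _]mulr1; apply: is_derive1_comp; first by rewrite subrr.
    by apply: (is_derB (is_derive_id _ _) (is_derC _ _ _)); rewrite subr0.
  by apply/funext => t /=; rewrite -rV_cons_ord0 subrK.
- by move=> a aB; apply/fB/out.
- by move=> a aB; apply/gB/out.
Qed.

End lebesgue_rV_theory.

(** * Test functions *)

Lemma lipschitz_of_derive (R : realType) (F dF : R -> R) (C : R) :
  (forall s : R, is_derive s (1 : R) F (dF s)) -> (forall s, `|dF s| <= C) ->
  forall a b, `|F a - F b| <= C * `|a - b|.
Proof.
move=> hF hC.
have cF : continuous F.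
  move=> s; apply: differentiable_continuous; apply/derivable1_diffP.
  by have [] := hF s.
have key a b : a <= b -> `|F b - F a| <= C * `|b - a|.
  move=> ab; have [c _ ->] := @MVT_segment R F dF a b ab (fun x _ => hF x)
    (continuous_subspaceT cF).
  by rewrite normrM ler_wpM2r.
move=> a b; have [ab|/ltW ab] := leP b a; first exact: key.
by rewrite distrC [X in _ * X]distrC; exact: key.
Qed.

(** Open set and enclosing cube are bundled so that the same theory serves the domain of the
    equation and the auxiliary cubes that carry the mollification kernels. *)
Record bdomain (R : realType) (n : nat) := BDomain {
  dom : set 'rV[R]_n;
  dom_bound : R;
  dom_open : open dom;
  dom_box : dom `<=` box dom_bound }.

Section test_functions.
Variables (R : realType) (n : nat) (D : bdomain R n).
Local Notation O := (dom D).
Local Notation B := (dom_bound D).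
Let O_open : open O := @dom_open _ _ D.
Let O_box : O `<=` box B := @dom_box _ _ D.
Local Notation mu := (lebesgue R n).
Local Notation E := 'rV[R]_n.
Local Notation test := (test_function O).
Implicit Types (phi f u v : E -> R) (g : 'I_n -> E -> R) (i : 'I_n).

Lemma test_out phi x : test phi -> ~ O x -> phi x = 0.
Proof. by move=> [_ [K [_ KO h]]] Ox; apply: h => /KO. Qed.

Lemma test_smooth phi : test phi -> smooth phi.
Proof. by case. Qed.

Lemma test_cont phi : test phi -> continuous phi.
Proof. by case=> /smooth_cont. Qed.

Lemma test_meas phi : test phi -> measurable_fun setT phi.
Proof. by move=> h; apply: continuous_measurable_rV; exact: test_cont. Qed.

Lemma compact_rV_closed (K : set E) : compact K -> closed K.
Proof. by apply: compact_closed; exact: norm_hausdorff. Qed.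

(** The compact set of [psi] serves for [phi]: off this closed set [psi] vanishes on a
    neighbourhood, hence so does whatever is built locally from [psi], derivatives included. *)
Lemma test_intro phi psi : test psi -> smooth phi ->
  (forall x, psi x = 0 -> (\forall y \near x, psi y = 0) -> phi x = 0) -> test phi.
Proof.
move=> [_ [K [cK KO h]]] sphi hpsi; split => //; exists K; split => // x Kx.
apply: hpsi; first exact: h.
have : open (~` K) by apply: closed_openC; exact: compact_rV_closed.
by move=> /(_ x Kx); apply: filterS => y; exact: h.
Qed.

Lemma test_partial phi i : test phi -> test (partial i phi).
Proof.
move=> h; apply: (test_intro h); first exact: smooth_partial (test_smooth h).
move=> x _ hx; rewrite /partial.
by have [_] := near_eq_is_derive (filterS (fun y => esym) hx) (is_derC x (delta_mx 0 i) 0).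
Qed.

Lemma test_smoothM f phi : smooth f -> test phi -> test (fun x => f x * phi x).
Proof.
move=> sf h; apply: (test_intro h) => [k|x h0 _]; last by rewrite h0 mulr0.
by apply: CkM; [exact: sf|exact: test_smooth].
Qed.

Lemma testZ (c : R) phi : test phi -> test (fun x => c * phi x).
Proof. by apply: test_smoothM => k; exact: Ck_cst. Qed.

Lemma testD phi psi : test phi -> test psi -> test (fun x => phi x + psi x).
Proof.
move=> [s1 [K1 [c1 K1O h1]]] [s2 [K2 [c2 K2O h2]]]; split.
  by move=> k; apply: CkD; [exact: s1|exact: s2].
exists (K1 `|` K2); split; first exact: compactU.
  by move=> x [/K1O|/K2O].
by move=> x K; rewrite h1 ?h2 ?addr0// => hx; apply: K; [right|left].
Qed.

Lemma test0 : test (fun=> 0).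
Proof.
split; first by move=> k; exact: Ck_cst.
by exists set0; split => //; exact: compact0.
Qed.

(** The outer functions that may be composed with test functions; [F 0 = 0] keeps the support
    compact. *)
Definition chain (F dF : R -> R) := [/\ forall k f, Ck k f -> Ck k (F \o f),
  forall s : R, is_derive s (1 : R) F (dF s) & F 0 = 0].

Lemma test_chain F dF phi : chain F dF -> test phi -> test (F \o phi).
Proof.
move=> [hF _ F0] h; apply: (test_intro h) => [k|x h0 _ /=]; last by rewrite h0.
by apply: hF; exact: test_smooth.
Qed.

Lemma partial_chain F dF phi i : chain F dF -> smooth phi ->
  partial i (F \o phi) = (fun x => dF (phi x) * partial i phi x).
Proof.
move=> [_ hF _] h; apply: partialE => x.
by apply: is_derive_comp_line => //; exact: smooth_derive.
Qed.

Lemma partialM f phi i : smooth f -> smooth phi -> partial i (fun x => f x * phi x) =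
  (fun x => f x * partial i phi x + phi x * partial i f x).
Proof.
move=> sf sphi; apply: partialE => x.
by apply: (is_derM (smooth_derive i x sf) (smooth_derive i x sphi)).
Qed.

Lemma partialZ (c : R) phi i : smooth phi ->
  partial i (fun x => c * phi x) = (fun x => c * partial i phi x).
Proof.
by move=> sphi; apply: partialE => x; exact: (is_derZ (smooth_derive i x sphi)).
Qed.

Lemma partialD f phi i : smooth f -> smooth phi -> partial i (fun x => f x + phi x) =
  (fun x => partial i f x + partial i phi x).
Proof.
move=> sf sphi; apply: partialE => x.
exact: (is_derD (smooth_derive i x sf) (smooth_derive i x sphi)).
Qed.

Lemma test_bounded phi : test phi -> exists2 M : R, 0 < M & forall x, `|phi x| <= M.
Proof.
move=> h; have [K [cK _ hK]] := h.2.
have [M M0 hM] := continuous_bounded_compact (test_cont h) cK.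
exists M => // x; have [/hM//|/hK ->] := pselect (K x); by rewrite normr0 ltW.
Qed.

Lemma box_out f x : (forall x, ~ O x -> f x = 0) -> ~ box B x -> f x = 0.
Proof. by move=> h nB; apply: h => /O_box. Qed.

Lemma test_l1 phi : test phi -> l1 mu phi.
Proof.
move=> h; have [M _ hM] := test_bounded h.
apply: (l1_bounded (B := B) (test_meas h) hM) => x.
by apply: box_out => y; exact: test_out.
Qed.

Lemma test_l2 phi : test phi -> l2 mu phi.
Proof.
move=> h; split; first exact: test_meas.
by under eq_fun do rewrite expr2; apply: test_l1; apply: test_smoothM => //; case: h.
Qed.

Lemma integr_partial phi i : test phi -> \int[mu]_x (partial i phi x) = 0.
Proof.
move=> h; have h' := test_partial i h; have [M _ hM] := test_bounded h'.
rewrite -[RHS](erefl (fine (0%E : \bar R))); congr fine.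
apply: (@integral_partial_eq0 R n phi (partial i phi) i B M) => //.
- exact: test_meas.
- by move=> x; apply: smooth_derive; case: h.
- move=> x t.
  apply: (@continuous_comp _ _ _ (fun t : R => t *: delta_mx 0 i + x) (partial i phi)).
    have h1 : (s *: (delta_mx 0 i : E)) @[s --> t] --> (t *: (delta_mx 0 i : E)).
      exact: scalel_continuous.
    exact: (cvgD h1 (cvg_cst x)).
  exact: test_cont.
- by move=> x; apply: box_out => y; exact: test_out.
- by move=> x; apply: box_out => y; exact: test_out.
Qed.

Lemma integr_by_parts f phi i : smooth f -> test phi ->
  \int[mu]_x (f x * partial i phi x) = - \int[mu]_x (partial i f x * phi x).
Proof.
move=> sf h; apply/eqP; rewrite -addr_eq0 -integrD; first 1 last.
- by apply: test_l1; apply: test_smoothM => //; exact: test_partial.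
- by apply: test_l1; apply: test_smoothM => //; exact: smooth_partial.
apply/eqP; rewrite -[RHS](integr_partial i (test_smoothM sf h)).
rewrite partialM//; last by case: h.
by apply: eq_Rintegral => x _; rewrite [_ * phi x]mulrC.
Qed.

End test_functions.

(** * The space W_0^{1,2} *)

Lemma cvg_harmonicS (R : realType) : (k.+1%:R^-1 : R) @[k --> \oo] --> (0 : R).
Proof. exact: cvg_harmonic. Qed.

Lemma eq_near_bool (R : realType) (f : nat -> R) (a : R) : a <> 0 ->
  f k @[k --> \oo] --> a -> \forall k \near \oo, (0 < f k) = (0 < a).
Proof.
move=> /eqP a0 fa; have e0 : 0 < `|a| by rewrite normr_gt0.
move/cvgrPdist_lt : fa => /(_ _ e0); apply: filterS => k.
move: a0; case: (ltrgtP a 0) => [a0 _|a0 _|//].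
  by rewrite (ltr0_norm a0) ltr_norml => /andP[h _]; apply/negbTE; rewrite -leNgt; lra.
by rewrite (gtr0_norm a0) ltr_norml => /andP[]; lra.
Qed.

Section W0.
Variables (R : realType) (n : nat) (D : bdomain R n).
Local Notation O := (dom D).
Local Notation B := (dom_bound D).
Let O_open : open O := @dom_open _ _ D.
Let O_box : O `<=` box B := @dom_box _ _ D.
Local Notation mu := (lebesgue R n).
Local Notation E := 'rV[R]_n.
Local Notation test := (test_function O).
Implicit Types (phi f u v : E -> R) (g : 'I_n -> E -> R) (i : 'I_n).

Let tl2 phi : test phi -> l2 mu phi.
Proof. exact: test_l2. Qed.

Definition H0cvg (u_ : nat -> E -> R) (g_ : nat -> 'I_n -> E -> R) u g :=
  l2cvg mu u_ u /\ forall i, l2cvg mu (fun k => g_ k i) (g i).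

(* The elements of W_0^{1,2}(O) with their gradients, extended by 0 outside O. *)
Definition H0 u g := [/\ l2 mu u, forall i, l2 mu (g i),
  forall x, ~ O x -> u x = 0 /\ forall i, g i x = 0 &
  exists2 phi_ : nat -> E -> R, forall k, test (phi_ k) &
    H0cvg phi_ (fun k i => partial i (phi_ k)) u g].

Lemma H0_l2 u g : H0 u g -> l2 mu u. Proof. by case. Qed.
Lemma H0_l2g u g i : H0 u g -> l2 mu (g i). Proof. by case. Qed.
Lemma H0_out u g x : H0 u g -> ~ O x -> u x = 0.
Proof. by case=> _ _ h _ /h[]. Qed.
Lemma H0_meas u g : H0 u g -> measurable_fun setT u. Proof. by case=> [[]]. Qed.
Lemma H0_measg u g i : H0 u g -> measurable_fun setT (g i).
Proof. by case=> _ /(_ i)[]. Qed.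

Lemma l1_of_l2 f : l2 mu f -> (forall x, ~ O x -> f x = 0) -> l1 mu f.
Proof.
move=> hf h0; have hb : l2 mu (\1_(box B)).
  split; first by apply: measurable_indic; exact: measurable_box.
  rewrite (_ : (fun x => _) = (\1_(box B) : E -> R)); first exact: l1_box.
  by apply/funext => x; rewrite indicE expr2 -natrM mulnb andbb.
have := l2M hf hb; rewrite (_ : (fun x => _) = f)//.
apply/funext => x; rewrite indicE; have [h|h] := pselect (box B x).
  by rewrite mem_set// mulr1.
by rewrite memNset// mulr0 h0// => /O_box.
Qed.

Lemma H0_l1 u g : H0 u g -> l1 mu u.
Proof. by move=> h; apply: l1_of_l2 (H0_l2 h) _ => x; exact: H0_out h. Qed.

Lemma H0_test phi : test phi -> H0 phi (fun i => partial i phi).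
Proof.
move=> h; split => //.
- exact: tl2.
- by move=> i; apply/tl2/test_partial.
- move=> x Ox; split; first exact: test_out h Ox.
  by move=> i; apply: test_out Ox; exact: test_partial.
- by exists (fun=> phi) => //; split => [|i]; exact: l2cvg_cst.
Qed.

Lemma H0D u v g g' : H0 u g -> H0 v g' ->
  H0 (fun x => u x + v x) (fun i x => g i x + g' i x).
Proof.
move=> [hu hg u0 [p tp [pu pg]]] [hv hg' v0 [q tq [qv qg]]]; split.
- exact: l2D.
- by move=> i; exact: l2D.
- move=> x Ox; have [-> ug] := u0 x Ox; have [-> vg] := v0 x Ox.
  by rewrite addr0; split => // i; rewrite ug vg addr0.
- exists (fun k x => p k x + q k x); first by move=> k; exact: testD.
  split; first by apply: l2cvgD => // k; exact: tl2.
  move=> i; have := l2cvgD (fun k => tl2 (test_partial i (tp k)))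
    (fun k => tl2 (test_partial i (tq k))) (hg i) (hg' i) (pg i) (qg i).
  by apply: eq_rcvg => k; rewrite partialD; [|case: (tp k)|case: (tq k)].
Qed.

Lemma H0Z (c : R) u g : H0 u g -> H0 (fun x => c * u x) (fun i x => c * g i x).
Proof.
move=> [hu hg u0 [p tp [pu pg]]]; split.
- exact: l2Z.
- by move=> i; exact: l2Z.
- move=> x Ox; have [-> ug] := u0 x Ox.
  by rewrite mulr0; split => // i; rewrite ug mulr0.
- exists (fun k x => c * p k x); first by move=> k; exact: testZ.
  split; first by apply: l2cvgZ => // k; exact: tl2.
  move=> i; have := l2cvgZ c (fun k => tl2 (test_partial i (tp k))) (hg i) (pg i).
  by apply: eq_rcvg => k; rewrite partialZ; [|case: (tp k)].
Qed.

Lemma H0B u v g g' : H0 u g -> H0 v g' ->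
  H0 (fun x => u x - v x) (fun i x => g i x - g' i x).
Proof.
move=> hu /(H0Z (-1)) /(H0D hu); congr H0.
  by apply/funext => x; rewrite mulN1r.
by apply/funext => i; apply/funext => x; rewrite mulN1r.
Qed.

Lemma H00 : H0 (fun=> 0) (fun _ _ => 0).
Proof.
have := H0Z 0 (H0_test (@test0 R n D)); congr H0.
  by apply/funext => x; rewrite mul0r.
by apply/funext => i; apply/funext => x; rewrite mul0r.
Qed.

(** A diagonal choice: each [u_ k] is replaced by a test function within [k.+1%:R^-1] of it, in
    value and in gradient. *)
Lemma H0_lim (u_ : nat -> E -> R) (g_ : nat -> 'I_n -> E -> R) u g : (forall k, H0 (u_ k) (g_ k)) -> l2 mu u ->
  (forall i, l2 mu (g i)) -> (forall x, ~ O x -> u x = 0 /\ forall i, g i x = 0) ->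
  H0cvg u_ g_ u g -> H0 u g.
Proof.
move=> h hu hg u0 [uu gg]; split => //.
have H k : exists phi : E -> R, [/\ test phi,
    \int[mu]_x ((phi x - u_ k x) ^+ 2) <= k.+1%:R^-1 &
    forall i, \int[mu]_x ((partial i phi x - g_ k i x) ^+ 2) <= k.+1%:R^-1].
  have [_ _ _ [p tp [pu pg]]] := h k.
  have k0 : 0 < k.+1%:R^-1 :> R by rewrite invr_gt0.
  have hpu : \forall j \near \oo, \int[mu]_x ((p j x - u_ k x) ^+ 2) <= k.+1%:R^-1.
    move/cvgr0Pnorm_le : pu => /(_ _ k0); apply: filterS => j.
    exact: le_trans (ler_norm _).
  have hpg : \forall j \near \oo, forall i,
      \int[mu]_x ((partial i (p j) x - g_ k i x) ^+ 2) <= k.+1%:R^-1.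
    apply: filter_forall => i.
    move/cvgr0Pnorm_le : (pg i) => /(_ _ k0); apply: filterS => j.
    exact: le_trans (ler_norm _).
  near \oo => j; exists (p j); split => //.
    by near: j.
  by near: j.
have [p hp] := choice H; exists p; first by move=> k; have [] := hp k.
have aux (F G : nat -> E -> R) (f : E -> R) : (forall k, l2 mu (F k)) ->
    (forall k, l2 mu (G k)) -> l2 mu f ->
    (forall k, \int[mu]_x ((F k x - G k x) ^+ 2) <= k.+1%:R^-1) ->
    l2cvg mu G f -> l2cvg mu F f.
  move=> hF hG hf FG Gf.
  apply: (@l2cvg_sq0 _ _ _ _ _ _ (fun k => 2 * k.+1%:R^-1 +
     2 * \int[mu]_x ((G k x - f x) ^+ 2))).
    move=> k; have [_ h1] := l2B (hF k) (hG k); have [_ h2] := l2B (hG k) hf.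
    apply: (@le_trans _ _ (2 * \int[mu]_x ((F k x - G k x) ^+ 2) +
       2 * \int[mu]_x ((G k x - f x) ^+ 2))); last by rewrite lerD2r ler_wpM2l.
    rewrite -!integrZ// -integrD; [|exact: l1Z..].
    apply: integr_le.
    - by have [] := l2B (hF k) hf.
    - by apply: l1D; exact: l1Z.
    - apply: aeW => x; rewrite -subr_ge0.
      rewrite (_ : _ - _ = (F k x - G k x - (G k x - f x)) ^+ 2) ?sqr_ge0//; ring.
  apply: (rcvgD (rcvgZ (@cvg_harmonicS R) (erefl _)) (rcvgZ Gf (erefl _))).
  by rewrite !mulr0 addr0.
split.
  apply: (aux p u_) => //; try by move=> k; have [] := hp k.
  - by move=> k; apply: tl2; have [] := hp k.
  - by move=> k; exact: H0_l2 (h k).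
move=> i; apply: (aux _ (fun k => g_ k i)) => //.
- by move=> k; apply/tl2/test_partial; have [] := hp k.
- by move=> k; exact: H0_l2g (h k).
- by move=> k; have [_ _] := hp k.
Unshelve. all: end_near. Qed.

Lemma H0_ae_eq u v g g' : H0 u g -> measurable_fun setT v ->
  (forall i, measurable_fun setT (g' i)) ->
  (forall x, ~ O x -> v x = 0 /\ forall i, g' i x = 0) ->
  {ae mu, forall x, u x = v x} -> (forall i, {ae mu, forall x, g i x = g' i x}) ->
  H0 v g'.
Proof.
move=> h mv mg v0 uv gg.
have hv : l2 mu v by apply: l2_ae_eq uv (H0_l2 h).
have hg i : l2 mu (g' i) by apply: l2_ae_eq (gg i) (H0_l2g i h).
apply: (@H0_lim (fun=> u) (fun=> g)) => //; split.
  apply: (@l2cvg_ae_eq _ _ _ _ (fun=> u) _ u) => //; try exact: l2cvg_cst.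
  - by move=> k; exact: H0_l2 h.
  - exact: H0_l2 h.
  - by move=> k; exact: H0_meas h.
  - by move=> k; apply: aeW.
move=> i; apply: (@l2cvg_ae_eq _ _ _ _ (fun=> g i) _ (g i)) => //; try exact: l2cvg_cst.
- by move=> k; exact: H0_l2g h.
- exact: H0_l2g h.
- by move=> k; exact: H0_measg h.
- by move=> k; apply: aeW.
Qed.

Lemma H0_complete (u_ : nat -> E -> R) (g_ : nat -> 'I_n -> E -> R) : (forall k, H0 (u_ k) (g_ k)) ->
  (forall e : R, 0 < e -> exists K, forall k l, (K <= k)%N -> (K <= l)%N ->
     \int[mu]_x ((u_ k x - u_ l x) ^+ 2) <= e /\
     forall i, \int[mu]_x ((g_ k i x - g_ l i x) ^+ 2) <= e) ->
  exists u g, H0 u g /\ H0cvg u_ g_ u g.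
Proof.
move=> h hC; have mO : measurable O by exact: open_measurable_rV.
have aux (F : nat -> E -> R) : (forall k, l2 mu (F k)) ->
    (forall k x, ~ O x -> F k x = 0) ->
    (forall e : R, 0 < e -> exists K, forall k l, (K <= k)%N -> (K <= l)%N ->
      \int[mu]_x ((F k x - F l x) ^+ 2) <= e) ->
    exists f, [/\ l2 mu f, forall x, ~ O x -> f x = 0 & l2cvg mu F f].
  move=> hF F0 FC; have [f hf Ff] := l2_complete hF FC.
  have i1 (x : E) : `|\1_O x : R| <= 1 by rewrite indicE; case: (_ \in _); rewrite ?normr1 ?normr0.
  have mi : measurable_fun setT (\1_O : E -> R) by exact: measurable_indic.
  (* An L^2 limit vanishes off [O] only almost everywhere; the indicator makes it vanish there at
     every point. *)
  exists (fun x => \1_O x * f x); split.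
  - exact: (l2_bM mi i1).
  - by move=> x Ox; rewrite indicE memNset// mul0r.
  - have cc : {ae mu, forall x, f x <> 0 -> (\1_O x : R) @[_ --> \oo] --> (\1_O x : R)}.
      by apply: aeW => x _; exact: cvg_cst.
    have := @l2cvg_bM _ _ _ mu (fun=> \1_O) F \1_O f 1 (fun=> mi) mi (fun=> i1) i1
      cc hF hf Ff.
    apply: eq_rcvg => k; apply: eq_Rintegral => x _; rewrite [X in X - _](_ : _ = F k x)//.
    have [Ox|Ox] := pselect (O x); first by rewrite indicE mem_set// mul1r.
    by rewrite F0// mulr0.
have [||u [hu u0 uu]] := aux u_ (fun k => H0_l2 (h k)).
- by move=> k x; exact: H0_out (h k).
- move=> e e0; have [K hK] := hC e e0; exists K => k l Kk Kl.
  by have [] := hK k l Kk Kl.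
have Hg i : exists f, [/\ l2 mu f, forall x, ~ O x -> f x = 0 & l2cvg mu (fun k => g_ k i) f].
  apply: aux.
  - by move=> k; exact: H0_l2g (h k).
  - by move=> k x Ox; have [_ _ /(_ x Ox)[]] := h k.
  - move=> e e0; have [K hK] := hC e e0; exists K => k l Kk Kl.
    by have [] := hK k l Kk Kl.
have [g hg] := choice Hg.
have Hc : H0cvg u_ g_ u g by split => // i; have [] := hg i.
exists u, g; split => //; apply: (H0_lim h) => //.
- by move=> i; have [] := hg i.
- by move=> x Ox; split; [exact: u0|move=> i; have [_ /(_ x Ox)] := hg i].
Qed.

Lemma H0_weak_gradient u g phi i : H0 u g -> test phi ->
  \int[mu]_x (u x * partial i phi x) = - \int[mu]_x (g i x * phi x).
Proof.
move=> [hu hg _ [p tp [pu pg]]] tphi.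
have tpi := test_partial i tphi.
have h1 := l2cvg_dot (fun k => tl2 (tp k)) (fun k => tl2 tpi) hu (tl2 tpi) pu (l2cvg_cst _ _).
have h2 := l2cvg_dot (fun k => tl2 (test_partial i (tp k))) (fun k => tl2 tphi)
  (hg i) (tl2 tphi) (pg i) (l2cvg_cst _ _).
have h3 : \int[mu]_x (p k x * partial i phi x) @[k --> \oo] --> - \int[mu]_x (g i x * phi x).
  have h3 : - 1 * \int[mu]_x (partial i (p k) x * phi x) @[k --> \oo] -->
      - \int[mu]_x (g i x * phi x) by apply: (rcvgZ h2); rewrite mulN1r.
  apply: eq_rcvg h3 => k.
  by rewrite mulN1r -(@integr_by_parts _ _ D)//; case: (tp k).
exact: cvg_unique h1 h3.
Qed.

(** The difference of the gradients is orthogonal to every test function, by the weak gradient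
    formula for a null function. Being itself an L^2 limit of partial derivatives of test functions,
    it is orthogonal to itself. *)
Lemma H0_unique u v g g' i : H0 u g -> H0 v g' -> {ae mu, forall x, u x = v x} ->
  {ae mu, forall x, g i x = g' i x}.
Proof.
move=> hu hv uv; have hw := H0B hu hv.
set w := (fun x => u x - v x) in hw; set gw := (fun i x => g i x - g' i x) in hw.
have h0 phi : test phi -> \int[mu]_x (gw i x * phi x) = 0.
  move=> tphi; apply/eqP; rewrite -oppr_eq0 -(H0_weak_gradient i hw tphi).
  rewrite -(integr0 mu); apply/eqP; apply: integr_ae_eq => //.
    apply: measurable_funM; first exact: H0_meas hw.
    by apply: (@test_meas _ _ D); exact: test_partial.
  by apply: filterS uv => x; rewrite /w => ->; rewrite subrr mul0r.
have [_ hg _ [p tp [_ pg]]] := hw.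
have h1 := l2cvg_dot (fun k => hg i) (fun k => tl2 (test_partial i (tp k)))
  (hg i) (hg i) (l2cvg_cst _ _) (pg i).
have h2 : \int[mu]_x (gw i x * gw i x) = 0.
  apply: (cvg_unique _ h1) => //.
  apply: (eq_rcvg (f := fun=> 0)); last exact: cvg_cst.
  by move=> k; rewrite h0//; exact: test_partial.
have := @integr_eq0 _ _ _ mu (fun x => gw i x * gw i x) (l2M (hg i) (hg i)).
rewrite h2 => /(_ (aeW _ (fun x => _)) (lexx _)).
have sq x : 0 <= gw i x * gw i x by rewrite -expr2 sqr_ge0.
by move=> /(_ sq); apply: filterS => x /eqP; rewrite mulf_eq0 orbb subr_eq0 => /eqP.
Qed.

Lemma chain_bound F dF (C : R) : chain n F dF -> (forall s, `|dF s| <= C) ->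
  forall s, `|F s| <= C * `|s|.
Proof.
move=> [_ dFd F0] dC s; rewrite -[F s]subr0 -{1}F0.
by apply: (le_trans (lipschitz_of_derive dFd dC _ _)); rewrite subr0.
Qed.

(** The approximants are returned along with the limit, because composites [F \o p] are again test
    functions and inherit the sign and the bounds of [F]. Passing to a subsequence gives the almost
    everywhere convergence under which [dF (p k)] converges. *)
Lemma H0_chain_cvg F dF (C : R) u g (p : nat -> E -> R) :
  chain n F dF -> continuous dF -> (forall s, `|dF s| <= C) -> H0 u g ->
  (forall k, test (p k)) -> H0cvg p (fun k i => partial i (p k)) u g ->
  exists2 s : nat -> nat, forall k, (k <= s k)%N &
  H0cvg (fun k => F \o p (s k)) (fun k i => partial i (F \o p (s k)))
    (F \o u) (fun i x => dF (u x) * g i x).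
Proof.
move=> cF cdF dC hu tp [pu pg]; have [hF dFd F0] := cF.
have [l2u l2g u0 _] := hu.
have lip := lipschitz_of_derive dFd dC.
have cFc : continuous F.
  by move=> s; apply: differentiable_continuous; apply/derivable1_diffP; have [] := dFd s.
have mF : measurable_fun setT F by exact: continuous_measurable_fun.
have mdF : measurable_fun setT dF by exact: continuous_measurable_fun.
have [s ks pae] := l2cvg_ae (fun k => tl2 (tp k)) l2u pu.
exists s => //.
have mu_ : measurable_fun setT u by case: l2u.
have mdFu : measurable_fun setT (dF \o u) by exact: measurableT_comp.
have mdFp k : measurable_fun setT (dF \o p k).
  by apply: measurableT_comp => //; exact: test_meas.
have lFu : l2 mu (F \o u).
  apply: (l2_le _ (l2Z C l2u)); first exact: measurableT_comp.
  apply: aeW => x /=; apply: (le_trans (chain_bound cF dC _)).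
  by rewrite normrM ler_wpM2r// ler_norm.
split.
  apply: (@l2cvg_sq0 _ _ _ _ _ _ (fun k => C ^+ 2 * \int[mu]_x ((p (s k) x - u x) ^+ 2))).
    move=> k; have [_ h] := l2B (tl2 (tp (s k))) l2u; rewrite -integrZ//.
    apply: integr_le; last 1 first.
    - apply: aeW => x /=; rewrite -exprMn -[leLHS]real_normK ?num_real//.
      rewrite -[leRHS]real_normK ?num_real// ler_pXn2r ?nnegrE// normrM.
      by apply: (le_trans (lip _ _)); rewrite ler_wpM2r// ler_norm.
    - by have [] := l2B (tl2 (test_chain cF (tp (s k)))) lFu.
    - exact: l1Z.
  by apply: (rcvgZ (rcvg_sub ks pu)); rewrite mulr0.
move=> i.
have := @l2cvg_bM _ _ _ mu (fun k => dF \o p (s k)) (fun k => partial i (p (s k)))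
  (dF \o u) (g i) C (fun k => mdFp (s k)) mdFu (fun k x => dC _) (fun x => dC _) _
  (fun k => tl2 (test_partial i (tp (s k)))) (l2g i) (rcvg_sub ks (pg i)).
have cc : {ae mu, forall x, g i x <> 0 -> dF (p (s k) x) @[k --> \oo] --> dF (u x)}.
  by apply: filterS pae => x h _; apply: (cvg_comp _ _ h); exact: cdF.
move=> /(_ cc); apply: eq_rcvg => k; rewrite (partial_chain _ cF)//.
by case: (tp (s k)).
Qed.

Lemma H0_chain F dF (C : R) u g : chain n F dF -> continuous dF ->
  (forall s, `|dF s| <= C) -> H0 u g ->
  H0 (F \o u) (fun i x => dF (u x) * g i x).
Proof.
move=> cF cdF dC hu; have [l2u l2g u0 [p tp pu]] := hu; have [_ dFd F0] := cF.
have [s ks H] := H0_chain_cvg cF cdF dC hu tp pu.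
have mdF : measurable_fun setT (dF \o u).
  by apply: measurableT_comp; [exact: continuous_measurable_fun|case: l2u].
have cFc : continuous F.
  by move=> t; apply: differentiable_continuous; apply/derivable1_diffP; have [] := dFd t.
apply: (@H0_lim (fun k => F \o p (s k)) (fun k i => partial i (F \o p (s k)))) => //.
- by move=> k; apply: H0_test; exact: (test_chain cF (tp _)).
- apply: (l2_le _ (l2Z C l2u)).
    by apply: measurableT_comp; [exact: continuous_measurable_fun|case: l2u].
  apply: aeW => x /=; apply: (le_trans (chain_bound cF dC _)).
  by rewrite normrM ler_wpM2r// ler_norm.
- by move=> i; apply: (l2_bM mdF) => //; move=> x; exact: dC.
- by move=> x Ox; have [ux ug] := u0 x Ox; rewrite /= ux F0; split => // i; rewrite ug mulr0.
Qed.

Lemma measurable_gt0 f : measurable_fun setT f ->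
  measurable_fun setT (fun x => (0 < f x)%R%:R : R).
Proof.
move=> mf; rewrite (_ : (fun x => _) = \1_(f @^-1` `]0, +oo[)).
  apply: measurable_indic; rewrite -[X in measurable X]setTI; exact: mf.
apply/funext => x; rewrite indicE; case: (boolP (0 < f x)) => h.
  by rewrite mem_set//= in_itv/= h.
by rewrite memNset//= in_itv/= andbT; exact/negP.
Qed.

Lemma norm_nat_le1 (b : bool) : `|b%:R : R| <= 1.
Proof. by case: b; rewrite ?normr1 ?normr0. Qed.

Lemma chain_pospart (e : R) : 0 < e -> chain n (pospart_approx e) (dpospart_approx e).
Proof.
move=> e0; split.
- move=> k f hf; rewrite (_ : _ \o _ = (fun x => f x * (gexp 0 \o (fun x => e^-1 * f x)) x))//.
  by apply: CkM => //; apply: Ck_gexp; exact: CkZ.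
- by move=> s; exact: is_derive_pospart_approx.
- by rewrite /pospart_approx mul0r.
Qed.

Lemma continuous_dpospart (e : R) : continuous (dpospart_approx e).
Proof.
have h m : continuous (fun s : R => gexp m (e^-1 * s)).
  move=> s; apply: (@continuous_comp _ _ _ (fun s => e^-1 * s) (gexp m)).
    by apply: (rcvgZ (@cvg_id _ _)).
  exact: continuous_gexp.
by move=> s; apply: (rcvgD (h 0 s) (h 1 s)).
Qed.

Lemma H0_pospart_approx u g (e : R) : 0 < e -> H0 u g ->
  H0 (pospart_approx e \o u) (fun i x => dpospart_approx e (u x) * g i x).
Proof.
move=> e0 hu; apply: (H0_chain (C := 2) (chain_pospart e0)) => //.
  exact: continuous_dpospart.
exact: dpospart_approx_norm.
Qed.

Lemma H0_pos u g : H0 u g ->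
  H0 (fun x => Num.max (u x) 0) (fun i x => (0 < u x)%R%:R * g i x) /\
  H0cvg (fun k => pospart_approx k.+1%:R^-1 \o u)
    (fun k i x => dpospart_approx k.+1%:R^-1 (u x) * g i x)
    (fun x => Num.max (u x) 0) (fun i x => (0 < u x)%R%:R * g i x).
Proof.
move=> hu; have k0 k : 0 < k.+1%:R^-1 :> R by rewrite invr_gt0.
have hk k := H0_pospart_approx (k0 k) hu.
have mu_ := H0_meas hu; have mu0 := measurable_gt0 mu_.
have h1 x : `|(0 < u x)%R%:R : R| <= 2 by apply: (le_trans (norm_nat_le1 _)); lra.
have [hm cm] : l2 mu (fun x => Num.max (u x) 0) /\
    l2cvg mu (fun k => pospart_approx k.+1%:R^-1 \o u) (fun x => Num.max (u x) 0).
  apply: (l2cvg_dct _ _ (l2_norm (H0_l2 hu))).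
  - by move=> k; exact: H0_meas (hk k).
  - by apply: measurable_maxr => //; exact: measurable_cst.
  - by apply: aeW => x; apply: cvg_pospart_approx => //; exact: cvg_harmonicS.
  - by move=> k; apply: aeW => x; exact: pospart_approx_norm.
have cg i : l2cvg mu (fun k x => dpospart_approx k.+1%:R^-1 (u x) * g i x)
    (fun x => (0 < u x)%R%:R * g i x).
  apply: (@l2cvg_bM _ _ _ mu (fun k x => dpospart_approx k.+1%:R^-1 (u x)) (fun=> g i)
    _ (g i) 2) => //.
  - move=> k; apply: (measurableT_comp (f := dpospart_approx k.+1%:R^-1)) => //.
    by apply: continuous_measurable_fun; exact: continuous_dpospart.
  - by move=> k x; exact: dpospart_approx_norm.
  - by apply: aeW => x _; apply: cvg_dpospart_approx => //; exact: cvg_harmonicS.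
  - by move=> k; exact: H0_l2g hu.
  - exact: H0_l2g hu.
  - exact: l2cvg_cst.
split; last by split.
apply: (H0_lim hk) => //.
- by move=> i; apply: (l2_bM mu0 h1); exact: H0_l2g hu.
- move=> x Ox; rewrite (H0_out hu Ox) maxxx; split => // i.
  by rewrite ltxx mul0r.
Qed.

(** Write [u] as the difference of the positive parts of [u] and [- u]. The gradients found for
    these carry the indicators of [0 < u] and [u < 0], both zero where [u = 0], and the gradient of
    [u] is unique. *)
Lemma H0_grad_eq0 u g i : H0 u g -> {ae mu, forall x, u x = 0 -> g i x = 0}.
Proof.
move=> hu; have hp := (H0_pos hu).1; have hn := (H0_pos (H0Z (-1) hu)).1.
have hd := H0B hp hn.
have : {ae mu, forall x, u x = Num.max (u x) 0 - Num.max (-1 * u x) 0}.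
  by apply: aeW => x; exact: max0_sub.
move=> /(H0_unique i hu hd); apply: filterS => x -> ux.
by rewrite ux mulr0 ltxx !mul0r subr0.
Qed.

Lemma H0_mul u g f : test f -> H0 u g ->
  H0 (fun x => f x * u x) (fun i x => f x * g i x + partial i f x * u x).
Proof.
move=> tf [hu hg u0 [p tp [pu pg]]].
have [M _ hM] := test_bounded tf; have mf := test_meas tf.
have bf i := test_bounded (test_partial i tf).
have tfi i := test_partial i tf.
have cc (h b : E -> R) : {ae mu, forall x, b x <> 0 -> h x @[_ --> \oo] --> h x}.
  by apply: aeW => x _; exact: cvg_cst.
apply: (@H0_lim (fun k x => f x * p k x) (fun k i => partial i (fun x => f x * p k x))).
- by move=> k; apply: H0_test; apply: test_smoothM => //; case: tf.
- exact: (l2_bM mf hM).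
- move=> i; apply: l2D; first exact: (l2_bM mf hM).
  by have [Mi _ hMi] := bf i; apply: (l2_bM (test_meas (tfi i)) hMi).
- by move=> x Ox; have [-> ug] := u0 x Ox; rewrite mulr0; split => // i; rewrite ug !mulr0 addr0.
split.
  exact: (@l2cvg_bM _ _ _ mu (fun=> f) p f u M (fun=> mf) mf (fun=> hM) hM (cc _ _)
    (fun k => tl2 (tp k)) hu pu).
move=> i; have [Mi _ hMi] := bf i; have mfi := test_meas (tfi i).
have h1 := @l2cvg_bM _ _ _ mu (fun=> f) (fun k => partial i (p k)) f (g i) M (fun=> mf) mf
  (fun=> hM) hM (cc _ _) (fun k => tl2 (test_partial i (tp k))) (hg i) (pg i).
have h2 := @l2cvg_bM _ _ _ mu (fun=> partial i f) p (partial i f) u Mi (fun=> mfi) mfi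
  (fun=> hMi) hMi (cc _ _) (fun k => tl2 (tp k)) hu pu.
have h3 := l2cvgD (fun k => l2_bM mf hM (tl2 (test_partial i (tp k))))
  (fun k => l2_bM mfi hMi (tl2 (tp k))) (l2_bM mf hM (hg i)) (l2_bM mfi hMi hu) h1 h2.
apply: eq_rcvg h3 => k; apply: eq_Rintegral => x _.
rewrite partialM; [|by case: tf|by case: (tp k)].
by rewrite [p k x * _]mulrC.
Qed.

(** Integrating [phi ^+ 2] by parts against the coordinate [x 0 i], whose [i]-th derivative is [1],
    gives [- 2] times the integral of [phi * x 0 i * partial i phi]. Cauchy-Schwarz and
    [|x 0 i| <= B] on [O] yield the constant [(2 * B) ^+ 2]. *)
Lemma poincare u g i : H0 u g ->
  \int[mu]_x (u x ^+ 2) <= (2 * B) ^+ 2 * \int[mu]_x (g i x ^+ 2).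
Proof.
move=> [hu hg _ [p tp [pu pg]]].
have key phi : test phi ->
    \int[mu]_x (phi x * phi x) <= (2 * B) ^+ 2 * \int[mu]_x (partial i phi x * partial i phi x).
  move=> tphi; have tpi := test_partial i tphi.
  have t2 : test (fun x => phi x * phi x) by apply: test_smoothM => //; case: tphi.
  have sc : smooth (fun x : E => x 0 i) by move=> k; exact: Ck_coord.
  set a := \int[mu]_x (phi x * phi x); set b := \int[mu]_x (_ * _).
  have tx : test (fun x => x 0 i * partial i phi x) by exact: test_smoothM.
  have ea : a = - (2 * \int[mu]_x (phi x * (x 0 i * partial i phi x))).
    have e1 : partial i (fun x : E => x 0 i) = (fun=> 1).
      by apply: partialE => x; have := is_derive_coord i x (delta_mx 0 i); rewrite mxE !eqxx.
    rewrite -integrZ; last by apply: l2M; exact: tl2.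
    have := integr_by_parts i sc t2; rewrite partialM; [|by case: tphi..].
    rewrite e1 => e2; rewrite -[LHS]opprK; congr (- _).
    transitivity (- \int[mu]_x (1 * (phi x * phi x))).
      by congr (- _); apply: eq_Rintegral => x _; rewrite mul1r.
    by rewrite -e2; apply: eq_Rintegral => x _; ring.
  have a0 : 0 <= a by apply: integr_ge0 => x; rewrite -expr2 sqr_ge0.
  have cs := cauchy_schwarz (tl2 tphi) (tl2 tx).
  have h1 : \int[mu]_x ((x 0 i * partial i phi x) ^+ 2) <= B ^+ 2 * b.
    rewrite -integrZ; last by apply: l2M; exact: tl2.
    apply: integr_le; first by case: (tl2 tx).
      by apply: l1Z; apply: l2M; exact: tl2.
    apply: aeW => x; rewrite exprMn -expr2.
    have [Ox|Ox] := pselect (O x); last by rewrite (test_out tpi Ox) expr0n !mulr0.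
    rewrite ler_wpM2r ?sqr_ge0// -[leLHS]real_normK ?num_real//.
    have h := O_box Ox i; rewrite ler_pXn2r ?nnegrE//.
    exact: le_trans (normr_ge0 _) h.
  have aE : \int[mu]_x (phi x ^+ 2) = a by apply: eq_Rintegral => x _; rewrite expr2.
  rewrite aE in cs.
  have h2 : a ^+ 2 <= a * ((2 * B) ^+ 2 * b).
    rewrite {1}ea sqrrN exprMn.
    apply: (@le_trans _ _ (2 ^+ 2 * (a * (B ^+ 2 * b)))).
      by rewrite ler_wpM2l ?exprn_ge0//; apply: (le_trans cs); rewrite ler_wpM2l.
    by rewrite (_ : 2 ^+ 2 * _ = a * ((2 * B) ^+ 2 * b))//; ring.
  move: a0; rewrite le_eqVlt => /predU1P[<-|a0].
    rewrite mulr_ge0 ?sqr_ge0//; apply: integr_ge0 => x; by rewrite -expr2 sqr_ge0.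
  by rewrite -(ler_pM2l a0) -expr2.
have h1 := l2cvg_dot (fun k => tl2 (tp k)) (fun k => tl2 (tp k)) hu hu pu pu.
have h2 := l2cvg_dot (fun k => tl2 (test_partial i (tp k)))
  (fun k => tl2 (test_partial i (tp k))) (hg i) (hg i) (pg i) (pg i).
have sqE (f : E -> R) : \int[mu]_x (f x ^+ 2) = \int[mu]_x (f x * f x).
  by apply: eq_Rintegral => x _; rewrite expr2.
rewrite !sqE.
have h3 : (2 * B) ^+ 2 * \int[mu]_x (partial i (p k) x * partial i (p k) x) @[k --> \oo]
   --> (2 * B) ^+ 2 * \int[mu]_x (g i x * g i x) by exact: (rcvgZ h2).
apply: (ler_cvg_to h1 h3); apply: nearW => k; exact: key.
Qed.

(** Along a subsequence converging almost everywhere the indicators of positivity converge where [u]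
    is nonzero, and the limit gradient vanishes where [u = 0]. *)
Lemma H0_pos_cvg (u_ : nat -> E -> R) (g_ : nat -> 'I_n -> E -> R) u g :
  (forall k, H0 (u_ k) (g_ k)) -> H0 u g -> H0cvg u_ g_ u g ->
  exists2 s : nat -> nat, forall k, (k <= s k)%N &
  H0cvg (fun k x => Num.max (u_ (s k) x) 0) (fun k i x => (0 < u_ (s k) x)%R%:R * g_ (s k) i x)
    (fun x => Num.max (u x) 0) (fun i x => (0 < u x)%R%:R * g i x).
Proof.
move=> hk hu [uu gg].
have [s ks sae] := l2cvg_ae (fun k => H0_l2 (hk k)) (H0_l2 hu) uu.
exists s => //; split.
  apply: (@l2cvg_sq0 _ _ _ _ _ _ (fun k => \int[mu]_x ((u_ (s k) x - u x) ^+ 2))).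
    move=> k; apply: integr_le.
    - by have [] := l2B (H0_l2 (H0_pos (hk (s k))).1) (H0_l2 (H0_pos hu).1).
    - by have [] := l2B (H0_l2 (hk (s k))) (H0_l2 hu).
    - apply: aeW => x; rewrite -[leLHS]real_normK ?num_real// -[leRHS]real_normK ?num_real//.
      by rewrite ler_pXn2r ?nnegrE//; exact: max0_lip.
  exact: rcvg_sub ks uu.
move=> i; apply: (@l2cvg_bM _ _ _ mu (fun k x => (0 < u_ (s k) x)%R%:R) (fun k => g_ (s k) i)
  (fun x => (0 < u x)%R%:R) (g i) 1) => //.
- by move=> k; apply: measurable_gt0; exact: H0_meas (hk _).
- by apply: measurable_gt0; exact: H0_meas hu.
- by move=> k x; exact: norm_nat_le1.
- by move=> x; exact: norm_nat_le1.
- apply: filterS2 sae (H0_grad_eq0 i hu) => x h1 h2 gx.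
  have ux : u x <> 0 by move=> /h2.
  have h := eq_near_bool ux h1.
  apply: cvg_near_cst; by apply: filterS h => k ->.
- by move=> k; exact: H0_l2g (hk _).
- exact: H0_l2g hu.
- exact: rcvg_sub ks (gg i).
Qed.

End W0.

(** * Subsolutions *)

Section subsolutions.
Variables (R : realType) (n : nat) (D : bdomain R n.+1).
Local Notation O := (dom D).
Local Notation B := (dom_bound D).
Let O_open : open O := @dom_open _ _ D.
Let O_box : O `<=` box B := @dom_box _ _ D.
Local Notation mu := (lebesgue R n.+1).
Local Notation E := 'rV[R]_n.+1.
Local Notation test := (test_function O).
Local Notation H0 := (H0 D).
Implicit Types (phi f u v a : E -> R) (g h G : 'I_n.+1 -> E -> R) (i : 'I_n.+1).

Let tl2 phi : test phi -> l2 mu phi.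
Proof. exact: test_l2. Qed.

Definition l2v g := forall i, l2 mu (g i).

Definition dot g h : R := \sum_i \int[mu]_x (g i x * h i x).

Lemma dotC g h : dot g h = dot h g.
Proof. by apply: eq_bigr => i _; apply: eq_Rintegral => x _; rewrite mulrC. Qed.

Lemma dotDr G g h : l2v G -> l2v g -> l2v h ->
  dot G (fun i x => g i x + h i x) = dot G g + dot G h.
Proof.
move=> hG hg hh; rewrite /dot -big_split/=; apply: eq_bigr => i _.
rewrite -integrD; [|exact: l2M..].
by apply: eq_Rintegral => x _; rewrite mulrDr.
Qed.

Lemma dotZr c g h : l2v g -> l2v h -> dot g (fun i x => c * h i x) = c * dot g h.
Proof.
move=> hg hh; rewrite /dot mulr_sumr; apply: eq_bigr => i _.
rewrite -integrZ; last exact: l2M.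
by apply: eq_Rintegral => x _; rewrite mulrCA.
Qed.

Lemma dotBr G g h : l2v G -> l2v g -> l2v h ->
  dot G (fun i x => g i x - h i x) = dot G g - dot G h.
Proof.
move=> hG hg hh; rewrite /dot -sumrB/=; apply: eq_bigr => i _.
rewrite -integrB; [|exact: l2M..].
by apply: eq_Rintegral => x _; rewrite mulrBr.
Qed.

Lemma dotBl G g h : l2v G -> l2v g -> l2v h ->
  dot (fun i x => g i x - h i x) G = dot g G - dot h G.
Proof. by move=> hG hg hh; rewrite dotC dotBr// dotC [dot G h]dotC. Qed.

Lemma dot_ge0 g : 0 <= dot g g.
Proof. by apply: sumr_ge0 => i _; apply: integr_ge0 => x; rewrite -expr2 sqr_ge0. Qed.

Lemma dot_sq g i : l2v g -> \int[mu]_x (g i x ^+ 2) <= dot g g.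
Proof.
move=> hg; have -> : \int[mu]_x (g i x ^+ 2) = \int[mu]_x (g i x * g i x).
  by apply: eq_Rintegral => x _; rewrite expr2.
rewrite /dot (bigD1 i)//= lerDl.
by apply: sumr_ge0 => j _; apply: integr_ge0 => x; rewrite -expr2 sqr_ge0.
Qed.

Lemma dot_ae_eq G g h : l2v G -> l2v g -> l2v h ->
  (forall i, {ae mu, forall x, g i x = h i x}) -> dot G g = dot G h.
Proof.
move=> hG hg hh gh; apply: eq_bigr => i _; apply: integr_ae_eq.
- by apply: measurable_funM; [case: (hG i)|case: (hg i)].
- by apply: measurable_funM; [case: (hG i)|case: (hh i)].
- by apply: filterS (gh i) => x ->.
Qed.

Lemma dot_cvg (g_ h_ : nat -> 'I_n.+1 -> E -> R) g h :
  (forall k, l2v (g_ k)) -> (forall k, l2v (h_ k)) -> l2v g -> l2v h ->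
  (forall i, l2cvg mu (fun k => g_ k i) (g i)) ->
  (forall i, l2cvg mu (fun k => h_ k i) (h i)) ->
  dot (g_ k) (h_ k) @[k --> \oo] --> dot g h.
Proof.
move=> hg_ hh_ hg hh gg hhh; rewrite /dot.
apply: rcvg_sum => i; apply: l2cvg_dot => //.
- by move=> k; exact: hg_.
- by move=> k; exact: hh_.
Qed.

Lemma H0_l2v u g : H0 u g -> l2v g. Proof. by move=> h i; exact: H0_l2g h. Qed.

Lemma test_l2v phi : test phi -> l2v (fun i => partial i phi).
Proof. by move=> h i; exact/tl2/test_partial. Qed.

Lemma l2vB g h : l2v g -> l2v h -> l2v (fun i x => g i x - h i x).
Proof. by move=> hg hh i; exact: l2B. Qed.

Lemma H0_grad0 u g : H0 u g -> dot g g <= 0 -> {ae mu, forall x, u x = 0}.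
Proof.
move=> hu g0; have h := poincare  ord0 hu.
have [_ hsq] := H0_l2 hu.
have : \int[mu]_x (u x ^+ 2) <= 0.
  apply: (le_trans h); rewrite mulr_ge0_le0 ?sqr_ge0//.
  exact: le_trans (dot_sq ord0 (H0_l2v hu)) g0.
move=> /(integr_eq0 hsq) => /(_ (aeW _ (fun x => sqr_ge0 _))).
by apply: filterS => x /eqP; rewrite sqrf_eq0 => /eqP.
Qed.

Lemma H0_complete_grad (u_ : nat -> E -> R) (g_ : nat -> 'I_n.+1 -> E -> R) :
  (forall k, H0 (u_ k) (g_ k)) ->
  (forall e : R, 0 < e -> exists K, forall k l, (K <= k)%N -> (K <= l)%N ->
     dot (fun i x => g_ k i x - g_ l i x) (fun i x => g_ k i x - g_ l i x) <= e) ->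
  exists u g, H0 u g /\ H0cvg u_ g_ u g.
Proof.
move=> hk hC; apply: (H0_complete  hk) => e e0.
pose c := (2 * B) ^+ 2 + 1; have c0 : 0 < c by rewrite ltr_wpDl ?sqr_ge0.
have [K hK] := hC (e / c) (divr_gt0 e0 c0); exists K => k l Kk Kl.
have h := hK k l Kk Kl; have hkl := H0B (hk k) (hk l).
have hi i := le_trans (dot_sq i (H0_l2v hkl)) h.
have ec : e / c <= e.
  by rewrite ler_pdivrMr// ler_peMr ?(ltW e0)// /c lerDr sqr_ge0.
split; last by move=> i; exact: le_trans (hi i) ec.
apply: (le_trans (poincare  ord0 hkl)).
apply: (@le_trans _ _ ((2 * B) ^+ 2 * (e / c))).
  by rewrite ler_wpM2l ?sqr_ge0.
by rewrite mulrCA ler_piMr ?(ltW e0)// ler_pdivrMr// mul1r /c lerDl.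
Qed.

Lemma H0_min u v g h : H0 u g -> H0 v h ->
  H0 (fun x => Num.min (u x) (v x))
    (fun i x => g i x - (0 < u x - v x)%R%:R * (g i x - h i x)).
Proof.
move=> hu hv; have := H0B hu (H0_pos  (H0B hu hv)).1.
by congr H0; apply/funext => x; rewrite minE_max0.
Qed.

(** The weak form of [Delta u >= - M]. Sign and bound are required at every point, so that later
    estimates between representatives need no exceptional sets. *)
Definition subsol (M : R) u g := [/\ H0 u g, forall x, 0 <= u x,
  exists C : R, forall x, u x <= C &
  forall phi, test phi -> (forall x, 0 <= phi x) ->
    dot g (fun i => partial i phi) <= M * \int[mu]_x phi x].

Lemma subsol_H0 M u g : subsol M u g -> H0 u g. Proof. by case. Qed.

Lemma integr_l2cvg (F : nat -> E -> R) f : (forall k, l2 mu (F k)) -> l2 mu f ->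
  (forall k x, ~ O x -> F k x = 0) -> (forall x, ~ O x -> f x = 0) ->
  l2cvg mu F f -> \int[mu]_x F k x @[k --> \oo] --> \int[mu]_x f x.
Proof.
move=> hF hf F0 f0 Ff.
have hb : l2 mu (\1_O).
  have mO : measurable_fun setT (\1_O : E -> R).
    by apply: measurable_indic; exact: open_measurable_rV.
  split => //; apply: (l1_bounded (B := B) (M := 1)).
  - exact: measurable_funX.
  - by move=> x; rewrite indicE; case: (_ \in _); rewrite ?expr1n ?expr0n ?normr1 ?normr0.
  - by move=> x nB; rewrite indicE memNset ?expr0n// => /O_box.
have e (F' : E -> R) : (forall x, ~ O x -> F' x = 0) ->
    \int[mu]_x F' x = \int[mu]_x (F' x * \1_O x).
  move=> h; apply: eq_Rintegral => x _; rewrite indicE.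
  by have [Ox|Ox] := pselect (O x); [rewrite mem_set// mulr1|rewrite memNset// mulr0 h].
rewrite e//; apply: (eq_rcvg (f := fun k => \int[mu]_x (F k x * \1_O x))).
  by move=> k; rewrite -e//; exact: F0.
by apply: l2cvg_dot => //; exact: l2cvg_cst.
Qed.

Lemma H0cvg_integr (u_ : nat -> E -> R) (g_ : nat -> 'I_n.+1 -> E -> R) u g :
  (forall k, H0 (u_ k) (g_ k)) -> H0 u g -> H0cvg u_ g_ u g ->
  \int[mu]_x u_ k x @[k --> \oo] --> \int[mu]_x u x.
Proof.
move=> hk hu [uu _]; apply: integr_l2cvg => //.
- by move=> k; exact: H0_l2 (hk k).
- exact: H0_l2 hu.
- by move=> k x; exact: H0_out (hk k).
- by move=> x; exact: H0_out hu.
Qed.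

(* The inequality passes from test functions to W_0^{1,2}: a nonnegative element
   is a limit of pospart_approx of test functions, which are nonnegative. *)
Lemma weak_ineq_ext (M : R) G v h : l2v G ->
  (forall phi, test phi -> (forall x, 0 <= phi x) ->
    dot G (fun i => partial i phi) <= M * \int[mu]_x phi x) ->
  H0 v h -> {ae mu, forall x, 0 <= v x} -> dot G h <= M * \int[mu]_x v x.
Proof.
move=> hG hM hv v0.
have step1 (e : R) : 0 < e -> dot G (fun i x => dpospart_approx e (v x) * h i x) <=
    M * \int[mu]_x (pospart_approx e \o v) x.
  move=> e0; have [_ _ _ [p tp pv]] := hv.
  have [s ks Hs] := H0_chain_cvg (chain_pospart _ e0) (@continuous_dpospart _ e)
    (@dpospart_approx_norm _ e) hv tp pv.
  have hb := H0_pospart_approx  e0 hv.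
  have tF k : test (pospart_approx e \o p (s k)).
    by apply: test_chain (tp _); exact: chain_pospart.
  have h1 : dot G (fun i => partial i (pospart_approx e \o p (s k))) @[k --> \oo] -->
      dot G (fun i x => dpospart_approx e (v x) * h i x).
    apply: (@dot_cvg (fun=> G) (fun k i => partial i (pospart_approx e \o p (s k)))) => //.
    - by move=> k; exact: test_l2v.
    - exact: H0_l2v hb.
    - by move=> i; exact: l2cvg_cst.
    - by case: Hs.
  have h2 : M * \int[mu]_x (pospart_approx e \o p (s k)) x @[k --> \oo] -->
      M * \int[mu]_x (pospart_approx e \o v) x.
    apply: rcvgZ => //; apply: H0cvg_integr hb Hs => k.
    exact: (H0_test (tF k)).
  apply: (ler_cvg_to h1 h2); apply: nearW => k; apply: hM => //.
  by move=> x; exact: pospart_approx_ge0.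
have k0 k : 0 < k.+1%:R^-1 :> R by rewrite invr_gt0.
have [hp cp] := H0_pos  hv.
have hk k := H0_pospart_approx  (k0 k) hv.
have h1 : dot G (fun i x => dpospart_approx k.+1%:R^-1 (v x) * h i x) @[k --> \oo] -->
      dot G (fun i x => (0 < v x)%R%:R * h i x).
  apply: (@dot_cvg (fun=> G) (fun k i x => dpospart_approx k.+1%:R^-1 (v x) * h i x)) => //.
  - by move=> k; exact: H0_l2v (hk k).
  - exact: H0_l2v hp.
  - by move=> i; exact: l2cvg_cst.
  - by case: cp.
have h2 : M * \int[mu]_x (pospart_approx k.+1%:R^-1 \o v) x @[k --> \oo] -->
    M * \int[mu]_x Num.max (v x) 0 by apply: (rcvgZ (H0cvg_integr hk hp cp)).
have ev : {ae mu, forall x, v x = Num.max (v x) 0}.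
  by apply: filterS v0 => x h0; rewrite (max_idPl h0).
rewrite (dot_ae_eq hG (H0_l2v hv) (H0_l2v hp)); last first.
  by move=> i; exact: (H0_unique i hv hp ev).
rewrite (integr_ae_eq (H0_meas hv) (H0_meas hp) ev).
by apply: (ler_cvg_to h1 h2); apply: nearW => k; exact: step1.
Qed.

Lemma subsol_ext (M : R) u g v h : subsol M u g -> H0 v h ->
  {ae mu, forall x, 0 <= v x} -> dot g h <= M * \int[mu]_x v x.
Proof. by case=> hu _ _ hM; apply: weak_ineq_ext => //; exact: H0_l2v hu. Qed.

(** A smooth nondecreasing approximation, as [e] tends to [0], of the indicator of [0 < s],
    vanishing exactly for [s <= 0]. *)
Definition step_approx (e s : R) : R := gexp 0 (e^-1 * s).
Definition dstep_approx (e s : R) : R := e^-1 * gexp 2 (e^-1 * s).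

Lemma chain_step (e : R) : chain n.+1 (step_approx e) (dstep_approx e).
Proof.
split.
- move=> k f hf; apply: (@Ck_gexp _ _ k 0 (fun x => e^-1 * f x)); exact: CkZ.
- move=> s; apply: (is_derive_eq (is_derive_gexpZ e 0 s)).
  by rewrite mul0r subr0.
- by rewrite /step_approx mulr0 gexp_le0.
Qed.

Lemma continuous_dstep (e : R) : continuous (dstep_approx e).
Proof.
move=> s; apply: rcvgZ => //.
apply: (@continuous_comp _ _ _ (fun s => e^-1 * s) (gexp 2)).
  by apply: (rcvgZ (@cvg_id _ _)).
exact: continuous_gexp.
Qed.

Lemma dstep_ge0 (e s : R) : 0 < e -> 0 <= dstep_approx e s.
Proof. by move=> e0; rewrite mulr_ge0 ?gexp_ge0// invr_ge0 ltW. Qed.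

Lemma dstep_norm (e s : R) : 0 < e -> `|dstep_approx e s| <= e^-1 * 2.
Proof.
move=> e0; rewrite ger0_norm ?dstep_ge0// ler_wpM2l ?invr_ge0 ?(ltW e0)//.
exact: gexp_le.
Qed.

Lemma step_ge0 (e s : R) : 0 <= step_approx e s. Proof. exact: gexp_ge0. Qed.
Lemma step_le1 (e s : R) : step_approx e s <= 1. Proof. exact: gexp0_le1. Qed.
Lemma step_norm (e s : R) : `|step_approx e s| <= 1.
Proof. by rewrite ger0_norm ?step_ge0// step_le1. Qed.

Lemma H0_step u g (e : R) : 0 < e -> H0 u g ->
  H0 (step_approx e \o u) (fun i x => dstep_approx e (u x) * g i x).
Proof.
move=> e0; apply: (H0_chain  (chain_step e) (@continuous_dstep e)) => s.
exact: dstep_norm.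
Qed.

Lemma measurable_step (e : R) f : measurable_fun setT f ->
  measurable_fun setT (step_approx e \o f).
Proof.
move=> mf; apply: measurableT_comp => //; apply: continuous_measurable_fun => s.
apply: (@continuous_comp _ _ _ (fun s => e^-1 * s) (gexp 0)).
  by apply: (rcvgZ (@cvg_id _ _)).
exact: continuous_gexp.
Qed.

(** The hypothesis is the inequality tested with [phi * step_approx e a]. The term in which the
    derivative falls on the step carries the nonnegative factor [\sum_i G i x * h i x] and is
    dropped; the rest tends to the claim as [e] tends to [0]. *)
Lemma kato (M : R) G a h : 0 <= M -> l2v G -> H0 a h ->
  {ae mu, forall x, 0 <= \sum_i G i x * h i x} ->
  (forall phi (e : R), 0 < e -> test phi -> (forall x, 0 <= phi x) ->
    dot G (fun i x => phi x * (dstep_approx e (a x) * h i x) +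
                      partial i phi x * step_approx e (a x)) <=
    M * \int[mu]_x (phi x * step_approx e (a x))) ->
  forall phi, test phi -> (forall x, 0 <= phi x) ->
    dot (fun i x => (0 < a x)%R%:R * G i x) (fun i => partial i phi) <=
    M * \int[mu]_x phi x.
Proof.
move=> M0 hG ha Gh hM phi tphi phi0.
have ma := H0_meas ha; have ms e := measurable_step e ma.
have hsG e : l2v (fun i x => step_approx e (a x) * G i x).
  by move=> i; apply: (l2_bM (ms e) (fun x => step_norm e _)).
have key (e : R) : 0 < e -> dot (fun i x => step_approx e (a x) * G i x)
    (fun i => partial i phi) <= M * \int[mu]_x phi x.
  move=> e0; have hst := H0_mul  tphi (H0_step e0 ha).
  have [P _ hP] := test_bounded tphi; have mphi := test_meas tphi.
  have hA : l2v (fun i x => phi x * (dstep_approx e (a x) * h i x)).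
    by move=> i; apply: (l2_bM mphi hP); exact: H0_l2g (H0_step e0 ha).
  have hBB : l2v (fun i x => partial i phi x * step_approx e (a x)).
    move=> i; under eq_fun do rewrite mulrC.
    by apply: (l2_bM (ms e) (fun x => step_norm e _)); exact/tl2/test_partial.
  have h1 := hM phi e e0 tphi phi0; rewrite dotDr// in h1.
  have hA0 : 0 <= dot G (fun i x => phi x * (dstep_approx e (a x) * h i x)).
    have e1 : dot G (fun i x => phi x * (dstep_approx e (a x) * h i x)) =
        \int[mu]_x (\sum_i G i x * (phi x * (dstep_approx e (a x) * h i x))).
      by rewrite integr_sum// => i; exact: l2M.
    rewrite e1; apply: (@le_trans _ _ (\int[mu]_x (0 : R))); first by rewrite integr0.
    apply: integr_le.
    - exact: l10.
    - by apply: l1_sum => i; exact: l2M.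
    - apply: filterS Gh => x Gx.
      rewrite (_ : \sum_i _ = phi x * dstep_approx e (a x) * \sum_i G i x * h i x).
        by rewrite mulr_ge0//; apply: mulr_ge0; [exact: phi0|exact: dstep_ge0].
      by rewrite mulr_sumr; apply: eq_bigr => i _; ring.
  have e2 : dot G (fun i x => partial i phi x * step_approx e (a x)) =
      dot (fun i x => step_approx e (a x) * G i x) (fun i => partial i phi).
    by apply: eq_bigr => i _; apply: eq_Rintegral => x _; ring.
  rewrite -e2; apply: (@le_trans _ _ (M * \int[mu]_x (phi x * step_approx e (a x)))).
    by apply: le_trans h1; rewrite lerDr.
  rewrite ler_wpM2l//; apply: integr_le.
  - exact: (H0_l1 hst).
  - exact: (test_l1 tphi).
  - by apply: aeW => x; rewrite ler_piMr// step_le1.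
have k0 k : 0 < k.+1%:R^-1 :> R by rewrite invr_gt0.
have c1 : dot (fun i x => step_approx k.+1%:R^-1 (a x) * G i x) (fun i => partial i phi)
    @[k --> \oo] --> dot (fun i x => (0 < a x)%R%:R * G i x) (fun i => partial i phi).
  apply: (@dot_cvg (fun k i x => step_approx k.+1%:R^-1 (a x) * G i x)
    (fun k i => partial i phi)) => //.
  - by move=> k; exact: test_l2v.
  - by move=> i; apply: (l2_bM (measurable_gt0 ma) (fun x => norm_nat_le1 _ _)).
  - exact: test_l2v.
  - move=> i; apply: (@l2cvg_bM _ _ _ mu (fun k x => step_approx k.+1%:R^-1 (a x))
      (fun=> G i) _ (G i) 1) => //.
    + by move=> k; exact: ms.
    + exact: measurable_gt0.
    + by move=> k x; exact: step_norm.
    + by move=> x; exact: norm_nat_le1.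
    + by apply: aeW => x _; apply: cvg_gexp0 => //; exact: cvg_harmonicS.
    + exact: l2cvg_cst.
  - by move=> i; exact: l2cvg_cst.
by apply: (ler_cvg_to c1 (cvg_cst _)); apply: nearW => k; exact: key.
Qed.

(** Expanding, the left side is [dot h h - dot g g] plus twice the pairing of [g] with [g - h], and
    the subsolution tested with [u - v >= 0] bounds this pairing. Differences of energies thus
    control distances of gradients. *)
Lemma subsol_energy_le (M : R) u g v h : subsol M u g -> H0 v h ->
  (forall x, v x <= u x) ->
  dot (fun i x => g i x - h i x) (fun i x => g i x - h i x) <=
  (dot h h - 2 * M * \int[mu]_x v x) - (dot g g - 2 * M * \int[mu]_x u x).
Proof.
move=> su hv vu; have hu := subsol_H0 su.
have huv := H0B hu hv.
have uv0 : {ae mu, forall x, 0 <= u x - v x} by apply: aeW => x; rewrite subr_ge0.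
have := subsol_ext su huv uv0.
rewrite integrB; [|exact: H0_l1 hu|exact: H0_l1 hv].
have lu := H0_l2v hu; have lv := H0_l2v hv.
rewrite dotBr// dotBr ?dotBl//; last exact: l2vB.
rewrite [dot h g]dotC; nra.
Qed.

(* The energies increase along a decreasing sequence of subsolutions. *)
Lemma subsol_decr (M : R) (u_ : nat -> E -> R) (g_ : nat -> 'I_n.+1 -> E -> R) : 0 <= M ->
  (forall k, subsol M (u_ k) (g_ k)) -> (forall k x, u_ k.+1 x <= u_ k x) ->
  exists u g, [/\ subsol M u g, H0cvg u_ g_ u g,
    forall x, u_ k x @[k --> \oo] --> u x & forall k x, u x <= u_ k x].
Proof.
move=> M0 su du.
have hk k := subsol_H0 (su k).
have dec k l x : (k <= l)%N -> u_ l x <= u_ k x.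
  move=> kl; have -> : l = (l - k + k)%N by rewrite subnK.
  elim: (l - k)%N => [//|j ih]; rewrite addSn; exact: le_trans (du _ _) ih.
pose a k := dot (g_ k) (g_ k) - 2 * M * \int[mu]_x u_ k x.
have key k l : (k <= l)%N -> dot (fun i x => g_ k i x - g_ l i x)
    (fun i x => g_ k i x - g_ l i x) <= a l - a k.
  by move=> kl; apply: subsol_energy_le => // x; exact: dec.
have nda : nondecreasing_seq a.
  by move=> k l kl; rewrite -subr_ge0; apply: le_trans (key k l kl); exact: dot_ge0.
(* A subsolution tested with itself satisfies [dot g g <= M * \int u], which is at most twice that
   value. *)
have uba k : a k <= 0.
  have h := subsol_ext (su k) (hk k) (aeW _ (fun x => _)).
  have [_ u0 _ _] := su k.
  have {}h := h u0; have I0 : 0 <= \int[mu]_x u_ k x by exact: integr_ge0.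
  rewrite /a subr_le0 (le_trans h)// -mulrA ler_peMl// ?mulr_ge0//; lra.
have ca : cvgn a.
  by apply: nondecreasing_is_cvgn => //; exists 0 => _ [k _ <-]; exact: uba.
have [|u [g [hu Hc]]] := H0_complete_grad hk.
  move=> e e0; have e20 : 0 < e / 2 by rewrite divr_gt0.
  move/cvgrPdist_lt : ca => /(_ _ e20)[K _ hK].
  have aux k l : (K <= k)%N -> (k <= l)%N -> a l - a k <= e.
    move=> Kk kl; have h1 := hK k Kk; have h2 := hK l (leq_trans Kk kl).
    have := ler_norm (a l - a k); have := ler_distD (limn a) (a l) (a k).
    move: h1 h2; rewrite /= [`|limn a - a l|]distrC; lra.
  exists K => k l Kk Kl; have [kl|/ltnW lk] := leqP k l.
    exact: le_trans (key k l kl) (aux _ _ Kk kl).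
  have := le_trans (key l k lk) (aux _ _ Kl lk).
  congr (_ <= _); apply: eq_bigr => i _; apply: eq_Rintegral => x _; ring.
(* The limit in W_0^{1,2} is only a class; the pointwise limit is the representative that satisfies
   the stated inequalities everywhere. *)
pose U x := limn (fun k => u_ k x).
have u0 k x : 0 <= u_ k x by have [_ + _ _] := su k; apply.
have cU x : u_ k x @[k --> \oo] --> U x.
  apply: nonincreasing_is_cvgn; first by move=> k l kl; exact: dec.
  by exists 0 => _ [k _ <-]; exact: u0.
have U0 x : 0 <= U x.
  by apply: limr_ge; [exact: cU|exact: nearW].
have Uk k x : U x <= u_ k x.
  apply: limr_le; first exact: cU.
  by exists k => // l /= kl; exact: dec.
have mU : measurable_fun setT U.
  apply: (measurable_fun_cvg (h := u_)) => [k|x _]; last exact: cU.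
  exact: H0_meas (hk k).
have [s ks sae] := l2cvg_ae (fun k => H0_l2 (hk k)) (H0_l2 hu) Hc.1.
have uU : {ae mu, forall x, u x = U x}.
  apply: filterS sae => x h; apply: (cvg_unique _ h) => //.
  exact: rcvg_sub ks (cU x).
have hU : H0 U g.
  apply: (H0_ae_eq hu mU) => //; first by move=> i; exact: H0_measg hu.
    move=> x Ox; split; last by move=> i; have [_ _ /(_ x Ox)[]] := hu.
    apply/eqP; rewrite eq_le U0 andbT; apply: (le_trans (Uk 0%N x)).
    by rewrite (H0_out (hk 0%N) Ox).
  by move=> i; apply: aeW.
have HcU : H0cvg u_ g_ U g.
  split; last by case: Hc.
  apply: (@l2cvg_ae_eq _ _ _ _ u_ _ u) => //.
  - by move=> k; exact: H0_l2 (hk k).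
  - exact: H0_l2 hu.
  - by move=> k; exact: H0_meas (hk k).
  - by move=> k; apply: aeW.
  - by case: Hc.
exists U, g; split => //; split => //.
  by have [_ _ [C hC] _] := su 0%N; exists C => x; exact: le_trans (Uk _ _) (hC x).
move=> phi tphi phi0.
have c1 : dot (g_ k) (fun i => partial i phi) @[k --> \oo] --> dot g (fun i => partial i phi).
  apply: (@dot_cvg g_ (fun _ i => partial i phi)) => //.
  - by move=> k; exact: H0_l2v (hk k).
  - by move=> k; exact: test_l2v.
  - exact: H0_l2v hu.
  - exact: test_l2v.
  - by case: Hc.
  - by move=> i; exact: l2cvg_cst.
apply: (ler_cvg_to c1 (cvg_cst _)); apply: nearW => k.
by have [_ _ _] := su k; apply.
Qed.

End subsolutions.

(** * Convolution *)

Lemma is_derive_under_integral (R : realType) d (T : measurableType d)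
    (mu : {measure set T -> \bar R}) (f df : R -> T -> R) (a u v : R) (G : T -> R) :
  u < a < v -> (forall s : R, u < s < v -> l1 mu (f s)) ->
  (forall (s : R) y, u < s < v -> is_derive s (1 : R) (f ^~ y) (df s y)) ->
  l1 mu G -> (forall (s : R) y, u < s < v -> `|df s y| <= G y) ->
  is_derive a (1 : R) (fun s => \int[mu]_y f s y) (\int[mu]_y df a y).
Proof.
move=> ha hf hdf hG dfG.
have dfE s y : u < s < v -> partial1of2 f s y = df s y.
  by move=> hs; rewrite partial1of2E; have [_] := hdf s y hs.
have auv : `]u, v[%classic a by rewrite /= in_itv.
have hb s y : `]u, v[%classic s -> [set: T] y -> `|partial1of2 f s y| <= `|G y|.
  rewrite /= in_itv/= => hs _; rewrite dfE//.
  exact: le_trans (dfG s y hs) (ler_norm _).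
have hf' s : `]u, v[%classic s -> l1 mu (f s) by rewrite /= in_itv; exact: hf.
have hdf' s y : `]u, v[%classic s -> [set: T] y -> derivable (f ^~ y) s (1 : R).
  by rewrite /= in_itv/= => hs _; have [] := hdf s y hs.
have h := @cvg_differentiation_under_integral R _ T mu f setT measurableT a u v auv
  hf' hdf' (fun y => `|G y|) (fun y => normr_ge0 _) (l1_norm hG) hb.
have E : \int[mu]_y partial1of2 f a y = \int[mu]_y df a y.
  by apply: eq_Rintegral => y _; exact: dfE.
rewrite E in h.
apply: DeriveDef.
  apply/cvg_ex; exists (\int[mu]_y df a y); move: h; apply: cvg_trans.
  by apply: near_eq_cvg; apply: nearW => t; rewrite /= /GRing.scale/= mulr1.
apply/cvg_lim => //; move: h; apply: cvg_trans.
by apply: near_eq_cvg; apply: nearW => t; rewrite /= /GRing.scale/= mulr1.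
Qed.

(** * Functions with bounded partial derivatives *)

Section coordinates.
Variables (R : realType) (n : nat).
Local Notation E := 'rV[R]_n.
Implicit Types (f g : E -> R) (x y : E) (i : 'I_n).

Lemma is_derive_line_at f x (v : E) (s l : R) : is_derive (s *: v + x) v f l ->
  is_derive s (1 : R) (fun h : R => f (h *: v + x)) l.
Proof.
move=> /is_derive_line h.
rewrite (_ : (fun h : R => _) = (fun h => f (h *: v + (s *: v + x))) \o (fun h => h - s)).
  rewrite -[l]mulr1; apply: is_derive1_comp; first by rewrite subrr.
  by apply: (is_derB (is_derive_id _ _) (is_derC _ _ _)); rewrite subr0.
by apply/funext => h' /=; rewrite addrA -scalerDl subrK.
Qed.

(** The coordinates are changed one at a time, so the mean value theorem is applied on lines
    parallel to the axes and only partial derivatives enter. *)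
Lemma rV_path_lipschitz f (df : 'I_n -> E -> R) (C : R) :
  (forall i x, is_derive x (delta_mx 0 i) f (df i x)) ->
  (forall i x, `|df i x| <= C) ->
  forall x y, `|f y - f x| <= C * \sum_i `|y 0 i - x 0 i|.
Proof.
move=> hdf dfC x y.
pose p (k : nat) : E := \row_i (if (i < k)%N then y 0 i else x 0 i).
have p0 : p 0%N = x by apply/rowP => i; rewrite mxE.
have pn : p n = y by apply/rowP => i; rewrite mxE ltn_ord.
have step (i : 'I_n) : `|f (p i.+1) - f (p i)| <= C * `|y 0 i - x 0 i|.
  pose h (s : R) := f (s *: delta_mx 0 i + p i).
  have E1 : p i.+1 = (y 0 i - x 0 i) *: delta_mx 0 i + p i.
    apply/rowP => j; rewrite !mxE /=; have [->|ji] := eqVneq j i.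
      by rewrite ltnS leqnn ltnn mulr1 subrK.
    by rewrite mulr0 add0r ltnS leq_eqVlt (negPf (ji : (j : nat) != i)).
  have := @lipschitz_of_derive R h (fun s => df i (s *: delta_mx 0 i + p i)) C _ _
    (y 0 i - x 0 i) 0.
  rewrite /h -E1 scale0r add0r subr0; apply => [s|s]; last exact: dfC.
  exact: is_derive_line_at.
have -> : f y - f x = \sum_(i < n) (f (p i.+1) - f (p i)).
  by rewrite -(big_mkord xpredT (fun i : nat => f (p i.+1) - f (p i))) telescope_sumr// pn p0.
apply: (le_trans (ler_norm_sum _ _ _)); rewrite mulr_sumr.
by apply: ler_sum => i _; exact: step.
Qed.

Lemma continuous_of_bounded_partials f (df : 'I_n -> E -> R) (C : R) :
  (forall i x, is_derive x (delta_mx 0 i) f (df i x)) ->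
  (forall i x, `|df i x| <= C) -> continuous f.
Proof.
move=> hdf dfC; have lip := rV_path_lipschitz hdf dfC.
suff h (x : E) : f @ x --> f x by move=> x; exact: h.
have FF : Filter (nbhs x) by exact: nbhs_filter.
apply/cvgrPdist_lt => e e0.
have h : (fun y : E => C * (\sum_i `|x 0 i - y 0 i|)) @ x --> (0 : R).
  apply: (rcvgZ (a := \sum_(i < n) 0)); last by rewrite big1 ?mulr0.
  apply: rcvg_sum => i; rewrite -(@normr0 _ R) -(subrr (x 0 i)).
  apply: cvg_norm; apply: cvgB; first exact: cvg_cst.
  exact: coord_continuous.
move/cvgr0Pnorm_lt : h => /(_ _ e0); apply: filterS => y hy.
by apply: le_lt_trans (lip _ _) _; apply: le_lt_trans hy; exact: ler_norm.
Qed.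

End coordinates.

Section convolution.
Variables (R : realType) (n : nat) (D : bdomain R n).
Local Notation mu := (lebesgue R n).
Local Notation E := 'rV[R]_n.
Implicit Types (k v f : E -> R) (x y z : E) (i : 'I_n).

(** Local integrability, tested on cubes. Unlike [l1] it contains the constants, which enter through
    [|v - c|]. *)
Definition loc v := measurable_fun setT v /\ forall B, l1 mu (fun z => \1_(box B) z * v z).

Lemma loc_l1 v : l1 mu v -> loc v.
Proof.
move=> hv; split; first exact: l1_meas hv.
move=> B; apply: (l1_le _ hv).
  apply: measurable_funM; last exact: l1_meas hv.
  by apply: measurable_indic; exact: measurable_box.
apply: aeW => z; rewrite normrM indicE ler_piMl//.
by case: (_ \in _); rewrite ?normr1 ?normr0.
Qed.

Lemma loc_cst (c : R) : loc (fun=> c).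
Proof.
split; first exact: measurable_cst.
move=> B; under eq_fun do rewrite mulrC; apply: l1Z; exact: l1_box.
Qed.

Lemma locD v w : loc v -> loc w -> loc (fun z => v z + w z).
Proof.
move=> [mv hv] [mw hw]; split; first exact: measurable_funD.
by move=> B; under eq_fun do rewrite mulrDr; exact: l1D.
Qed.

Lemma locZ (c : R) v : loc v -> loc (fun z => c * v z).
Proof.
move=> [mv hv]; split; first exact: measurable_funM.
by move=> B; under eq_fun do rewrite mulrCA; exact: l1Z.
Qed.

Lemma locB v w : loc v -> loc w -> loc (fun z => v z - w z).
Proof.
move=> hv /(locZ (-1)) hw; have := locD hv hw.
by congr loc; apply/funext => x; rewrite mulN1r.
Qed.

Lemma loc_le v w : measurable_fun setT v -> loc w ->
  {ae mu, forall x, `|v x| <= `|w x|} -> loc v.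
Proof.
move=> mv [mw hw] vw; split => // B; apply: (l1_le _ (hw B)).
  apply: measurable_funM => //; apply: measurable_indic; exact: measurable_box.
by apply: filterS vw => x h; rewrite !normrM ler_wpM2l.
Qed.

Lemma loc_norm v : loc v -> loc (fun z => `|v z|).
Proof.
move=> hv; apply: (loc_le _ hv); last by apply: aeW => x; rewrite normr_id.
by apply: measurableT_comp => //; case: hv.
Qed.

Lemma l1_bM_loc k v (B M : R) : measurable_fun setT k -> (forall z, `|k z| <= M) ->
  (forall z, ~ box B z -> k z = 0) -> loc v -> l1 mu (fun z => k z * v z).
Proof.
move=> mk kM kB [mv hv]; apply: (l1_le _ (l1Z M (hv B))).
  exact: measurable_funM.
apply: aeW => z; have [Bz|nBz] := pselect (box B z).
  rewrite indicE mem_set// mul1r !normrM ler_wpM2r//.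
  exact: le_trans (kM z) (ler_norm _).
by rewrite kB// mul0r normr0.
Qed.

Lemma measurable_shift k x : continuous k -> measurable_fun setT (fun z => k (z - x)).
Proof.
move=> ck; apply: continuous_measurable_rV => z.
apply: (@continuous_comp _ _ _ (fun z : E => z - x) k); last exact: ck.
have h1 : y @[y --> z] --> z by exact: cvg_id.
exact: (cvgB h1 (cvg_cst x)).
Qed.

Lemma coord_le_norm x i : `|x 0 i| <= `|x|.
Proof. by rewrite [leRHS]/Num.Def.normr/= mx_normrE; exact: (@le_bigmax _ _ _ _ _ (0, i)). Qed.

Lemma shift_box k x (c : R) : test_function (dom D) k -> (forall i, `|x 0 i| <= c) ->
  forall z, ~ box (dom_bound D + c) z -> k (z - x) = 0.
Proof.
move=> tk xc z nz; apply: (test_out tk) => /(@dom_box _ _ D) hz; apply: nz => i.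
have := hz i; rewrite !mxE => h.
have := ler_normD (z 0 i - x 0 i) (x 0 i); rewrite subrK; have := xc i; lra.
Qed.

Lemma l1_conv k v x : test_function (dom D) k -> loc v -> l1 mu (fun z => k (z - x) * v z).
Proof.
move=> tk hv; have [M _ hM] := test_bounded tk.
apply: (@l1_bM_loc (fun z => k (z - x)) v (dom_bound D + `|x|) M) => //.
- by apply: measurable_shift; exact: (test_cont tk).
- by apply: shift_box => // i; exact: coord_le_norm.
Qed.

(** The kernel is evaluated at [z - x], whence the minus sign in [is_derive_conv]; for an even
    kernel this is the convolution. *)
Definition conv k v x : R := \int[mu]_z (k (z - x) * v z).

Lemma is_derive_conv k v x i : test_function (dom D) k -> loc v ->
  is_derive x (delta_mx 0 i) (conv k v) (- conv (partial i k) v x).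
Proof.
move=> tk hv; have tki := test_partial i tk; have [M M0 hM] := test_bounded tki.
apply/is_derive_line; set e := delta_mx 0 i.
have -> : - conv (partial i k) v x =
    \int[mu]_z (- partial i k (z - ((0 : R) *: e + x)) * v z).
  rewrite /conv -integrN; last exact: l1_conv.
  by apply: eq_Rintegral => z _; rewrite scale0r add0r mulNr.
apply: (@is_derive_under_integral R _ E mu (fun s z => k (z - (s *: e + x)) * v z)
  (fun s z => - partial i k (z - (s *: e + x)) * v z) 0 (-1) 1
  (fun z => M * `|\1_(box (dom_bound D + `|x| + 1)) z * v z|)).
- by rewrite ltrN10 ltr01.
- by move=> s _; exact: l1_conv.
- move=> s z _; apply: (is_derM _ (is_derC _ _ (v z))); last by rewrite mulr0 add0r mulrC.
  have h1 : is_derive (s *: e + x) e (fun y => k (-1 *: y + z))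
      (-1 * partial i k (-1 *: (s *: e + x) + z)).
    by apply: is_derive_affine; apply: smooth_derive; case: tk.
  have := is_derive_line_at h1; rewrite scaleN1r mulN1r addrC.
  congr (is_derive _ _ _ _); apply/funext => t; by rewrite scaleN1r addrC.
- by apply/l1Z/l1_norm; case: hv.
- move=> s z /andP[s1 s2]; rewrite mulNr normrN normrM.
  have [Bz|nBz] := pselect (box (dom_bound D + `|x| + 1) z).
    by rewrite indicE mem_set// mul1r ler_wpM2r.
  rewrite (_ : partial i k _ = 0) ?normr0 ?mul0r ?mulr_ge0 ?(ltW M0)//.
  rewrite -addrA in nBz; apply: (shift_box tki _ nBz) => j; rewrite !mxE.
  apply: (le_trans (ler_normD _ _)); rewrite [leRHS]addrC; apply: lerD; last exact: coord_le_norm.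
  rewrite normrM; have : `|s| <= 1 by rewrite ler_norml; lra.
  by case: (_ && _); rewrite ?normr1 ?normr0 ?mulr1 ?mulr0.
Qed.

Lemma conv_bounded k v : test_function (dom D) k -> l1 mu v ->
  exists C : R, forall x, `|conv k v x| <= C.
Proof.
move=> tk hv; have [M M0 hM] := test_bounded tk.
exists (M * \int[mu]_z `|v z|) => x.
apply: (le_trans (integr_norm (l1_conv x tk (loc_l1 hv)))).
rewrite -integrZ; last exact: l1_norm.
apply: integr_le.
- exact: l1_norm (l1_conv x tk (loc_l1 hv)).
- by apply: l1Z; exact: l1_norm.
- by apply: aeW => z; rewrite normrM ler_wpM2r.
Qed.

Lemma smooth_conv k v : test_function (dom D) k -> l1 mu v -> smooth (conv k v).
Proof.
move=> tk hv m; elim: m k tk => [|m ih] k tk.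
  split => //.
  have [C hC] : exists C : R, forall i x, `|- conv (partial i k) v x| <= C.
    have H i := conv_bounded (test_partial i tk) hv.
    have [C hC] := choice H; exists (\sum_i `|C i|) => i x.
    rewrite normrN; apply: (le_trans (hC i x)); apply: (le_trans (ler_norm _)).
    by rewrite (bigD1 i)//= lerDl sumr_ge0.
  apply: continuous_of_bounded_partials hC => i x.
  exact: (is_derive_conv x i tk (loc_l1 hv)).
apply/CkP; split; first by exact: Ck_cont (ih k tk).
move=> i; exists (fun x => - conv (partial i k) v x).
  by move=> x; exact: (is_derive_conv x i tk (loc_l1 hv)).
have := CkZ (-1) (ih _ (test_partial i tk)).
by congr (Ck m _); apply/funext => x; rewrite mulN1r.
Qed.

End convolution.

(** * Radial mollification *)

Section shift.
Variables (R : realType) (n : nat).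
Local Notation E := 'rV[R]_n.
Implicit Types (f : E -> R) (x : E).

Lemma smooth_shift f x : smooth f -> smooth (fun z => f (z - x)).
Proof.
move=> sf k; have := Ck_affine 1 (- x) (sf k).
by congr (Ck k _); apply/funext => z; rewrite scale1r.
Qed.

Lemma partial_shift f x i : smooth f ->
  partial i (fun z => f (z - x)) = (fun z => partial i f (z - x)).
Proof.
move=> sf; apply: partialE => z.
have h : is_derive (1 *: z + - x) (delta_mx 0 i) f (partial i f (1 *: z + - x)).
  exact: smooth_derive.
have := is_derive_affine h; rewrite scale1r mul1r; congr (is_derive _ _ _ _).
by apply/funext => y; rewrite scale1r.
Qed.

Lemma laplacian_shift f x : smooth f ->
  laplacian (fun z => f (z - x)) = (fun z => laplacian f (z - x)).
Proof.
move=> sf; apply/funext => z; apply: eq_bigr => i _.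
by rewrite (partial_shift x i sf) (partial_shift x i (smooth_partial i sf)).
Qed.

Lemma box_compact (x : E) (r : R) : compact [set z : E | forall i, `|z 0 i - x 0 i| <= r].
Proof.
rewrite (_ : [set _ | _] = [set z : E | forall i, `[x 0 i - r, x 0 i + r]%classic (z 0 i)]).
  by apply: (@rV_compact R n (fun i => `[x 0 i - r, x 0 i + r]%classic)) => i; exact: segment_compact.
by apply/seteqP; split => z h i; have := h i; rewrite /= in_itv/= ler_distl.
Qed.

End shift.

Section kernels.
Variables (R : realType) (n : nat).
Local Notation N := n.+1.
Local Notation E := 'rV[R]_N.
Local Notation mu := (lebesgue R N).
Implicit Types (x y z : E) (t s : R) (v f : E -> R) (m : nat) (i : 'I_N).

Definition sq z : R := \sum_i (z 0 i) ^+ 2.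

Definition radial m t z : R := gexp m (1 - t^-2 * sq z).

(** The factor [t ^- N] makes the total mass independent of [t]; the index [2] is the one for which
    [laplacian_radial0] holds. *)
Definition rho t z : R := t ^- N * radial 2 t z.

Definition drho t z : R :=
  t ^- n.+2 * (2 * (t^-2 * sq z) * (radial 4 t z - 2 * radial 3 t z) - N%:R * radial 2 t z).

Lemma sq_ge0 z : 0 <= sq z.
Proof. by apply: sumr_ge0 => i _; exact: sqr_ge0. Qed.

Lemma sq_coord z i : (z 0 i) ^+ 2 <= sq z.
Proof. by rewrite /sq (bigD1 i)//= lerDl sumr_ge0// => j _; exact: sqr_ge0. Qed.

Lemma sqN z : sq (- z) = sq z.
Proof. by apply: eq_bigr => i _; rewrite !mxE sqrrN. Qed.

Lemma radial_eq0 m t z : 0 < t -> t ^+ 2 <= sq z -> radial m t z = 0.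
Proof.
move=> t0 h; rewrite /radial gexp_le0// subr_le0 mulrC ler_pdivlMr ?exprn_gt0//.
by rewrite mul1r.
Qed.

Lemma radial_ge0 m t z : 0 <= radial m t z. Proof. exact: gexp_ge0. Qed.

Lemma radial_le m t z : radial m t z <= m`!%:R. Proof. exact: gexp_le. Qed.

Lemma radial_out_box m t z : 0 < t -> ~ box t z -> radial m t z = 0.
Proof.
move=> t0 nb; apply: radial_eq0 => //.
have [i ti] : exists i, t < `|z 0 i|.
  by apply: contrapT => h; apply: nb => i; rewrite leNgt; apply/negP => hi; apply: h; exists i.
apply: (le_trans _ (sq_coord z i)); rewrite -(real_normK (num_real (z 0 i))).
by rewrite ler_pXn2r ?nnegrE ?ltW// (lt_trans t0).
Qed.

Lemma radial_sq m t z : 0 < t -> t^-2 * sq z * radial m t z <= m`!%:R.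
Proof.
move=> t0; have [h|h] := leP (t ^+ 2) (sq z); first by rewrite radial_eq0// mulr0.
apply: le_trans (radial_le m t z); rewrite ler_piMl ?radial_ge0//.
by rewrite mulrC ler_pdivrMr ?exprn_gt0// mul1r ltW.
Qed.

Lemma smooth_sq k : Ck k sq.
Proof.
apply: Ck_sum => i; under eq_fun do rewrite expr2.
by apply: CkM; exact: Ck_coord.
Qed.

Lemma smooth_radial m t : smooth (radial m t).
Proof.
move=> k; apply: (@Ck_gexp _ _ k m (fun z => 1 - t^-2 * sq z)).
by apply: CkB; [exact: Ck_cst|apply: CkZ; exact: smooth_sq].
Qed.

Lemma is_derive_sq z i : is_derive z (delta_mx 0 i) sq (2 * z 0 i).
Proof.
rewrite (_ : sq = \sum_j (fun z : E => (z 0 j) ^+ 2)); last first.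
  by apply/funext => y; rewrite fct_sumE.
have h j : is_derive z (delta_mx 0 i) (fun z : E => (z 0 j) ^+ 2)
    (2 * z 0 j * (delta_mx 0 i : E) 0 j).
  under eq_fun do rewrite expr2.
  by apply: (is_derM (is_derive_coord j z _) (is_derive_coord j z _)); ring.
apply: (is_derive_eq (is_derive_sum h)).
rewrite (bigD1 i)//= big1 ?addr0; first by rewrite mxE !eqxx mulr1.
by move=> j ji; rewrite mxE (negPf ji) andbF mulr0.
Qed.

Lemma partial_radial m t i : partial i (radial m t) =
  (fun z => (radial m.+2 t z - m%:R * radial m.+1 t z) * (- 2 * t^-2 * z 0 i)).
Proof.
apply: partialE => z; apply: is_derive_comp_line; last exact: is_derive_gexp.
apply: (is_derB (is_derC _ _ _) (is_derZ (is_derive_sq z i) (erefl _))); ring.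
Qed.

(** By scaling, the derivative [drho] of [rho] in [t] is [- t ^- n.+2] times the divergence of
    [z * radial 2 t z]. The field [- 2 * t^-2 * z * radial 2 t z] is the gradient of
    [radial 0 t]. *)
Lemma laplacian_radial0 t z : 0 < t -> laplacian (radial 0 t) z = 2 * t ^+ n * drho t z.
Proof.
move=> t0; rewrite /laplacian.
have P i : partial i (partial i (radial 0 t)) z =
    - 2 * t^-2 * radial 2 t z +
    4 * t^-2 * t^-2 * (radial 4 t z - 2 * radial 3 t z) * (z 0 i) ^+ 2.
  rewrite partial_radial.
  have -> : (fun z : E => (radial 2 t z - 0%:R * radial 1 t z) * (- 2 * t^-2 * z 0 i)) =
      (fun z => radial 2 t z * ((- 2 * t^-2) * z 0 i)).
    by apply/funext => y; rewrite mul0r subr0.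
  rewrite (_ : partial i _ = (fun z => radial 2 t z * (-2 * t^-2) +
     (-2 * t^-2 * z 0 i) * partial i (radial 2 t) z)).
    by rewrite partial_radial; ring.
  apply: partialE => y; apply: (is_derM (smooth_derive i y (smooth_radial 2 t)) (is_derZ (is_derive_coord i y _) (erefl _))).
  by rewrite mxE !eqxx mulr1.
rewrite (eq_bigr _ (fun i _ => P i)) big_split/= sumr_const card_ord -mulr_sumr -/(sq z).
rewrite /drho -mulr_natl; have t0' : t != 0 by rewrite gt_eqF.
rewrite -!exprVn (_ : n.+2 = (2 + n)%N)// exprD.
have e : t ^+ n * t^-1 ^+ n = 1 by rewrite -exprMn mulfV// expr1n.
rewrite [RHS](_ : _ = 2 * (t ^+ n * t^-1 ^+ n) * t^-1 ^+ 2 *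
  (2 * (t^-1 ^+ 2 * sq z) * (radial 4 t z - 2 * radial 3 t z) - N%:R * radial 2 t z)); last by ring.
by rewrite e; ring.
Qed.

Lemma is_derive_rho t z : 0 < t -> is_derive t (1 : R) (rho ^~ z) (drho t z).
Proof.
move=> t0; have t0' : t != 0 by rewrite gt_eqF.
have dV : is_derive t (1 : R) (fun t : R => t^-1) (- t^-2).
  by have := is_deriveV t0' (is_derive_id t (1 : R)); rewrite /GRing.scale/= mulr1.
have dX m : is_derive t (1 : R) (fun t : R => t ^- m) (- m%:R * t ^- m.+1).
  have := is_deriveX m dV; rewrite (_ : _ ^+ m = (fun t : R => t ^- m)).
    move=> h; apply: (is_derive_eq h); rewrite /GRing.scale/= -!exprVn.
    case: m {h} => [|m]; first by rewrite !mul0r oppr0 mul0r.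
    by rewrite /= mulNr !exprS; ring.
  by apply/funext => s; rewrite fctE exprVn.
have d1 : is_derive t (1 : R) (fun t : R => 1 - t^-2 * sq z) (2 * t ^- 3 * sq z).
  apply: (is_derB (is_derC _ _ _) (is_derM (dX 2) (is_derC _ _ (sq z)) (erefl _))).
  by rewrite mulr0 add0r; ring.
have d2 : is_derive t (1 : R) (fun t => radial 2 t z)
    ((radial 4 t z - 2 * radial 3 t z) * (2 * t ^- 3 * sq z)).
  by apply: (@is_derive1_comp _ (gexp 2) (fun t : R => 1 - t^-2 * sq z)); exact: is_derive_gexp.
apply: (is_derM (dX N) d2); rewrite /drho -!exprVn !exprS; ring.
Qed.

(** On the support [t^-2 * sq z <= 1], and [gexp_le] bounds [radial 4], [radial 3] and [radial 2] by
    [24], [6] and [2]; the constant [72] is [2 * (24 + 2 * 6)]. *)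
Lemma drho_norm t z : 0 < t -> `|drho t z| <= t ^- n.+2 * (2 * N%:R + 72).
Proof.
move=> t0; rewrite normrM ger0_norm ?invr_ge0 ?exprn_ge0 ?(ltW t0)//.
rewrite ler_wpM2l ?invr_ge0 ?exprn_ge0 ?(ltW t0)//.
have q0 : 0 <= t^-2 * sq z by rewrite mulr_ge0 ?sq_ge0// invr_ge0 exprn_ge0// ltW.
have h4 := radial_sq 4 z t0; have h3 := radial_sq 3 z t0.
have h2 : radial 2 t z <= 2 := radial_le 2 t z.
have f4 : (4`!%:R : R) = 24 by [].
have f3 : (3`!%:R : R) = 6 by [].
rewrite f4 in h4; rewrite f3 in h3.
have p4 := mulr_ge0 q0 (radial_ge0 4 t z); have p3 := mulr_ge0 q0 (radial_ge0 3 t z).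
have p2 := radial_ge0 2 t z.
have N0 : 0 <= N%:R :> R by rewrite ler0n.
have h : N%:R * radial 2 t z <= 2 * N%:R by nra.
have h' : 0 <= N%:R * radial 2 t z by nra.
rewrite ler_norml; apply/andP; split; nra.
Qed.

Lemma drho_out_box t z : 0 < t -> ~ box t z -> drho t z = 0.
Proof. by move=> t0 nb; rewrite /drho !(radial_out_box _ t0 nb); ring. Qed.

Lemma cube_open t : open [set z : E | forall i, `|z 0 i| < t].
Proof.
rewrite (_ : [set _ | _] = ball (0 : E) t); first exact: ball_open.
apply/seteqP; split => [z h|z [_ h] i].
  split; first exact: le_lt_trans (normr_ge0 _) (h ord0).
  by move=> i j; rewrite /ball/= mxE sub0r normrN (ord1 i).
by have := h 0 i; rewrite /ball/= mxE sub0r normrN.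
Qed.

Definition cube t : bdomain R N := @BDomain R N [set z : E | forall i, `|z 0 i| < t] t
  (@cube_open t) (fun z h i => ltW (h i)).

Lemma test_radial m t : 0 < t -> test_function (dom (cube (t + 1))) (radial m t).
Proof.
move=> t0; split; first exact: smooth_radial.
exists [set z : E | forall i, `|z 0 i - (0 : E) 0 i| <= t]; split.
- exact: box_compact.
- by move=> z /= h i; have := h i; rewrite mxE subr0; move/le_lt_trans; apply; rewrite ltrDl.
- move=> z nz; apply: radial_out_box => // hz; apply: nz => i.
  by rewrite mxE subr0; exact: hz.
Qed.

Lemma test_rho t : 0 < t -> test_function (dom (cube (t + 1))) (rho t).
Proof. by move=> t0; apply: testZ; exact: test_radial. Qed.

Lemma test_radial_shift (O : set E) m t x (d : R) : 0 < t -> t < d ->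
  (forall z, sq (z - x) < d ^+ 2 -> O z) ->
  test_function O (fun z => radial m t (z - x)).
Proof.
move=> t0 td dO; split; first exact: smooth_shift (smooth_radial m t).
exists [set z : E | sq (z - x) <= t ^+ 2]; split.
- apply: (@subclosed_compact _ _ _ _ (@box_compact _ _ x t)).
    rewrite (_ : [set _ | _] = (fun z => sq (z - x)) @^-1` [set y | y <= t ^+ 2])//.
    apply: closed_comp; last exact: closed_le.
    by move=> z _; apply: smooth_cont; apply: smooth_shift => k; exact: smooth_sq.
  move=> z /= h i; have h2 := le_trans (sq_coord (z - x) i) h.
  by rewrite !mxE in h2; apply: norm_le_sqr h2; exact: ltW.
- move=> z /= h; apply: dO; apply: (le_lt_trans h).
  by rewrite ltr_pXn2r ?nnegrE ?ltW// (lt_trans t0).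
- move=> z /= /negP; rewrite -ltNge => h; apply: radial_eq0 => //; exact: ltW.
Qed.

Lemma rho_ge0 t z : 0 < t -> 0 <= rho t z.
Proof. by move=> t0; rewrite mulr_ge0 ?radial_ge0// invr_ge0 exprn_ge0// ltW. Qed.

Lemma rhoN t z : rho t (- z) = rho t z.
Proof. by rewrite /rho /radial sqN. Qed.

Lemma rho_out_box t z : 0 < t -> ~ box t z -> rho t z = 0.
Proof. by move=> t0 nb; rewrite /rho radial_out_box// mulr0. Qed.

Definition mol t v x := conv (rho t) v x.

Lemma l1_mol t v x : 0 < t -> loc v -> l1 mu (fun z => rho t (z - x) * v z).
Proof. by move=> t0; exact: l1_conv (test_rho t0). Qed.

Lemma is_derive_mol t v x : 0 < t -> loc v ->
  is_derive t (1 : R) (fun s => mol s v x) (\int[mu]_z (drho t (z - x) * v z)).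
Proof.
move=> t0 hv; pose C := (t / 2) ^- n.+2 * (2 * N%:R + 72).
have C0 : 0 <= C.
  by rewrite mulr_ge0 ?invr_ge0 ?exprn_ge0 ?addr_ge0 ?mulr_ge0// ?divr_ge0// ltW.
apply: (@is_derive_under_integral R _ E mu (fun s z => rho s (z - x) * v z)
  (fun s z => drho s (z - x) * v z) t (t / 2) (2 * t)
  (fun z => C * `|\1_(box (2 * t + `|x|)) z * v z|)).
- by apply/andP; split; lra.
- by move=> s /andP[s1 s2]; apply: l1_mol => //; lra.
- move=> s z /andP[s1 s2]; apply: (is_derM _ (is_derC _ _ _)); last by rewrite mulr0 add0r mulrC.
  by apply: is_derive_rho; lra.
- by apply/l1Z/l1_norm; case: hv.
- move=> s z /andP[s1 s2]; have s0 : 0 < s by lra.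
  rewrite normrM; have [Bz|nBz] := pselect (box (2 * t + `|x|) z).
    rewrite indicE mem_set// mul1r ler_wpM2r//; apply: (le_trans (drho_norm _ s0)).
    rewrite ler_wpM2r ?addr_ge0 ?mulr_ge0//.
    by rewrite lef_pV2 ?posrE ?exprn_gt0// ?divr_gt0// lerXn2r ?nnegrE ?divr_ge0 ?ltW.
  rewrite drho_out_box ?normr0 ?mul0r// => [|hz]; first exact: mulr_ge0.
  apply: nBz => i.
  have := hz i; rewrite !mxE; have := coord_le_norm x i.
  have := ler_normD (z 0 i - x 0 i) (x 0 i); rewrite subrK; lra.
Qed.

Lemma sq_ball_cube x z (d : R) : 0 <= d -> sq (z - x) < d ^+ 2 -> forall i, `|z 0 i| < d + `|x|.
Proof.
move=> d0 h i; have h2 := le_lt_trans (sq_coord (z - x) i) h; rewrite !mxE in h2.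
have {}h2 : `|z 0 i - x 0 i| < d.
  by move: d0 h2; rewrite le_eqVlt => /predU1P[<-|d0]; [rewrite expr0n ltNge sqr_ge0|exact: norm_lt_sqr].
have := coord_le_norm x i; have := ler_normD (z 0 i - x 0 i) (x 0 i); rewrite subrK; lra.
Qed.

Lemma continuous_radial m t : continuous (radial m t : E -> R).
Proof. by apply: smooth_cont; exact: smooth_radial. Qed.

Lemma continuous_drho t : continuous (drho t : E -> R).
Proof.
apply: smooth_cont => k; rewrite /drho.
have cr m : Ck k (radial m t : E -> R) by exact: smooth_radial.
have cs : Ck k (sq : E -> R) by exact: smooth_sq.
apply: CkZ; apply: CkB; last exact: CkZ.
by apply: CkM; [apply: CkZ; exact: CkZ|apply: CkB => //; exact: CkZ].
Qed.

Lemma integr_drho t x : 0 < t -> \int[mu]_z drho t (z - x) = 0.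
Proof.
move=> t0; have t1 : t < t + 1 by rewrite ltrDl.
have tphi := @test_radial_shift (dom (cube (t + 1 + `|x|))) 0 t x (t + 1) t0 t1
  (fun z => @sq_ball_cube x z (t + 1) (ltW (lt_trans t0 t1))).
have sphi := test_smooth tphi.
apply: (@mulfI _ (2 * t ^+ n)); first by rewrite mulf_neq0// expf_neq0// gt_eqF.
rewrite mulr0 -integrZ; last first.
  apply: (l1_bounded (B := t + `|x|) (M := t ^- n.+2 * (2 * N%:R + 72))).
  - apply: measurable_shift; exact: continuous_drho.
  - by move=> z; exact: drho_norm.
  - move=> z nz; rewrite drho_out_box// => hz; apply: nz => i.
    have := hz i; rewrite !mxE; have := coord_le_norm x i.
    have := ler_normD (z 0 i - x 0 i) (x 0 i); rewrite subrK; lra.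
rewrite (_ : \int[mu]_z _ = \int[mu]_z (laplacian (fun z => radial 0 t (z - x)) z)).
  rewrite /laplacian integr_sum; last first.
    by move=> i; apply: (test_l1 (D := cube (t + 1 + `|x|))); do 2 apply: test_partial.
  rewrite big1// => i _; apply: (integr_partial (D := cube (t + 1 + `|x|))).
  exact: test_partial.
apply: eq_Rintegral => z _; rewrite (laplacian_shift x (smooth_radial 0 t)).
by rewrite laplacian_radial0.
Qed.

Lemma is_derive0_cst (h : R -> R) : (forall t, 0 < t -> is_derive t (1 : R) h 0) ->
  forall s t, 0 < s -> 0 < t -> h s = h t.
Proof.
move=> dh; suff key s t : 0 < s -> s <= t -> h s = h t.
  by move=> s t s0 t0; have [st|/ltW ts] := leP s t; [exact: key|apply/esym/key].
move=> s0 st; have ch : {within `[s, t], continuous h}.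
  apply: derivable_within_continuous => r; rewrite in_itv/= => /andP[sr _].
  by have [] := dh r (lt_le_trans s0 sr).
have [|c _] := @MVT_segment R h (fun=> 0) s t st _ ch.
  move=> r; rewrite in_itv/= => /andP[sr _]; exact: dh (lt_trans s0 sr).
by rewrite mul0r => /eqP; rewrite subr_eq0 => /eqP.
Qed.

(** The common mass of all the kernels, left unnormalised: only its positivity enters the
    estimates. *)
Definition kappa : R := mol 1 (fun=> 1) 0.

(** Independence of [t] and [x] is obtained by differentiation: the derivative in [t] integrates to
    [0] as a Laplacian, those in the coordinates of [x] as partial derivatives of a test
    function. *)
Lemma integr_rho t x : 0 < t -> \int[mu]_z rho t (z - x) = kappa.
Proof.
move=> t0; have E s y : mol s (fun=> 1) y = \int[mu]_z rho s (z - y).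
  by apply: eq_Rintegral => z _; rewrite mulr1.
rewrite -E; transitivity (mol 1 (fun=> 1 : R) x).
  apply: (@is_derive0_cst (fun s => mol s (fun=> 1) x)) => //.
  move=> s s0; have := is_derive_mol x s0 (@loc_cst R N 1).
  congr (is_derive _ _ _ _); rewrite -(integr_drho x s0).
  by apply: eq_Rintegral => z _; rewrite mulr1.
have d0 i y : is_derive y (delta_mx 0 i) (mol 1 (fun=> 1)) 0.
  have t1 := test_rho (@ltr01 R).
  have := is_derive_conv y i t1 (@loc_cst R N 1); congr (is_derive _ _ _ _).
  apply/eqP; rewrite oppr_eq0; apply/eqP.
  rewrite /conv -[RHS](integr_partial (D := cube (1 + 1 + `|y|)) (phi := fun z => rho 1 (z - y)) i).
    apply: eq_Rintegral => z _; rewrite mulr1 partial_shift//.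
    by apply: test_smooth t1.
  apply: testZ; apply: (@test_radial_shift _ 2 1 y (1 + 1)) => //; first by rewrite ltrDl.
  by move=> z; exact: sq_ball_cube.
have h : forall i y, `|(fun _ _ => 0 : R) i y| <= 0 by move=> i y; rewrite normr0.
have := @rV_path_lipschitz R N (mol 1 (fun=> 1)) (fun _ _ => 0) 0 d0 h 0 x.
by rewrite mul0r normr_le0 subr_eq0 => /eqP.
Qed.

(** The factor [3 / 4] keeps the argument of [gexp 2] between [1 / 4] and [1], where it is at least
    [exp (- 4)]. At scale [2 * r] this covers the ball of radius [r]. *)
Lemma rho_lb t z : 0 < t -> sq z <= 3 / 4 * t ^+ 2 -> t ^- N * expR (-4) <= rho t z.
Proof.
move=> t0 h; rewrite /rho ler_wpM2l ?invr_ge0 ?exprn_ge0 ?(ltW t0)//.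
have q0 : 0 <= t^-2 * sq z by rewrite mulr_ge0 ?sq_ge0// invr_ge0 exprn_ge0// ltW.
apply: gexp2_ge; last by lra.
have : t^-2 * sq z <= 3 / 4 by rewrite mulrC ler_pdivrMr ?exprn_gt0.
by lra.
Qed.

Lemma rho_ub t z : 0 < t -> rho t z <= t ^- N * 2.
Proof.
move=> t0; rewrite /rho ler_wpM2l ?invr_ge0 ?exprn_ge0 ?(ltW t0)//.
exact: radial_le.
Qed.

Lemma kappa_gt0 : 0 < kappa.
Proof.
(* On the cube of half side [r] one has [sq z <= N * r ^+ 2 = r / 2], below the threshold of
   [rho_lb]. *)
rewrite -(integr_rho 0 ltr01); pose r : R := (2 * N%:R)^-1.
have r0 : 0 < r by rewrite invr_gt0 mulr_gt0// ltr0n.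
have hr : l1 mu (fun z => expR (-4) * \1_(box r) z) by apply/l1Z/l1_box.
have hr1 : l1 mu (fun z => rho 1 (z - 0)).
  have := l1_mol 0 ltr01 (@loc_cst R N 1); congr l1; apply/funext => z; by rewrite mulr1.
apply: (@lt_le_trans _ _ (\int[mu]_z (expR (-4) * \1_(box r) z))); last first.
  apply: integr_le => //; apply: aeW => z; rewrite subr0.
  have [hz|hz] := pselect (box r z); last first.
    by rewrite indicE memNset// mulr0 rho_ge0.
  rewrite indicE mem_set// mulr1 -[leLHS]mul1r.
  have := @rho_lb 1 z ltr01; rewrite !expr1n invr1; apply.
  rewrite mulr1; apply: (@le_trans _ _ (\sum_(i < N) r ^+ 2)).
    apply: ler_sum => i _; rewrite -real_normK ?num_real// ler_pXn2r ?nnegrE ?(ltW r0)//.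
  rewrite sumr_const card_ord /r expr2.
  have N1 : 1 <= N%:R :> R by rewrite ler1n.
  have aN : (2 * N%:R)^-1 * N%:R = 2^-1 :> R.
    by rewrite invfM -mulrA mulVf ?mulr1// gt_eqF// (lt_le_trans ltr01).
  rewrite -[leLHS]mulr_natr -mulrA aN.
  have : (2 * N%:R)^-1 <= 1 :> R by rewrite invf_le1 ?mulr_gt0//; lra.
  by move: (_^-1) => a; lra.
rewrite integrZ; last exact: l1_box.
rewrite mulr_gt0 ?expR_gt0// /Rintegral integral_indic//; last exact: measurable_box.
rewrite setIT [X in fine X](_ : _ = ((2 * r) ^+ N)%:E); last exact: (lebesgue_boxE N (ltW r0)).
by rewrite /= exprn_gt0// mulr_gt0.
Qed.

Lemma mol_cst t (c : R) x : 0 < t -> mol t (fun=> c) x = kappa * c.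
Proof.
move=> t0; rewrite -(integr_rho x t0) [RHS]mulrC -integrZ; last first.
  have := l1_mol x t0 (@loc_cst R N 1); congr l1; apply/funext => z; by rewrite mulr1.
by apply: eq_Rintegral => z _; rewrite mulrC.
Qed.

Lemma mol_le t v w x : 0 < t -> loc v -> loc w -> {ae mu, forall z, rho t (z - x) * v z <= rho t (z - x) * w z} ->
  mol t v x <= mol t w x.
Proof. by move=> t0 hv hw vw; apply: integr_le vw; exact: l1_mol. Qed.

Lemma mol_ae_le t v w x : 0 < t -> loc v -> loc w -> {ae mu, forall z, v z <= w z} ->
  mol t v x <= mol t w x.
Proof.
move=> t0 hv hw vw; apply: mol_le => //; apply: filterS vw => z h.
by rewrite ler_wpM2l// rho_ge0.
Qed.

Lemma molD t v w x : 0 < t -> loc v -> loc w ->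
  mol t (fun z => v z + w z) x = mol t v x + mol t w x.
Proof.
move=> t0 hv hw; rewrite -integrD; [|exact: l1_mol..].
by apply: eq_Rintegral => z _; rewrite mulrDr.
Qed.

Lemma molZ t (c : R) v x : 0 < t -> loc v -> mol t (fun z => c * v z) x = c * mol t v x.
Proof.
move=> t0 hv; rewrite -integrZ; last exact: l1_mol.
by apply: eq_Rintegral => z _; rewrite mulrCA.
Qed.

Lemma molB t v w x : 0 < t -> loc v -> loc w ->
  mol t (fun z => v z - w z) x = mol t v x - mol t w x.
Proof.
move=> t0 hv hw; rewrite -integrB; [|exact: l1_mol..].
by apply: eq_Rintegral => z _; rewrite mulrBr.
Qed.

Lemma mol_norm t v x : 0 < t -> loc v -> `|mol t v x| <= mol t (fun z => `|v z|) x.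
Proof.
move=> t0 hv; apply: (le_trans (integr_norm (l1_mol x t0 hv))).
rewrite le_eqVlt; apply/orP; left; apply/eqP; apply: eq_Rintegral => z _.
by rewrite normrM ger0_norm// rho_ge0.
Qed.

Lemma mol_ge0 t v x : 0 < t -> (forall z, 0 <= v z) -> 0 <= mol t v x.
Proof. by move=> t0 v0; apply: integr_ge0 => z; rewrite mulr_ge0 ?rho_ge0. Qed.

Lemma smooth_mol t v : 0 < t -> l1 mu v -> smooth (mol t v).
Proof. by move=> t0; exact: smooth_conv (test_rho t0). Qed.

Lemma continuous_rho t : continuous (rho t).
Proof.
move=> z; exact: (rcvgZ (@continuous_radial 2 t z)).
Qed.

Lemma integr_mol t v : 0 < t -> l1 mu v -> (forall z, 0 <= v z) ->
  l1 mu (mol t v) /\ \int[mu]_x mol t v x = kappa * \int[mu]_x v x.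
Proof.
move=> t0 hv v0.
have mm : measurable_fun setT (mol t v).
  by apply: continuous_measurable_rV; apply: smooth_cont; exact: smooth_mol.
pose F (p : E * E) : \bar R := (rho t (p.2 - p.1) * v p.2)%:E.
have mF : measurable_fun setT F.
  apply/measurable_EFinP; apply: measurable_funM.
    apply: (@measurableT_comp _ _ _ _ _ _ (rho t) _ (fun p : E * E => p.2 - p.1)).
      exact: continuous_measurable_rV (@continuous_rho t).
    apply: measurable_fun_rV => i; under eq_fun do rewrite !mxE.
    apply: measurable_funB.
      exact: measurableT_comp (measurable_coord i) measurable_snd.
    exact: measurableT_comp (measurable_coord i) measurable_fst.
  by apply: measurableT_comp (l1_meas hv) measurable_snd.
have F0 p : (0 <= F p)%E by rewrite lee_fin mulr_ge0 ?rho_ge0.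
have E1 : (\int[mu]_x (mol t v x)%:E = \int[mu]_x (kappa * v x)%:E)%E.
  transitivity (\int[mu]_x \int[mu]_z F (x, z))%E.
    apply: eq_integral => x _; rewrite /mol /conv integrE//.
    exact: l1_mol (loc_l1 hv).
  rewrite (@fubini_tonelli _ _ _ _ R mu mu F mF F0).
  apply: eq_integral => z _.
  have l1r : l1 mu (fun x => rho t (x - z)).
    have := l1_mol z t0 (@loc_cst R N 1); congr l1; apply/funext => y; by rewrite mulr1.
  transitivity (\int[mu]_x (v z * rho t (x - z))%:E)%E.
    apply: eq_integral => x _; rewrite /F/= mulrC -[rho t (z - x)]rhoN; congr (_ * rho t _)%:E.
    by rewrite opprB.
  rewrite -integrE; last exact: l1Z.
  by rewrite integrZ// integr_rho// mulrC.
have hm : l1 mu (mol t v).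
  apply/integrableP; split; first exact/measurable_EFinP.
  under eq_integral do rewrite /= ger0_norm ?mol_ge0//.
  rewrite E1 -integrE; last exact: l1Z.
  exact: ltry.
split => //; rewrite -integrZ//; apply: EFin_inj.
by rewrite !integrE//; exact: l1Z.
Qed.

(** Cauchy-Schwarz for the weight [rho t], split into two square roots, bounds [mol t f x ^+ 2] by
    [kappa] times the mollification of [f ^+ 2]; the latter is then integrated by [integr_mol]. *)
Lemma mol_l2 t f : 0 < t -> l1 mu f -> l2 mu f ->
  l2 mu (mol t f) /\ \int[mu]_x (mol t f x ^+ 2) <= kappa ^+ 2 * \int[mu]_x (f x ^+ 2).
Proof.
move=> t0 hf [mf hf2].
have [hg Ig] := integr_mol t0 hf2 (fun z => sqr_ge0 (f z)).
have key x : mol t f x ^+ 2 <= kappa * mol t (fun z => f z ^+ 2) x.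
  have msr : measurable_fun setT (fun z => Num.sqrt (rho t (z - x))).
    apply: (@measurableT_comp _ _ _ _ _ _ (@Num.sqrt R)).
      by apply: continuous_measurable_fun; exact: sqrt_continuous.
    by apply: measurable_shift; exact: continuous_rho.
  have sr z : Num.sqrt (rho t (z - x)) ^+ 2 = rho t (z - x) by rewrite sqr_sqrtr ?rho_ge0.
  have l2a : l2 mu (fun z => Num.sqrt (rho t (z - x))).
    split => //; under eq_fun do rewrite sr.
    have := l1_mol x t0 (@loc_cst R N 1); congr l1; apply/funext => y; by rewrite mulr1.
  have l2b : l2 mu (fun z => Num.sqrt (rho t (z - x)) * f z).
    split; first exact: measurable_funM.
    under eq_fun do rewrite exprMn sr; exact: l1_mol (loc_l1 hf2).
  have := cauchy_schwarz l2a l2b.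
  under eq_Rintegral do rewrite mulrA -expr2 sr.
  by under [X in _ <= X * _ -> _]eq_Rintegral do rewrite sr;
    under [X in _ <= _ * X -> _]eq_Rintegral do rewrite exprMn sr; rewrite integr_rho.
have mm : measurable_fun setT (mol t f).
  by apply: continuous_measurable_rV; apply: smooth_cont; exact: smooth_mol.
have l2m : l2 mu (mol t f).
  split => //; apply: (l1_le _ (l1Z kappa hg)); first exact: measurable_funX.
  apply: aeW => x; rewrite ger0_norm ?sqr_ge0//; apply: (le_trans (key x)); exact: ler_norm.
split => //; rewrite expr2 -mulrA -Ig -integrZ//.
by apply: integr_le; [case: l2m|exact: l1Z|exact: aeW].
Qed.

End kernels.

(** * Lebesgue points of subsolutions *)

Section lebesgue_points.
Variables (R : realType) (n : nat).
Local Notation N := n.+1.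
Local Notation E := 'rV[R]_N.
Local Notation mu := (lebesgue R N).
Implicit Types (x y z : E) (t s : R) (v w f : E -> R) (i : 'I_N).

(* The weights [rho t (z - x)] are comparable with the normalised indicator of
   the ball of radius [t] around [x]. *)
Definition lebpt v x (c : R) := mol t (fun z => `|v z - c|) x @[t --> 0^'+] --> (0 : R).

(** A single Lipschitz estimate from which the stability of Lebesgue points under sums, multiples
    and positive parts follows; unary operations take [v1 = v2]. *)
Lemma lebptL (C c1 c2 c : R) v1 v2 v x : loc v1 -> loc v2 -> loc v ->
  {ae mu, forall z, `|v z - c| <= C * (`|v1 z - c1| + `|v2 z - c2|)} ->
  lebpt v1 x c1 -> lebpt v2 x c2 -> lebpt v x c.
Proof.
move=> h1 h2 h le_v l1c l2c.
have k1 := loc_norm (locB h1 (@loc_cst R N c1)).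
have k2 := loc_norm (locB h2 (@loc_cst R N c2)).
have k := loc_norm (locB h (@loc_cst R N c)).
apply: (@rcvg0_le _ _ _ _ _ (fun t => C * (mol t (fun z => `|v1 z - c1|) x + mol t (fun z => `|v2 z - c2|) x))).
  near=> t; have t0 : 0 < t by near: t; exact: nbhs_right_gt.
  rewrite ger0_norm ?mol_ge0// -molD// -molZ//; last exact: locD.
  by apply: mol_ae_le => //; apply: locZ; exact: locD.
apply: (@rcvgZ _ _ _ _ _ _ 0); last by rewrite mulr0.
by apply: (@rcvgD _ _ _ _ _ _ 0 0); rewrite ?addr0.
Unshelve. all: by end_near. Qed.

Lemma lebpt_ae_eq v w x c : loc v -> loc w -> {ae mu, forall z, v z = w z} ->
  lebpt v x c -> lebpt w x c.
Proof.
move=> hv hw vw lv; apply: (@lebptL 1 c c c v v w x hv hv hw _ lv lv).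
by apply: filterS vw => z ->; rewrite mul1r lerDl.
Qed.

Lemma lebpt_cst (c : R) x : lebpt (fun=> c) x c.
Proof.
apply: (@rcvg0_le _ _ _ _ _ (fun=> 0)); last exact: cvg_cst.
near=> t; have t0 : 0 < t by near: t; exact: nbhs_right_gt.
by rewrite subrr normr0 mol_cst// mulr0 normr0.
Unshelve. all: by end_near. Qed.

Lemma lebptD v w x (c d : R) : loc v -> loc w -> lebpt v x c -> lebpt w x d ->
  lebpt (fun z => v z + w z) x (c + d).
Proof.
move=> hv hw; apply: (@lebptL 1) => //; first exact: locD.
by apply: aeW => z; rewrite mul1r opprD addrACA ler_normD.
Qed.

Lemma lebptZ (k : R) v x (c : R) : loc v -> lebpt v x c -> lebpt (fun z => k * v z) x (k * c).
Proof.
move=> hv lv; apply: (@lebptL `|k| c c _ v v) => //; first exact: locZ.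
by apply: aeW => z; rewrite -mulrBr normrM ler_wpM2l// lerDl.
Qed.

Lemma lebptB v w x (c d : R) : loc v -> loc w -> lebpt v x c -> lebpt w x d ->
  lebpt (fun z => v z - w z) x (c - d).
Proof.
move=> hv hw; apply: (@lebptL 1) => //; first exact: locB.
apply: aeW => z; rewrite mul1r (_ : _ - _ = (v z - c) - (w z - d)); last by ring.
exact: ler_normB.
Qed.

Lemma loc_max0 v : loc v -> loc (fun z => Num.max (v z) 0).
Proof.
move=> hv; apply: (loc_le _ hv); first by apply: measurable_maxr => //; case: hv.
by apply: aeW => z; have := max0_lip (v z) 0; rewrite maxxx !subr0.
Qed.

Lemma loc_min v w : loc v -> loc w -> loc (fun z => Num.min (v z) (w z)).
Proof.
move=> hv hw; under eq_fun do rewrite minE_max0.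
by apply: locB => //; apply: loc_max0; exact: locB.
Qed.

Lemma lebpt_max0 v x (c : R) : loc v -> lebpt v x c ->
  lebpt (fun z => Num.max (v z) 0) x (Num.max c 0).
Proof.
move=> hv lv; apply: (@lebptL 1 c c _ v v) => //; first exact: loc_max0.
by apply: aeW => z; rewrite mul1r (le_trans (max0_lip _ _))// lerDl.
Qed.

Lemma lebpt_min v w x (c d : R) : loc v -> loc w -> lebpt v x c -> lebpt w x d ->
  lebpt (fun z => Num.min (v z) (w z)) x (Num.min c d).
Proof.
move=> hv hw lv lw; rewrite minE_max0; under eq_fun do rewrite minE_max0.
apply: lebptB => //; first by apply: loc_max0; exact: locB.
by apply: lebpt_max0; [exact: locB|exact: lebptB].
Qed.

Lemma lebpt_cvg v x (c : R) : loc v -> lebpt v x c ->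
  mol t v x @[t --> 0^'+] --> kappa R n * c.
Proof.
move=> hv lv; have h0 : mol t v x - kappa R n * c @[t --> 0^'+] --> (0 : R).
  apply: (@rcvg0_le _ _ _ _ _ (fun t => mol t (fun z => `|v z - c|) x)) => //.
  near=> t; have t0 : 0 < t by near: t; exact: nbhs_right_gt.
  rewrite -(mol_cst c x t0) -molB//; last exact: loc_cst.
  by apply: mol_norm => //; apply: locB => //; exact: loc_cst.
apply: (@eq_rcvg _ _ _ (fun t => mol t v x - kappa R n * c + kappa R n * c)).
  by move=> t; rewrite subrK.
exact: (rcvgD h0 (cvg_cst _) (add0r _)).
Unshelve. all: by end_near. Qed.

(** The route by which an almost everywhere inequality reaches every common Lebesgue point:
    mollifications preserve it and converge to [kappa] times the precise values. *)
Lemma lebpt_le v w x (c d : R) : loc v -> loc w -> {ae mu, forall z, v z <= w z} ->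
  lebpt v x c -> lebpt w x d -> c <= d.
Proof.
move=> hv hw vw lv lw; rewrite -(ler_pM2l (kappa_gt0 R n)).
apply: (ler_cvg_to (lebpt_cvg hv lv) (lebpt_cvg hw lw)).
near=> t; have t0 : 0 < t by near: t; exact: nbhs_right_gt.
exact: mol_ae_le.
Unshelve. all: by end_near. Qed.

Lemma lebpt_unique v x (c d : R) : loc v -> lebpt v x c -> lebpt v x d -> c = d.
Proof.
move=> hv lc ld; apply: le_anti.
by rewrite (lebpt_le hv hv _ lc ld) ?(lebpt_le hv hv _ ld lc)//; exact: aeW.
Qed.

Lemma lebpt_uniform (v_ : nat -> E -> R) (c_ e_ : nat -> R) v x (c : R) :
  (forall k, loc (v_ k)) -> loc v -> (forall k, {ae mu, forall z, `|v z - v_ k z| <= e_ k}) ->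
  (forall k, `|c - c_ k| <= e_ k) -> e_ k @[k --> \oo] --> (0 : R) ->
  (forall k, lebpt (v_ k) x (c_ k)) -> lebpt v x c.
Proof.
move=> hv_ hv ve ce e0 lv; have K0 := kappa_gt0 R n.
apply/cvgr0Pnorm_le => e epos; pose e' := e / (2 + 2 * kappa R n).
have D0 : 0 < 2 + 2 * kappa R n by lra.
have e'0 : 0 < e' by exact: divr_gt0.
have [k ek] : exists k, `|e_ k| <= e'.
  by move/cvgr0Pnorm_le : e0 => /(_ _ e'0)[k _ hk]; exists k; apply: hk => /=.
have {}ek := le_trans (ler_norm _) ek.
have h1 : \forall t \near 0^'+, `|mol t (fun z => `|v_ k z - c_ k|) x| <= e'.
  by move/cvgr0Pnorm_le : (lv k) => /(_ _ e'0).
near=> t; have t0 : 0 < t by near: t; exact: nbhs_right_gt.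
have h1t : `|mol t (fun z => `|v_ k z - c_ k|) x| <= e' by near: t.
rewrite ger0_norm ?mol_ge0//.
have lk := loc_norm (locB (hv_ k) (@loc_cst R N (c_ k))).
apply: (@le_trans _ _ (mol t (fun z => `|v_ k z - c_ k| + 2 * e') x)).
  apply: mol_ae_le => //; [exact/loc_norm/locB/loc_cst|exact/locD/loc_cst|].
  apply: filterS (ve k) => z hz.
  have := ler_normD (v z - v_ k z) (v_ k z - c).
  have := ler_normD (v_ k z - c_ k) (c_ k - c).
  rewrite (distrC (c_ k)); rewrite !addrA !subrK => a1 a2.
  have := ce k; lra.
rewrite molD//; last exact: loc_cst.
rewrite mol_cst//; have := ler_norm (mol t (fun z => `|v_ k z - c_ k|) x).
have : e' * (2 + 2 * kappa R n) = e by rewrite /e' divfK// gt_eqF.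
lra.
Unshelve. all: by end_near. Qed.

Lemma lebpt_continuous v x : loc v -> v y @[y --> x] --> v x -> lebpt v x (v x).
Proof.
move=> hv /cvgrPdist_le cv; have K0 := kappa_gt0 R n.
apply/cvgr0Pnorm_le => e epos; pose e' := e / kappa R n.
have e'0 : 0 < e' by exact: divr_gt0.
have /nbhs_ballP[d /= d0 hd] := cv _ e'0.
near=> t; have t0 : 0 < t by near: t; exact: nbhs_right_gt.
have td : t < d by near: t; exact: nbhs_right_lt.
rewrite ger0_norm ?mol_ge0// (_ : e = kappa R n * e'); last first.
  by rewrite /e' mulrC divfK// gt_eqF.
rewrite -(mol_cst e' x t0); apply: mol_le => //.
- exact/loc_norm/locB/loc_cst.
- exact: loc_cst.
- apply: aeW => z; have [bz|nz] := pselect (box t (z - x)); last first.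
    by rewrite rho_out_box// !mul0r.
  rewrite ler_wpM2l ?rho_ge0// distrC; apply: hd; split => // i j.
  rewrite (ord1 i) /ball/= distrC; apply: (@le_lt_trans _ _ t) => //.
  by have := bz j; rewrite !mxE.
Unshelve. all: by end_near. Qed.

Definition tau (k : nat) : R := k.+1%:R^-1.

Lemma tau_gt0 k : 0 < tau k. Proof. by rewrite invr_gt0. Qed.

Lemma tau_le1 k : tau k <= 1. Proof. by rewrite invf_le1// ler1n. Qed.

Lemma cvg_tau : tau k @[k --> \oo] --> (0 : R)^'+.
Proof.
move=> P hP; have : \forall k \near \oo, 0 < tau k -> P (tau k) by exact: cvg_harmonicS hP.
by apply: filterS => k; apply; exact: tau_gt0.
Qed.

Lemma rcvg_tau (f : R -> R) (a : R) : f t @[t --> 0^'+] --> a -> f (tau k) @[k --> \oo] --> a.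
Proof. by move=> h P /h; exact: cvg_tau. Qed.

Lemma lebpt_cvg_tau v x (c : R) : loc v -> lebpt v x c ->
  mol (tau k) v x @[k --> \oo] --> kappa R n * c.
Proof. by move=> hv lv; exact: (rcvg_tau (lebpt_cvg hv lv)). Qed.

(** * Convergence of mollifications in L^2 *)

Section l2_mollification.
Variable D : bdomain R N.
Local Notation O := (dom D).
Local Notation B := (dom_bound D).
Local Notation test := (test_function O).
Implicit Types phi : E -> R.

Lemma mol_l2cvg_test phi : test phi ->
  l2cvg mu (fun k => mol (tau k) phi) (fun z => kappa R n * phi z).
Proof.
move=> tphi; have lphi : loc phi by exact: loc_l1 (test_l1 tphi).
have [M M0 hM] := test_bounded tphi; have K0 := kappa_gt0 R n.
apply: (@l2cvg_dct _ _ _ mu (fun k => mol (tau k) phi) (fun z => kappa R n * phi z)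
  (fun z => kappa R n * M * \1_(box (B + 1)) z) _ _ _ _ _).2.
- move=> k; apply: continuous_measurable_rV; apply: smooth_cont.
  exact: smooth_mol (tau_gt0 k) (test_l1 tphi).
- by apply: measurable_funM => //; exact: test_meas tphi.
- apply: l2Z; split; first by apply: measurable_indic; exact: measurable_box.
  rewrite (_ : (fun x => _) = \1_(box (B + 1))); first exact: l1_box.
  by apply/funext => x; rewrite indicE; case: (_ \in _); rewrite ?expr1n// expr0n.
- apply: aeW => x; apply: lebpt_cvg_tau => //; apply: lebpt_continuous => //.
  exact: (test_cont tphi).
- move=> k; apply: aeW => x; have t0 := tau_gt0 k.
  have [hx|hx] := pselect (box (B + 1) x); last first.
    rewrite indicE memNset// mulr0 (_ : mol _ _ _ = 0) ?normr0//.
    rewrite /mol /conv -[RHS](integr0 mu); apply: eq_Rintegral => z _.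
    have [bz|nz] := pselect (box (tau k) (z - x)); last by rewrite rho_out_box// mul0r.
    rewrite (test_out tphi) ?mulr0// => Oz; apply: hx => i.
    have := bz i; have := dom_box Oz i; rewrite !mxE; have := tau_le1 k.
    have := ler_normB (z 0 i) (z 0 i - x 0 i); rewrite subKr; lra.
  rewrite indicE mem_set// mulr1 -(mol_cst M x t0); apply: (le_trans (mol_norm _ _ _)) => //.
  apply: mol_ae_le => //; [exact: loc_norm|exact: loc_cst|exact: aeW].
Qed.

(** The bound of [mol_l2], uniform in the scale, transfers the convergence from test functions to
    their L^2 limits. *)
Lemma mol_l2cvg f (F : nat -> E -> R) : l2 mu f -> l1 mu f -> (forall k, test (F k)) ->
  l2cvg mu F f -> l2cvg mu (fun k => mol (tau k) f) (fun z => kappa R n * f z).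
Proof.
move=> f2 f1 tF cF; have K0 := kappa_gt0 R n.
have l2F k := test_l2 (tF k); have l1F k := test_l1 (tF k).
apply/cvgr0Pnorm_le => e epos; pose c := 3 * (2 * kappa R n ^+ 2 + 1).
have c0 : 0 < c by rewrite /c; have := sqr_ge0 (kappa R n); lra.
have arith (q a b d r s : R) : a <= q * r -> b <= r -> q * d <= q * r ->
  r * (3 * (2 * q + 1)) = s -> 3 * (a + (b + q * d)) <= s by lra.
have e'0 : 0 < e / c by exact: divr_gt0.
have [m hm] : exists m, \int[mu]_x ((F m x - f x) ^+ 2) <= e / c.
  move/cvgr0Pnorm_le : cF => /(_ _ e'0)[m _ hm]; exists m.
  by apply: le_trans (ler_norm _) _; apply: hm => /=.
have := mol_l2cvg_test (tF m); move/cvgr0Pnorm_le => /(_ _ e'0).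
apply: filterS => k /(le_trans (ler_norm _)) hk; have t0 := tau_gt0 k.
rewrite ger0_norm; last by apply: integr_ge0 => x; exact: sqr_ge0.
have [d2 hd] := mol_l2 t0 (l1B f1 (l1F m)) (l2B f2 (l2F m)).
have [dF _] := mol_l2 t0 (l1F m) (l2F m).
have [df _] := mol_l2 t0 f1 f2.
have b2 := l2B dF (l2Z (kappa R n) (l2F m)); have c2 := l2B (l2F m) f2.
have := @integr_le _ _ _ mu (fun x => (mol (tau k) f x - kappa R n * f x) ^+ 2)
  (fun x => 3 * ((mol (tau k) (fun z => f z - F m z) x) ^+ 2 +
     ((mol (tau k) (F m) x - kappa R n * F m x) ^+ 2 + kappa R n ^+ 2 * (F m x - f x) ^+ 2))).
have l1a : l1 mu (fun x => mol (tau k) (fun z => f z - F m z) x ^+ 2) by case: d2.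
have l1b : l1 mu (fun x => (mol (tau k) (F m) x - kappa R n * F m x) ^+ 2) by case: b2.
have l1c : l1 mu (fun x => (F m x - f x) ^+ 2) by case: c2.
have l1d := l1Z (kappa R n ^+ 2) l1c.
rewrite integrZ; last by apply: l1D => //; exact: l1D.
rewrite integrD//; last exact: l1D.
rewrite integrD// integrZ// => H; apply: (le_trans (H _ _ _)).
- by have [] := l2B df (l2Z (kappa R n) f2).
- by apply: l1Z; apply: l1D => //; exact: l1D.
- apply: aeW => x; rewrite (molB x t0 (loc_l1 f1) (loc_l1 (l1F m))).
  set a := mol _ f x; set b := mol _ _ x; move: (F m x) (f x) (kappa R n) => y z q.
  rewrite -subr_ge0 (_ : _ - _ = ((a - b) - (b - q * y)) ^+ 2 +
    ((b - q * y) - q * (y - z)) ^+ 2 + ((a - b) - q * (y - z)) ^+ 2); last by ring.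
  by rewrite !addr_ge0 ?sqr_ge0.
have : \int[mu]_x (f x - F m x) ^+ 2 <= e / c.
  by apply: le_trans hm; rewrite le_eqVlt; apply/orP; left; apply/eqP;
    apply: eq_Rintegral => x _; rewrite -sqrrN opprB.
have E1 : e / c * (3 * (2 * kappa R n ^+ 2 + 1)) = e by rewrite -/c divfK// gt_eqF.
move=> h1; have k2 := sqr_ge0 (kappa R n).
exact: arith (le_trans hd (ler_wpM2l k2 h1)) hk (ler_wpM2l k2 hm) E1.
Qed.

Lemma mol_l2cvg_H0 u g : H0 D u g -> l2cvg mu (fun k => mol (tau k) u) (fun z => kappa R n * u z).
Proof.
move=> hu; have [u2 _ _ [p tp [cp _]]] := hu.
exact: mol_l2cvg u2 (H0_l1 hu) tp cp.
Qed.

Lemma mol_l2cvg_H0g u g i : H0 D u g ->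
  l2cvg mu (fun k => mol (tau k) (g i)) (fun z => kappa R n * g i z).
Proof.
move=> hu; have [_ g2 gO [p tp [_ cp]]] := hu.
have g1 : l1 mu (g i) by apply: (@l1_of_l2 _ _ D) => // x /gO[].
exact: (mol_l2cvg (F := fun k => partial i (p k)) (g2 i) g1 (fun k => test_partial i (tp k)) (cp i)).
Qed.

Lemma mol_ae u g : H0 D u g -> exists2 s : nat -> nat, (forall k, (k <= s k)%N) &
  {ae mu, forall x, mol (tau (s k)) u x @[k --> \oo] --> kappa R n * u x}.
Proof.
move=> hu; have u2 := H0_l2 hu; have u1 := H0_l1 hu.
apply: l2cvg_ae (mol_l2cvg_H0 hu); last exact: l2Z.
by move=> k; have [] := mol_l2 (tau_gt0 k) u1 u2.
Qed.

(** Mollifications converge to [kappa * h] at every point of [O] and, along a subsequence, to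
    [kappa * u] almost everywhere. This does the work of Lebesgue's differentiation theorem. *)
Lemma lebpt_ae u g (h : E -> R) : H0 D u g -> (forall x, O x -> lebpt u x (h x)) ->
  {ae mu, forall x, O x -> u x = h x}.
Proof.
move=> hu hh; have [s ks cs] := mol_ae hu; apply: filterS cs => x cx Ox.
have lu := loc_l1 (H0_l1 hu).
have c2 : mol (tau (s k)) u x @[k --> \oo] --> kappa R n * h x.
  exact: (rcvg_sub ks (lebpt_cvg_tau lu (hh x Ox))).
have : kappa R n * u x = kappa R n * h x by exact: (cvg_unique (@norm_hausdorff _ _) cx c2).
by move/(mulfI (lt0r_neq0 (kappa_gt0 R n))).
Qed.

Lemma is_derive_mol_H0 u g t x i : 0 < t -> H0 D u g ->
  is_derive x (delta_mx 0 i) (mol t u) (mol t (g i) x).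
Proof.
move=> t0 hu; have u1 := H0_l1 hu; have [u2 g2 gO [p tp [cp cpg]]] := hu.
have g1 : l1 mu (g i) by apply: (@l1_of_l2 _ _ D) => // y /gO[].
have tr := @test_rho R n t t0.
have := is_derive_conv x i tr (loc_l1 u1); congr (is_derive _ _ _ _).
have sr : smooth (fun z => rho t (z - x)) by apply: smooth_shift; exact: test_smooth tr.
have l2s (k : E -> R) : test_function (dom (cube n (t + 1))) k -> l2 mu (fun z => k (z - x)).
  move=> tk; split.
    by apply: measurable_shift; exact: test_cont tk.
  have := l1_conv x (test_smoothM (test_smooth tk) tk) (@loc_cst R N 1).
  by congr l1; apply/funext => z; rewrite mulr1 expr2.
have l2r := l2s _ tr.
have l2d := l2s _ (test_partial i tr).
have c1 : \int[mu]_z (rho t (z - x) * partial i (p k) z) @[k --> \oo] -->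
    \int[mu]_z (rho t (z - x) * g i z).
  apply: (l2cvg_dot (F := fun _ z => rho t (z - x))) => //.
    by move=> k; apply: test_l2; exact: test_partial.
  exact: l2cvg_cst.
have c2 : \int[mu]_z (partial i (rho t) (z - x) * p k z) @[k --> \oo] -->
    \int[mu]_z (partial i (rho t) (z - x) * u z).
  apply: (l2cvg_dot (F := fun _ z => partial i (rho t) (z - x))) => //.
    by move=> k; exact: test_l2.
  exact: l2cvg_cst.
have c3 : \int[mu]_z (rho t (z - x) * partial i (p k) z) @[k --> \oo] -->
    - \int[mu]_z (partial i (rho t) (z - x) * u z).
  apply: eq_rcvg (cvgN c2) => k.
  rewrite (integr_by_parts i sr (tp k)) partial_shift//; exact: test_smooth tr.
exact: (cvg_unique (@norm_hausdorff _ _) c3 c1).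
Qed.

End l2_mollification.

(** * Monotonicity of the mollifications of a subsolution *)

Section mean_value.
Variable D : bdomain R N.
Local Notation O := (dom D).
Local Notation test := (test_function O).
Implicit Types phi : E -> R.

(** One radius serves all centres near [x]: the monotonicity of mollifications is also used at
    neighbouring points, where upper bounds on [u] are derived. *)
Lemma inner_radius x : O x -> exists2 d : R, 0 < d &
  forall z, ball x d z -> forall y, sq (y - z) < d ^+ 2 -> O y.
Proof.
move=> Ox; have /nbhs_ballP[e /= e0 he] : nbhs x O.
  by apply: open_nbhs_nbhs; split => //; exact: dom_open.
exists (e / 2); first by rewrite divr_gt0.
move=> z [_ hz] y hy; apply: he; split => // i j; rewrite (ord1 i) /ball/=.
have := hz 0 j; rewrite /ball/= => h1.
have h2 := le_lt_trans (sq_coord (y - z) j) hy; rewrite !mxE in h2.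
have h3 := norm_lt_sqr (divr_gt0 e0 (ltr0n _ 2)) h2.
have := ler_normB (x 0 j - z 0 j) (y 0 j - z 0 j).
rewrite opprB addrA subrK; lra.
Qed.

Lemma ler_of_derive (h dh : R -> R) (d : R) :
  (forall t, 0 < t < d -> is_derive t (1 : R) h (dh t)) ->
  (forall t, 0 < t < d -> 0 <= dh t) ->
  forall s t, 0 < s -> s <= t -> t < d -> h s <= h t.
Proof.
move=> hd hp s t s0 st td.
have inr r : r \in `[s, t] -> 0 < r < d.
  by rewrite in_itv/= => /andP[sr rt]; rewrite (lt_le_trans s0 sr) (le_lt_trans rt td).
have ch : {within `[s, t], continuous h}.
  by apply: derivable_within_continuous => r /inr /hd [].
have [|r /inr hr E1] := @MVT_segment R h dh s t st _ ch.
  by move=> r rst; apply: hd; apply: inr; exact: subset_itv_oo_cc rst.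
by rewrite -subr_ge0 E1 mulr_ge0 ?hp// subr_ge0.
Qed.

(** The subsolution is tested with [radial 0 t] centred at [x], whose integral is at most the volume
    [(2 * t) ^+ N] of a cube; dividing by the factor [2 * t ^+ n] of [laplacian_radial0] leaves
    [2 ^+ n * t]. *)
Lemma integr_drho_subsol (M : R) u g x t (d : R) : 0 <= M -> subsol D M u g ->
  (forall y, sq (y - x) < d ^+ 2 -> O y) -> 0 < t < d ->
  - (M * 2 ^+ n * t) <= \int[mu]_z (drho t (z - x) * u z).
Proof.
move=> M0 [hu u0 _ hM] dO /andP[t0 td].
have tpsi := test_radial_shift 0 t0 td dO; set psi := fun z => _ in tpsi.
have psi0 z : 0 <= psi z by exact: radial_ge0.
have E1 : 2 * t ^+ n * \int[mu]_z (drho t (z - x) * u z) = - dot g (fun i => partial i psi).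
  rewrite -integrZ; last first.
    apply: (@l1_bM_loc _ _ (fun z => drho t (z - x)) u (t + `|x|) (t ^- n.+2 * (2 * N%:R + 72))).
    - by apply: measurable_shift; exact: continuous_drho.
    - by move=> z; exact: drho_norm.
    - move=> z nz; rewrite drho_out_box// => hz; apply: nz => i.
      have := hz i; rewrite !mxE; have := coord_le_norm x i.
      have := ler_normD (z 0 i - x 0 i) (x 0 i); rewrite subrK; lra.
    - exact: loc_l1 (H0_l1 hu).
  rewrite (_ : \int[mu]_z _ = \int[mu]_z (\sum_i u z * partial i (partial i psi) z)).
    rewrite integr_sum; last first.
      move=> i; apply: l2M; first exact: H0_l2 hu.
      exact: test_l2 (test_partial i (test_partial i tpsi)).
    rewrite -sumrN; apply: eq_bigr => i _; rewrite (H0_weak_gradient i hu)//.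
    exact: test_partial.
  apply: eq_Rintegral => z _; rewrite -mulr_sumr -/(laplacian psi z).
  rewrite /psi laplacian_shift; last exact: smooth_radial.
  by rewrite laplacian_radial0//; ring.
have E2 : \int[mu]_z psi z <= (2 * t) ^+ N.
  pose Q := [set y : E | forall i, `[x 0 i - t, x 0 i + t]%classic (y 0 i)].
  have mQ : measurable Q.
    rewrite (_ : Q = \bigcap_(i in [set: 'I_N]) ((fun y : E => y 0 i) @^-1` `[x 0 i - t, x 0 i + t]%classic)).
      apply: fin_bigcap_measurable => [|i _]; first exact: finite_finset.
      by rewrite -[X in measurable X]setTI; apply: measurable_coord.
    by apply/seteqP; split => [y h i _|y h i]; exact: h.
  have lQ : mu Q = ((2 * t) ^+ N)%:E by rewrite /Q (lebesgue_cube x (ltW t0)).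
  have l1Q : l1 mu (\1_Q).
    apply/integrableP; split; first by apply/measurable_EFinP; exact: measurable_indic.
    under eq_integral do rewrite /= ger0_norm// .
    rewrite integral_indic// setIT; apply: le_lt_trans (ltry ((2 * t) ^+ N)).
    by rewrite -lQ.
  have -> : (2 * t) ^+ N = \int[mu]_z \1_Q z.
    by rewrite /Rintegral integral_indic// setIT; apply: esym; exact: (congr1 fine lQ).
  apply: integr_le => //; first exact: test_l1 tpsi.
  apply: aeW => z; have [hz|nz] := pselect (Q z).
    by rewrite indicE mem_set//; exact: radial_le.
  rewrite indicE memNset// /psi radial_out_box// => hz; apply: nz => i.
  by have := hz i; rewrite /= !mxE in_itv/= ler_distl.
have E3 := hM _ tpsi psi0.
have tn0 : 0 < t ^+ n by exact: exprn_gt0.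
rewrite -(ler_pM2l (mulr_gt0 (ltr0n _ 2) tn0)) E1.
have := ler_wpM2l M0 E2; rewrite exprMn !exprS => h.
rewrite mulrN lerN2; apply: (le_trans E3); apply: (le_trans h).
by rewrite le_eqVlt; apply/orP; left; apply/eqP; ring.
Qed.

Lemma subsol_mol_mono (M : R) u g x (d : R) : 0 <= M -> subsol D M u g ->
  (forall y, sq (y - x) < d ^+ 2 -> O y) -> forall s t, 0 < s -> s <= t -> t < d ->
  mol s u x + M * 2 ^+ n * s ^+ 2 <= mol t u x + M * 2 ^+ n * t ^+ 2.
Proof.
move=> M0 hu dO; have lu := loc_l1 (H0_l1 (subsol_H0 hu)).
apply: (@ler_of_derive (fun t => mol t u x + M * 2 ^+ n * t ^+ 2)
  (fun t => \int[mu]_z (drho t (z - x) * u z) + M * 2 ^+ n * (2 * t))) => t /andP[t0 td].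
  apply: (is_derD (is_derive_mol x t0 lu) _ (erefl _)); apply: (is_derZ _ (erefl _)).
  have i1 : is_derive t (1 : R) (fun s : R => s) 1 by exact: is_derive_id.
  rewrite (_ : (fun s : R => s ^+ 2) = (fun s => s * s)); last by apply/funext => s; rewrite expr2.
  by apply: (is_derM i1 i1); ring.
have := integr_drho_subsol M0 hu dO; rewrite -/(0 < t < d) => /(_ t); rewrite t0 td => /(_ isT).
have : 0 <= M * 2 ^+ n * t by rewrite !mulr_ge0 ?exprn_ge0// ltW.
lra.
Qed.

Lemma cvg_sqr0 (k : R) : k * t ^+ 2 @[t --> 0^'+] --> (0 : R).
Proof.
have h : (t : R) @[t --> 0^'+] --> (0 : R) by apply: cvg_within_filter; exact: cvg_id.
apply: (@rcvgZ _ _ _ _ _ _ 0); last by rewrite mulr0.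
under eq_fun do rewrite expr2.
by apply: (rcvgM h h); rewrite mulr0.
Qed.

Lemma subsol_hat_le (M : R) u g x (d c : R) : 0 <= M -> subsol D M u g ->
  (forall y, sq (y - x) < d ^+ 2 -> O y) -> lebpt u x c -> forall t, 0 < t < d ->
  kappa R n * c <= mol t u x + M * 2 ^+ n * t ^+ 2.
Proof.
move=> M0 hu dO lu t /andP[t0 td]; have lou := loc_l1 (H0_l1 (subsol_H0 hu)).
have h : mol s u x + M * 2 ^+ n * s ^+ 2 @[s --> 0^'+] --> kappa R n * c.
  exact: (rcvgD (lebpt_cvg lou lu) (cvg_sqr0 (M * 2 ^+ n)) (addr0 _)).
apply: (ler_cvg_to h (cvg_cst _)); near=> s.
apply: (subsol_mol_mono M0 hu dO) => //.
by near: s; exact: nbhs_right_ltW.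
Unshelve. all: by end_near. Qed.

(** The candidate [c] is the infimum over [t] of the corrected mollifications, divided by [kappa].
    Near [x] the function is almost everywhere at most [c + e'], hence [|u - c| <= 2 * e' + c - u],
    and the average of the right side is small because the mollification of [u] is at least
    [kappa * c] up to a multiple of [t ^+ 2]. *)
Lemma subsol_lebpt (M : R) u g x : 0 <= M -> subsol D M u g -> O x -> exists c : R, lebpt u x c.
Proof.
have arith (a b c d e q : R) : a <= b + q -> b <= c + e / 2 -> c + q < d + e / 2 -> a <= d + e by lra.
have arith2 (a c k q d e : R) : 0 < d -> 0 < k -> k * c <= a + q -> q <= d * k ->
    d * (4 * k + 4) = e -> k * (2 * d + c) - a <= e.
  by move=> d0 k0; have := mulr_gt0 d0 k0; lra.
move=> M0 hu Ox; have [d d0 dO] := inner_radius Ox; have K0 := kappa_gt0 R n.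
have hH0 := subsol_H0 hu; have lu := loc_l1 (H0_l1 hH0).
have u0 z : 0 <= u z by case: hu.
pose K := M * 2 ^+ n; have K_ge0 : 0 <= K by rewrite mulr_ge0// exprn_ge0.
pose m t := mol t u x + K * t ^+ 2.
have bx : ball x d x by exact: ballxx.
have mm := subsol_mol_mono M0 hu (dO x bx).
have m0 t : 0 < t -> 0 <= m t.
  by move=> t0; rewrite addr_ge0 ?mol_ge0// mulr_ge0// sqr_ge0.
pose S := [set m t | t in [set t | 0 < t < d]].
have hS : has_inf S.
  split; first by exists (m (d / 2)), (d / 2) => //=; apply/andP; split; lra.
  by exists 0 => _ [t /andP[t0 _] <-]; exact: m0.
pose c : R := inf S / kappa R n; exists c.
have kc : kappa R n * c = inf S by rewrite /c mulrC divfK// gt_eqF.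
clearbody c.
have infS_le t : 0 < t < d -> inf S <= m t.
  by move=> htd; apply: (inf_lbound hS.2); exists t.
have [s ks cs] := mol_ae hH0.
apply/cvgr0Pnorm_le => e e0; pose e' := e / (4 * kappa R n + 4).
have D0 : 0 < 4 * kappa R n + 4 by lra.
have e'0 : 0 < e' by exact: divr_gt0.
have e'E : e' * (4 * kappa R n + 4) = e by rewrite /e' divfK// gt_eqF.
clearbody e'; pose e1 := e' * kappa R n; have e10 : 0 < e1 by exact: mulr_gt0.
have e1E : e1 = e' * kappa R n by [].
clearbody e1.
have [t1 t1d mt1] : exists2 t, 0 < t < d & m t < inf S + e1 / 2.
  have [|_ [t td <-] h] := @inf_adherent _ S (e1 / 2) _ hS; first by rewrite divr_gt0.
  by exists t.
have [t10 t1d'] := andP t1d.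
(* [mol t1 u] is continuous, so that the upper bound on [u] it provides is
   uniform near [x]. *)
have cm : continuous (mol t1 u) by apply: smooth_cont; apply: smooth_mol => //; exact: H0_l1 hH0.
have /cvgrPdist_le/(_ (e1 / 2)) := cm x; rewrite divr_gt0// => /(_ isT)/nbhs_ballP[r /= r0 hr].
have ub : {ae mu, forall z, ball x d z -> ball x r z -> u z <= c + e'}.
  apply: filterS cs => z cz bz rz.
  have mz := subsol_mol_mono M0 hu (dO z bz).
  have h1 : kappa R n * u z <= mol t1 u z + K * t1 ^+ 2.
    apply: (ler_cvg_to cz (cvg_cst _)); near=> k.
    apply: (@le_trans _ _ (mol (tau (s k)) u z + K * (tau (s k)) ^+ 2)).
      by rewrite lerDl mulr_ge0// sqr_ge0.
    apply: mz => //; first exact: tau_gt0.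
    apply: (@le_trans _ _ (tau k)); first by rewrite /tau lef_pV2 ?posrE// ler_nat ltnS; exact: ks.
    by apply/ltW; near: k; have := @cvg_tau _ (nbhs_right_lt t10).
  have := hr z rz; rewrite ler_distlC => /andP[_ h2].
  have E1 : kappa R n * (c + e') = inf S + e1 by rewrite mulrDr kc e1E (mulrC e').
  have h3 : kappa R n * u z <= kappa R n * (c + e') by rewrite E1; exact: arith h1 h2 mt1.
  by rewrite ler_pM2l in h3.
near=> t; have t0 : 0 < t by near: t; exact: nbhs_right_gt.
have td : t < d by near: t; exact: nbhs_right_lt.
have tr : t < r by near: t; exact: nbhs_right_lt.
have h1 : `|K * t ^+ 2| <= e1.
  by near: t; move/cvgr0Pnorm_le : (cvg_sqr0 K) => /(_ _ e10).
rewrite ger0_norm ?mol_ge0//.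
have hm : inf S <= m t by apply: infS_le; rewrite t0.
apply: (@le_trans _ _ (mol t (fun z => (2 * e' + c) - u z) x)).
  apply: mol_le => //; [exact/loc_norm/locB/loc_cst|by apply: locB => //; exact: loc_cst|].
  apply: filterS ub => z hz; have [bz|nz] := pselect (box t (z - x)); last first.
    by rewrite rho_out_box// !mul0r.
  have bz' (q : R) : t < q -> ball x q z.
    move=> tq; split; first exact: lt_trans tq.
    move=> i j; rewrite (ord1 i) /ball/= distrC; apply: (@le_lt_trans _ _ t) => //.
    by have := bz j; rewrite !mxE.
  rewrite ler_wpM2l ?rho_ge0//.
  have := hz (bz' _ td) (bz' _ tr); rewrite ler_norml => h2; apply/andP; split; lra.
rewrite molB//; last exact: loc_cst.
rewrite mol_cst//; have := ler_norm (K * t ^+ 2); move: hm; rewrite -kc /m.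
rewrite e1E in h1; move=> a1 a2; exact: arith2 e'0 K0 a1 (le_trans a2 h1) e'E.
Unshelve. all: by end_near. Qed.

(** Fix a scale [t] at which the mollification of [u] is close to [kappa * c]. At this scale L^2
    convergence gives convergence of the mollifications, and [subsol_hat_le] bounds every [c_ k] by
    that of [u_ k]. For decreasing sequences the opposite inequality is [lebpt_le]. *)
Lemma subsol_cvg_hat (M : R) (u_ : nat -> E -> R) (g_ : nat -> 'I_N -> E -> R) u g x
    (c_ : nat -> R) (c : R) : 0 <= M ->
  (forall k, subsol D M (u_ k) (g_ k)) -> H0 D u g -> l2cvg mu u_ u -> O x ->
  (forall k, lebpt (u_ k) x (c_ k)) -> lebpt u x c ->
  forall e : R, 0 < e -> \forall k \near \oo, c_ k <= c + e.
Proof.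
move=> M0 hs hu cu Ox lc_ lc e e0; have [d d0 dO] := inner_radius Ox.
have K0 := kappa_gt0 R n; have bx : ball x d x by exact: ballxx.
have lu := loc_l1 (H0_l1 hu).
have e10 : 0 < kappa R n * e / 3 by rewrite divr_gt0// mulr_gt0.
have [t [t0 td h1 h2]] : exists t, [/\ 0 < t, t < d,
    mol t u x <= kappa R n * c + kappa R n * e / 3 & M * 2 ^+ n * t ^+ 2 <= kappa R n * e / 3].
  near (0 : R)^'+ => t; exists t; split.
  - by near: t; exact: nbhs_right_gt.
  - by near: t; exact: nbhs_right_lt.
  - rewrite -lerBlDl; apply: (le_trans (ler_norm _)); rewrite distrC; near: t.
    by move/cvgrPdist_le : (lebpt_cvg lu lc) => /(_ _ e10).
  - apply: (le_trans (ler_norm _)); near: t.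
    by move/cvgr0Pnorm_le : (cvg_sqr0 (M * 2 ^+ n)) => /(_ _ e10).
have cm : mol t (u_ k) x @[k --> \oo] --> mol t u x.
  have l2r : l2 mu (fun z => rho t (z - x)).
    split; first by apply: measurable_shift; exact: continuous_rho.
    have tr := @test_rho R n t t0.
    have := l1_conv x (test_smoothM (test_smooth tr) tr) (@loc_cst R N 1).
    by congr l1; apply/funext => z; rewrite mulr1 expr2.
  apply: (l2cvg_dot (F := fun _ z => rho t (z - x))) => //.
  - by move=> k; exact: H0_l2 (subsol_H0 (hs k)).
  - exact: H0_l2 hu.
  - exact: l2cvg_cst.
move/cvgrPdist_le : cm => /(_ _ e10); apply: filterS => k.
rewrite ler_distlC => /andP[_ h3].
have := subsol_hat_le M0 (hs k) (dO x bx) (lc_ k); rewrite -/(0 < t < d).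
move=> /(_ t); rewrite t0 td => /(_ isT) h4.
rewrite -(ler_pM2l K0) mulrDr; lra.
Unshelve. all: by end_near. Qed.

End mean_value.
End lebesgue_points.

(** * Splitting *)

Section positive_functionals.
Variables (R : realType) (T : Type).
Implicit Types (A : set T) (L : set (T -> R)) (F : (T -> R) -> R) (f g h : T -> R).

(** The traces left by integration against a measure carried by [A]: a positive linear functional on
    a vector lattice, continuous along sequences that decrease to [0] on [A]. *)
Record positive_functional A L F : Prop := {
  posfD : forall f g, L f -> L g -> L (fun x => f x + g x) /\
    F (fun x => f x + g x) = F f + F g;
  posfZ : forall c f, L f -> L (fun x => c * f x) /\ F (fun x => c * f x) = c * F f;
  posf_max : forall f, L f -> L (fun x => Num.max (f x) 0);
  posf_ge0 : forall f, L f -> (forall x, 0 <= f x) -> 0 <= F f;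
  posf_dini : forall f_ : nat -> T -> R, (forall k, L (f_ k)) -> (forall k x, 0 <= f_ k x) ->
    (forall k x, f_ k.+1 x <= f_ k x) -> (forall x, A x -> f_ k x @[k --> \oo] --> (0 : R)) ->
    F (f_ k) @[k --> \oo] --> (0 : R) }.

Variables (A : set T) (L : set (T -> R)) (F : (T -> R) -> R).

Lemma posfB f g : positive_functional A L F -> L f -> L g ->
  L (fun x => f x - g x) /\ F (fun x => f x - g x) = F f - F g.
Proof.
move=> P Lf Lg; have [Lg' Eg] := posfZ P (-1) Lg.
have [Lh Eh] := posfD P Lf Lg'.
have E : (fun x => f x - g x) = (fun x => f x + -1 * g x).
  by apply/funext => x; rewrite mulN1r.
by rewrite E Eh Eg mulN1r.
Qed.

Lemma posf_le f g : positive_functional A L F -> L f -> L g -> (forall x, f x <= g x) -> F f <= F g.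
Proof.
move=> P Lf Lg fg; have [Lh Eh] := posfB P Lg Lf; rewrite -subr_ge0 -Eh.
by apply: (posf_ge0 P Lh) => x; rewrite subr_ge0.
Qed.

Lemma posf_sum (J : Type) (s : seq J) (f_ : J -> T -> R) : positive_functional A L F ->
  (exists f, L f) -> (forall j, L (f_ j)) ->
  L (fun x => \sum_(j <- s) f_ j x) /\ F (fun x => \sum_(j <- s) f_ j x) = \sum_(j <- s) F (f_ j).
Proof.
move=> P [f0 Lf0] Lf; elim: s => [|j s [IH1 IH2]].
  have [L0 E0] := posfZ P 0 Lf0; rewrite mul0r in E0; rewrite big_nil.
  have E : (fun x => \sum_(j <- [::]) f_ j x) = (fun x => 0 * f0 x).
    by apply/funext => x; rewrite big_nil mul0r.
  by rewrite E.
have E : (fun x => \sum_(j0 <- j :: s) f_ j0 x) = (fun x => f_ j x + \sum_(j0 <- s) f_ j0 x).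
  by apply/funext => x; rewrite big_cons.
by have [h1 h2] := posfD P (Lf j) IH1; rewrite E h2 IH2 big_cons.
Qed.

Lemma sum_half_le1 m : \sum_(i < m) (2^-1 : R) ^+ i.+1 <= 1.
Proof.
suff -> : \sum_(i < m) (2^-1 : R) ^+ i.+1 = 1 - 2^-1 ^+ m by rewrite gerBl exprn_ge0// invr_ge0.
elim: m => [|m IH]; first by rewrite big_ord0 expr0 subrr.
rewrite big_ord_recr /= IH exprS; set q := _ ^+ m; lra.
Qed.

(* Arzela's bounded convergence theorem, by Luxemburg's argument: finite maxima
   nearly realise the suprema of the tails of the sequence, and the minima of
   these maxima decrease to [0]. *)
Lemma posf_bounded_cvg (f_ : nat -> T -> R) b : positive_functional A L F ->
  (forall k, L (f_ k)) -> L b -> (forall k x, 0 <= f_ k x) -> (forall k x, f_ k x <= b x) ->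
  (forall x, A x -> f_ k x @[k --> \oo] --> (0 : R)) -> F (f_ k) @[k --> \oo] --> (0 : R).
Proof.
move=> P Lf Lb f0 fb fc.
have Lmin f g : L f -> L g -> L (fun x => Num.min (f x) (g x)).
  move=> Lf' Lg; rewrite (_ : (fun x => _) = (fun x => f x - Num.max (f x - g x) 0)).
    by have [h _] := posfB P Lf' (posf_max P (posfB P Lf' Lg).1).
  by apply/funext => x; rewrite minE_max0.
have Lmax f g : L f -> L g -> L (fun x => Num.max (f x) (g x)).
  move=> Lf' Lg; rewrite (_ : (fun x => _) = (fun x => Num.max (f x - g x) 0 + g x)).
    by have [h _] := posfD P (posf_max P (posfB P Lf' Lg).1) Lg.
  apply/funext => x; rewrite addr_maxl subrK add0r//.
(* Maxima of [f_ k] up to [f_ (k + m)] stand in for the supremum of the tail, which need not belong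
   to [L]. *)
pose mx k := fix mx m x := if m is p.+1 then Num.max (mx p x) (f_ (k + p.+1)%N x) else f_ k x.
have Lmx k m : L (mx k m) by elim: m => [|m IH] /=; [exact: Lf|exact: Lmax].
have mx_ub k m x (B : R) : (forall j, (k <= j)%N -> f_ j x <= B) -> mx k m x <= B.
  move=> hB; elim: m => [|m IH] /=; first exact: hB.
  by rewrite ge_max IH hB// leq_addr.
have mx_le k m p x : (m <= p)%N -> mx k m x <= mx k p x.
  move=> /subnK <-; elim: (p - m)%N => [|q IH] //=; apply: (le_trans IH).
  by rewrite le_max lexx.
have le_mx k m j x : (k <= j)%N -> (j <= k + m)%N -> f_ j x <= mx k m x.
  move=> kj; rewrite -(subnKC kj) leq_add2l => /(mx_le k (j - k)%N m x).
  apply: le_trans; case: (j - k)%N => [|q] /=; first by rewrite addn0.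
  by rewrite le_max lexx orbT.
have mx_mx k m i p x : (i <= k)%N -> (k + m <= i + p)%N -> mx k m x <= mx i p x.
  move=> ik; elim: m => [|m IH] h /=.
    by apply: le_mx => //; rewrite addn0 in h.
  rewrite ge_max IH ?le_mx// ?(leq_trans ik (leq_addr _ _))//.
  by apply: leq_trans h; rewrite leq_add2l.
have mx_ge0 k m x : 0 <= mx k m x.
  by apply: (le_trans (f0 k x)); apply: le_mx; rewrite ?leq_addr.
apply/cvgr0Pnorm_le => e e0; have e20 : 0 < e / 2 by rewrite divr_gt0.
have hsup k : exists m, forall p, F (mx k p) <= F (mx k m) + e / 2 * 2^-1 ^+ k.+1.
  pose S := [set F (mx k m) | m in [set: nat]].
  have hS : has_sup S.
    split; first by exists (F (mx k 0)), 0%N.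
    exists (F b) => _ [m _ <-]; apply: (posf_le P) => // x; exact: mx_ub.
  have d0 : 0 < e / 2 * 2^-1 ^+ k.+1 by rewrite mulr_gt0// exprn_gt0// invr_gt0.
  have [_ [m _ <-] hm] := sup_adherent d0 hS; exists m => p.
  have h1 : F (mx k p) <= sup S by apply: (sup_upper_bound hS); exists p.
  by rewrite ltrBlDr in hm; exact: le_trans h1 (ltW hm).
pose M k := projT1 (cid (hsup k)); have hM k := projT2 (cid (hsup k)).
pose h k := mx k (M k); have Lh k : L (h k) by exact: Lmx.
(* Adding [h i] to the excess gives the maximum of [h k] and [h i], which lies below a longer
   maximum starting at [i]; by the choice of [M i] its value exceeds [F (h i)] by at most the stated
   slack. *)
have h_close i k : (i <= k)%N ->
    F (fun x => Num.max (h k x - h i x) 0) <= e / 2 * 2^-1 ^+ i.+1.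
  move=> ik; have [Ls Es] := posfD P (posf_max P (posfB P (Lh k) (Lh i)).1) (Lh i).
  rewrite -(lerD2r (F (h i))) -Es addrC.
  pose p := (k + M k + M i - i)%N.
  apply: le_trans (hM i p); apply: (posf_le P) => // x.
  rewrite addr_maxl subrK add0r ge_max; apply/andP; split.
    apply: mx_mx => //; rewrite /p subnKC; first exact: leq_addr.
    by rewrite -addnA (leq_trans ik)// leq_addr.
  apply: mx_le; rewrite /p -(leq_add2l i) subnKC; last first.
    by rewrite -addnA (leq_trans ik)// leq_addr.
  by rewrite leq_add2r (leq_trans ik)// leq_addr.
(* The [h k] tend to [0] on [A] but need not decrease; their running minima do, and [posf_dini]
   applies to them. *)
pose kk := fix kk m x := if m is p.+1 then Num.min (kk p x) (h p.+1 x) else h 0%N x.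
have Lkk m : L (kk m) by elim: m => [|m IH] /=; [exact: Lh|exact: Lmin].
have kk_ge0 m x : 0 <= kk m x.
  by elim: m => [|m IH] /=; rewrite ?le_min ?IH; exact: mx_ge0.
have kk_le m x : kk m x <= h m x by case: m => [|m] //=; rewrite ge_min lexx orbT.
have hc x : A x -> h k x @[k --> \oo] --> (0 : R).
  move=> Ax; apply/cvgr0Pnorm_le => d d0; move/cvgr0Pnorm_le : (fc x Ax) => /(_ _ d0)[J _ hJ].
  exists J => // k /= Jk; rewrite ger0_norm; last exact: mx_ge0.
  apply: mx_ub => j kj; apply: (le_trans (ler_norm _)); apply: hJ => /=; exact: leq_trans kj.
have cF : F (kk m) @[m --> \oo] --> (0 : R).
  apply: (posf_dini P) => //; first by move=> m x /=; rewrite ge_min lexx.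
  move=> x Ax; apply: (@rcvg0_le _ _ _ _ _ (h ^~ x)); last exact: hc.
  by apply: nearW => m; rewrite ger0_norm.
(* For [c = h m], passing to the running minimum costs at most the excesses over the [h i], on which
   [F] sums to at most [e / 2]. *)
have key m (c : T -> R) x : c x <= kk m x + \sum_(i < m.+1) Num.max (c x - h i x) 0.
  elim: m => [|m IH] /=.
    by rewrite big_ord_recl big_ord0 addr0 -lerBlDl le_max lexx.
  rewrite big_ord_recr /= addrA -lerBlDr.
  have [a1|a2] := leP (kk m x) (h m.+1 x).
    by rewrite lerBlDr (le_trans IH)// lerDl le_max lexx orbT.
  apply: (@le_trans _ _ (h m.+1 x)); first by rewrite lerBlDl -lerBlDr le_max lexx.
  by rewrite lerDl sumr_ge0// => i _; rewrite le_max lexx orbT.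
move/cvgr0Pnorm_le : cF => /(_ _ e20); apply: filterS => m hm.
rewrite ger0_norm; last exact: (posf_ge0 P).
have [Ls Es] := posf_sum (f_ := fun i x => Num.max (h m x - h i x) 0) (index_enum 'I_m.+1) P
  (ex_intro _ b Lb) (fun i => posf_max P (posfB P (Lh m) (Lh i)).1).
have [Lt Et] := posfD P (Lkk m) Ls.
apply: (@le_trans _ _ (F (fun x => kk m x + \sum_(i < m.+1) Num.max (h m x - h i x) 0))).
  apply: (posf_le P) => // x; apply: le_trans (key m (h m) x).
  by apply: le_mx; rewrite ?leq_addr.
rewrite Et Es (splitr e) lerD//; first exact: le_trans (ler_norm _) hm.
apply: (@le_trans _ _ (\sum_(i < m.+1) (e / 2 * 2^-1 ^+ i.+1))).
  by apply: ler_sum => i _; apply: h_close; rewrite -ltnS.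
by rewrite -mulr_sumr ler_piMr ?(ltW e20)// sum_half_le1.
Qed.

End positive_functionals.

Section dini.
Variables (R : realType) (n : nat).
Local Notation E := 'rV[R]_n.

Lemma dini (K : set E) (f_ : nat -> E -> R) (e : R) : compact K ->
  (forall k, continuous (f_ k)) -> (forall k x, f_ k.+1 x <= f_ k x) ->
  (forall x, K x -> f_ k x @[k --> \oo] --> (0 : R)) -> 0 < e ->
  \forall k \near \oo, forall x, K x -> f_ k x <= e.
Proof.
move=> cK cf df fc e0.
have dle k m x : (k <= m)%N -> f_ m x <= f_ k x.
  by move=> /subnK <-; elim: (m - k)%N => [|q IH]//=; rewrite addSn (le_trans (df _ _)).
apply: (compact_near_coveringP K).1 => // x Kx.
have e20 : 0 < e / 2 by rewrite divr_gt0.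
move/cvgr0Pnorm_le : (fc x Kx) => /(_ _ e20)[m _ hm].
have := cf m x; move/cvgrPdist_le => /(_ _ e20) hx.
exists ([set y | `|f_ m x - f_ m y| <= e / 2], [set k | (m <= k)%N]).
  by split => //; exists m.
move=> [y k] [/= hy mk]; apply: (le_trans (dle _ _ y mk)).
have := hm m (leqnn m); move/(le_trans (ler_norm _)) => h1.
by move: hy; rewrite ler_distlC => /andP[_ h2]; lra.
Qed.

End dini.

(** * The functional [M + Delta u] and minimisation below a subsolution *)

Section splitting.
Variables (R : realType) (n : nat) (D : bdomain R n.+1).
Local Notation O := (dom D).
Local Notation mu := (lebesgue R n.+1).
Local Notation E := 'rV[R]_n.+1.
Local Notation test := (test_function O).
Local Notation H0 := (H0 D).
Implicit Types (phi f u v w p r : E -> R) (g G : 'I_n.+1 -> E -> R) (i : 'I_n.+1).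

Definition pw u (h : E -> R) := forall x, O x -> lebpt u x (h x).

Lemma subsol_pw (M : R) u g : 0 <= M -> subsol D M u g -> exists h, pw u h.
Proof.
move=> M0 hu.
have H x : exists c : R, O x -> lebpt u x c.
  have [Ox|nO] := pselect (O x); last by exists 0.
  by have [c hc] := subsol_lebpt M0 hu Ox; exists c.
by exists (fun x => projT1 (cid (H x))) => x Ox; exact: (projT2 (cid (H x))).
Qed.

Lemma H0_loc u g : H0 u g -> loc u.
Proof. by move=> hu; exact: loc_l1 (H0_l1 hu). Qed.

(* By [H0] the gradient is determined almost everywhere, hence so is the value below. *)
Definition defect (M : R) G v : R :=
  xget 0 [set c | exists g, H0 v g /\ c = M * \int[mu]_x v x - dot G g].

Lemma defectE M G v g : l2v G -> H0 v g -> defect M G v = M * \int[mu]_x v x - dot G g.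
Proof.
move=> hG hv; rewrite /defect; case: xgetP => [c -> [g' [hv' ->]]|]; last first.
  by move/(_ (M * \int[mu]_x v x - dot G g)) => []; exists g.
congr (_ - _); apply: dot_ae_eq; [exact: hG|exact: H0_l2v hv'|exact: H0_l2v hv|].
by move=> i; apply: (H0_unique i hv' hv); exact: aeW.
Qed.

Lemma defectD M G u v g g' : l2v G -> H0 u g -> H0 v g' ->
  defect M G (fun x => u x + v x) = defect M G u + defect M G v.
Proof.
move=> hG hu hv; rewrite (defectE M hG (H0D hu hv)) (defectE M hG hu) (defectE M hG hv).
rewrite (integrD (H0_l1 hu) (H0_l1 hv)) (dotDr hG (H0_l2v hu) (H0_l2v hv)); ring.
Qed.

Lemma defectZ M G (c : R) u g : l2v G -> H0 u g ->
  defect M G (fun x => c * u x) = c * defect M G u.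
Proof.
move=> hG hu; rewrite (defectE M hG (H0Z c hu)) (defectE M hG hu).
rewrite integrZ; last exact: H0_l1 hu.
rewrite dotZr//; [ring|exact: H0_l2v hu].
Qed.

Lemma defect_cvg M G (u_ : nat -> E -> R) (g_ : nat -> 'I_n.+1 -> E -> R) u g : l2v G ->
  (forall k, H0 (u_ k) (g_ k)) -> H0 u g -> H0cvg u_ g_ u g ->
  defect M G (u_ k) @[k --> \oo] --> defect M G u.
Proof.
move=> hG hk hu hc; rewrite (defectE M hG hu).
under eq_fun => k do rewrite (defectE M hG (hk k)).
apply: (rcvgB (rcvgZ (H0cvg_integr hk hu hc) (erefl _)) _ (erefl _)).
apply: (dot_cvg (g_ := fun=> G)) => //.
- by move=> k; exact: H0_l2v (hk k).
- exact: H0_l2v hu.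
- by move=> i; exact: l2cvg_cst.
- by case: hc.
Qed.

Lemma defect_ge0 M u g v h : subsol D M u g -> H0 v h -> {ae mu, forall x, 0 <= v x} ->
  0 <= defect M g v.
Proof.
move=> hu hv v0; rewrite (defectE M (H0_l2v (subsol_H0 hu)) hv) subr_ge0.
exact: (subsol_ext hu hv v0).
Qed.

(** A mollification spreads beyond [O]; the cut-off [chi] makes it a test function, at the price of
    the term with [partial i chi]. *)
Lemma H0cvg_mol_cutoff chi u g : test chi -> H0 u g ->
  H0 (fun x => chi x * (kappa R n * u x))
     (fun i x => chi x * (kappa R n * g i x) + partial i chi x * (kappa R n * u x)) /\
  H0cvg (fun k x => chi x * mol (tau R k) u x)
    (fun k i => partial i (fun x => chi x * mol (tau R k) u x))
    (fun x => chi x * (kappa R n * u x))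
    (fun i x => chi x * (kappa R n * g i x) + partial i chi x * (kappa R n * u x)).
Proof.
move=> tchi hu; split; first exact: H0_mul tchi (H0Z _ hu).
have u2 := H0_l2 hu; have u1 := H0_l1 hu.
have g1 i : l1 mu (g i).
  by have [_ g2 gO _] := hu; apply: (@l1_of_l2 _ _ D) => // x /gO[].
have bM (psi v : E -> R) : test psi -> l2 mu v -> l1 mu v ->
    l2cvg mu (fun k => mol (tau R k) v) (fun x => kappa R n * v x) ->
    (forall k, l2 mu (fun x => psi x * mol (tau R k) v x)) /\
    l2cvg mu (fun k x => psi x * mol (tau R k) v x) (fun x => psi x * (kappa R n * v x)).
  move=> tpsi v2 v1 cv; have [C C0 hC] := test_bounded tpsi.
  have m2 k : l2 mu (mol (tau R k) v) by have [] := mol_l2 (tau_gt0 R k) v1 v2.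
  split=> [k|]; first exact: (l2_bM (test_meas tpsi) hC).
  apply: (@l2cvg_bM _ _ _ mu (fun=> psi) _ psi _ C) => //.
  - by move=> _; exact: test_meas tpsi.
  - exact: test_meas tpsi.
  - by apply: aeW => x _; exact: cvg_cst.
  - exact: l2Z.
split=> [|i]; first exact: (bM _ _ tchi u2 u1 (mol_l2cvg_H0 hu)).2.
have [a1 a2] := bM _ _ tchi (H0_l2g i hu) (g1 i) (mol_l2cvg_H0g i hu).
have [b1 b2] := bM _ _ (test_partial i tchi) u2 u1 (mol_l2cvg_H0 hu).
have [C C0 hC] := test_bounded tchi; have [C' C'0 hC'] := test_bounded (test_partial i tchi).
rewrite (_ : (fun k => partial i _) = (fun k x =>
  chi x * mol (tau R k) (g i) x + partial i chi x * mol (tau R k) u x)); last first.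
  apply/funext => k; apply: partialE => x.
  apply: (is_derM (smooth_derive i x (test_smooth tchi)) (is_derive_mol_H0 x i (tau_gt0 R k) hu)).
  by rewrite (mulrC (mol _ _ _)).
exact: (l2cvgD a1 b1 (l2_bM (test_meas tchi) hC (l2Z (kappa R n) (H0_l2g i hu)))
  (l2_bM (test_meas (test_partial i tchi)) hC' (l2Z (kappa R n) u2)) a2 b2).
Qed.

Lemma continuous_max0 f : continuous f -> continuous (fun x => Num.max (f x) 0).
Proof.
move=> cf x; have c0 : continuous (fun s : R => Num.max s 0).
  move=> s; apply/cvgrPdist_le => e e0; have : \forall t \near s, `|s - t| <= e.
    by exists e => //= t /ltW.
  by apply: filterS => t; exact: le_trans (max0_lip _ _).
exact: (continuous_comp (cf x) (c0 (f x))).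
Qed.

(** The Dini property comes from the compact support of [chi]: on it the convergence is uniform by
    [dini], so [chi * f_ k] is eventually at most [e' * chi], and the defect is monotone. *)
Lemma defect_positive M u g chi : subsol D M u g -> test chi -> (forall x, 0 <= chi x) ->
  positive_functional O [set f | continuous f /\ exists h, H0 (fun x => chi x * f x) h]
    (fun f => defect M g (fun x => chi x * f x)).
Proof.
move=> hu tchi chi0; have hg := H0_l2v (subsol_H0 hu).
have hchi := H0_test tchi.
have chi_ge0 : 0 <= defect M g chi by apply: (defect_ge0 hu hchi); exact: aeW.
have [_ [K [cK KO chiK]]] := tchi.
split.
- move=> f f' [cf [h hf]] [cf' [h' hf']].
  have E1 : (fun x => chi x * (f x + f' x)) = (fun x => chi x * f x + chi x * f' x).
    by apply/funext => x; rewrite mulrDr.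
  rewrite E1 (defectD M hg hf hf'); split => //; split.
    by move=> x; exact: (rcvgD (cf x) (cf' x) (erefl _)).
  by rewrite E1; exists (fun i x => h i x + h' i x); exact: H0D.
- move=> c f [cf [h hf]].
  have E1 : (fun x => chi x * (c * f x)) = (fun x => c * (chi x * f x)).
    by apply/funext => x; rewrite mulrCA.
  rewrite E1 (defectZ M c hg hf); split => //; split.
    by move=> x; exact: (rcvgZ (cf x) (erefl _)).
  by rewrite E1; exists (fun i x => c * h i x); exact: H0Z.
- move=> f [cf [h hf]]; split; first exact: continuous_max0.
  rewrite (_ : (fun x => _) = (fun x => Num.max (chi x * f x) 0)).
    by have [hm _] := H0_pos hf; exists (fun i x => (0 < chi x * f x)%R%:R * h i x).
  by apply/funext => x; rewrite maxr_pMr// mulr0.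
- move=> f [cf [h hf]] f0; apply: (defect_ge0 hu hf).
  by apply: aeW => x; rewrite mulr_ge0.
- move=> f_ Lf f0 df fc; apply/cvgr0Pnorm_le => e e0.
  have c0 : 0 < defect M g chi + 1 by rewrite ltr_wpDl.
  pose e' := e / (defect M g chi + 1); have e'0 : 0 < e' by exact: divr_gt0.
  have := @dini _ _ K f_ e' cK (fun k => (Lf k).1) df (fun x Kx => fc x (KO x Kx)) e'0.
  apply: filterS => k hk; have [_ [h hf]] := Lf k.
  rewrite ger0_norm; last by apply: (defect_ge0 hu hf); apply: aeW => x; rewrite mulr_ge0.
  have hd := H0B (H0Z e' hchi) hf.
  have : 0 <= defect M g (fun x => e' * chi x + -1 * (chi x * f_ k x)).
    apply: (defect_ge0 hu (H0D (H0Z e' hchi) (H0Z (-1) hf))); apply: aeW => x.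
    have [Kx|nK] := pselect (K x); last by rewrite (chiK x nK) mulr0 mul0r mulr0 addr0.
    by rewrite mulN1r subr_ge0 (mulrC e') ler_wpM2l// hk.
  rewrite (defectD M hg (H0Z e' hchi) (H0Z (-1) hf)) (defectZ M _ hg hchi) (defectZ M _ hg hf).
  rewrite mulN1r subr_ge0 => h1; apply: (le_trans h1).
  have : e' * (defect M g chi + 1) = e by rewrite /e' divfK// gt_eqF.
  by rewrite mulrDr mulr1; lra.
Qed.

(** The cut-offs are made from [r] itself: for test functions [p] tending to [r],
    [step_approx e p * r] tends to [pospart_approx e r], and then [e] tends to [0]. The bound on [r]
    controls the term in which the derivative falls on the cut-off. *)
Lemma defect_cutoff M G r gr : l2v G -> H0 r gr -> (forall x, 0 <= r x) ->
  (exists C : R, forall x, r x <= C) ->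
  (forall chi, test chi -> (forall x, 0 <= chi x) -> defect M G (fun x => chi x * r x) = 0) ->
  defect M G r = 0.
Proof.
move=> hG hr r0 [C hC] H.
have step0 (e : R) : 0 < e -> defect M G (pospart_approx e \o r) = 0.
  move=> e0; have [r2 gr2 rO [p tp cp]] := hr.
  have [s ks cs] := H0_chain_cvg (@chain_step R n e) (@continuous_dstep R e)
    (fun t => dstep_norm t e0) hr tp cp.
  pose q k := step_approx e \o p (s k).
  have tq k : test (q k) := test_chain (@chain_step R n e) (tp (s k)).
  have hq := H0_step e0 hr.
  have [cq cqg] := cs.
  have [s2 ks2 ae2] := l2cvg_ae (fun k => test_l2 (tq k)) (H0_l2 hq) cq.
  have rC x : `|r x| <= C by rewrite ger0_norm.
  pose gl i x := step_approx e (r x) * gr i x + r x * (dstep_approx e (r x) * gr i x).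
  have hqk k : H0 (fun x => q (s2 k) x * r x)
      (fun i x => q (s2 k) x * gr i x + partial i (q (s2 k)) x * r x) := H0_mul (tq _) hr.
  have mr := H0_meas hr; have ms : measurable_fun setT (step_approx e \o r) by exact: measurable_step.
  have l2a i : l2 mu (fun x => step_approx e (r x) * gr i x).
    by apply: (@l2_bM _ _ _ mu (step_approx e \o r) (gr i) 1) => // x; exact: step_norm.
  have l2b i : l2 mu (fun x => r x * (dstep_approx e (r x) * gr i x)).
    by apply: (l2_bM mr rC); exact: H0_l2g hq.
  have l2c : l2 mu (fun x => step_approx e (r x) * r x).
    by apply: (@l2_bM _ _ _ mu (step_approx e \o r) r 1) => // x; exact: step_norm.
  have cvg1 : H0cvg (fun k x => q (s2 k) x * r x)
      (fun k i x => q (s2 k) x * gr i x + partial i (q (s2 k)) x * r x)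
      (fun x => step_approx e (r x) * r x) gl.
    split=> [|i].
      apply: (@l2cvg_bM _ _ _ mu (fun k => q (s2 k)) (fun=> r) (step_approx e \o r) r 1) => //.
      - by move=> k; exact: test_meas (tq _).
      - by move=> k x; exact: step_norm.
      - by move=> x; exact: step_norm.
      - by apply: filterS ae2 => x h _; exact: h.
      - exact: l2cvg_cst.
    apply: l2cvgD => //.
    - move=> k; apply: (@l2_bM _ _ _ mu (q (s2 k)) (gr i) 1) => //.
        exact: test_meas (tq _).
      by move=> x; exact: step_norm.
    - move=> k; under eq_fun do rewrite mulrC.
      by apply: (l2_bM mr rC); exact: test_l2 (test_partial i (tq _)).
    - apply: (@l2cvg_bM _ _ _ mu (fun k => q (s2 k)) (fun=> gr i) (step_approx e \o r) (gr i) 1) => //.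
      + by move=> k; exact: test_meas (tq _).
      + by move=> k x; exact: step_norm.
      + by move=> x; exact: step_norm.
      + by apply: filterS ae2 => x h _; exact: h.
      + exact: l2cvg_cst.
    - rewrite (_ : (fun k x => _) = (fun k x => r x * partial i (q (s2 k)) x)); last first.
        by apply/funext => k; apply/funext => x; rewrite mulrC.
      apply: (@l2cvg_bM _ _ _ mu (fun=> r) (fun k => partial i (q (s2 k))) r _ C) => //.
      + by apply: aeW => x _; exact: cvg_cst.
      + by move=> k; exact: test_l2 (test_partial i (tq _)).
      + exact: H0_l2g hq.
      + exact: l2cvg_sub ks2 (cqg i).
  have hl : H0 (fun x => step_approx e (r x) * r x) gl.
    apply: (H0_lim hqk) => //.
      by move=> i; exact: l2D.
    by move=> x /rO[rx gx]; rewrite /gl rx mulr0; split => // i; rewrite gx !(mulr0, mul0r) addr0.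
  have : defect M G (fun x => q (s2 k) x * r x) @[k --> \oo] -->
      defect M G (fun x => step_approx e (r x) * r x).
    exact: (@defect_cvg M G (fun k x => q (s2 k) x * r x) _ _ _ hG hqk hl cvg1).
  under eq_fun => k do rewrite (H _ (tq (s2 k)) (fun x => step_ge0 _ _)).
  move=> h; rewrite (_ : pospart_approx e \o r = (fun x => step_approx e (r x) * r x)); last first.
    by apply/funext => x; rewrite /= /pospart_approx mulrC.
  exact: (cvg_unique (@norm_hausdorff _ _) h (cvg_cst _)).
have [hp cp] := H0_pos hr.
have hk k := @H0_pospart_approx _ _ D r gr _ (tau_gt0 R k) hr.
have Er : (fun x => Num.max (r x) 0) = r by apply/funext => x; apply/max_idPl.
have : defect M G (pospart_approx (tau R k) \o r) @[k --> \oo] --> defect M G r.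
  rewrite -[X in _ --> defect M G X]Er.
  exact: (@defect_cvg M G (fun k => pospart_approx (tau R k) \o r) _ _ _ hG hk hp cp).
under eq_fun => k do rewrite (step0 _ (tau_gt0 R k)).
by move=> h; exact: (cvg_unique (@norm_hausdorff _ _) h (cvg_cst _)).
Qed.

(* The analogue of the statement that the measure [M + Delta u] does not charge
   sets of zero capacity. *)
Lemma defect_quasi M u g r gr zeta gz (hr hz : E -> R) : 0 <= M -> subsol D M u g ->
  H0 r gr -> (forall x, 0 <= r x) -> (exists C : R, forall x, r x <= C) ->
  H0 zeta gz -> (forall x, 0 <= zeta x) -> pw r hr -> pw zeta hz ->
  (forall x, O x -> hz x = 0 -> hr x = 0) ->
  defect M g (fun x => Num.min (zeta x) (r x)) <= 0 -> defect M g r = 0.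
Proof.
move=> M0 hu hr0 r0 [C rC] hzeta z0 pr pz zr Lp0.
have hg := H0_l2v (subsol_H0 hu).
apply: (defect_cutoff hg hr0 r0); first by exists C.
move=> chi tchi chi0; have hchi := H0_mul tchi hr0.
have K0 := kappa_gt0 R n.
pose p x := Num.min (zeta x) (r x).
have [gp hp] : exists gp, H0 p gp by eexists; exact: H0_min hzeta hr0.
rewrite -/p in Lp0.
have p0 x : 0 <= p x by rewrite le_min z0 r0.
pose hatp x := Num.min (hz x) (hr x).
have pp : pw p hatp.
  move=> x Ox; apply: lebpt_min; [exact: H0_loc hzeta|exact: H0_loc hr0|exact: pz|exact: pr].
(* Both [chi * p] and [A * p - chi * p] are nonnegative, and their defects add up to [A] times a
   nonpositive number. *)
have chip : defect M g (fun x => chi x * p x) = 0.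
  have [A A0 hA] := test_bounded tchi; have hcp := H0_mul tchi hp.
  have h1 : 0 <= defect M g (fun x => chi x * p x).
    by apply: (defect_ge0 hu hcp); apply: aeW => x; rewrite mulr_ge0.
  have : 0 <= defect M g (fun x => A * p x + -1 * (chi x * p x)).
    apply: (defect_ge0 hu (H0D (H0Z A hp) (H0Z (-1) hcp))); apply: aeW => x.
    by rewrite mulN1r subr_ge0 ler_wpM2r// (le_trans (ler_norm _)).
  rewrite (defectD M hg (H0Z A hp) (H0Z (-1) hcp)) (defectZ M _ hg hp) (defectZ M _ hg hcp).
  have := ler_wpM2l (ltW A0) Lp0; rewrite mulr0; lra.
have P := defect_positive hu tchi chi0.
set L := [set _ | _] in P; set F := (fun f => _) in P.
pose a k := mol (tau R k) p; pose b k := mol (tau R k) r.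
have smol k v gv : H0 v gv -> smooth (mol (tau R k) v).
  by move=> hv; apply: smooth_mol; [exact: tau_gt0|exact: H0_l1 hv].
have Lmol k v gv : H0 v gv -> L (mol (tau R k) v).
  move=> hv; split; first exact: smooth_cont (smol k _ _ hv).
  exists (fun i => partial i (fun x => chi x * mol (tau R k) v x)); apply: H0_test.
  by under eq_fun do rewrite mulrC; apply: test_smoothM => //; exact: smol hv.
have Fmol v gv : H0 v gv -> F (mol (tau R k) v) @[k --> \oo] --> kappa R n * F v.
  move=> hv; have [h1 h2] := H0cvg_mol_cutoff tchi hv.
  have -> : kappa R n * F v = defect M g (fun x => chi x * (kappa R n * v x)).
    rewrite /F -(defectZ M _ hg (H0_mul tchi hv)); congr defect.
    by apply/funext => x; rewrite mulrCA.
  apply: (@defect_cvg M g (fun k x => chi x * mol (tau R k) v x) _ _ _ hg _ h1 h2) => k.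
  apply: H0_test.
  by under eq_fun do rewrite mulrC; apply: test_smoothM => //; exact: smol hv.
have a0 k x : 0 <= a k x by apply: mol_ge0 => //; exact: tau_gt0.
have b0 k x : 0 <= b k x by apply: mol_ge0 => //; exact: tau_gt0.
have Fa0 k : 0 <= F (a k) by apply: (posf_ge0 P) => //; exact: Lmol hp.
have Fa : F (a k) @[k --> \oo] --> (0 : R).
  by have := Fmol _ _ hp; rewrite /F chip mulr0.
have sq0 : Num.sqrt (F (a k)) @[k --> \oo] --> (0 : R).
  by rewrite -(sqrtr0 R); exact: (continuous_cvg _ (@sqrt_continuous R 0) Fa).
(* [d] tends to [0] slowly enough for [F (a k) / d k] to tend to [0] as well; [tau] keeps it
   positive. *)
pose d k := Num.sqrt (F (a k)) + tau R k.
have d0 k : 0 < d k by rewrite ltr_wpDl ?sqrtr_ge0 ?tau_gt0.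
have dc : d k @[k --> \oo] --> (0 : R).
  by apply: (rcvgD sq0 (@cvg_harmonicS R)); rewrite addr0.
(* [b k] is at most [rho_ k + a k / d k]. At every point of [O], [rho_ k] tends to [0]: it is below
   [b k] where [hr] vanishes, and where [hr] is positive so are [hz] and [hatp], so [a k / d k]
   overtakes [b k]. *)
pose rho_ k x := Num.max (b k x - (d k)^-1 * a k x) 0.
have Lrho0 k : L (fun x => b k x - (d k)^-1 * a k x) /\
    F (fun x => b k x - (d k)^-1 * a k x) = F (b k) - (d k)^-1 * F (a k).
  have [h1 <-] := posfZ P (d k)^-1 (Lmol k _ _ hp).
  exact: posfB P (Lmol k _ _ hr0) h1.
have Lrho k : L (rho_ k) := posf_max P (Lrho0 k).1.
have Lcst : L (fun=> kappa R n * C).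
  split; first exact: (Ck_cont (@Ck_cst R n.+1 0 (kappa R n * C))).
  exists (fun i => partial i (fun x => chi x * (kappa R n * C))); apply: H0_test.
  by under eq_fun do rewrite mulrC; exact: testZ.
have rho_le k x : rho_ k x <= b k x by rewrite ge_max b0 andbT gerBl mulr_ge0// invr_ge0 ltW.
have rho_ub k x : rho_ k x <= kappa R n * C.
  apply: (le_trans (rho_le k x)); rewrite -(mol_cst C x (tau_gt0 R k)).
  apply: mol_ae_le; [exact: tau_gt0|exact: H0_loc hr0|exact: loc_cst|exact: aeW].
have crho x : O x -> rho_ k x @[k --> \oo] --> (0 : R).
  move=> Ox; have cb := lebpt_cvg_tau (H0_loc hr0) (pr x Ox).
  have ca := lebpt_cvg_tau (H0_loc hp) (pp x Ox).
  have hr_ge0 : 0 <= hr x.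
    exact: (lebpt_le (@loc_cst _ _ 0) (H0_loc hr0) (aeW _ r0) (@lebpt_cst _ _ 0 x) (pr x Ox)).
  have hz_ge0 : 0 <= hz x.
    exact: (lebpt_le (@loc_cst _ _ 0) (H0_loc hzeta) (aeW _ z0) (@lebpt_cst _ _ 0 x) (pz x Ox)).
  have [hr00|hrn0] := eqVneq (hr x) 0.
    apply: (@rcvg0_le _ _ _ _ _ (fun k => b k x)); last by rewrite hr00 mulr0 in cb.
    by apply: nearW => k; rewrite ger0_norm// le_max lexx orbT.
  have hp_gt0 : 0 < hatp x.
    rewrite lt_min !lt0r hr_ge0 hz_ge0 hrn0 !andbT.
    by apply/eqP => /(zr x Ox)/eqP; rewrite (negbTE hrn0).
  have ka0 : 0 < kappa R n * hatp x by rewrite mulr_gt0.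
  apply: cvg_near_cst.
  have /cvgrPdist_le/(_ _ (divr_gt0 ka0 (ltr0n _ 2))) na := ca.
  have /cvgrPdist_le/(_ _ (@ltr01 R)) nb := cb.
  pose B := kappa R n * hr x + 1; have B0 : 0 < B by rewrite ltr_wpDl// mulr_ge0// ltW.
  have /cvgr0Pnorm_le/(_ _ (divr_gt0 (divr_gt0 ka0 (ltr0n _ 2)) B0)) nd := dc.
  apply: filterS3 na nb nd => k.
  rewrite !ler_distlC => /andP[h1 _] /andP[_ h2]; rewrite ger0_norm ?(ltW (d0 k))// => h3.
  rewrite /rho_; apply/max_idPr; rewrite subr_le0.
  apply: (le_trans h2); rewrite ler_pdivlMl//.
  rewrite ler_pdivlMr// in h3; apply: (le_trans h3); apply: le_trans h1; lra.
have c1 := posf_bounded_cvg P Lrho Lcst (fun k x => ltac:(by rewrite le_max lexx orbT)) rho_ub crho.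
have c2 : (d k)^-1 * F (a k) @[k --> \oo] --> (0 : R).
  apply: (@rcvg0_le _ _ _ _ _ (fun k => Num.sqrt (F (a k)))) => //.
  apply: nearW => k; rewrite ger0_norm ?mulr_ge0 ?invr_ge0 ?(ltW (d0 k))//.
  rewrite ler_pdivrMl// -{1}(sqr_sqrtr (Fa0 k)) expr2 ler_wpM2r ?sqrtr_ge0// lerDl.
  exact: ltW (tau_gt0 R k).
have le0 : kappa R n * F r <= 0.
  have c3 : F (rho_ k) + (d k)^-1 * F (a k) @[k --> \oo] --> (0 : R).
    exact: (rcvgD c1 c2 (addr0 _)).
  apply: (ler_cvg_to (Fmol _ _ hr0) c3); apply: nearW => k.
  rewrite -lerBlDr -(Lrho0 k).2; apply: (posf_le P) => //; first exact: (Lrho0 k).1.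
  by move=> x; rewrite le_max lexx.
apply: le_anti; rewrite (defect_ge0 hu hchi) ?andbT; last by apply: aeW => x; rewrite mulr_ge0.
by move: le0; rewrite /F pmulr_rle0.
Qed.

Lemma dot_lin (a b : R) g G : l2v g -> l2v G ->
  dot (fun i x => a * g i x + b * G i x) (fun i x => a * g i x + b * G i x) =
  a ^+ 2 * dot g g + 2 * a * b * dot g G + b ^+ 2 * dot G G.
Proof.
move=> hg hG; have ha : l2v (fun i x => a * g i x) by move=> i; exact: l2Z.
have hb : l2v (fun i x => b * G i x) by move=> i; exact: l2Z.
have hab : l2v (fun i x => a * g i x + b * G i x) by move=> i; exact: l2D.
rewrite dotDr// !dotZr// !(dotC (fun i x => a * g i x + b * G i x)) !dotDr// !dotZr//.
rewrite (dotC G g); ring.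
Qed.

Lemma ge0_of_small (a b : R) : 0 <= b -> (forall t : R, 0 < t -> t <= 1 -> 0 <= a + t * b) -> 0 <= a.
Proof.
move=> b0 H; rewrite leNgt; apply/negP => a0; have ba : 0 < b - a by lra.
have := H (- a / (b - a)); rewrite divr_gt0 ?oppr_gt0// ler_pdivrMr// mul1r lerDr.
move=> /(_ isT b0); rewrite -(ler_pM2r ba) mul0r mulrDl mulrAC divfK ?gt_eqF//.
by rewrite (_ : _ + _ = - (a * a)); [rewrite oppr_ge0 leNgt nmulr_rgt0// a0|ring].
Qed.

Lemma H0cvgD (u_ v_ : nat -> E -> R) (g_ h_ : nat -> 'I_n.+1 -> E -> R) u v g h :
  (forall k, H0 (u_ k) (g_ k)) -> (forall k, H0 (v_ k) (h_ k)) -> H0 u g -> H0 v h ->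
  H0cvg u_ g_ u g -> H0cvg v_ h_ v h ->
  H0cvg (fun k x => u_ k x + v_ k x) (fun k i x => g_ k i x + h_ k i x)
    (fun x => u x + v x) (fun i x => g i x + h i x).
Proof.
move=> hu_ hv_ hu hv [cu cg] [cv ch]; split=> [|i].
  by apply: l2cvgD => //; [move=> k; exact: H0_l2 (hu_ k)|move=> k; exact: H0_l2 (hv_ k)|
    exact: H0_l2 hu|exact: H0_l2 hv].
by apply: l2cvgD => //; [move=> k; exact: H0_l2g (hu_ k)|move=> k; exact: H0_l2g (hv_ k)|
  exact: H0_l2g hu|exact: H0_l2g hv].
Qed.

Lemma H0cvgZ (c : R) (u_ : nat -> E -> R) (g_ : nat -> 'I_n.+1 -> E -> R) u g :
  (forall k, H0 (u_ k) (g_ k)) -> H0 u g -> H0cvg u_ g_ u g ->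
  H0cvg (fun k x => c * u_ k x) (fun k i x => c * g_ k i x)
    (fun x => c * u x) (fun i x => c * g i x).
Proof.
move=> hu_ hu [cu cg]; split=> [|i].
  by apply: l2cvgZ => //; [move=> k; exact: H0_l2 (hu_ k)|exact: H0_l2 hu].
by apply: l2cvgZ => //; [move=> k; exact: H0_l2g (hu_ k)|exact: H0_l2g hu].
Qed.

Lemma H0cvg_cst u g : H0cvg (fun=> u) (fun=> g) u g.
Proof. by split=> [|i]; exact: l2cvg_cst. Qed.

Lemma H0cvg_sub (u_ : nat -> E -> R) (g_ : nat -> 'I_n.+1 -> E -> R) u g (s : nat -> nat) :
  (forall k, (k <= s k)%N) -> H0cvg u_ g_ u g ->
  H0cvg (fun k => u_ (s k)) (fun k => g_ (s k)) u g.
Proof. by move=> ks [cu cg]; split=> [|i]; [exact: l2cvg_sub ks cu|exact: l2cvg_sub ks (cg i)]. Qed.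

(** The constant [c] may depend on [v]. This makes the class convex without making it closed. *)
Definition dominated w zeta v g := [/\ H0 v g, forall x, 0 <= v x, forall x, v x <= w x &
  exists2 c : R, 0 <= c & forall x, v x <= c * zeta x].

Definition energy (M : R) v g := dot g g - 2 * M * \int[mu]_x v x.

Lemma energy_cvg M (u_ : nat -> E -> R) (g_ : nat -> 'I_n.+1 -> E -> R) u g :
  (forall k, H0 (u_ k) (g_ k)) -> H0 u g -> H0cvg u_ g_ u g ->
  energy M (u_ k) (g_ k) @[k --> \oo] --> energy M u g.
Proof.
move=> hu_ hu cu; apply: (rcvgB _ (rcvgZ (H0cvg_integr hu_ hu cu) (erefl _)) (erefl _)).
apply: dot_cvg; [by move=> k; exact: H0_l2v (hu_ k)|by move=> k; exact: H0_l2v (hu_ k)|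
  exact: H0_l2v hu|exact: H0_l2v hu|exact: cu.2|exact: cu.2].
Qed.

Lemma energy_lin M (a b : R) u v g h : H0 u g -> H0 v h ->
  energy M (fun x => a * u x + b * v x) (fun i x => a * g i x + b * h i x) =
  a ^+ 2 * dot g g + 2 * a * b * dot g h + b ^+ 2 * dot h h
  - 2 * M * (a * \int[mu]_x u x + b * \int[mu]_x v x).
Proof.
move=> hu hv; rewrite /energy (dot_lin a b (H0_l2v hu) (H0_l2v hv)).
rewrite (integrD (H0_l1 (H0Z a hu)) (H0_l1 (H0Z b hv))).
by rewrite (integrZ a (H0_l1 hu)) (integrZ b (H0_l1 hv)).
Qed.

Lemma dominated_convex w zeta (a b : R) u v g h : 0 <= a -> 0 <= b -> a + b = 1 ->
  dominated w zeta u g -> dominated w zeta v h ->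
  dominated w zeta (fun x => a * u x + b * v x) (fun i x => a * g i x + b * h i x).
Proof.
move=> a0 b0 ab [hu u0 uw [c c0 uc]] [hv v0 vw [d d0 vd]]; split.
- exact: H0D (H0Z a hu) (H0Z b hv).
- by move=> x; rewrite addr_ge0// mulr_ge0.
- by move=> x; rewrite -[leRHS]mul1r -ab mulrDl lerD// ler_wpM2l.
- exists (a * c + b * d); first by rewrite addr_ge0// mulr_ge0.
  by move=> x; rewrite mulrDl -!mulrA lerD// ler_wpM2l.
Qed.

(** Midpoints of dominated functions are dominated, so the parallelogram identity makes a minimising
    sequence Cauchy. As the limit may leave the class, its variational inequality is stated against
    all limits [v] of dominated functions. *)
Lemma exists_minimiser (M : R) w g zeta : 0 <= M -> H0 w g -> (forall x, 0 <= w x) ->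
  exists (v_ : nat -> E -> R) (g_ : nat -> 'I_n.+1 -> E -> R) u gu,
  [/\ forall k, dominated w zeta (v_ k) (g_ k), H0cvg v_ g_ u gu,
      H0 u gu /\ (forall x, 0 <= u x <= w x) &
      forall (p_ : nat -> E -> R) (h_ : nat -> 'I_n.+1 -> E -> R) v h,
        (forall k, dominated w zeta (p_ k) (h_ k)) -> H0 v h -> H0cvg p_ h_ v h ->
        defect M gu (fun x => v x - u x) <= 0].
Proof.
move=> M0 hw w0; have hw_l1 := H0_l1 hw.
pose S := [set r | exists v h, dominated w zeta v h /\ r = energy M v h].
have hS : has_inf S.
  split.
    exists (energy M (fun=> 0) (fun _ _ => 0)), (fun=> 0), (fun _ _ => 0); split => //.
    split => //; first exact: H00.
    by exists 0 => // x; rewrite mul0r.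
  exists (- (2 * M * \int[mu]_x w x)) => _ [v [h [[hv v0 vw _] ->]]].
  have := dot_ge0 h; have : \int[mu]_x v x <= \int[mu]_x w x.
    by apply: integr_le => //; [exact: H0_l1 hv|exact: aeW].
  by move/(ler_wpM2l M0) => h1 h2; rewrite /energy; lra.
have infS v h : dominated w zeta v h -> inf S <= energy M v h.
  by move=> hd; apply: (inf_lbound hS.2); exists v, h.
have H k : exists vh : (E -> R) * ('I_n.+1 -> E -> R),
    dominated w zeta vh.1 vh.2 /\ energy M vh.1 vh.2 < inf S + tau R k.
  have [_ [v [h [hd ->]]] he] := inf_adherent (tau_gt0 R k) hS.
  by exists (v, h).
pose v_ k := (projT1 (cid (H k))).1; pose g_ k := (projT1 (cid (H k))).2.
have hd k : dominated w zeta (v_ k) (g_ k) := (projT2 (cid (H k))).1.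
have he k : energy M (v_ k) (g_ k) < inf S + tau R k := (projT2 (cid (H k))).2.
have hv k : H0 (v_ k) (g_ k) by case: (hd k).
have cauchy k l : dot (fun i x => g_ k i x - g_ l i x) (fun i x => g_ k i x - g_ l i x) <=
    2 * (tau R k + tau R l).
  have arith (a b c r p q m I J : R) :
      r <= 2^-1 ^+ 2 * a + 2 * 2^-1 * 2^-1 * b + 2^-1 ^+ 2 * c - 2 * m * (2^-1 * I + 2^-1 * J) ->
      a - 2 * m * I < r + p -> c - 2 * m * J < r + q -> a - b - (b - c) <= 2 * (p + q).
    lra.
  have h2 : 0 <= 2^-1 :> R by rewrite invr_ge0.
  have h3 : 2^-1 + 2^-1 = 1 :> R by lra.
  have := infS _ _ (dominated_convex h2 h2 h3 (hd k) (hd l)).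
  rewrite (energy_lin _ _ _ (hv k) (hv l)) => /arith /(_ (he k) (he l)).
  have gk := H0_l2v (hv k); have gl := H0_l2v (hv l).
  by rewrite (dotBr (l2vB gk gl) gk gl) (dotBl gk gk gl) (dotBl gl gk gl) (dotC (g_ l) (g_ k)).
have [u0 [gu [hu0 cu0]]] : exists u g, H0 u g /\ H0cvg v_ g_ u g.
  apply: (H0_complete_grad hv) => e e0; have e4 : 0 < e / 4 by rewrite divr_gt0.
  have /cvgr0Pnorm_le/(_ _ e4)[K _ hK] := @cvg_harmonicS R.
  exists K => k l /hK/= hk /hK/= hl; apply: (le_trans (cauchy k l)).
  have := le_trans (ler_norm _) hk; have := le_trans (ler_norm _) hl.
  rewrite -/(tau R l) -/(tau R k); lra.
have [s ks cs] := l2cvg_ae (fun k => H0_l2 (hv k)) (H0_l2 hu0) cu0.1.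
(* The truncation alters [u0] on a null set only and makes the bounds [0 <= u <= w] hold at every
   point. *)
pose u x := Num.min (Num.max (u0 x) 0) (w x).
have [hp _] := H0_pos hu0; have hu' := H0_min hp hw.
have u0u : {ae mu, forall x, u0 x = u x}.
  apply: filterS cs => x cx; have h1 : 0 <= u0 x.
    by apply: (ler_cvg_to (cvg_cst _) cx); apply: nearW => k; case: (hd (s k)).
  have h2 : u0 x <= w x.
    by apply: (ler_cvg_to cx (cvg_cst _)); apply: nearW => k; case: (hd (s k)).
  by rewrite /u (max_idPl h1); apply/esym/min_idPl.
have mu_ : measurable_fun setT u := H0_meas hu'.
have uO x : ~ O x -> u x = 0 by exact: H0_out hu'.
have hu : H0 u gu.
  apply: (H0_ae_eq hu0) => //; first by move=> i; exact: H0_measg hu0.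
    by move=> x nO; split; [exact: uO|case: hu0 => _ _ /(_ x nO)[]].
  by move=> i; exact: aeW.
have cu : H0cvg v_ g_ u gu.
  split; last exact: cu0.2.
  apply: (l2cvg_ae_eq _ _ _ _ _ u0u cu0.1) => //; first by move=> k; exact: H0_l2 (hv k).
  - exact: H0_l2 hu0.
  - by move=> k; exact: H0_meas (hv k).
  - by move=> k; exact: aeW.
have u_bd x : 0 <= u x <= w x by rewrite le_min w0 andbT le_max lexx orbT ge_min lexx orbT.
have eu : energy M u gu <= inf S.
  have ct : inf S + tau R k @[k --> \oo] --> inf S.
    exact: (rcvgD (cvg_cst _) (@cvg_harmonicS R) (addr0 _)).
  have ce : energy M (v_ k) (g_ k) @[k --> \oo] --> energy M u gu by exact: energy_cvg.
  apply: (ler_cvg_to ce ct).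
  by apply: nearW => k; exact: ltW (he k).
exists v_, g_, u, gu; split => // p_ h_ v h hp_ hvh cvp.
have hp0 k : H0 (p_ k) (h_ k) by case: (hp_ k).
have hgu := H0_l2v hu; have hh := H0_l2v hvh.
rewrite (defectE M hgu (H0B hvh hu)) (integrB (H0_l1 hvh) (H0_l1 hu)) (dotBr hgu hh hgu).
set a := dot gu gu; set b := dot gu h; set I := Rintegral _ _ u; set J := Rintegral _ _ v.
have B0 : 0 <= a - 2 * b + dot h h.
  have := dot_ge0 (fun i x => h i x - gu i x).
  rewrite (dotBr (l2vB hh hgu) hh hgu) (dotBl hh hh hgu) (dotBl hgu hh hgu) (dotC h gu) -/a -/b.
  by rewrite (_ : _ - _ = a - 2 * b + dot h h)//; ring.
(* The change of energy from [u] to [(1 - t) * u + t * v], divided by [t], is this quantity plus [t]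
   times the remainder bounded in [B0]. *)
suff : 0 <= 2 * (b - a - M * (J - I)) by lra.
apply: (ge0_of_small B0) => t t0 t1.
have t10 : 0 <= 1 - t by rewrite subr_ge0.
have cvt := H0cvgD (fun k => H0Z (1 - t) (hv k)) (fun k => H0Z t (hp0 k)) (H0Z (1 - t) hu) (H0Z t hvh)
  (H0cvgZ (1 - t) hv hu cu) (H0cvgZ t hp0 hvh cvp).
have ce : energy M (fun x => (1 - t) * v_ k x + t * p_ k x)
    (fun i x => (1 - t) * g_ k i x + t * h_ k i x) @[k --> \oo] -->
    energy M (fun x => (1 - t) * u x + t * v x) (fun i x => (1 - t) * gu i x + t * h i x).
  exact: (@energy_cvg M (fun k x => (1 - t) * v_ k x + t * p_ k x)
    (fun k i x => (1 - t) * g_ k i x + t * h_ k i x) _ _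
    (fun k => H0D (H0Z (1 - t) (hv k)) (H0Z t (hp0 k))) (H0D (H0Z (1 - t) hu) (H0Z t hvh)) cvt).
have : inf S <= energy M (fun x => (1 - t) * u x + t * v x) (fun i x => (1 - t) * gu i x + t * h i x).
  apply: (ler_cvg_to (cvg_cst _) ce); apply: nearW => k; apply: infS.
  by apply: dominated_convex => //; [exact: ltW|rewrite subrK].
rewrite (energy_lin _ _ _ hu hvh) -/a -/b -/I -/J => /(le_trans eu).
rewrite /energy -/a -/I => h1; rewrite -(ler_pM2l t0) mulr0.
by move: h1; set c := dot h h; nra.
Qed.

(** For [0 <= psi <= u] the positive parts of [v_ k - psi] are dominated and tend, along a
    subsequence, to [u - psi]; hence [psi] has nonnegative defect. A small multiple of a test
    function times [step_approx e u] is such a [psi], and [kato] removes the step. *)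
Lemma minimiser_subsol (M : R) w zeta (v_ : nat -> E -> R) (g_ : nat -> 'I_n.+1 -> E -> R) u gu :
  0 <= M -> (exists C : R, forall x, w x <= C) ->
  (forall k, dominated w zeta (v_ k) (g_ k)) -> H0cvg v_ g_ u gu ->
  H0 u gu -> (forall x, 0 <= u x <= w x) ->
  (forall (p_ : nat -> E -> R) (h_ : nat -> 'I_n.+1 -> E -> R) v h,
        (forall k, dominated w zeta (p_ k) (h_ k)) -> H0 v h -> H0cvg p_ h_ v h ->
        defect M gu (fun x => v x - u x) <= 0) ->
  subsol D M u gu.
Proof.
move=> M0 [C wC] hd cu hu u_bd vi; have hgu := H0_l2v hu.
have hv k : H0 (v_ k) (g_ k) by case: (hd k).
have u0 x : 0 <= u x by case/andP: (u_bd x).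
have dom0 psi h : H0 psi h -> (forall x, 0 <= psi x <= u x) -> 0 <= defect M gu psi.
  move=> hpsi psi_bd.
  have hN := H0Z (-1) hpsi.
  have cN := H0cvgD hv (fun=> hN) hu hN cu (H0cvg_cst _ _).
  have [s ks cs] := H0_pos_cvg (fun k => H0D (hv k) hN) (H0D hu hN) cN.
  have [hp _] := H0_pos (H0D hu hN).
  have dk k : dominated w zeta (fun x => Num.max (v_ (s k) x + -1 * psi x) 0)
    (fun i x => (0 < v_ (s k) x + -1 * psi x)%R%:R * (g_ (s k) i x + -1 * h i x)).
    have [h1 h2 h3 [c c0 h4]] := hd (s k).
    have vle x : Num.max (v_ (s k) x + -1 * psi x) 0 <= v_ (s k) x.
      by rewrite ge_max h2 andbT mulN1r gerBl; case/andP: (psi_bd x).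
    split.
    - exact: (H0_pos (H0D h1 hN)).1.
    - by move=> x; rewrite le_max lexx orbT.
    - by move=> x; exact: le_trans (vle x) (h3 x).
    - by exists c => // x; exact: le_trans (vle x) (h4 x).
  have := vi _ _ _ _ dk hp cs.
  rewrite (_ : (fun x => _) = (fun x => -1 * psi x)).
    by rewrite (defectZ M _ hgu hpsi) mulN1r oppr_le0.
  apply/funext => x; rewrite mulN1r (max_idPl _) ?subr_ge0; last by case/andP: (psi_bd x).
  by rewrite addrAC subrr add0r.
split => //; first by exists C => x; apply: le_trans (wC x); case/andP: (u_bd x).
move=> phi tphi phi0.
have sq0 : {ae mu, forall x, 0 <= \sum_i gu i x * gu i x}.
  by apply: aeW => x; apply: sumr_ge0 => i _; rewrite -expr2 sqr_ge0.
have test_ineq (psi : E -> R) (e : R) : 0 < e -> test psi -> (forall x, 0 <= psi x) ->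
    dot gu (fun i x => psi x * (dstep_approx e (u x) * gu i x) +
                      partial i psi x * step_approx e (u x)) <=
    M * \int[mu]_x (psi x * step_approx e (u x)).
  move=> e0 tpsi psi0; have h1 := H0_mul tpsi (H0_step e0 hu).
  rewrite -subr_ge0 -(defectE M hgu h1).
  (* Since [step_approx e (u x) <= e^-1 * u x], the factor [c] brings the product below [u]. *)
  have [A A0 hA] := test_bounded tpsi; pose c := (A * e^-1)^-1.
  have c0 : 0 < c by rewrite invr_gt0 mulr_gt0// invr_gt0.
  have := dom0 _ _ (H0Z c h1); rewrite (defectZ M _ hgu h1) pmulr_rge0//; apply => x.
  rewrite !mulr_ge0 ?step_ge0 ?(ltW c0)//= /c ler_pdivrMl ?mulr_gt0 ?invr_gt0//.
  rewrite -mulrA ler_pM ?step_ge0//; first exact: le_trans (ler_norm _) (hA x).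
  apply: (le_trans (ler_norm _)); apply: (le_trans (gexpZ_norm _ e0)).
  by rewrite (ger0_norm (u0 x)).
have := kato M0 hgu hu sq0 test_ineq tphi phi0.
rewrite dotC (dotC gu); congr (_ <= _); apply: dot_ae_eq.
- exact: test_l2v tphi.
- exact: H0_l2v (H0_pos hu).1.
- exact: hgu.
- move=> i; apply: filterS (H0_grad_eq0 i hu) => x hx.
  have [ux|ux] := ltP 0 (u x); first by rewrite mul1r.
  by rewrite mul0r hx//; apply: le_anti; rewrite ux u0.
Qed.

(** Let [r = w - u] with [u] the minimiser. The admissible competitor
    [min (u + zeta) w = u + min zeta r] gives [min zeta r] nonpositive defect, so [defect_quasi]
    gives [M * \int r = dot gu gr], with [gr] the gradient of [r]. As [w] is a subsolution,
    [dot g gr <= M * \int r]; subtracting, the gradient of [r] vanishes. *)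
Lemma subsol_dominated_limit (M : R) w g zeta gz (h hz : E -> R) : 0 <= M -> subsol D M w g ->
  H0 zeta gz -> (forall x, 0 <= zeta x) -> pw w h -> pw zeta hz ->
  (forall x, O x -> hz x = 0 -> h x = 0) ->
  exists (v_ : nat -> E -> R) (g_ : nat -> 'I_n.+1 -> E -> R),
    (forall k, dominated w zeta (v_ k) (g_ k)) /\ H0cvg v_ g_ w g.
Proof.
move=> M0 hw hzeta z0 pwh pz zh; have hw0 := subsol_H0 hw.
have [_ w0 [C wC] _] := hw.
have [v_ [g_ [u [gu [hd cu [hu u_bd] vi]]]]] := @exists_minimiser M w g zeta M0 hw0 w0.
have wb : exists C : R, forall x, w x <= C by exists C.
have su : subsol D M u gu := minimiser_subsol M0 wb hd cu hu u_bd vi.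
have hgu := H0_l2v hu; have hgw := H0_l2v hw0.
have hv k : H0 (v_ k) (g_ k) by case: (hd k).
have [hatu pu] := subsol_pw M0 su.
pose r x := w x - u x; have hr := H0B hw0 hu.
have r0 x : 0 <= r x by rewrite subr_ge0; case/andP: (u_bd x).
have rC : exists C : R, forall x, r x <= C.
  by exists C => x; apply: (le_trans _ (wC x)); rewrite gerBl; case/andP: (u_bd x).
have pr : pw r (fun x => h x - hatu x).
  by move=> x Ox; apply: lebptB; [exact: H0_loc hw0|exact: H0_loc hu|exact: pwh|exact: pu].
have zr x : O x -> hz x = 0 -> h x - hatu x = 0.
  move=> Ox hz0; rewrite (zh x Ox hz0) sub0r; apply/eqP; rewrite oppr_eq0; apply/eqP.
  apply: le_anti; apply/andP; split.
    rewrite -(zh x Ox hz0); apply: (lebpt_le (H0_loc hu) (H0_loc hw0) _ (pu x Ox) (pwh x Ox)).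
    by apply: aeW => y; case/andP: (u_bd y).
  apply: (lebpt_le (@loc_cst _ _ 0) (H0_loc hu) _ (@lebpt_cst _ _ 0 x) (pu x Ox)).
  by apply: aeW => y; case/andP: (u_bd y).
have hN := H0Z (-1) hw0; have hzN := H0D hzeta hN.
have min_le0 : defect M gu (fun x => Num.min (zeta x) (r x)) <= 0.
  have ha k := H0D (hv k) hzN; have hau := H0D hu hzN.
  have ca := H0cvgD hv (fun=> hzN) hu hzN cu (H0cvg_cst _ _).
  have [s ks cs] := H0_pos_cvg ha hau ca.
  pose Nm (q : E -> R) (gq : 'I_n.+1 -> E -> R) (x : E) :=
    (q x + zeta x) + -1 * Num.max (q x + (zeta x + -1 * w x)) 0.
  have Nm_min q gq x : Nm q gq x = Num.min (q x + zeta x) (w x).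
    by rewrite minE_max0 /Nm !mulN1r addrA.
  have hp k := (H0_pos (ha k)).1; have hpu := (H0_pos hau).1.
  have c1 := H0cvgD (fun k => H0D (hv (s k)) hzeta) (fun k => H0Z (-1) (hp (s k)))
    (H0D hu hzeta) (H0Z (-1) hpu)
    (H0cvgD (fun k => hv (s k)) (fun=> hzeta) hu hzeta (H0cvg_sub ks cu) (H0cvg_cst _ _))
    (H0cvgZ (-1) (fun k => hp (s k)) hpu cs).
  have dk k : dominated w zeta (Nm (v_ (s k)) (g_ (s k))) (fun i x => (g_ (s k) i x + gz i x) +
     -1 * ((0 < v_ (s k) x + (zeta x + -1 * w x))%R%:R * (g_ (s k) i x + (gz i x + -1 * g i x)))).
    have [h1 h2 h3 [c c0 h4]] := hd (s k).
    split.
    - exact: H0D (H0D h1 hzeta) (H0Z (-1) (hp (s k))).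
    - by move=> x; rewrite Nm_min le_min w0 andbT addr_ge0.
    - by move=> x; rewrite Nm_min ge_min lexx orbT.
    - exists (c + 1); first by rewrite addr_ge0.
      by move=> x; rewrite Nm_min ge_min mulrDl mul1r lerD2r h4.
  have := vi _ _ _ _ dk (H0D (H0D hu hzeta) (H0Z (-1) hpu)) c1.
  congr (defect M gu _ <= 0); apply/funext => x; rewrite -/(Nm u gu x) Nm_min /r.
  by rewrite addr_minl addrAC subrr add0r.
have Lr := defect_quasi M0 su hr r0 rC hzeta z0 pr pz zr min_le0.
have e1 := subsol_ext hw hr (aeW _ r0).
have e2 : M * \int[mu]_x (w x - u x) = dot gu (fun i x => g i x - gu i x).
  by apply/eqP; rewrite -subr_eq0 -(defectE M hgu hr); apply/eqP.
have d0 : dot (fun i x => g i x - gu i x) (fun i x => g i x - gu i x) <= 0.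
  by rewrite (dotBl (l2vB hgw hgu) hgw hgu) subr_le0 -e2.
have rae : {ae mu, forall x, w x - u x = 0} := H0_grad0 hr d0.
have wu : {ae mu, forall x, u x = w x}.
  by apply: filterS rae => x /eqP; rewrite subr_eq0 => /eqP ->.
exists v_, g_; split => //; split=> [|i].
  apply: (l2cvg_ae_eq _ _ _ _ _ wu cu.1) => //; first by move=> k; exact: H0_l2 (hv k).
  - exact: H0_l2 hu.
  - by move=> k; exact: H0_meas (hv k).
  - exact: H0_meas hw0.
  - by move=> k; exact: aeW.
apply: (l2cvg_ae_eq _ _ _ _ _ (H0_unique i hu hw0 wu) (cu.2 i)) => //.
- by move=> k; exact: H0_l2g (hv k).
- by move=> k; exact: H0_measg (hv k).
- exact: H0_measg hw0.
- by move=> k; exact: aeW.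
Qed.

Lemma pw_ae u g (h : E -> R) : H0 u g -> pw u h -> {ae mu, forall x, O x -> u x = h x}.
Proof. exact: lebpt_ae. Qed.

Lemma pw_ge0 u g (h : E -> R) x : H0 u g -> (forall x, 0 <= u x) -> pw u h -> O x -> 0 <= h x.
Proof.
move=> hu u0 pu Ox.
exact: (lebpt_le (@loc_cst _ _ 0) (H0_loc hu) (aeW _ u0) (@lebpt_cst _ _ 0 x) (pu x Ox)).
Qed.

(** For the dominated approximants, [v_ k <= c * (xi + eta)] and [xi], [eta] have almost disjoint
    supports, so [chi * v_ k] is the minimum of [v_ k] and [c * xi] and lies in W_0^{1,2}. The limit
    gives [chi * w], and [kato] its differential inequality. *)
Lemma subsol_part (M : R) w g xi gx eta ge (h hx he : E -> R) : 0 <= M -> subsol D M w g ->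
  H0 xi gx -> (forall x, 0 <= xi x) -> H0 eta ge -> (forall x, 0 <= eta x) ->
  pw w h -> pw xi hx -> pw eta he ->
  (forall x, O x -> hx x = 0 \/ he x = 0) ->
  (forall x, O x -> 0 < h x -> 0 < hx x \/ 0 < he x) ->
  subsol D M (fun x => (0 < xi x)%R%:R * w x) (fun i x => (0 < xi x)%R%:R * g i x) /\
  {ae mu, forall x, xi x = 0 -> eta x = 0 -> w x = 0}.
Proof.
move=> M0 hw hxi xi0 heta eta0 pwh pxi peta disj cover.
have hw0 := subsol_H0 hw; have [_ w0 [C wC] wineq] := hw.
have hzeta := H0D hxi heta.
have z0 x : 0 <= xi x + eta x by rewrite addr_ge0.
have pz : pw (fun x => xi x + eta x) (fun x => hx x + he x).
  by move=> x Ox; apply: lebptD; [exact: H0_loc hxi|exact: H0_loc heta|exact: pxi|exact: peta].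
have zh x : O x -> hx x + he x = 0 -> h x = 0.
  move=> Ox; have := pw_ge0 hxi xi0 pxi Ox; have := pw_ge0 heta eta0 peta Ox => a1 a2 a3.
  have h0 := pw_ge0 hw0 w0 pwh Ox; apply/eqP; rewrite eq_le h0 andbT leNgt; apply/negP.
  by move=> /(cover x Ox)[]; lra.
have [v_ [g_ [hd cv]]] := subsol_dominated_limit M0 hw hzeta z0 pwh pz zh.
have hv k : H0 (v_ k) (g_ k) by case: (hd k).
have [s ks cs] := l2cvg_ae (fun k => H0_l2 (hv k)) (H0_l2 hw0) cv.1.
have wae : {ae mu, forall x, xi x = 0 -> eta x = 0 -> w x = 0}.
  apply: filterS cs => x cx x0 e0; have v0 k : v_ (s k) x = 0.
    have [_ h1 _ [c c0 /(_ x)]] := hd (s k); rewrite x0 e0 addr0 mulr0 => h2.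
    by apply: le_anti; rewrite h2 h1.
  have c0 : v_ (s k) x @[k --> \oo] --> (0 : R).
    by under eq_fun do rewrite v0; exact: cvg_cst.
  exact: (cvg_unique (@norm_hausdorff _ _) cx c0).
split => //.
have dae : {ae mu, forall x, xi x = 0 \/ eta x = 0}.
  apply: filterS2 (pw_ae hxi pxi) (pw_ae heta peta) => x e1 e2.
  have [Ox|nO] := pselect (O x); last by left; exact: H0_out hxi nO.
  by rewrite (e1 Ox) (e2 Ox); exact: disj.
pose chi x : R := (0 < xi x)%R%:R.
have mchi : measurable_fun setT chi by apply: measurable_gt0; exact: H0_meas hxi.
have chi1 x : `|chi x| <= 1 by exact: norm_nat_le1.
have hcv k : H0 (fun x => chi x * v_ k x) (fun i x => chi x * g_ k i x).
  have [_ v0 _ [c c0 vc]] := hd k; have hcx := H0Z c hxi.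
  have hm := H0_min (hv k) hcx; set gm := (fun i x => _) in hm.
  have Em : {ae mu, forall x, Num.min (v_ k x) (c * xi x) = chi x * v_ k x}.
    apply: filterS dae => x hx0; rewrite /chi; have [xp|xn] := ltP 0 (xi x).
      rewrite mul1r; apply/min_idPl; have := vc x.
      by case: hx0 => [hx0|->]; [rewrite hx0 ltxx in xp|rewrite addr0].
    have -> : xi x = 0 by apply: le_anti; rewrite xn xi0.
    by rewrite mul0r mulr0; apply/min_idPr; exact: v0.
  apply: (H0_ae_eq hm) => //.
  - by apply: measurable_funM => //; exact: H0_meas (hv k).
  - by move=> i; apply: measurable_funM => //; exact: H0_measg (hv k).
  - move=> x nO; split; first by rewrite (H0_out (hv k) nO) mulr0.
    by move=> i; have [_ _ /(_ x nO)[_ ->] _] := hv k; rewrite mulr0.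
  - move=> i; apply: filterS3 dae Em (H0_grad_eq0 i hm) => x hx0 e1 e2.
    rewrite /chi in e1 *; have [xp|xn] := ltP 0 (xi x).
      rewrite mul1r /gm; have := vc x; case: hx0 => [hx0|->]; first by rewrite hx0 ltxx in xp.
      by rewrite addr0 -subr_le0 leNgt => /negbTE ->; rewrite mul0r subr0.
    by rewrite mul0r; apply: e2; rewrite e1 ltNge xn mul0r.
have hcvg : H0cvg (fun k x => chi x * v_ k x) (fun k i x => chi x * g_ k i x)
    (fun x => chi x * w x) (fun i x => chi x * g i x).
  split=> [|i].
    apply: (@l2cvg_bM _ _ _ mu (fun=> chi) v_ chi w 1) => //.
    - by apply: aeW => x _; exact: cvg_cst.
    - by move=> k; exact: H0_l2 (hv k).
    - exact: H0_l2 hw0.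
    - exact: cv.1.
  apply: (@l2cvg_bM _ _ _ mu (fun=> chi) (fun k => g_ k i) chi (g i) 1) => //.
  - by apply: aeW => x _; exact: cvg_cst.
  - by move=> k; exact: H0_l2g (hv k).
  - exact: H0_l2g hw0.
  - exact: cv.2.
have hcw : H0 (fun x => chi x * w x) (fun i x => chi x * g i x).
  apply: (H0_lim hcv) => //.
  - exact: l2_bM mchi chi1 (H0_l2 hw0).
  - by move=> i; exact: l2_bM mchi chi1 (H0_l2g i hw0).
  - move=> x nO; split; first by rewrite (H0_out hw0 nO) mulr0.
    by move=> i; have [_ _ /(_ x nO)[_ ->] _] := hw0; rewrite mulr0.
have chi0 x : 0 <= chi x by exact: ler0n.
split => //.
- by move=> x; rewrite mulr_ge0.
- exists C => x; apply: le_trans (wC x); rewrite -[leRHS]mul1r ler_wpM2r//.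
  by have := chi1 x; rewrite ger0_norm.
move=> phi tphi phi0.
have hcg := H0_l2v hcw.
have sq0 : {ae mu, forall x, 0 <= \sum_i (chi x * g i x) * (chi x * g i x)}.
  by apply: aeW => x; apply: sumr_ge0 => i _; rewrite -expr2 sqr_ge0.
have test_ineq (psi : E -> R) (e : R) : 0 < e -> test psi -> (forall x, 0 <= psi x) ->
    dot (fun i x => chi x * g i x) (fun i x => psi x * (dstep_approx e (chi x * w x) * (chi x * g i x)) +
                      partial i psi x * step_approx e (chi x * w x)) <=
    M * \int[mu]_x (psi x * step_approx e (chi x * w x)).
  move=> e0 tpsi psi0; have h1 := H0_mul tpsi (H0_step e0 hcw).
  have := subsol_ext hw h1; rewrite /dot => h2.
  (* Where [chi] vanishes so does the gradient of the test function, hence [g] and [chi * g] give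
     the same pairing. *)
  rewrite (eq_bigr (fun i => \int[mu]_x (g i x * (psi x * (dstep_approx e (chi x * w x) * (chi x * g i x)) +
                      partial i psi x * step_approx e (chi x * w x))))).
    by apply: h2; apply: aeW => x; rewrite mulr_ge0//; exact: step_ge0.
  move=> i _; apply: eq_Rintegral => x _; rewrite /chi; case: ltP => _; first by rewrite !mul1r.
  by rewrite !(mul0r, mulr0) /step_approx mulr0 gexp_le0// !(mulr0, addr0).
have := kato M0 hcg hcw sq0 test_ineq tphi phi0.
rewrite dotC [in X in _ -> X]dotC; congr (_ <= _); apply: dot_ae_eq.
- exact: test_l2v tphi.
- move=> i; apply: l2_bM (hcg i); first by apply: measurable_gt0; exact: H0_meas hcw.
  by move=> x; exact: norm_nat_le1.
- exact: hcg.
- move=> i; apply: filterS (H0_grad_eq0 i hcw) => x hx0.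
  have [cw|cw] := ltP 0 (chi x * w x); first by rewrite mul1r.
  by rewrite mul0r hx0//; apply: le_anti; rewrite cw mulr_ge0.
Qed.

(** The two parts [v] and [v'] satisfy [v + v' = w], [min v eta = 0] and [min v' xi = 0] almost
    everywhere. These identities pass to representatives at every point, where they determine that
    of [v]. *)
Lemma subsol_split (M : R) w g xi gx eta ge (h hx he : E -> R) : 0 <= M -> subsol D M w g ->
  H0 xi gx -> (forall x, 0 <= xi x) -> H0 eta ge -> (forall x, 0 <= eta x) ->
  pw w h -> pw xi hx -> pw eta he ->
  (forall x, O x -> hx x = 0 \/ he x = 0) ->
  (forall x, O x -> 0 < h x -> 0 < hx x \/ 0 < he x) ->
  exists v gv, [/\ subsol D M v gv, forall x, v x <= w x &
    pw v (fun x => if 0 < hx x then h x else 0)].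
Proof.
move=> M0 hw hxi xi0 heta eta0 pwh pxi peta disj cover.
have [s1 wae] := subsol_part M0 hw hxi xi0 heta eta0 pwh pxi peta disj cover.
have [s2 _] := subsol_part M0 hw heta eta0 hxi xi0 pwh peta pxi
  (fun x Ox => (or_comm _ _).1 (disj x Ox)) (fun x Ox h0 => (or_comm _ _).1 (cover x Ox h0)).
pose v x : R := (0 < xi x)%R%:R * w x; pose v' x : R := (0 < eta x)%R%:R * w x.
rewrite -/v in s1; rewrite -/v' in s2.
have [hv pv] := subsol_pw M0 s1; have [hv' pv'] := subsol_pw M0 s2.
have hw0 := subsol_H0 hw; have w0 x : 0 <= w x by case: hw.
have h1 := subsol_H0 s1; have h2 := subsol_H0 s2.
have v0 x : 0 <= v x by case: s1.
have v'0 x : 0 <= v' x by case: s2.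
have dae : {ae mu, forall x, xi x = 0 \/ eta x = 0}.
  apply: filterS2 (pw_ae hxi pxi) (pw_ae heta peta) => x e1 e2.
  have [Ox|nO] := pselect (O x); last by left; exact: H0_out hxi nO.
  by rewrite (e1 Ox) (e2 Ox); exact: disj.
have Ew : {ae mu, forall x, v x + v' x = w x}.
  apply: filterS2 wae dae => x w1 d1; rewrite /v /v'.
  have [xp|xn] := ltP 0 (xi x); have [ep|en] := ltP 0 (eta x).
  - by case: d1 => d1; [rewrite d1 ltxx in xp|rewrite d1 ltxx in ep].
  - by rewrite mul1r mul0r addr0.
  - by rewrite mul1r mul0r add0r.
  - by rewrite !mul0r addr0 w1//; apply: le_anti; rewrite ?xn ?en ?xi0 ?eta0.
have Ev : {ae mu, forall x, Num.min (v x) (eta x) = 0}.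
  apply: filterS dae => x d1; rewrite /v.
  by case: d1 => ->; [rewrite ltxx mul0r; apply/min_idPl|apply/min_idPr; exact: v0].
have Ev' : {ae mu, forall x, Num.min (v' x) (xi x) = 0}.
  apply: filterS dae => x d1; rewrite /v'.
  by case: d1 => ->; [apply/min_idPr; exact: v'0|rewrite ltxx mul0r; apply/min_idPl].
exists v, (fun i x => (0 < xi x)%R%:R * g i x); split => //.
  by move=> x; rewrite -[leRHS]mul1r ler_wpM2r//; case: (0 < xi x).
have lv := H0_loc h1; have lv' := H0_loc h2; have lw := H0_loc hw0.
have lxi := H0_loc hxi; have leta := H0_loc heta; have l0 := @loc_cst R n.+1 0.
move=> x Ox; have hv_ge0 := pw_ge0 h1 v0 pv Ox; have hv'_ge0 := pw_ge0 h2 v'0 pv' Ox.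
have e1 : hv x + hv' x = h x.
  apply: (lebpt_unique lw _ (pwh x Ox)).
  exact: (lebpt_ae_eq (locD lv lv') lw Ew (lebptD lv lv' (pv x Ox) (pv' x Ox))).
have e2 : Num.min (hv x) (he x) = 0.
  apply: (lebpt_unique l0 _ (@lebpt_cst _ _ 0 x)).
  exact: (lebpt_ae_eq (loc_min lv leta) l0 Ev (lebpt_min lv leta (pv x Ox) (peta x Ox))).
have e3 : Num.min (hv' x) (hx x) = 0.
  apply: (lebpt_unique l0 _ (@lebpt_cst _ _ 0 x)).
  exact: (lebpt_ae_eq (loc_min lv' lxi) l0 Ev' (lebpt_min lv' lxi (pv' x Ox) (pxi x Ox))).
have min0 (a b : R) : 0 <= a -> 0 < b -> Num.min a b = 0 -> a = 0.
  by move=> a0 b0; have [ab|ba] := leP a b => // b0'; rewrite b0' ltxx in b0.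
suff -> : (if 0 < hx x then h x else 0) = hv x by exact: pv.
case: ifPn => [hx0|hx0]; first by rewrite -e1 (min0 _ _ hv'_ge0 hx0 e3) addr0.
have [h0|h0] := ltP 0 (h x); last by apply: le_anti; rewrite hv_ge0; lra.
by case: (cover x Ox h0) => [h3|h3]; [rewrite h3 in hx0|rewrite (min0 _ _ hv_ge0 h3 e2)].
Qed.

End splitting.

(** * Decomposition *)

Section weighted_series.
Variable R : realType.
Implicit Types (a : nat -> R) (l m p k : nat).

(* [\sum_(l <= k < l + p) 2 ^- (k - l + 1) * a k], in the form that makes it an
   iterated midpoint and lets convex bounds pass through it. *)
Fixpoint ser a l p : R := if p is q.+1 then 2^-1 * a l + 2^-1 * ser a l.+1 q else 0.

Lemma ser_cat a l m p : ser a l (m + p) = ser a l m + 2^-1 ^+ m * ser a (l + m) p.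
Proof.
elim: m l => [|m IH] l; first by rewrite add0n addn0 expr0 mul1r add0r.
by rewrite addSn /= IH mulrDr addrA mulrA -exprS addSnnS.
Qed.

Lemma ser_bd a l p : (forall k, 0 <= a k <= 1) -> 0 <= ser a l p <= 1.
Proof.
move=> ha; elim: p l => [|p IH] l /=; first by rewrite lexx ler01.
have /andP[a1 a2] := IH l.+1; have /andP[b1 b2] := ha l; lra.
Qed.

Definition sersum a : R := sup (range (ser a 0)).

Lemma half_ge0 m : 0 <= 2^-1 ^+ m :> R. Proof. by rewrite exprn_ge0// invr_ge0. Qed.

Lemma sersumP a m : (forall k, 0 <= a k <= 1) -> ser a 0 m <= sersum a <= ser a 0 m + 2^-1 ^+ m.
Proof.
move=> ha; have le_ser p q : (p <= q)%N -> ser a 0 p <= ser a 0 q.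
  move=> /subnKC <-; rewrite ser_cat lerDl mulr_ge0 ?half_ge0//.
  by case/andP: (ser_bd (0 + p) (q - p) ha).
have hs : has_sup (range (ser a 0)).
  split; first by exists (ser a 0 0), 0%N.
  by exists 1 => _ [p _ <-]; case/andP: (ser_bd 0 p ha).
apply/andP; split; first by apply: (sup_upper_bound hs); exists m.
apply: ge_sup; first by exists (ser a 0 0), 0%N.
move=> _ [p _ <-]; have [mp|/ltnW pm] := leqP m p.
  rewrite -(subnKC mp) ser_cat lerD2l ler_piMr ?half_ge0//.
  by case/andP: (ser_bd (0 + m) (p - m) ha).
by rewrite (le_trans (le_ser _ _ pm))// lerDl half_ge0.
Qed.

Lemma cvg_half : 2^-1 ^+ m @[m --> \oo] --> (0 : R).
Proof. by apply: cvg_expr; rewrite ger0_norm ?invr_ge0// invf_lt1 ?ltr1n. Qed.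

Lemma cvg_ser a : (forall k, 0 <= a k <= 1) -> ser a 0 m @[m --> \oo] --> sersum a.
Proof.
move=> ha; have h : sersum a - ser a 0 m @[m --> \oo] --> (0 : R).
  apply: (rcvg0_le _ cvg_half); apply: nearW => m.
  by have /andP[h1 h2] := sersumP m ha; rewrite ger0_norm ?subr_ge0// lerBlDl.
apply: (@eq_rcvg _ _ _ (fun m => sersum a - (sersum a - ser a 0 m))).
  by move=> m; rewrite subKr.
exact: (rcvgB (cvg_cst _) h (subr0 _)).
Qed.

Lemma sersum_gt0 a : (forall k, 0 <= a k <= 1) -> (0 < sersum a) <-> exists k, 0 < a k.
Proof.
move=> ha; split=> [s0|[k ak]].
  apply: contrapT => h; have a0 k : a k = 0.
    by apply: le_anti; case/andP: (ha k) => -> _; rewrite andbT leNgt; apply/negP => ak; apply: h; exists k.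
  have ser0 p l : ser a l p = 0 by elim: p l => [|p IH] l //=; rewrite a0 IH !mulr0 addr0.
  have := ler_cvg_to (cvg_ser ha) (cvg_cst 0) => H.
  suff : sersum a <= 0 by rewrite leNgt s0.
  by apply: (ler_cvg_to (cvg_ser ha) (cvg_cst 0)); apply: nearW => m; rewrite ser0.
have /andP[+ _] := sersumP k.+1 ha; apply: lt_le_trans.
rewrite -addn1 ser_cat /= mulr0 addr0 add0n ltr_wpDl//; first by case/andP: (ser_bd 0 k ha).
by rewrite mulr_gt0 ?exprn_gt0 ?invr_gt0// mulr_gt0// invr_gt0.
Qed.

End weighted_series.

Section decomposition.
Variables (R : realType) (n : nat) (D : bdomain R n.+1).
Local Notation O := (dom D).
Local Notation mu := (lebesgue R n.+1).
Local Notation E := 'rV[R]_n.+1.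
Local Notation test := (test_function O).
Local Notation H0 := (H0 D).
Local Notation pw := (pw D).
Implicit Types (phi f u v w : E -> R) (g G : 'I_n.+1 -> E -> R) (i : 'I_n.+1) (A B : set E).

Lemma H0_ser (u_ : nat -> E -> R) (g_ : nat -> 'I_n.+1 -> E -> R) l p :
  (forall k, H0 (u_ k) (g_ k)) ->
  H0 (fun x => ser (u_ ^~ x) l p) (fun i x => ser (fun k => g_ k i x) l p).
Proof.
move=> hu; elim: p l => [|p IH] l /=; first exact: H00.
exact: (H0D (H0Z 2^-1 (hu l)) (H0Z 2^-1 (IH l.+1))).
Qed.

Lemma dot_ser (u_ : nat -> E -> R) (g_ : nat -> 'I_n.+1 -> E -> R) l p :
  (forall k, H0 (u_ k) (g_ k)) -> (forall k, dot (g_ k) (g_ k) <= 1) ->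
  dot (fun i x => ser (fun k => g_ k i x) l p) (fun i x => ser (fun k => g_ k i x) l p) <= 1.
Proof.
move=> hu hg; elim: p l => [|p IH] l /=.
  rewrite /dot big1// => i _; rewrite -[RHS](integr0 mu); apply: eq_Rintegral => x _; exact: mulr0.
have h1 := H0_l2v (hu l); have h2 := H0_l2v (H0_ser l.+1 p hu).
rewrite (dot_lin 2^-1 2^-1 h1 h2).
have := dot_ge0 (fun i x => 1 * g_ l i x + -1 * ser (fun k => g_ k i x) l.+1 p).
rewrite (dot_lin 1 (-1) h1 h2).
move: (hg l) (IH l.+1); set a := dot _ _; set b := dot _ _; set c := dot _ _; lra.
Qed.

Lemma H0_sersum (u_ : nat -> E -> R) (g_ : nat -> 'I_n.+1 -> E -> R) :
  (forall k, H0 (u_ k) (g_ k)) -> (forall k, dot (g_ k) (g_ k) <= 1) ->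
  (forall x k, 0 <= u_ k x <= 1) ->
  exists g, H0 (fun x => sersum (u_ ^~ x)) g /\
    H0cvg (fun m x => ser (u_ ^~ x) 0 m) (fun m i x => ser (fun k => g_ k i x) 0 m)
      (fun x => sersum (u_ ^~ x)) g.
Proof.
move=> hu hg hb; have hk m := H0_ser 0 m hu.
have cu x := cvg_ser (hb x).
have key (a b : nat) : (a <= b)%N ->
    dot (fun i x => ser (fun k => g_ k i x) 0 b - ser (fun k => g_ k i x) 0 a)
        (fun i x => ser (fun k => g_ k i x) 0 b - ser (fun k => g_ k i x) 0 a) <= 2^-1 ^+ a.
  move=> ab; rewrite (_ : (fun i x => _) = (fun i x => 2^-1 ^+ a * ser (fun k => g_ k i x) a (b - a))).
    have hl := H0_l2v (H0_ser a (b - a) hu).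
    rewrite dotZr//; last by move=> i; exact: l2Z.
    rewrite dotC dotZr// mulrA -[leRHS]mulr1 ler_pM ?mulr_ge0 ?half_ge0 ?dot_ge0//.
      by rewrite ler_piMr ?half_ge0// exprn_ile1 ?invr_ge0// invf_le1 ?ler1n.
    exact: dot_ser.
  apply/funext => i; apply/funext => x; rewrite -{1}(subnKC ab) ser_cat.
  by rewrite addrAC subrr add0r.
have [|u0 [g [hu0 cu0]]] := H0_complete_grad hk.
  move=> e e0; have /cvgr0Pnorm_le/(_ _ e0)[K _ hK] := @cvg_half R.
  have hK' (a : nat) : (K <= a)%N -> 2^-1 ^+ a <= e.
    by move=> Ka; apply: le_trans (ler_norm _) (hK a Ka).
  exists K => a b Ka Kb; have [ba|/ltnW ab] := leqP b a.
    exact: le_trans (key _ _ ba) (hK' _ Kb).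
  apply: le_trans (hK' _ Ka); apply: le_trans (key _ _ ab).
  rewrite le_eqVlt; apply/orP; left; apply/eqP.
  by apply: eq_bigr => i _; apply: eq_Rintegral => x _; ring.
pose U x := sersum (u_ ^~ x).
have [s ks cs] := l2cvg_ae (fun k => H0_l2 (hk k)) (H0_l2 hu0) cu0.1.
have uU : {ae mu, forall x, u0 x = U x}.
  apply: filterS cs => x h; apply: (cvg_unique (@norm_hausdorff _ _) h).
  exact: (rcvg_sub ks (cu x)).
have mU : measurable_fun setT U.
  apply: (measurable_fun_cvg (h := fun m x => ser (u_ ^~ x) 0 m)) => [m|x _]; last exact: cu.
  exact: H0_meas (hk m).
have UO x : ~ O x -> U x = 0.
  move=> nO; have c0 : ser (u_ ^~ x) 0 m @[m --> \oo] --> (0 : R).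
    by under eq_fun do rewrite (H0_out (hk _) nO); exact: cvg_cst.
  exact: (cvg_unique (@norm_hausdorff _ _) (cu x) c0).
have hU : H0 U g.
  apply: (H0_ae_eq hu0 mU) => //; first by move=> i; exact: H0_measg hu0.
    by move=> x nO; split; [exact: UO|case: hu0 => _ _ /(_ x nO)[]].
  by move=> i; exact: aeW.
exists g; split => //; split; last exact: cu0.2.
apply: (l2cvg_ae_eq _ _ _ _ _ uU cu0.1) => //.
- by move=> m; exact: H0_l2 (hk m).
- exact: H0_l2 hu0.
- by move=> m; exact: H0_meas (hk m).
- by move=> m; exact: aeW.
Qed.

Lemma pw_le1 u g (h : E -> R) x : H0 u g -> (forall x, u x <= 1) -> pw u h -> O x -> h x <= 1.
Proof.
move=> hu u1 pu Ox.
exact: (lebpt_le (H0_loc hu) (@loc_cst _ _ 1) (aeW _ u1) (pu x Ox) (@lebpt_cst _ _ 1 x)).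
Qed.

(** Partial sums converge uniformly at rate [2^-1 ^+ k], for the functions and for the
    representatives alike, which is the setting of [lebpt_uniform]. *)
Lemma pw_sersum (u_ : nat -> E -> R) (g_ : nat -> 'I_n.+1 -> E -> R) (h_ : nat -> E -> R) :
  (forall k, H0 (u_ k) (g_ k)) -> (forall k, dot (g_ k) (g_ k) <= 1) ->
  (forall x k, 0 <= u_ k x <= 1) -> (forall k, pw (u_ k) (h_ k)) ->
  (forall x, O x -> forall k, 0 <= h_ k x <= 1) /\
  pw (fun x => sersum (u_ ^~ x)) (fun x => sersum (h_ ^~ x)).
Proof.
move=> hu hg hb ph.
have hh x : O x -> forall k, 0 <= h_ k x <= 1.
  move=> Ox k; rewrite (pw_ge0 (hu k) _ (ph k) Ox) ?(pw_le1 (hu k) _ (ph k) Ox)// => y.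
    by case/andP: (hb y k).
  by case/andP: (hb y k).
split => // x Ox; have [g [hU _]] := H0_sersum hu hg hb.
have lser p l : lebpt (fun y => ser (u_ ^~ y) l p) x (ser (h_ ^~ x) l p).
  elim: p l => [|p IH] l /=; first exact: lebpt_cst.
  apply: lebptD.
  - by apply: locZ; exact: H0_loc (hu l).
  - by apply: locZ; exact: H0_loc (H0_ser l.+1 p hu).
  - by apply: lebptZ; [exact: H0_loc (hu l)|exact: ph].
  - by apply: lebptZ; [exact: H0_loc (H0_ser l.+1 p hu)|exact: IH].
have near_ser (a : nat -> R) k : (forall j, 0 <= a j <= 1) -> `|sersum a - ser a 0 k| <= 2^-1 ^+ k.
  by move=> ha; have /andP[h1 h2] := sersumP k ha; rewrite ger0_norm ?subr_ge0// lerBlDl.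
apply: (@lebpt_uniform _ _ (fun k y => ser (u_ ^~ y) 0 k) (fun k => ser (h_ ^~ x) 0 k)
  (fun k => 2^-1 ^+ k)) => //.
- by move=> k; exact: H0_loc (H0_ser 0 k hu).
- exact: H0_loc hU.
- by move=> k; apply: aeW => y; exact: near_ser.
- by move=> k; apply: near_ser; exact: hh.
- exact: cvg_half.
Qed.

Lemma H0_normalise u g (C : R) : H0 u g -> (forall x, u x <= C) ->
  exists c : R, [/\ 0 < c, c <= 1, forall x, c * u x <= 1 &
    dot (fun i x => c * g i x) (fun i x => c * g i x) <= 1].
Proof.
move=> hu uC; pose d := 1 + `|C| + dot g g.
have d1 : 1 <= d by rewrite /d -addrA lerDl addr_ge0// dot_ge0.
have d0 : 0 < d by exact: lt_le_trans d1.
exists d^-1; split; first by rewrite invr_gt0.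
- by rewrite invf_le1.
- move=> x; rewrite ler_pdivrMl// mulr1; apply: (le_trans (uC x)).
  apply: (le_trans (ler_norm _)); by rewrite /d -addrA addrCA lerDl addr_ge0 ?dot_ge0.
- have hg := H0_l2v hu; rewrite dotZr//; last by move=> i; exact: l2Z.
  rewrite dotC dotZr// ler_pdivrMl// mulr1 ler_pdivrMl//.
  have gd : dot g g <= d by rewrite /d lerDr addr_ge0.
  by apply: (le_trans gd); rewrite ler_peMl// ltW.
Qed.

(** The working form of [sobolev_open]: the function is [0] off [O] and nonnegative everywhere, and
    its precise representative is named. The two agree by [sopenP]. *)
Definition sopen A := exists u g h,
  [/\ H0 u g, forall x, 0 <= u x, pw u h & A = [set x | O x /\ 0 < h x]].

Definition sconn A := A `<=` O /\ forall B B', sopen B -> sopen B' -> B `&` B' = set0 ->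
  A `<=` B `|` B' -> A `<=` B \/ A `<=` B'.

Definition sdecomp A (C : set (set E)) := [/\ countable C, trivIset C id,
  \bigcup_(B in C) B = A & forall B, C B -> [/\ B !=set0, sopen B & sconn B]].

(** * Pieces of the positivity set of a subsolution *)

Section pieces.
Variables (M : R) (w0 : E -> R) (g0 : 'I_n.+1 -> E -> R) (h0 : E -> R).
Let G := [set x | O x /\ 0 < h0 x].

(** The precise representative of [u] is that of [w0] cut off to [A]. The function is kept as an
    argument because its integral is minimised. *)
Definition piece A u := A `<=` G /\ exists g h, [/\ subsol D M u g, forall x, u x <= w0 x,
  pw u h & forall x, O x -> h x = if `[< A x >] then h0 x else 0].

Lemma piece_supp A h : A `<=` G -> (forall x, O x -> h x = if `[< A x >] then h0 x else 0) ->
  A = [set x | O x /\ 0 < h x].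
Proof.
move=> AG hA; apply/seteqP; split => [x Ax|x [Ox]] /=.
  have [Ox hx] := AG x Ax; split => //; rewrite hA//.
  by case: asboolP.
by rewrite hA//; case: asboolP => //; rewrite ltxx.
Qed.

Lemma piece_sopen A u : piece A u -> sopen A.
Proof.
move=> [AG [g [h [su uw pu hA]]]]; exists u, g, h; split => //.
- exact: subsol_H0 su.
- by case: su.
- exact: piece_supp hA.
Qed.

(** The difference [w0 - u] has the representative of [w0] cut off to the rest of [G]. A piece is
    thus both open and closed in [G], in the Sobolev sense. *)
Lemma piece_compl A u : H0 w0 g0 -> pw w0 h0 -> piece A u -> sopen (G `\` A).
Proof.
move=> hw pw0 [AG [g [h [su uw pu hA]]]]; have hu := subsol_H0 su.
exists (fun x => w0 x - u x), (fun i x => g0 i x - g i x), (fun x => h0 x - h x); split.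
- exact: H0B.
- by move=> x; rewrite subr_ge0.
- by move=> x Ox; apply: lebptB; [exact: H0_loc hw|exact: H0_loc hu|exact: pw0|exact: pu].
- apply/seteqP; split => [x [[Ox hx] nA]|x [Ox]] /=.
    by split => //; rewrite hA//; case: asboolP => // _; rewrite subr0.
  rewrite hA//; case: asboolP => nA; first by rewrite subrr ltxx.
  by rewrite subr0.
Qed.

Lemma piece_split A u B B' : 0 <= M -> piece A u -> sopen B -> sopen B' -> B `&` B' = set0 ->
  A `<=` B `|` B' -> exists v, piece (A `&` B) v /\ forall x, v x <= u x.
Proof.
move=> M0 [AG [g [h [su uw pu hA]]]] [xi [gx [hx [hxi xi0 pxi EB]]]]
  [eta [ge [he [heta eta0 peta EB']]]] disj cov.
have EA := piece_supp AG hA.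
have [||v [gv [sv vu pv]]] := @subsol_split R n D M u g xi gx eta ge h hx he M0 su hxi xi0 heta eta0 pu pxi peta.
- move=> x Ox; have h1 := pw_ge0 hxi xi0 pxi Ox; have h2 := pw_ge0 heta eta0 peta Ox.
  have [hx0|hx0] := ltP 0 (hx x); last by left; apply: le_anti; rewrite hx0.
  have [he0|he0] := ltP 0 (he x); last by right; apply: le_anti; rewrite he0.
  have : (B `&` B') x by rewrite EB EB'.
  by rewrite disj.
- move=> x Ox hx0; have /cov : A x by rewrite EA.
  by rewrite EB EB' => -[[_ h1]|[_ h1]]; [left|right].
exists v; split => //; split; first by move=> x [Ax _]; exact: AG.
exists gv, (fun x => if 0 < hx x then h x else 0); split => //.
  by move=> x; exact: le_trans (vu x) (uw x).
move=> x Ox; rewrite EB; case: asboolP => [[Ax [_ ->]]|nAB].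
  by rewrite hA//; case: asboolP.
case: ifPn => // hx0; rewrite hA//; case: asboolP => // Ax; exfalso; apply: nAB.
by split.
Qed.

Lemma piece_le A u B v : piece A u -> piece B v -> A `<=` B -> {ae mu, forall x, u x <= v x}.
Proof.
move=> [AG [g [h [su uw pu hA]]]] [BG [g' [h' [sv vw pv hB]]]] AB.
have hu := subsol_H0 su; have hv := subsol_H0 sv.
apply: filterS2 (pw_ae hu pu) (pw_ae hv pv) => x e1 e2.
have [Ox|nO] := pselect (O x); last by rewrite (H0_out hu nO) (H0_out hv nO).
rewrite (e1 Ox) (e2 Ox) hA// hB//; case: asboolP => Ax.
  by case: asboolP => // nB; exfalso; exact/nB/AB.
by case: asboolP => // /BG[_ /ltW].
Qed.

Lemma piece_l1 A u : piece A u -> l1 mu u.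
Proof. by move=> [_ [g [h [su _ _ _]]]]; exact: H0_l1 (subsol_H0 su). Qed.

(** At a point of the intersection every [h_ k] equals [h0], and [subsol_cvg_hat] keeps the
    representative of the limit from dropping below; at other points some [h_ k] is already [0]. *)
Lemma piece_lim (A_ : nat -> set E) (u_ : nat -> E -> R) : 0 <= M ->
  (forall k, piece (A_ k) (u_ k)) -> (forall k, A_ k.+1 `<=` A_ k) ->
  (forall k x, u_ k.+1 x <= u_ k x) ->
  exists2 u, piece (\bigcap_k A_ k) u & forall k x, u x <= u_ k x.
Proof.
move=> M0 hp dA du.
have H k : exists gh : ('I_n.+1 -> E -> R) * (E -> R), [/\ subsol D M (u_ k) gh.1,
    forall x, u_ k x <= w0 x, pw (u_ k) gh.2 &
    forall x, O x -> gh.2 x = if `[< A_ k x >] then h0 x else 0].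
  by have [_ [g [h hh]]] := hp k; exists (g, h).
pose g_ k := (projT1 (cid (H k))).1; pose h_ k := (projT1 (cid (H k))).2.
have su k : subsol D M (u_ k) (g_ k) by have [] := projT2 (cid (H k)).
have uw k x : u_ k x <= w0 x by have [] := projT2 (cid (H k)).
have pu k : pw (u_ k) (h_ k) by have [] := projT2 (cid (H k)).
have hA k x : O x -> h_ k x = if `[< A_ k x >] then h0 x else 0.
  by have [_ _ _] := projT2 (cid (H k)); apply.
have [u [g [s cu cux ule]]] := subsol_decr M0 su du.
have [h ph] := subsol_pw M0 s.
exists u => //; split; first by move=> x /(_ 0%N I); exact: (hp 0%N).1.
exists g, h; split => //; first by move=> x; exact: le_trans (ule 0%N x) (uw 0%N x).
move=> x Ox; have hle k : h x <= h_ k x.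
  apply: (lebpt_le (H0_loc (subsol_H0 s)) (H0_loc (subsol_H0 (su k))) _ (ph x Ox) (pu k x Ox)).
  exact: aeW.
have h_ge0 : 0 <= h x by apply: (pw_ge0 (subsol_H0 s) _ ph Ox); case: s.
case: asboolP => hx.
  have Ek k : h_ k x = h0 x by rewrite hA//; case: asboolP => // nA; exfalso; apply: nA; exact: hx.
  apply: le_anti; rewrite -{1}(Ek 0%N) hle/=; apply/ler_addgt0Pr => e e0.
  have [K _ hK] := subsol_cvg_hat M0 su (subsol_H0 s) cu.1 Ox (fun k => pu k x Ox) (ph x Ox) e0.
  by rewrite -(Ek K); exact: hK (leqnn K).
have [k nk] : exists k, ~ A_ k x.
  by apply: contrapT => nh; apply: hx => k _; apply: contrapT => nk; apply: nh; exists k.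
by apply: le_anti; rewrite h_ge0 andbT; have := hle k; rewrite hA//; case: asboolP.
Qed.

(** A minimising sequence of pieces need not be nested. It is replaced by successive intersections,
    each obtained by splitting the preceding one along the next piece and its complement; by
    [piece_le] the integrals do not grow. *)
Lemma piece_min x : 0 <= M -> subsol D M w0 g0 -> pw w0 h0 -> G x ->
  exists A u, [/\ piece A u, A x & forall B v, piece B v -> B x ->
    \int[mu]_y u y <= \int[mu]_y v y].
Proof.
move=> M0 sw pw0 Gx; have hw := subsol_H0 sw.
have pG : piece G w0.
  split => //; exists g0, h0; split => // y Oy; case: asboolP => // nG.
  apply: le_anti; rewrite (pw_ge0 hw _ pw0 Oy) ?andbT; last by case: sw.
  by rewrite leNgt; apply/negP => h; apply: nG.
have p_ge0 B v : piece B v -> 0 <= \int[mu]_y v y.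
  by move=> [_ [g [h [[_ v0 _ _] _ _ _]]]]; exact: integr_ge0.
pose S := [set r | exists B v, [/\ piece B v, B x & r = \int[mu]_y v y]].
have hS : has_inf S.
  split; first by exists (\int[mu]_y w0 y), G, w0.
  by exists 0 => _ [B [v [hp _ ->]]]; exact: p_ge0 hp.
have H k : exists Bv : set E * (E -> R), [/\ piece Bv.1 Bv.2, Bv.1 x &
    \int[mu]_y Bv.2 y < inf S + tau R k].
  have [_ [B [v [hp Bx ->]]] hlt] := inf_adherent (tau_gt0 R k) hS.
  by exists (B, v).
pose B_ k := (projT1 (cid (H k))).1; pose v_ k := (projT1 (cid (H k))).2.
have pB k : piece (B_ k) (v_ k) by have [] := projT2 (cid (H k)).
have Bx k : B_ k x by have [] := projT2 (cid (H k)).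
have vlt k : \int[mu]_y v_ k y < inf S + tau R k by have [] := projT2 (cid (H k)).
pose T := {Au : set E * (E -> R) | piece Au.1 Au.2}.
have step (t : T) k : exists t' : T, (projT1 t').1 = (projT1 t).1 `&` B_ k /\
    forall y, (projT1 t').2 y <= (projT1 t).2 y.
  have hp := projT2 t.
  have [||v [hv vle]] := piece_split M0 hp (piece_sopen (pB k)) (piece_compl hw pw0 (pB k)).
  - by apply/seteqP; split => // y [h1 [_ h2]].
  - move=> y Ay; have [h|h] := pselect (B_ k y); [by left|right; split => //].
    by have [h1 _] := hp; exact: h1.
  by exists (exist _ ((projT1 t).1 `&` B_ k, v) hv).
pose seqT := fix seqT k : T := if k is j.+1 then projT1 (cid (step (seqT j) j)) else exist _ (G, w0) pG.
have seqTE k : (projT1 (seqT k.+1)).1 = (projT1 (seqT k)).1 `&` B_ k /\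
    forall y, (projT1 (seqT k.+1)).2 y <= (projT1 (seqT k)).2 y := projT2 (cid (step (seqT k) k)).
have pk k : piece (projT1 (seqT k)).1 (projT1 (seqT k)).2 := projT2 (seqT k).
have dA k : (projT1 (seqT k.+1)).1 `<=` (projT1 (seqT k)).1 by move=> y; rewrite (seqTE k).1 => -[].
have [u pu ule] := piece_lim M0 pk dA (fun k => (seqTE k).2).
exists (\bigcap_k (projT1 (seqT k)).1), u; split => //.
  by move=> k _; elim: k => [//|k IH]; rewrite (seqTE k).1; split.
move=> B v pv Bx'; apply: (@le_trans _ _ (inf S)); last first.
  by apply: (inf_lbound hS.2); exists B, v.
have ct : inf S + tau R k @[k --> \oo] --> inf S.
  exact: (rcvgD (cvg_cst _) (@cvg_harmonicS R) (addr0 _)).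
apply: (ler_cvg_to (cvg_cst _) ct); apply: nearW => k; apply: le_trans (ltW (vlt k)).
apply: integr_le; [exact: piece_l1 pu|exact: piece_l1 (pB k)|].
apply: filterS (piece_le (pk k.+1) (pB k) _) => [y|y]; last by rewrite (seqTE k).1 => -[].
exact: le_trans (ule k.+1 y).
Qed.

Definition atom A := [/\ A !=set0, sconn A & exists u, piece A u].

(** If [A] is covered by disjoint [B] and [B'] with [x] in [B], then the part of [A] in [B] is a
    piece containing [x]. By minimality its function coincides with [u] almost everywhere, so the
    representatives coincide everywhere and nothing of [A] lies off [B]. *)
Lemma piece_min_atom x A u : 0 <= M -> subsol D M w0 g0 -> pw w0 h0 -> piece A u -> A x ->
  (forall B v, piece B v -> B x -> \int[mu]_y u y <= \int[mu]_y v y) -> atom A.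
Proof.
move=> M0 sw pw0 pA Ax mA; split; [by exists x| |by exists u].
split; first by move=> y /(pA.1)[].
have key B B' : sopen B -> sopen B' -> B `&` B' = set0 -> A `<=` B `|` B' -> B x -> A `<=` B.
  move=> sB sB' disj cov Bx; have [v [pv vu]] := piece_split M0 pA sB sB' disj cov.
  have uv := mA _ _ pv (conj Ax Bx); have lu := piece_l1 pA; have lv := piece_l1 pv.
  have ae0 : {ae mu, forall y, u y - v y = 0}.
    apply: integr_eq0; [exact: l1B|by apply: aeW => y; rewrite subr_ge0|].
    by rewrite integrB// subr_le0.
  have ae1 : {ae mu, forall y, v y = u y}.
    by apply: filterS ae0 => y /eqP; rewrite subr_eq0 => /eqP.
  move=> y Ay; apply: contrapT => nB.
  have [Oy hy] := pA.1 y Ay.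
  have [_ [g [h [su _ ph hA]]]] := pA; have [_ [g' [h' [sv _ ph' hA']]]] := pv.
  have lpu := H0_loc (subsol_H0 su); have lpv := H0_loc (subsol_H0 sv).
  have := lebpt_unique lpu (ph y Oy) (lebpt_ae_eq lpv lpu ae1 (ph' y Oy)).
  rewrite hA// hA'//; case: asboolP => // _; case: asboolP => [[_ //]|_ h00].
  by rewrite h00 ltxx in hy.
move=> B B' sB sB' disj cov; have [Bx|B'x] := cov x Ax; first by left; exact: key cov Bx.
by right; apply: (key B' B) => //; rewrite 1?setIC 1?setUC.
Qed.

Lemma atom_cover x : 0 <= M -> subsol D M w0 g0 -> pw w0 h0 -> G x -> exists2 A, atom A & A x.
Proof.
move=> M0 sw pw0 Gx; have [A [u [pA Ax mA]]] := piece_min M0 sw pw0 Gx.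
by exists A => //; exact: piece_min_atom pA Ax mA.
Qed.

(** The piece [B] and its complement in [G] are disjoint Sobolev-open sets that cover [A]. *)
Lemma sconn_atom A B : H0 w0 g0 -> pw w0 h0 -> sconn A -> A `<=` G -> (exists u, piece B u) ->
  A `&` B !=set0 -> A `<=` B.
Proof.
move=> hw pw0 [_ cA] AG [u pB] [x [Ax Bx]].
have [||//|h] := cA _ _ (piece_sopen pB) (piece_compl hw pw0 pB).
- by apply/seteqP; split => // y [h1 [_ h2]].
- by move=> y Ay; have [h|h] := pselect (B y); [left|right; split => //; exact: AG].
by have [_] := h x Ax.
Qed.

Lemma atom_triv : H0 w0 g0 -> pw w0 h0 -> trivIset atom id.
Proof.
move=> hw pw0 A B [_ cA [u pA]] [_ cB [v pB]] /= [x [Ax Bx]].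
apply/seteqP; split.
  by apply: (sconn_atom hw pw0 cA pA.1); [exists v|exists x].
by apply: (sconn_atom hw pw0 cB pB.1); [exists u|exists x].
Qed.

(** Atoms are disjoint, so at each point of [O] the representatives add up to at most [h0], and they
    determine the functions almost everywhere. *)
Lemma atoms_integral_le (s : seq (set E)) (u_ : set E -> E -> R) : H0 w0 g0 -> (forall x, 0 <= w0 x) ->
  pw w0 h0 -> uniq s -> (forall A, A \in s -> atom A) -> (forall A, A \in s -> piece A (u_ A)) ->
  \sum_(A <- s) \int[mu]_x u_ A x <= \int[mu]_x w0 x.
Proof.
move=> hw w0_ge0 pw0 us sa sp.
have H (t : seq (set E)) : (forall A, A \in t -> piece A (u_ A)) -> exists g,
    H0 (fun x => \sum_(A <- t) u_ A x) g /\
    pw (fun x => \sum_(A <- t) u_ A x) (fun x => \sum_(A <- t) if `[< A x >] then h0 x else 0).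
  elim: t => [|A t IH] hp.
    exists (fun _ _ => 0); split.
      by under eq_fun do rewrite big_nil; exact: H00.
    by move=> x Ox; under eq_fun do rewrite big_nil; rewrite big_nil; exact: lebpt_cst.
  have hp' B : B \in t -> piece B (u_ B) by move=> Bt; apply: hp; rewrite in_cons Bt orbT.
  have [g [hs ps]] := IH hp'.
  have [_ [gA [hA [sA _ pA EA]]]] := hp A (mem_head _ _); have hA0 := subsol_H0 sA.
  exists (fun i x => gA i x + g i x); split.
    by under eq_fun do rewrite big_cons; exact: H0D.
  move=> x Ox; under eq_fun do rewrite big_cons; rewrite big_cons.
  apply: lebptD; [exact: H0_loc hA0|exact: H0_loc hs| |exact: ps].
  by rewrite -EA//; exact: pA.
have [g [hs ps]] := H s sp.
have l1u A : A \in s -> l1 mu (u_ A) by move=> /sp; exact: piece_l1.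
have -> : \sum_(A <- s) \int[mu]_x u_ A x = \int[mu]_x (\sum_(A <- s) u_ A x).
  elim: (s) l1u => [|A t IH] hl; first by under eq_Rintegral do rewrite big_nil; rewrite big_nil integr0.
  have hl' B : B \in t -> l1 mu (u_ B) by move=> Bt; apply: hl; rewrite in_cons Bt orbT.
  under eq_Rintegral do rewrite big_cons; rewrite big_cons integrD ?IH//.
    by apply: hl; rewrite mem_head.
  elim: (t) hl' => [|B r IHr] hr; first by under eq_fun do rewrite big_nil; exact: l10.
  under eq_fun do rewrite big_cons; apply: l1D; first by apply: hr; rewrite mem_head.
  by apply: IHr => A' hA'; apply: hr; rewrite in_cons hA' orbT.
apply: integr_le; [exact: H0_l1 hs|exact: H0_l1 hw|].
apply: filterS2 (pw_ae hs ps) (pw_ae hw pw0) => x e1 e2.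
have [Ox|nO] := pselect (O x); last by rewrite (H0_out hs nO) (H0_out hw nO).
rewrite (e1 Ox) (e2 Ox); have h00 := pw_ge0 hw w0_ge0 pw0 Ox.
have [[A As Ax]|nA] := pselect (exists2 A, A \in s & A x); last first.
  rewrite big_seq big1// => A As; case: asboolP => // Ax; exfalso; apply: nA; by exists A.
rewrite (bigD1_seq A)//= big_seq_cond big1 ?addr0; first by case: asboolP.
move=> B /andP[Bs BA]; case: asboolP => // Bx; move/eqP: BA; case.
by apply: (atom_triv hw pw0 (sa B Bs) (sa A As)); exists x.
Qed.

Lemma atom_countable : 0 <= M -> subsol D M w0 g0 -> pw w0 h0 -> countable atom.
Proof.
move=> M0 sw pw0; have hw := subsol_H0 sw; have w0_ge0 x : 0 <= w0 x by case: sw.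
have H A : exists u, atom A -> piece A u.
  by have [[_ _ [u pu]]|nA] := pselect (atom A); [exists u|exists (fun=> 0)].
pose u_ A := projT1 (cid (H A)); have pu A : atom A -> piece A (u_ A) := projT2 (cid (H A)).
have u_gt0 A : atom A -> 0 < \int[mu]_x u_ A x.
  move=> aA; have [_ [g [h [su _ ph hA]]]] := pu A aA; have hu := subsol_H0 su.
  have u0 x : 0 <= u_ A x by case: su.
  rewrite lt_neqAle integr_ge0// andbT; apply/negP => /eqP i0.
  have ae0 : {ae mu, forall x, u_ A x = 0}.
    by apply: integr_eq0; [exact: H0_l1 hu|exact: aeW|rewrite -i0].
  have [[x Ax] _ _] := aA; have [Ox hx] := (pu A aA).1 x Ax.
  have := lebpt_unique (@loc_cst _ _ 0) (lebpt_ae_eq (H0_loc hu) (@loc_cst _ _ 0) ae0 (ph x Ox)) (@lebpt_cst _ _ 0 x).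
  by rewrite hA//; case: asboolP => // _ h00; rewrite h00 ltxx in hx.
(* By [atoms_integral_le], each [C j] has at most the integral of [w0] divided by [tau R j]
   members. *)
pose C j := [set A | atom A /\ tau R j < \int[mu]_x u_ A x].
have fC j : finite_set (C j).
  apply: contrapT => /infinite_set_fset hinf; set I := \int[mu]_x w0 x.
  have [B BC nB] := hinf (Num.truncn (I * j.+1%:R)).+1.
  have sB A : A \in finmap.enum_fset B -> C j A by move=> AB; apply: BC.
  have := @atoms_integral_le (finmap.enum_fset B) u_ hw w0_ge0 pw0 (finmap.fset_uniq B)
    (fun A AB => (sB A AB).1) (fun A AB => pu A (sB A AB).1).
  apply/negP; rewrite -ltNge.
  apply: (@lt_le_trans _ _ (\sum_(A <- finmap.enum_fset B) tau R j)); last first.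
    by rewrite big_seq [leRHS]big_seq; apply: ler_sum => A /sB[_ /ltW].
  rewrite big_const_seq count_predT iter_addr_0 -mulr_natl -/I.
  rewrite ltr_pdivlMr//.
  by apply: (lt_le_trans (truncnS_gt _)); rewrite ler_nat.
rewrite (_ : atom = \bigcup_j C j); first by apply: bigcup_countable => // j _; exact: finite_set_countable.
apply/seteqP; split => [A aA|A [j _ []]//].
have [K _ hK] : \forall k \near \oo, `|tau R k| < \int[mu]_x u_ A x.
  by move/cvgr0Pnorm_lt : (@cvg_harmonicS R) => /(_ _ (u_gt0 A aA)).
exists K => //; split => //; apply: le_lt_trans (ler_norm _) (hK K (leqnn K)).
Qed.

(** A function defining a Sobolev-open set may be unbounded. Its minimum with [w0] is bounded, so it
    can be normalised for the series, and it defines the same set because [A] lies in [G]. *)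
Lemma sopen_bigcup (K : set (set E)) : H0 w0 g0 -> (forall x, 0 <= w0 x) ->
  (exists C : R, forall x, w0 x <= C) -> pw w0 h0 -> countable K ->
  (forall A, K A -> sopen A /\ A `<=` G) -> sopen (\bigcup_(A in K) A).
Proof.
move=> hw w0_ge0 [C wC] pw0 /countable_injP[f finj] hK.
have H k : exists ugh : (E -> R) * ('I_n.+1 -> E -> R) * (E -> R),
    [/\ H0 ugh.1.1 ugh.1.2, dot ugh.1.2 ugh.1.2 <= 1, (forall x, 0 <= ugh.1.1 x <= 1), pw ugh.1.1 ugh.2 &
      forall x, O x -> (0 < ugh.2 x <-> exists A, [/\ K A, f A = k & A x])].
  (* Indices that number no member of [K] receive the zero function. *)
  have [[A [KA fA]]|nA] := pselect (exists A, K A /\ f A = k); last first.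
    exists (fun=> 0, fun _ _ => 0, fun=> 0); split => //=.
    - exact: H00.
    - rewrite /dot big1// => i _; rewrite -[RHS](integr0 mu); apply: eq_Rintegral => x _; exact: mulr0.
    - by move=> x; rewrite lexx ler01.
    - by move=> x Ox; exact: lebpt_cst.
    - by move=> x Ox; rewrite ltxx; split => // -[A [KA fA _]]; exfalso; apply: nA; exists A.
  have [[u [g [h [hu u0 pu EA]]]] AG] := hK A KA.
  have [gm hm] : exists gm, H0 (fun x => Num.min (u x) (w0 x)) gm by eexists; exact: H0_min hu hw.
  have mC x : Num.min (u x) (w0 x) <= C by rewrite ge_min wC orbT.
  have [c [c0 c1 cm cd]] := H0_normalise hm mC.
  exists (fun x => c * Num.min (u x) (w0 x), fun i x => c * gm i x, fun x => c * Num.min (h x) (h0 x)).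
  split => //=.
  - exact: H0Z.
  - by move=> x; rewrite cm mulr_ge0 ?(ltW c0)// le_min u0 w0_ge0.
  - move=> x Ox; apply: lebptZ; first exact: H0_loc hm.
    by apply: lebpt_min; [exact: H0_loc hu|exact: H0_loc hw|exact: pu|exact: pw0].
  - move=> x Ox; rewrite pmulr_rgt0// lt_min; split=> [/andP[h1 h2]|[A' [KA' fA' A'x]]].
      by exists A; split => //; rewrite EA.
    have EAA : A' = A by apply: finj; rewrite ?inE// fA' fA.
    rewrite EAA in A'x; have [_ ->] := AG x A'x; rewrite andbT.
    by move: A'x; rewrite EA => -[].
pose u_ k := (projT1 (cid (H k))).1.1; pose g_ k := (projT1 (cid (H k))).1.2.
pose h_ k := (projT1 (cid (H k))).2.
have hu k : H0 (u_ k) (g_ k) by have [] := projT2 (cid (H k)).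
have hg k : dot (g_ k) (g_ k) <= 1 by have [] := projT2 (cid (H k)).
have hb x k : 0 <= u_ k x <= 1 by have [_ _ + _ _] := projT2 (cid (H k)); apply.
have ph k : pw (u_ k) (h_ k) by have [] := projT2 (cid (H k)).
have hh k x : O x -> (0 < h_ k x <-> exists A, [/\ K A, f A = k & A x]).
  by have [_ _ _ _] := projT2 (cid (H k)); apply.
have [g [hU _]] := H0_sersum hu hg hb; have [hb' pU] := pw_sersum hu hg hb ph.
exists (fun x => sersum (u_ ^~ x)), g, (fun x => sersum (h_ ^~ x)); split => //.
  by move=> x; have /andP[+ _] := sersumP 0 (hb x).
apply/seteqP; split => [x [A KA Ax]|x [Ox]] /=.
  have [Ox hx] := (hK A KA).2 x Ax; split => //; apply/(sersum_gt0 (hb' x Ox)).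
  by exists (f A); apply/(hh _ _ Ox); exists A.
by move=> /(sersum_gt0 (hb' x Ox))[k /(hh _ _ Ox)[A [KA _ Ax]]]; exists A.
Qed.

Theorem unique_decomposition : 0 <= M -> subsol D M w0 g0 -> pw w0 h0 ->
  exists C, unique (sdecomp G) C.
Proof.
move=> M0 sw pw0; have hw := subsol_H0 sw; have w0_ge0 x : 0 <= w0 x by case: sw.
have wb : exists C : R, forall x, w0 x <= C by case: sw.
have aG A : atom A -> A `<=` G by move=> [_ _ [u []]].
exists atom; split.
  split; [exact: atom_countable|exact: atom_triv| |].
    apply/seteqP; split => [x [A aA Ax]|x Gx]; first exact: aG Ax.
    by have [A aA Ax] := atom_cover M0 sw pw0 Gx; exists A.
  by move=> A [A0 cA [u pA]]; split => //; exact: piece_sopen pA.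
move=> C [cC tC CG hC].
have CsubG B : C B -> B `<=` G by move=> CB x Bx; rewrite -CG; exists B.
(* [B] lies in [A] because [B] is connected and [A] is a piece. Conversely [A] is covered by [B] and
   the union of the other members of [C], which is Sobolev-open because [C] is countable. *)
have key A B x : atom A -> C B -> A x -> B x -> A = B.
  move=> aA CB Ax Bx; have [_ sB cB] := hC B CB; have [_ cA pA] := aA.
  have BA : B `<=` A by apply: (sconn_atom hw pw0 cB (CsubG B CB) pA); exists x.
  apply/seteqP; split => //.
  have [|||//|h] := cA.2 B (\bigcup_(B' in C `\ B) B') sB.
  - apply: sopen_bigcup => //; first by apply: sub_countable cC; exact: card_le_setD.
    by move=> B' [CB' _]; have [_ ? _] := hC B' CB'; split => //; exact: CsubG.
  - rewrite -subset0 => y [By [B' [CB' nBB'] B'y]]; apply: nBB'.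
    by apply: (tC _ _ CB' CB); exists y.
  - move=> y Ay; have : G y by exact: aG Ay.
    rewrite -CG => -[B' CB' B'y]; have [BB'|nBB'] := pselect (B' = B).
      by left; rewrite -BB'.
    by right; exists B'.
  have [B' [CB' nBB'] B'x] := h x Ax; exfalso; apply: nBB'.
  by apply: (tC _ _ CB' CB); exists x.
apply/seteqP; split => [A aA|B CB].
  have [[x Ax] _ _] := aA; have : G x by exact: aG Ax.
  by rewrite -CG => -[B CB Bx]; rewrite (key A B x).
have [[x Bx] _ _] := hC B CB; have [A aA Ax] := atom_cover M0 sw pw0 (CsubG B CB x Bx).
by rewrite -(key A B x).
Qed.

End pieces.
End decomposition.

(** * Solutions *)

Section solutions.
Variables (R : realType) (n : nat) (D : bdomain R n.+1).
Local Notation O := (dom D).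
Local Notation mu := (lebesgue R n.+1).
Local Notation E := 'rV[R]_n.+1.
Local Notation test := (test_function O).
Local Notation H0 := (H0 D).
Local Notation pw := (pw D).
Variables (v : E -> R) (P : set E).
Implicit Types (phi f w a : E -> R) (g h : 'I_n.+1 -> E -> R) (i : 'I_n.+1).

(* [v] is the finite part of the potential and [P] the set where it is
   infinite, so that [V w] becomes the product [v * w] of reals. *)
Record weak_sol f w g : Prop := {
  sol_H0 : H0 w g;
  sol_l1 : l1 mu (fun x => v x * w x);
  sol_meas : measurable_fun setT f;
  sol_rhs : (forall x, 0 <= f x) /\ exists C : R, forall x, f x <= C;
  sol_eq : forall phi, test phi ->
    dot g (fun i => partial i phi) + \int[mu]_x (v x * w x * phi x) = \int[mu]_x (f x * phi x) }.

(** For a solution of the equation the added fields hold after a change on a null set: the sign is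
    [weak_sol_ge0], and integrability of [V w] forces [w = 0] on the poles. *)
Record sol f w g : Prop := {
  sol_weak :> weak_sol f w g;
  sol_ge0 : forall x, 0 <= w x;
  sol_bd : exists C : R, forall x, w x <= C;
  sol_pole : {ae mu, forall x, P x -> w x = 0} }.

Lemma sol_intro f w g : H0 w g -> (forall x, 0 <= w x) -> (exists C : R, forall x, w x <= C) ->
  l1 mu (fun x => v x * w x) -> {ae mu, forall x, P x -> w x = 0} -> measurable_fun setT f ->
  ((forall x, 0 <= f x) /\ exists C : R, forall x, f x <= C) ->
  (forall phi, test phi ->
    dot g (fun i => partial i phi) + \int[mu]_x (v x * w x * phi x) = \int[mu]_x (f x * phi x)) ->
  sol f w g.
Proof. by []. Qed.

Lemma H0cvg_mul phi (u_ : nat -> E -> R) (g_ : nat -> 'I_n.+1 -> E -> R) u g : test phi ->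
  (forall k, H0 (u_ k) (g_ k)) -> H0 u g -> H0cvg u_ g_ u g ->
  H0cvg (fun k x => phi x * u_ k x) (fun k i x => phi x * g_ k i x + partial i phi x * u_ k x)
    (fun x => phi x * u x) (fun i x => phi x * g i x + partial i phi x * u x).
Proof.
move=> tphi hk hu [cu cg].
have bM (psi : E -> R) (a_ : nat -> E -> R) a : test psi -> (forall k, l2 mu (a_ k)) -> l2 mu a ->
    l2cvg mu a_ a -> [/\ forall k, l2 mu (fun x => psi x * a_ k x), l2 mu (fun x => psi x * a x) &
    l2cvg mu (fun k x => psi x * a_ k x) (fun x => psi x * a x)].
  move=> tpsi ha_ ha ca; have [C C0 hC] := test_bounded tpsi; have mp := test_meas tpsi.
  split=> [k||]; [exact: l2_bM mp hC (ha_ k)|exact: l2_bM mp hC ha|].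
  apply: (@l2cvg_bM _ _ _ mu (fun=> psi) a_ psi a C) => //.
  by apply: aeW => x _; exact: cvg_cst.
split=> [|i]; first by have [] := bM phi u_ u tphi (fun k => H0_l2 (hk k)) (H0_l2 hu) cu.
have [a1 a2 a3] := bM phi _ _ tphi (fun k => H0_l2g i (hk k)) (H0_l2g i hu) (cg i).
have [b1 b2 b3] := bM _ _ _ (test_partial i tphi) (fun k => H0_l2 (hk k)) (H0_l2 hu) cu.
exact: l2cvgD.
Qed.

Lemma integr_mul_cvg a b (C : R) (phi_ : nat -> E -> R) phi : l1 mu b ->
  measurable_fun setT a -> (forall k, measurable_fun setT (phi_ k)) -> measurable_fun setT phi ->
  (forall x, `|a x| <= `|b x|) -> (forall k x, `|phi_ k x| <= C) ->
  {ae mu, forall x, phi_ k x @[k --> \oo] --> phi x} ->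
  \int[mu]_x (a x * phi_ k x) @[k --> \oo] --> \int[mu]_x (a x * phi x).
Proof.
move=> hb ma mk mp ab hC hc.
apply: (@integr_dct _ _ _ mu (fun k x => a x * phi_ k x) _ (fun x => C * `|b x|) _ _ _ _ _).2.
- by move=> k; exact: measurable_funM.
- exact: measurable_funM.
- by apply: l1Z; exact: l1_norm.
- by apply: filterS hc => x hx; exact: (rcvgZ hx (erefl _)).
- move=> k; apply: aeW => x; rewrite normrM mulrC.
  by rewrite ler_pM.
Qed.

(** [v * w] is merely integrable, so the test functions are enlarged only to products with a bounded
    function of [a]: the approximants then stay bounded and dominated convergence handles the
    potential term. *)
Lemma sol_step f w g a h phi (e : R) : weak_sol f w g -> H0 a h -> 0 < e -> test phi ->
  dot g (fun i x => phi x * (dstep_approx e (a x) * h i x) + partial i phi x * step_approx e (a x)) +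
  \int[mu]_x (v x * w x * (phi x * step_approx e (a x))) =
  \int[mu]_x (f x * (phi x * step_approx e (a x))).
Proof.
move=> hs ha e0 tphi; have hw := sol_H0 hs; have hg := H0_l2v hw.
have [_ _ _ [p tp cp]] := ha.
have [s ks cs] := H0_chain_cvg (@chain_step R n e) (@continuous_dstep R e)
  (fun t => dstep_norm t e0) ha tp cp.
have hq := H0_step e0 ha.
have tq' k : test (step_approx e \o p (s k)) := test_chain (@chain_step R n e) (tp (s k)).
have [s2 ks2 ae2] := l2cvg_ae (fun k => test_l2 (tq' k)) (H0_l2 hq) cs.1.
pose q k := step_approx e \o p (s (s2 k)).
have tq k : test (q k) := tq' (s2 k).
have cq : H0cvg q (fun k i => partial i (q k)) (step_approx e \o a)
    (fun i x => dstep_approx e (a x) * h i x) := H0cvg_sub ks2 cs.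
have hqk k := H0_test (tq k).
have ct := H0cvg_mul tphi hqk hq cq.
have tt k : test (fun x => phi x * q k x) := test_smoothM (test_smooth tphi) (tq k).
have [C C0 hC] := test_bounded tphi.
have mphi := test_meas tphi.
have tb k x : `|phi x * q k x| <= C.
  by rewrite normrM -[leRHS]mulr1 ler_pM// step_norm.
have tc : {ae mu, forall x, phi x * q k x @[k --> \oo] --> phi x * step_approx e (a x)}.
  by apply: filterS ae2 => x hx; exact: (rcvgZ hx (erefl _)).
have mt : measurable_fun setT (fun x => phi x * step_approx e (a x)).
  by apply: measurable_funM => //; apply: measurable_step; exact: H0_meas ha.
have Ek k : dot g (fun i x => phi x * partial i (q k) x + partial i phi x * q k x) +
    \int[mu]_x (v x * w x * (phi x * q k x)) = \int[mu]_x (f x * (phi x * q k x)).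
  rewrite -(sol_eq hs (tt k)); congr (_ + _); apply: eq_bigr => i _.
  apply: eq_Rintegral => x _; rewrite (partialM i (test_smooth tphi) (test_smooth (tq k))).
  by rewrite (mulrC (q k x)).
have c1 : dot g (fun i x => phi x * partial i (q k) x + partial i phi x * q k x) @[k --> \oo] -->
    dot g (fun i x => phi x * (dstep_approx e (a x) * h i x) + partial i phi x * step_approx e (a x)).
  apply: (dot_cvg (g_ := fun=> g)) => //.
  - by move=> k; exact: H0_l2v (H0_mul tphi (hqk k)).
  - exact: H0_l2v (H0_mul tphi hq).
  - by move=> i; exact: l2cvg_cst.
  - exact: ct.2.
have c2 : \int[mu]_x (v x * w x * (phi x * q k x)) @[k --> \oo] -->
    \int[mu]_x (v x * w x * (phi x * step_approx e (a x))).
  apply: (integr_mul_cvg (b := fun x => v x * w x) (C := C)) => //; first exact: sol_l1 hs.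
    exact: l1_meas (sol_l1 hs).
  by move=> k; exact: test_meas (tt k).
have c3 : \int[mu]_x (f x * (phi x * q k x)) @[k --> \oo] -->
    \int[mu]_x (f x * (phi x * step_approx e (a x))).
  have [f0 [A fA]] := sol_rhs hs; have mf := sol_meas hs.
  have E1 (b : E -> R) : \int[mu]_x (f x * (phi x * b x)) = \int[mu]_x (f x * phi x * b x).
    by apply: eq_Rintegral => x _; rewrite mulrA.
  rewrite (E1 (step_approx e \o a)); apply: (eq_rcvg (fun k => esym (E1 (q k)))).
  apply: (integr_mul_cvg (b := fun x => A * phi x) (C := 1)).
  - by apply: l1Z; exact: test_l1 tphi.
  - exact: measurable_funM.
  - by move=> k; exact: test_meas (tq k).
  - by apply: measurable_step; exact: H0_meas ha.
  - move=> x; rewrite !normrM ler_wpM2r// ger0_norm//.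
    by apply: (le_trans (fA x)); exact: ler_norm.
  - by move=> k x; exact: step_norm.
  - exact: ae2.
have c4 := rcvgD c1 c2 (erefl _).
have c5 : \int[mu]_x (f x * (phi x * q k x)) @[k --> \oo] -->
    dot g (fun i x => phi x * (dstep_approx e (a x) * h i x) + partial i phi x * step_approx e (a x)) +
    \int[mu]_x (v x * w x * (phi x * step_approx e (a x))).
  by apply: eq_rcvg Ek _; exact: c4.
exact: (cvg_unique (@norm_hausdorff _ _) c5 c3).
Qed.

Lemma dot_comb (k : R) G g h : l2v G -> l2v g -> l2v h ->
  dot (fun i x => g i x + k * h i x) G = dot g G + k * dot h G.
Proof.
move=> hG hg hh; rewrite dotC dotDr//; last by move=> i; exact: l2Z.
by rewrite dotZr// !(dotC G).
Qed.

Lemma l1_mul_bd (a b : E -> R) (C : R) : measurable_fun setT b -> (forall x, `|b x| <= C) -> l1 mu a ->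
  l1 mu (fun x => a x * b x).
Proof.
move=> mb hb ha; apply: (l1_le _ (l1Z C (l1_norm ha))).
  by apply: measurable_funM => //; exact: l1_meas ha.
apply: aeW => x; rewrite normrM mulrC [leRHS]ger0_norm ?ler_wpM2r//.
by rewrite mulr_ge0// (le_trans _ (hb x)).
Qed.

Lemma sol_pos f1 w1 g1 f2 w2 g2 (k M : R) : (forall x, 0 <= v x) -> 0 <= M ->
  sol f1 w1 g1 -> sol f2 w2 g2 -> (forall x, f1 x + k * f2 x <= M) ->
  subsol D M (fun x => Num.max (w1 x + k * w2 x) 0)
    (fun i x => (0 < w1 x + k * w2 x)%R%:R * (g1 i x + k * g2 i x)).
Proof.
move=> v0 M0 s1 s2 fM; have h1 := sol_H0 s1; have h2 := sol_H0 s2.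
have ha := H0D h1 (H0Z k h2); have hg := H0_l2v ha.
have [C1 wC1] := sol_bd s1; have [C2 wC2] := sol_bd s2.
split; first exact: (H0_pos ha).1.
- by move=> x; rewrite le_max lexx orbT.
- exists (C1 + `|k| * C2) => x; have w1_ge0 := sol_ge0 s1 x; have w2_ge0 := sol_ge0 s2 x.
  have a1 : k * w2 x <= `|k| * C2 by rewrite (le_trans (ler_norm _))// normrM (ger0_norm w2_ge0) ler_wpM2l.
  have a2 : 0 <= `|k| * C2 by rewrite mulr_ge0// (le_trans w2_ge0).
  by rewrite ge_max lerD//= addr_ge0// (le_trans w1_ge0).
apply: (kato M0 hg ha).
  by apply: aeW => x; apply: sumr_ge0 => i _; rewrite -expr2 sqr_ge0.
move=> psi e e0 tpsi psi0; have [C C0 hC] := test_bounded tpsi.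
have hpsi := H0_mul tpsi (H0_step e0 ha); have lpsi := H0_l2v hpsi.
rewrite (dot_comb k lpsi (H0_l2v h1) (H0_l2v h2)).
have mb : measurable_fun setT (fun x => psi x * step_approx e (w1 x + k * w2 x)).
  exact: H0_meas hpsi.
have bb x : `|psi x * step_approx e (w1 x + k * w2 x)| <= C.
  by rewrite normrM -[leRHS]mulr1 ler_pM// step_norm.
have E1 := sol_step s1 ha e0 tpsi; have E2 := sol_step s2 ha e0 tpsi.
have l1w1 := l1_mul_bd mb bb (sol_l1 s1); have l1w2 := l1_mul_bd mb bb (sol_l1 s2).
have lb := H0_l1 hpsi; rewrite /= in lb.
have l1f (f : E -> R) w g : sol f w g -> l1 mu (fun x => f x * (psi x * step_approx e (w1 x + k * w2 x))).
  move=> s; have [f0 [A fA]] := sol_rhs s; under eq_fun do rewrite mulrC.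
  apply: (@l1_mul_bd _ f A) => //; first exact: sol_meas s.
  by move=> x; rewrite ger0_norm.
have l1f1 := l1f _ _ _ s1; have l1f2 := l1f _ _ _ s2.
have le1 : \int[mu]_x (f1 x * (psi x * step_approx e (w1 x + k * w2 x))) +
    k * \int[mu]_x (f2 x * (psi x * step_approx e (w1 x + k * w2 x))) <=
    M * \int[mu]_x (psi x * step_approx e (w1 x + k * w2 x)).
  rewrite -(integrZ k l1f2) -(integrZ M lb) -(integrD l1f1 (l1Z k l1f2)).
  apply: integr_le; [exact: l1D l1f1 (l1Z k l1f2)|exact: l1Z|].
  apply: aeW => x; rewrite [k * (_ * _)]mulrA -mulrDl ler_wpM2r ?fM//.
  by rewrite mulr_ge0// step_ge0.
have le2 : 0 <= \int[mu]_x (v x * w1 x * (psi x * step_approx e (w1 x + k * w2 x))) +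
    k * \int[mu]_x (v x * w2 x * (psi x * step_approx e (w1 x + k * w2 x))).
  rewrite -(integrZ k l1w2) -(integrD l1w1 (l1Z k l1w2)); apply: integr_ge0 => x.
  rewrite [k * (_ * _)]mulrA -mulrDl (_ : v x * w1 x + _ = v x * (w1 x + k * w2 x)); last by ring.
  have [a0|a0] := leP (w1 x + k * w2 x) 0.
    by rewrite /step_approx gexp_le0 ?mulr0// mulr_ge0_le0 ?invr_ge0 ?(ltW e0).
  by rewrite mulr_ge0 ?mulr_ge0 ?(ltW a0)// step_ge0.
by move: le1 le2; rewrite -E1 -E2; lra.
Qed.

(** The weak maximum principle: the positive part of [- w] satisfies the weak inequality with
    [M = 0]; tested with itself, its gradient vanishes. *)
Lemma weak_sol_ge0 f w g : (forall x, 0 <= v x) -> weak_sol f w g -> {ae mu, forall x, 0 <= w x}.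
Proof.
move=> v0 s; have hw := sol_H0 s; have ha := H0Z (-1) hw; have hg := H0_l2v ha.
have [f0 [A fA]] := sol_rhs s; have lg := H0_l2v hw.
have [hp _] := H0_pos ha; have lp := H0_l2v hp.
have sq0 : {ae mu, forall x, 0 <= \sum_i (-1 * g i x) * (-1 * g i x)}.
  by apply: aeW => x; apply: sumr_ge0 => i _; rewrite -expr2 sqr_ge0.
have test_ineq (psi : E -> R) (e : R) : 0 < e -> test psi -> (forall x, 0 <= psi x) ->
    dot (fun i x => -1 * g i x) (fun i x => psi x * (dstep_approx e (-1 * w x) * (-1 * g i x)) +
                      partial i psi x * step_approx e (-1 * w x)) <=
    0 * \int[mu]_x (psi x * step_approx e (-1 * w x)).
  move=> e0 tpsi psi0; have E1 := sol_step s ha e0 tpsi.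
  have hpsi := H0_mul tpsi (H0_step e0 ha); have lpsi := H0_l2v hpsi.
  rewrite mul0r dotC dotZr// dotC mulN1r oppr_le0.
  have le1 : 0 <= \int[mu]_x (f x * (psi x * step_approx e (-1 * w x))).
    by apply: integr_ge0 => x; rewrite !mulr_ge0// step_ge0.
  have le2 : 0 <= - \int[mu]_x (v x * w x * (psi x * step_approx e (-1 * w x))).
    have [C C0 hC] := test_bounded tpsi.
    rewrite -integrN; last first.
      apply: (@l1_mul_bd _ _ C) (sol_l1 s); first exact: H0_meas hpsi.
      by move=> x; rewrite normrM -[leRHS]mulr1 ler_pM// step_norm.
    apply: integr_ge0 => x; have [w0|w0] := leP 0 (w x).
      by rewrite /step_approx gexp_le0 ?mulr0 ?oppr0// mulN1r mulrN oppr_le0 mulr_ge0// invr_ge0 ltW.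
    rewrite -mulNr mulr_ge0 ?mulr_ge0 ?step_ge0// -mulrN mulr_ge0// oppr_ge0 ltW//.
  by move: le1; rewrite -E1; lra.
have h1 := kato (lexx 0) hg ha sq0 test_ineq.
have p0 : {ae mu, forall x, 0 <= Num.max (-1 * w x) 0} by apply: aeW => x; rewrite le_max lexx orbT.
have h2 := weak_ineq_ext lp h1 hp p0; rewrite mul0r in h2.
by apply: filterS (H0_grad0 hp h2) => x /max_idPr; rewrite mulN1r oppr_le0.
Qed.

Lemma weak_sol_ae_eq f w w' g : measurable_fun setT v -> weak_sol f w g -> measurable_fun setT w' ->
  (forall x, ~ O x -> w' x = 0) -> {ae mu, forall x, w x = w' x} -> weak_sol f w' g.
Proof.
move=> mv s mw w'O ww'; have hw := sol_H0 s.
have vw : {ae mu, forall x, v x * w x = v x * w' x} by apply: filterS ww' => x ->.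
have mvw : measurable_fun setT (fun x => v x * w' x) by exact: measurable_funM.
split.
- apply: (H0_ae_eq hw) => //; first by move=> i; exact: H0_measg hw.
    by move=> x nO; split; [exact: w'O|case: hw => _ _ /(_ x nO)[]].
  by move=> i; exact: aeW.
- exact: l1_ae_eq mvw vw (sol_l1 s).
- exact: sol_meas s.
- exact: sol_rhs s.
- move=> phi tphi; rewrite -(sol_eq s tphi); congr (_ + _); apply: integr_ae_eq.
  + by apply: measurable_funM => //; exact: test_meas tphi.
  + by apply: measurable_funM; [exact: l1_meas (sol_l1 s)|exact: test_meas tphi].
  + by apply: filterS vw => x ->.
Qed.

Lemma sol_bound f w g : sol f w g -> exists2 M : R, 0 <= M & forall x, f x <= M.
Proof.
move=> s; have [f0 [C fC]] := sol_rhs s; exists C => //.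
by apply: (le_trans (f0 0)).
Qed.

Lemma sol0 : sol (fun=> 0) (fun=> 0) (fun _ _ => 0).
Proof.
have i0 (b : E -> R) : \int[mu]_x (0 * b x) = 0.
  by under eq_Rintegral do rewrite mul0r; exact: integr0.
apply: sol_intro => //; first exact: H00.
- by exists 0.
- by under eq_fun do rewrite mulr0; exact: l10.
- exact: aeW.
- by split => //; exists 0.
- move=> phi tphi; under eq_Rintegral do rewrite mulr0; rewrite i0 addr0.
  by rewrite /dot big1.
Qed.

Lemma sol_subsol f w g (M : R) : (forall x, 0 <= v x) -> 0 <= M -> (forall x, f x <= M) ->
  sol f w g -> exists g', subsol D M w g'.
Proof.
move=> v0 M0 fM s.
rewrite (_ : w = (fun x => Num.max (w x + 0 * 0) 0)).
  by eexists; apply: (@sol_pos f w g _ _ _ 0 M v0 M0 s sol0) => x; rewrite mul0r addr0.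
by apply/funext => x; rewrite mul0r addr0; apply/esym/max_idPl; exact: sol_ge0 s x.
Qed.

Lemma sol_comb f1 w1 g1 f2 w2 g2 (a b : R) : 0 <= a -> 0 <= b -> sol f1 w1 g1 -> sol f2 w2 g2 ->
  sol (fun x => a * f1 x + b * f2 x) (fun x => a * w1 x + b * w2 x)
    (fun i x => a * g1 i x + b * g2 i x).
Proof.
move=> a0 b0 s1 s2; have h1 := sol_H0 s1; have h2 := sol_H0 s2.
have Ev x : v x * (a * w1 x + b * w2 x) = a * (v x * w1 x) + b * (v x * w2 x) by ring.
apply: sol_intro.
- exact: H0D (H0Z a h1) (H0Z b h2).
- by move=> x; rewrite addr_ge0// mulr_ge0// ?(sol_ge0 s1) ?(sol_ge0 s2).
- have [C1 c1] := sol_bd s1; have [C2 c2] := sol_bd s2; exists (a * C1 + b * C2) => x.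
  by rewrite lerD// ler_wpM2l.
- by under eq_fun do rewrite Ev; apply: l1D; apply: l1Z; [exact: sol_l1 s1|exact: sol_l1 s2].
- by apply: filterS2 (sol_pole s1) (sol_pole s2) => x e1 e2 Px; rewrite e1// e2// !mulr0 addr0.
- by apply: measurable_funD; apply: measurable_funM => //; [exact: sol_meas s1|exact: sol_meas s2].
- have [f10 [C1 c1]] := sol_rhs s1; have [f20 [C2 c2]] := sol_rhs s2.
  split; first by move=> x; rewrite addr_ge0// mulr_ge0.
  by exists (a * C1 + b * C2) => x; rewrite lerD// ler_wpM2l.
- move=> phi tphi; have [C C0 hC] := test_bounded tphi; have mphi := test_meas tphi.
  have l1w1 := l1_mul_bd mphi hC (sol_l1 s1); have l1w2 := l1_mul_bd mphi hC (sol_l1 s2).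
  have l1f (f : E -> R) w g : sol f w g -> l1 mu (fun x => f x * phi x).
    move=> s; have [f0 [A fA]] := sol_rhs s; under eq_fun do rewrite mulrC.
    apply: (@l1_mul_bd _ f A); [exact: sol_meas s|by move=> x; rewrite ger0_norm|exact: test_l1 tphi].
  have -> : \int[mu]_x (v x * (a * w1 x + b * w2 x) * phi x) =
      a * \int[mu]_x (v x * w1 x * phi x) + b * \int[mu]_x (v x * w2 x * phi x).
    rewrite -!integrZ// -integrD; [|exact: l1Z|exact: l1Z].
    by apply: eq_Rintegral => x _; ring.
  have -> : \int[mu]_x ((a * f1 x + b * f2 x) * phi x) =
      a * \int[mu]_x (f1 x * phi x) + b * \int[mu]_x (f2 x * phi x).
    have k1 := l1f _ _ _ s1; have k2 := l1f _ _ _ s2.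
    rewrite -!integrZ// -integrD; [|exact: l1Z|exact: l1Z].
    by apply: eq_Rintegral => x _; ring.
  rewrite -(sol_eq s1 tphi) -(sol_eq s2 tphi).
  have lp := test_l2v tphi; have lg1 := H0_l2v h1; have lg2 := H0_l2v h2.
  rewrite [in LHS]dotC dotDr//; [|by move=> i; exact: l2Z..].
  by rewrite !dotZr// !(dotC (fun i => partial i phi)); ring.
Qed.

Lemma sol_ser (f_ w_ : nat -> E -> R) (g_ : nat -> 'I_n.+1 -> E -> R) l p :
  (forall k, sol (f_ k) (w_ k) (g_ k)) ->
  sol (fun x => ser (f_ ^~ x) l p) (fun x => ser (w_ ^~ x) l p) (fun i x => ser (fun k => g_ k i x) l p).
Proof.
move=> hs; elim: p l => [|p IH] l /=; first exact: sol0.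
by have := @sol_comb _ _ _ _ _ _ 2^-1 2^-1 _ _ (hs l) (IH l.+1); apply; rewrite invr_ge0.
Qed.

Lemma integr_v_ser (f_ w_ : nat -> E -> R) (g_ : nat -> 'I_n.+1 -> E -> R) l p :
  (forall k, sol (f_ k) (w_ k) (g_ k)) -> (forall k, \int[mu]_x (v x * w_ k x) <= 1) ->
  \int[mu]_x (v x * ser (w_ ^~ x) l p) <= 1.
Proof.
move=> hs hv; elim: p l => [|p IH] l /=.
  by under eq_Rintegral do rewrite mulr0; rewrite integr0 ler01.
have k1 := sol_l1 (hs l); have k2 := sol_l1 (sol_ser l.+1 p hs).
have -> : \int[mu]_x (v x * (2^-1 * w_ l x + 2^-1 * ser (w_ ^~ x) l.+1 p)) =
   2^-1 * \int[mu]_x (v x * w_ l x) + 2^-1 * \int[mu]_x (v x * ser (w_ ^~ x) l.+1 p).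
  rewrite -!integrZ// -integrD; [|exact: l1Z|exact: l1Z].
  by apply: eq_Rintegral => x _; ring.
by have := hv l; have := IH l.+1; lra.
Qed.

Lemma sol_sersum (f_ w_ : nat -> E -> R) (g_ : nat -> 'I_n.+1 -> E -> R) :
  measurable_fun setT v -> (forall x, 0 <= v x) ->
  (forall k, sol (f_ k) (w_ k) (g_ k)) -> (forall k x, w_ k x <= 1) -> (forall k x, f_ k x <= 1) ->
  (forall k, dot (g_ k) (g_ k) <= 1) -> (forall k, \int[mu]_x (v x * w_ k x) <= 1) ->
  exists g, sol (fun x => sersum (f_ ^~ x)) (fun x => sersum (w_ ^~ x)) g.
Proof.
move=> mv v0 hs w1 f1 g1 vw1; have hw k := sol_H0 (hs k).
have wb x k : 0 <= w_ k x <= 1 by rewrite (sol_ge0 (hs k)) w1.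
have fb x k : 0 <= f_ k x <= 1 by have [-> _] := sol_rhs (hs k); rewrite f1.
have [g [hU cU]] := H0_sersum hw g1 wb.
have hk m := sol_ser 0 m hs.
have cw x := cvg_ser (wb x); have cf x := cvg_ser (fb x).
have ub (a : nat -> R) : (forall k, 0 <= a k <= 1) -> 0 <= sersum a <= 1.
  by move=> ha; have := sersumP 0 ha; rewrite /= add0r expr0.
have ser_le (a : nat -> R) m : (forall k, 0 <= a k <= 1) -> `|ser a 0 m| <= sersum a.
  by move=> ha; have /andP[h1 _] := sersumP m ha; have /andP[h2 _] := ser_bd 0 m ha; rewrite ger0_norm.
(* Taking square roots brings the integrands under [fatou_sq]; the uniform bound [1] is
   [integr_v_ser]. *)
have vU : l1 mu (fun x => v x * sersum (w_ ^~ x)).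
  have msq (b : E -> R) : measurable_fun setT b -> measurable_fun setT (fun x => Num.sqrt (b x)).
    move=> mb; apply: (@measurableT_comp _ _ _ _ _ _ (@Num.sqrt R)) => //.
    by apply: continuous_measurable_fun; exact: sqrt_continuous.
  have sq_ser m x : Num.sqrt (v x * ser (w_ ^~ x) 0 m) ^+ 2 = v x * ser (w_ ^~ x) 0 m.
    by rewrite sqr_sqrtr// mulr_ge0//; case/andP: (ser_bd 0 m (wb x)).
  have [||||[_ h] _] := @fatou_sq _ _ _ mu (fun m x => Num.sqrt (v x * ser (w_ ^~ x) 0 m))
    (fun x => Num.sqrt (v x * sersum (w_ ^~ x))) 1.
  - move=> m; split.
      by apply: msq; exact: l1_meas (sol_l1 (hk m)).
    by under eq_fun do rewrite sq_ser; exact: sol_l1 (hk m).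
  - by apply: msq; apply: measurable_funM => //; exact: H0_meas hU.
  - apply: aeW => x; apply: (continuous_cvg _ (@sqrt_continuous R _)).
    exact: (rcvgZ (cw x) (erefl _)).
  - apply: nearW => m; under eq_Rintegral do rewrite sq_ser.
    exact: integr_v_ser hs vw1.
  rewrite (_ : (fun x => _) = (fun x => Num.sqrt (v x * sersum (w_ ^~ x)) ^+ 2))//.
  by apply/funext => x; rewrite sqr_sqrtr// mulr_ge0//; case/andP: (ub _ (wb x)).
have mf : measurable_fun setT (fun x => sersum (f_ ^~ x)).
  apply: (measurable_fun_cvg (h := fun m x => ser (f_ ^~ x) 0 m)) => [m|x _]; last exact: cf.
  exact: sol_meas (hk m).
exists g; apply: sol_intro => //.
- by move=> x; case/andP: (ub _ (wb x)).
- by exists 1 => x; case/andP: (ub _ (wb x)).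
- have : {ae mu, forall x, forall k, P x -> w_ k x = 0}.
    by apply: ae_foralln => k; exact: sol_pole (hs k).
  apply: filterS => x hx Px; apply/eqP; rewrite eq_le; case/andP: (ub _ (wb x)) => -> _; rewrite andbT.
  rewrite leNgt; apply/negP => /(sersum_gt0 (wb x))[k]; rewrite hx// ltxx//.
- by split; [|exists 1] => x; case/andP: (ub _ (fb x)).
move=> phi tphi; have [C C0 hC] := test_bounded tphi; have mphi := test_meas tphi.
have c1 : dot (fun i x => ser (fun k => g_ k i x) 0 m) (fun i => partial i phi) @[m --> \oo] -->
    dot g (fun i => partial i phi).
  apply: (dot_cvg (g_ := fun m i x => ser (fun k => g_ k i x) 0 m) (h_ := fun _ i => partial i phi)) => //.
  - by move=> m; exact: H0_l2v (sol_H0 (hk m)).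
  - by move=> _; exact: test_l2v tphi.
  - exact: H0_l2v hU.
  - exact: test_l2v tphi.
  - exact: cU.2.
  - by move=> i; exact: l2cvg_cst.
have c2 : \int[mu]_x (v x * ser (w_ ^~ x) 0 m * phi x) @[m --> \oo] -->
    \int[mu]_x (v x * sersum (w_ ^~ x) * phi x).
  apply: (@integr_dct _ _ _ mu (fun m x => v x * ser (w_ ^~ x) 0 m * phi x) _
    (fun x => C * (v x * sersum (w_ ^~ x))) _ _ _ _ _).2.
  - by move=> m; apply: measurable_funM => //; exact: l1_meas (sol_l1 (hk m)).
  - by apply: measurable_funM => //; exact: l1_meas vU.
  - exact: l1Z.
  - apply: aeW => x; apply: (rcvgM _ (cvg_cst _) (erefl _)).
    exact: (rcvgZ (cw x) (erefl _)).
  - move=> m; apply: aeW => x; rewrite normrM mulrC ler_pM// normrM (ger0_norm (v0 x)).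
    by rewrite ler_wpM2l// ser_le.
have c3 : \int[mu]_x (ser (f_ ^~ x) 0 m * phi x) @[m --> \oo] -->
    \int[mu]_x (sersum (f_ ^~ x) * phi x).
  apply: (@integr_dct _ _ _ mu (fun m x => ser (f_ ^~ x) 0 m * phi x) _ (fun x => `|phi x|) _ _ _ _ _).2.
  - by move=> m; apply: measurable_funM => //; exact: sol_meas (hk m).
  - exact: measurable_funM.
  - by apply: l1_norm; exact: test_l1 tphi.
  - by apply: aeW => x; apply: (rcvgM (cf x) (cvg_cst _) (erefl _)).
  - move=> m; apply: aeW => x; rewrite normrM -[leRHS]mul1r ler_wpM2r//.
    by apply: (le_trans (ser_le _ m (fb x))); case/andP: (ub _ (fb x)).
have c4 : \int[mu]_x (ser (f_ ^~ x) 0 m * phi x) @[m --> \oo] -->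
    dot g (fun i => partial i phi) + \int[mu]_x (v x * sersum (w_ ^~ x) * phi x).
  apply: (eq_rcvg (fun m => sol_eq (hk m) tphi)); exact: (rcvgD c1 c2 (erefl _)).
exact: (cvg_unique (@norm_hausdorff _ _) c4 c3).
Qed.

Lemma sol_normalise f w g : (forall x, 0 <= v x) -> sol f w g -> exists c : R,
  [/\ 0 < c, forall x, c * w x <= 1, forall x, c * f x <= 1 &
      dot (fun i x => c * g i x) (fun i x => c * g i x) <= 1 /\ \int[mu]_x (v x * (c * w x)) <= 1].
Proof.
move=> v0 s; have [C wC] := sol_bd s; have [f0 [A fA]] := sol_rhs s.
have w0 := sol_ge0 s; have C0 : 0 <= C := le_trans (w0 0) (wC 0).
have A0 : 0 <= A := le_trans (f0 0) (fA 0).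
set I := \int[mu]_x (v x * w x).
have I0 : 0 <= I by apply: integr_ge0 => x; rewrite mulr_ge0.
have g0 := dot_ge0 g; have hg := H0_l2v (sol_H0 s).
pose d := 1 + C + A + dot g g + I; have d1 : 1 <= d by rewrite /d; lra.
have d0 : 0 < d by exact: lt_le_trans d1.
have dE : d = 1 + C + A + dot g g + I by [].
clearbody d.
exists d^-1; split; first by rewrite invr_gt0.
- by move=> x; rewrite ler_pdivrMl// mulr1; apply: (le_trans (wC x)); rewrite dE; lra.
- by move=> x; rewrite ler_pdivrMl// mulr1; apply: (le_trans (fA x)); rewrite dE; lra.
split.
  rewrite dotZr//; last by move=> i; exact: l2Z.
  rewrite dotC dotZr// ler_pdivrMl// mulr1 ler_pdivrMl//.
  have gd : dot g g <= d by rewrite dE; lra.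
  by apply: (le_trans gd); rewrite ler_peMl// ltW.
have -> : \int[mu]_x (v x * (d^-1 * w x)) = d^-1 * I.
  by rewrite -integrZ; [apply: eq_Rintegral => x _; rewrite mulrCA|exact: sol_l1 s].
by rewrite ler_pdivrMl// mulr1 dE; lra.
Qed.

Lemma sol_scale f w g (c : R) : 0 <= c -> sol f w g ->
  sol (fun x => c * f x) (fun x => c * w x) (fun i x => c * g i x).
Proof.
move=> c0 s; have := sol_comb c0 (lexx 0) s sol0.
by congr sol; do ?[apply/funext => ?]; rewrite mulr0 addr0.
Qed.

Lemma l1_support f w g : sol f w g -> l1 mu (fun x => (0 < w x)%R%:R).
Proof.
move=> s; apply: (l1_bounded (B := dom_bound D) (M := 1)).
- by apply: measurable_gt0; exact: H0_meas (sol_H0 s).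
- by move=> x; exact: norm_nat_le1.
- move=> x nB; rewrite (H0_out (sol_H0 s)) ?ltxx// => Ox; apply: nB; exact: dom_box.
Qed.

(** The measure of the support is maximised: the series contains the supports of a maximising
    sequence. Since [w0 + w] is again a solution, its support cannot have larger measure, so that of
    [w] lies almost everywhere in that of [w0]. *)
Lemma exists_sol_max_support : measurable_fun setT v -> (forall x, 0 <= v x) ->
  exists f0 w0 g0, sol f0 w0 g0 /\ forall f w g, sol f w g -> {ae mu, forall x, 0 < w x -> 0 < w0 x}.
Proof.
move=> mv v0.
pose r (w : E -> R) := \int[mu]_x ((0 < w x)%R%:R : R).
pose S := [set c | exists f w g, sol f w g /\ c = r w].
have hS : has_sup S.
  split; first by exists (r (fun=> 0)), (fun=> 0), (fun=> 0), (fun _ _ => 0); split => //; exact: sol0.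
  exists (\int[mu]_x \1_(box (dom_bound D)) x) => _ [f [w [g [s ->]]]].
  apply: integr_le; [exact: l1_support s|exact: l1_box|apply: aeW => x].
  have [Bx|nB] := pselect (box (dom_bound D) x).
    by rewrite indicE mem_set//; case: (0 < w x).
  by rewrite (H0_out (sol_H0 s)) ?ltxx// => Ox; apply: nB; exact: dom_box.
have H k : exists fwg : (E -> R) * (E -> R) * ('I_n.+1 -> E -> R),
    [/\ sol fwg.1.1 fwg.1.2 fwg.2, forall x, fwg.1.1 x <= 1, forall x, fwg.1.2 x <= 1,
      dot fwg.2 fwg.2 <= 1 /\ \int[mu]_x (v x * fwg.1.2 x) <= 1 & sup S - tau R k < r fwg.1.2].
  have [_ [f [w [g [s ->]]]] hlt] := sup_adherent (tau_gt0 R k) hS.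
  have [c [c0 cw cf [cg cv]]] := sol_normalise v0 s.
  exists (fun x => c * f x, fun x => c * w x, fun i x => c * g i x); split => //=.
    exact: sol_scale (ltW c0) s.
  by rewrite (_ : r _ = r w)//; apply: eq_Rintegral => x _; rewrite pmulr_rgt0.
pose f_ k := (projT1 (cid (H k))).1.1; pose w_ k := (projT1 (cid (H k))).1.2.
pose g_ k := (projT1 (cid (H k))).2.
have hs k : sol (f_ k) (w_ k) (g_ k) by have [] := projT2 (cid (H k)).
have f1 k x : f_ k x <= 1 by have [_ + _ _ _] := projT2 (cid (H k)); apply.
have w1 k x : w_ k x <= 1 by have [_ _ + _ _] := projT2 (cid (H k)); apply.
have g1 k : dot (g_ k) (g_ k) <= 1 by have [_ _ _ []] := projT2 (cid (H k)).
have vw k : \int[mu]_x (v x * w_ k x) <= 1 by have [_ _ _ []] := projT2 (cid (H k)).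
have rw k : sup S - tau R k < r (w_ k) by have [] := projT2 (cid (H k)).
have [g0 s0] := sol_sersum mv v0 hs w1 f1 g1 vw.
set w0 := (fun x => sersum (w_ ^~ x)) in s0.
exists (fun x => sersum (f_ ^~ x)), w0, g0; split => // f w g s.
have wb x k : 0 <= w_ k x <= 1 by rewrite (sol_ge0 (hs k)) w1.
have rS : sup S <= r w0.
  have ct : sup S - tau R k @[k --> \oo] --> sup S.
    exact: (rcvgB (cvg_cst _) (@cvg_harmonicS R) (subr0 _)).
  apply: (ler_cvg_to ct (cvg_cst _)); apply: nearW => k; apply: (le_trans (ltW (rw k))).
  apply: integr_le; [exact: l1_support (hs k)|exact: l1_support s0|apply: aeW => x].
  have [wk|wk] := ltP 0 (w_ k x); last by rewrite ler0n.
  by rewrite (_ : 0 < w0 x)//; apply/(sersum_gt0 (wb x)); exists k.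
have s1 := sol_comb ler01 ler01 s0 s; set w' := (fun x => 1 * w0 x + 1 * w x) in s1.
have r1 : r w' <= r w0.
  by apply: le_trans rS; apply: (sup_upper_bound hS); do 3 eexists; split; first exact: s1.
have d0 : {ae mu, forall x, ((0 < w' x)%R%:R : R) - (0 < w0 x)%R%:R = 0}.
  have l1a := l1_support s1; have l1b := l1_support s0.
  apply: integr_eq0; [exact: l1B| |by rewrite integrB// subr_le0].
  apply: aeW => x; rewrite subr_ge0; have [a0|a0] := ltP 0 (w0 x); last by rewrite ler0n.
  by rewrite /w' ltr_wpDr ?mul1r// (sol_ge0 s).
apply: filterS d0 => x + wx; rewrite /w' ltr_wpDl ?mul1r ?(sol_ge0 s0)//.
by case: (0 < w0 x) => // /eqP; rewrite subr0 oner_eq0.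
Qed.

Section hats.
Variables (f0 w0 : E -> R) (g0 : 'I_n.+1 -> E -> R) (h0 : E -> R).

(** For the representatives of [(w1 - k * w2)^+]: where [h2 > 0] they are eventually [0]; where
    [h2 = 0] they all equal [h1], and [subsol_cvg_hat] shows that the limit does not drop below this
    value. *)
Lemma sol_decr_pos f1 w1 g1 (h1 : E -> R) f2 w2 g2 (h2 : E -> R) : (forall x, 0 <= v x) ->
  sol f1 w1 g1 -> sol f2 w2 g2 -> pw w1 h1 -> pw w2 h2 ->
  exists (M : R) (u : E -> R) g (h : E -> R), [/\ 0 <= M, subsol D M u g, pw u h,
    (forall x, if 0 < w2 x then u x = 0 else u x = w1 x) &
    forall x, O x -> (0 < h2 x -> h x = 0) /\ (h2 x = 0 -> h x = h1 x)].
Proof.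
move=> v0 s1 s2 p1 p2; have [M M0 fM] := sol_bound s1.
pose u_ (k : nat) x := Num.max (w1 x + - k%:R * w2 x) 0.
have f20 x : 0 <= f2 x by case: (sol_rhs s2) => h _.
have su k : subsol D M (u_ k) _ := @sol_pos f1 w1 g1 f2 w2 g2 (- k%:R) M v0 M0 s1 s2 (fun x =>
  ltac:(by apply: le_trans (fM x); rewrite mulNr gerBl mulr_ge0)).
have w20 := sol_ge0 s2; have w10 := sol_ge0 s1.
have du k x : u_ k.+1 x <= u_ k x.
  rewrite /u_ ge_max [X in _ && X]le_max lexx orbT andbT le_max lerD2l !mulNr lerN2 ler_wpM2r// ler_nat leqnSn//.
have [u [g [s cu cux ule]]] := subsol_decr M0 su du.
have [h ph] := subsol_pw M0 s.
have pu k : pw (u_ k) (fun x => Num.max (h1 x + - k%:R * h2 x) 0).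
  move=> x Ox; have l1' := H0_loc (sol_H0 s1); have l2' := H0_loc (sol_H0 s2).
  apply: lebpt_max0; first by apply: locD => //; exact: locZ.
  by apply: lebptD => //; [exact: locZ|exact: p1|apply: lebptZ => //; exact: p2].
have large (a b : R) : 0 < b -> exists k : nat, a + - k%:R * b <= 0.
  move=> b0; exists (Num.truncn (a / b)).+1; rewrite mulNr subr_le0 -ler_pdivrMr//.
  exact: ltW (truncnS_gt _).
have u0 x : 0 <= u x by case: s.
exists M, u, g, h; split => //.
  move=> x; case: ifPn => [w2x|]; last first.
    rewrite -leNgt => w2x; have w2x0 : w2 x = 0 by apply: le_anti; rewrite w2x w20.
    have c2 : u_ k x @[k --> \oo] --> w1 x.
      by under eq_fun do rewrite /u_ w2x0 mulr0 addr0 (max_idPl (w10 x)); exact: cvg_cst.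
    exact: (cvg_unique (@norm_hausdorff _ _) (cux x) c2).
  have [k hk] := large (w1 x) _ w2x; apply: le_anti; rewrite u0 andbT.
  by apply: (le_trans (ule k x)); rewrite /u_ ge_max hk lexx.
move=> x Ox; have h_ge0 := pw_ge0 (subsol_H0 s) u0 ph Ox.
have h10 := pw_ge0 (sol_H0 s1) w10 p1 Ox.
have hle k : h x <= Num.max (h1 x + - k%:R * h2 x) 0.
  apply: (lebpt_le (H0_loc (subsol_H0 s)) (H0_loc (subsol_H0 (su k))) _ (ph x Ox) (pu k x Ox)).
  exact: aeW.
split=> [h2x|h2x].
  have [k hk] := large (h1 x) _ h2x; apply: le_anti; rewrite h_ge0 andbT.
  by apply: (le_trans (hle k)); rewrite ge_max hk lexx.
apply: le_anti; have := hle 0%N; rewrite h2x mulr0 addr0 (max_idPl h10) => ->/=.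
apply/ler_addgt0Pr => e e0.
have [K _ hK] := subsol_cvg_hat M0 su (subsol_H0 s) cu.1 Ox (fun k => pu k x Ox) (ph x Ox) e0.
by have := hK K (leqnn K); rewrite h2x mulr0 addr0 (max_idPl h10).
Qed.

(** [sol_decr_pos] produces [w] restricted to [w0 = 0], a null function by maximality of the
    support. Its representative is then [0] throughout [O], and it equals [h] where [h0]
    vanishes. *)
Lemma sol_max_hat f w g (h : E -> R) x : (forall x, 0 <= v x) -> sol f0 w0 g0 -> sol f w g ->
  {ae mu, forall x, 0 < w x -> 0 < w0 x} -> pw w0 h0 -> pw w h -> O x -> h0 x = 0 -> h x = 0.
Proof.
move=> v0 s0 s hmax p0 p Ox hx0.
have [M [u [g' [h' [M0 su pu uE hE]]]]] := sol_decr_pos v0 s s0 p p0.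
have [_ /(_ hx0) <-] := hE x Ox.
have lu := H0_loc (subsol_H0 su); have lc := @loc_cst R n.+1 0.
apply: (lebpt_unique lc (lebpt_ae_eq lu lc _ (pu x Ox)) (@lebpt_cst _ _ 0 x)).
apply: filterS hmax => y hy; have := uE y; case: ifPn => //.
rewrite -leNgt => w0y ->; apply: le_anti; rewrite (sol_ge0 s) andbT leNgt; apply/negP => /hy.
by rewrite ltNge w0y.
Qed.

Lemma sopen_sol_zero f w g (h : E -> R) : (forall x, 0 <= v x) -> sol f0 w0 g0 -> sol f w g ->
  pw w0 h0 -> pw w h -> sopen D [set x | O x /\ (0 < h0 x /\ h x = 0)].
Proof.
move=> v0 s0 s p0 p; have [M [u [g' [h' [M0 su pu uE hE]]]]] := sol_decr_pos v0 s0 s p0 p.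
exists u, g', h'; split => //; [exact: subsol_H0 su|by case: su|].
have h_ge0 x : O x -> 0 <= h x := pw_ge0 (sol_H0 s) (sol_ge0 s) p.
apply/seteqP; split => x /= [Ox]; have [e1 e2] := hE x Ox.
  by move=> [h0x hx0]; rewrite e2.
move=> h'x; have hx0 : h x = 0.
  apply: le_anti; rewrite h_ge0// andbT leNgt; apply/negP => hx.
  by rewrite e1// ltxx in h'x.
by split => //; rewrite -e2.
Qed.

End hats.
End solutions.

(** * Precise representatives and the definitions of the theorem *)

Section restriction.
Variables (R : realType) (n : nat) (D : bdomain R n.+1).
Local Notation O := (dom D).
Local Notation mu := (lebesgue R n.+1).
Local Notation E := 'rV[R]_n.+1.
Local Notation test := (test_function O).
Local Notation pw := (pw D).
Implicit Types (u v w f : E -> R) (g : 'I_n.+1 -> E -> R) (x : E).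

Lemma measurable_dom : measurable O.
Proof. by apply: open_measurable_rV; exact: dom_open. Qed.

Lemma patch_in (A : set E) u x : A x -> (u \_ A) x = u x.
Proof. by move=> Ax; rewrite patchE mem_set. Qed.

Lemma patch_out (A : set E) u x : ~ A x -> (u \_ A) x = 0.
Proof. by move=> nA; rewrite patch_indic /= indicE memNset// mulr0. Qed.

Lemma patch_id (A : set E) u : (forall x, ~ A x -> u x = 0) -> u \_ A = u.
Proof.
move=> uA; apply/funext => x; have [Ax|nA] := pselect (A x); first exact: patch_in.
by rewrite patch_out// uA.
Qed.

Lemma EFin_patch (A : set E) (F : E -> \bar R) u : (forall x, A x -> F x = (u x)%:E) ->
  F \_ A = EFin \o (u \_ A).
Proof.
move=> Fu; apply/funext => x; have [Ax|nA] := pselect (A x).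
  by rewrite /= patch_in// patchE mem_set// Fu.
by rewrite /= patch_out// epatch_indic /= indicE memNset// mule0.
Qed.

Lemma integral_patch (A : set E) (F : E -> \bar R) u : (forall x, A x -> F x = (u x)%:E) ->
  (\int[mu]_(x in A) F x = \int[mu]_x ((u \_ A) x)%:E)%E.
Proof. by move=> Fu; rewrite integral_mkcond (EFin_patch Fu). Qed.

Lemma integral_dom (F : E -> \bar R) u : l1 mu u -> (forall x, ~ O x -> u x = 0) ->
  (forall x, O x -> F x = (u x)%:E) -> (\int[mu]_(x in O) F x = (\int[mu]_x u x)%:E)%E.
Proof. by move=> hu uO Fu; rewrite (integral_patch Fu) patch_id// integrE. Qed.

Lemma integrable_dom (F : E -> \bar R) u : (forall x, O x -> F x = (u x)%:E) ->
  mu.-integrable O F <-> l1 mu (u \_ O).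
Proof.
move=> Fu; rewrite (integrable_mkcond F measurable_dom) (EFin_patch Fu)//.
Qed.

Lemma measurable_patch u : measurable_fun O u <-> measurable_fun setT (u \_ O).
Proof. exact: measurable_restrictT measurable_dom. Qed.

Lemma L2_patch u : L2 O u <-> l2 mu (u \_ O).
Proof.
rewrite /L2 /l2 measurable_patch (@integrable_dom _ (fun x => u x ^+ 2))//.
rewrite (_ : (fun x => (u \_ O) x ^+ 2) = (fun x => u x ^+ 2) \_ O)//.
apply/funext => x; have [Ox|nO] := pselect (O x); first by rewrite !patch_in.
by rewrite !patch_out// expr0n.
Qed.

Lemma H0_patch u g : H0 D u g -> u \_ O = u.
Proof. by move=> hu; apply: patch_id => x; exact: H0_out hu. Qed.

Lemma H0_patchg u g i : H0 D u g -> g i \_ O = g i.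
Proof. by move=> hu; apply: patch_id => x nO; have [_ _ /(_ x nO)[]] := hu. Qed.

Definition dist_sq u v g g' x : R := (u x - v x) ^+ 2 + \sum_i (g i x - g' i x) ^+ 2.

Lemma l1_dist_sq u v g g' : l2 mu u -> l2 mu v -> (forall i, l2 mu (g i)) ->
  (forall i, l2 mu (g' i)) -> l1 mu (dist_sq u v g g').
Proof.
move=> hu hv hg hg'; apply: l1D; first by case: (l2B hu hv).
by apply: l1_sum => i; case: (l2B (hg i) (hg' i)).
Qed.

Lemma W012_H0 u : W012 O u -> exists g, H0 D (u \_ O) g.
Proof.
move=> [g [[/L2_patch lu lg _] [phi [tphi cphi]]]].
have {}lg i : l2 mu (g i \_ O) by apply/L2_patch.
exists (fun i => g i \_ O); split => //.
  by move=> x nO; rewrite patch_out//; split => // i; rewrite patch_out.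
exists phi => //.
have lphi k := test_l2 (tphi k); have lpphi k i := test_l2 (test_partial i (tphi k)).
pose q k := dist_sq (u \_ O) (phi k) (fun i => g i \_ O) (fun i => partial i (phi k)).
have lq k : l1 mu (q k) by apply: l1_dist_sq.
have cq : \int[mu]_x q k x @[k --> \oo] --> (0 : R).
  have : (\int[mu]_x q k x)%:E @[k --> \oo] --> 0%:E.
    apply: cvg_trans cphi; apply: near_eq_cvg; apply: nearW => k.
    apply: integral_dom => //.
      move=> x nO; rewrite /q /dist_sq patch_out// (test_out (tphi k) nO) subrr expr0n add0r.
      rewrite big1// => i _; rewrite patch_out// (test_out (test_partial i (tphi k)) nO).
      by rewrite subrr expr0n.
    move=> x Ox; rewrite /q /dist_sq patch_in//; congr (_ + _)%:E.
    by apply: eq_bigr => i _; rewrite patch_in.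
  by move/fine_cvg.
have sq0 (s : R) : 0 <= s ^+ 2 by exact: sqr_ge0.
split=> [|i].
  apply: (l2cvg_sq0 _ cq) => k; apply: integr_le => //; first by case: (l2B (lphi k) lu).
  apply: aeW => x; rewrite /q /dist_sq -sqrrN opprB lerDl sumr_ge0//.
apply: (l2cvg_sq0 _ cq) => k; apply: integr_le => //; first by case: (l2B (lpphi k i) (lg i)).
apply: aeW => x; rewrite /q /dist_sq -sqrrN opprB (bigD1 i)//= addrCA lerDl addr_ge0//.
by rewrite sumr_ge0.
Qed.

Lemma H0_W012 u g : H0 D u g -> W012 O u.
Proof.
move=> hu; have uE := H0_patch hu; have gE i := H0_patchg i hu.
have [lu lg uO [phi tphi [cu cg]]] := hu; exists g; split.
  split; first by apply/L2_patch; rewrite uE.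
    by move=> i; apply/L2_patch; rewrite gE.
  move=> i psi tpsi; have lp := test_l2 tpsi; have lpp := test_l2 (test_partial i tpsi).
  rewrite (@integral_dom _ (fun x => u x * partial i psi x))//; last first.
  - by move=> x /uO[-> _]; rewrite mul0r.
  - exact: l2M.
  rewrite (@integral_dom _ (fun x => g i x * psi x))//; last first.
  - by move=> x /uO[_ ->]; rewrite mul0r.
  - exact: l2M.
  by rewrite (H0_weak_gradient i hu tpsi).
exists phi; split => //.
have lphi k := test_l2 (tphi k); have lpphi k i := test_l2 (test_partial i (tphi k)).
pose q k := dist_sq u (phi k) g (fun i => partial i (phi k)).
have lq k : l1 mu (q k) by apply: l1_dist_sq.
have cq : \int[mu]_x q k x @[k --> \oo] --> (0 : R).
  have Eq k : \int[mu]_x ((phi k x - u x) ^+ 2) + \sum_i \int[mu]_x ((partial i (phi k) x - g i x) ^+ 2) =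
      \int[mu]_x q k x.
    rewrite -integr_sum; last by move=> i; case: (l2B (lpphi k i) (lg i)).
    rewrite -integrD; [|by case: (l2B (lphi k) lu)|]; last first.
      by apply: l1_sum => i; case: (l2B (lpphi k i) (lg i)).
    apply: eq_Rintegral => x _; rewrite /q /dist_sq -sqrrN opprB; congr (_ + _).
    by apply: eq_bigr => i _; rewrite -sqrrN opprB.
  apply: (eq_rcvg Eq); have c0 : \sum_i \int[mu]_x ((partial i (phi k) x - g i x) ^+ 2) @[k --> \oo] --> (0 : R).
    have c1 : \sum_i \int[mu]_x ((partial i (phi k) x - g i x) ^+ 2) @[k --> \oo] -->
        \sum_(i < n.+1) (0 : R) by apply: rcvg_sum => i; exact: cg.
    by rewrite big1 in c1.
  exact: (rcvgD cu c0 (addr0 _)).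
have : (\int[mu]_x q k x)%:E @[k --> \oo] --> 0%:E.
  by apply: cvg_EFin => //; exact: nearW.
apply: cvg_trans; apply: near_eq_cvg; apply: nearW => k; apply/esym.
apply: integral_dom => // x nO; have [u0 g0] := uO x nO.
rewrite /q /dist_sq u0 (test_out (tphi k) nO) subrr expr0n add0r big1// => i _.
by rewrite g0 (test_out (test_partial i (tphi k)) nO) subrr expr0n.
Qed.

Lemma eballE x (r : R) : 0 < r -> eball x r = [set y | sq (y - x) < r ^+ 2].
Proof.
move=> r0; have E1 (y : E) : (Num.sqrt (\sum_i (y 0 i - x 0 i) ^+ 2) < r) = (sq (y - x) < r ^+ 2).
  rewrite -[X in _ < X](ger0_norm (ltW r0)) -sqrtr_sqr ltr_sqrt ?exprn_gt0//; congr (_ < _).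
  by apply: eq_bigr => i _; rewrite !mxE.
by apply/seteqP; split => y; rewrite /eball /= E1.
Qed.

Lemma measurable_eball x (r : R) : 0 < r -> measurable (eball x r).
Proof.
move=> r0; rewrite eballE//; apply: open_measurable_rV.
rewrite (_ : [set _ | _] = (fun z => sq (z - x)) @^-1` [set s | s < r ^+ 2])//.
apply: open_comp; last exact: open_lt.
by move=> z _; apply: smooth_cont; apply: smooth_shift => k; exact: smooth_sq.
Qed.

(** The ball lies between the concentric cubes of half sides [r / n.+2%:R] and [r]: in the smaller
    one the squared distance is at most [n.+1] times [(r / n.+2%:R) ^+ 2], which is less than
    [r ^+ 2]. *)
Lemma eball_mass x (r : R) : 0 < r -> exists m : R, [/\ mu (eball x r) = m%:E,
  (2 * (r / n.+2%:R)) ^+ n.+1 <= m & m <= (2 * r) ^+ n.+1].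
Proof.
move=> r0; pose Q (s : R) := [set y : E | forall i, `[x 0 i - s, x 0 i + s]%classic (y 0 i)].
have mQ s : measurable (Q s).
  rewrite (_ : Q s = \bigcap_(i in [set: 'I_n.+1]) ((fun y : E => y 0 i) @^-1` `[x 0 i - s, x 0 i + s]%classic)).
    apply: fin_bigcap_measurable => [|i _]; first exact: finite_finset.
    by rewrite -[X in measurable X]setTI; apply: measurable_coord.
  by apply/seteqP; split => [y h i _|y h i]; exact: h.
have lQ s : 0 <= s -> mu (Q s) = ((2 * s) ^+ n.+1)%:E by move=> s0; rewrite /Q (lebesgue_cube x s0).
have mE := measurable_eball x r0; pose h := r / n.+2%:R.
have h0 : 0 < h by rewrite divr_gt0.
have ub : (mu (eball x r) <= ((2 * r) ^+ n.+1)%:E)%E.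
  rewrite -(lQ _ (ltW r0)); apply: le_measure; rewrite ?inE//; rewrite eballE// => y /= hy i.
  have h2 := le_lt_trans (sq_coord (y - x) i) hy; rewrite !mxE in h2.
  by have := norm_lt_sqr r0 h2; rewrite /= in_itv/= -ler_distl => /ltW.
have lb : (((2 * h) ^+ n.+1)%:E <= mu (eball x r))%E.
  rewrite -(lQ _ (ltW h0)); apply: le_measure; rewrite ?inE//; rewrite eballE// => y /= hy.
  apply: (@le_lt_trans _ _ (\sum_(i < n.+1) h ^+ 2)).
    apply: ler_sum => i _; rewrite !mxE -real_normK ?num_real// ler_pXn2r ?nnegrE ?(ltW h0)//.
    by have := hy i; rewrite /= in_itv/= -ler_distl.
  rewrite sumr_const card_ord -[ltLHS]mulr_natr /h expr_div_n mulrAC ltr_pdivrMr ?exprn_gt0//.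
  by rewrite ltr_pM2l ?exprn_gt0// -natrX ltr_nat expnS expn1 (@leq_ltn_trans (n.+1 * n.+2)%N)// ?leq_pmulr// ltn_pmul2r.
have fin : mu (eball x r) \is a fin_num.
  by rewrite ge0_fin_numE//; apply: le_lt_trans ub (ltry _).
exists (fine (mu (eball x r))); rewrite fineK//; split => //.
  by rewrite -lee_fin fineK.
by rewrite -lee_fin fineK.
Qed.

Lemma near_right_scale (A : R -> Prop) (k : R) : 0 < k -> (\forall t \near 0^'+, A t) ->
  \forall t \near 0^'+, A (k * t).
Proof.
move=> k0 [d /= d0 hd]; exists (d / k) => /=; first by rewrite divr_gt0.
move=> t /= ht t0; apply: hd => /=; last exact: mulr_gt0.
move: ht; rewrite !sub0r !normrN !gtr0_norm ?mulr_gt0// ltr_pdivlMr//.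
by rewrite mulrC.
Qed.

(** Averages over balls and mollifications control each other: [rho t] is supported in the ball of
    radius [t] and at most [2 * t ^- N] there, while [rho (2 * r)] is at least a constant times
    [r ^- N] on the ball of radius [r]. For small radii the balls lie in [O], where [u] and its
    extension by [0] agree. *)
Lemma precise_valueP u x (c : R) : O x -> loc (u \_ O) ->
  precise_value u x c <-> lebpt (u \_ O) x c.
Proof.
move=> Ox lu; pose f z := `|(u \_ O) z - c|.
have lf : loc f by exact/loc_norm/locB/loc_cst.
have f0 z : 0 <= f z by exact: normr_ge0.
have [d d0 /(_ x (ballxx x d0)) dO] := inner_radius Ox.
pose I (r : R) := \int[mu]_z ((f \_ (eball x r)) z).
have out_ball (r : R) z : 0 < r -> ~ eball x r z -> r ^+ 2 <= sq (z - x).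
  by move=> r0; rewrite eballE//= => /negP; rewrite -leNgt.
have lI (r : R) : 0 < r -> l1 mu (f \_ (eball x r)).
  move=> r0; apply: (l1_le _ (lf.2 (r + `|x|))).
    by apply/(measurable_restrictT _ (measurable_eball x r0)); apply: measurable_funTS; exact: lf.1.
  apply: aeW => z; have [hz|nz] := pselect (eball x r z); last by rewrite patch_out// normr0.
  rewrite patch_in// indicE mem_set ?mul1r// => i.
  by rewrite eballE//= in hz; apply/ltW; exact: sq_ball_cube (ltW r0) hz i.
pose q (r : R) := ((mu (eball x r))^-1 * \int[mu]_(y in eball x r) `|u y - c|%:E)%E.
have qE (r : R) : 0 < r -> r < d -> exists m : R, [/\ q r = (I r / m)%:E,
    (2 * (r / n.+2%:R)) ^+ n.+1 <= m & m <= (2 * r) ^+ n.+1].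
  move=> r0 rd; have [m [mE m1 m2]] := eball_mass x r0; exists m; split => //.
  have m0 : 0 < m by apply: lt_le_trans m1; rewrite exprn_gt0// mulr_gt0// divr_gt0.
  rewrite /q mE inver gt_eqF// (@integral_patch _ _ f).
    by rewrite -integrE ?lI// -EFinM mulrC.
  move=> y hy; rewrite /f patch_in//; apply: dO; rewrite eballE//= in hy; apply: (lt_trans hy).
  by rewrite ltr_pXn2r ?nnegrE ?ltW.
have I0 r : 0 <= I r.
  apply: integr_ge0 => z; have [hz|nz] := pselect (eball x r z); [by rewrite patch_in|by rewrite patch_out].
have mol_le_I (t : R) : 0 < t -> mol t f x <= t ^- n.+1 * 2 * I t.
  move=> t0; rewrite -integrZ; last exact: lI.
  apply: integr_le; [exact: l1_mol|by apply: l1Z; exact: lI|apply: aeW => z].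
  have [hz|nz] := pselect (eball x t z); first by rewrite patch_in// ler_wpM2r// rho_ub.
  by rewrite patch_out// mulr0 /rho radial_eq0 ?mulr0 ?mul0r// out_ball.
have I_le_mol (r : R) : 0 < r -> I r <= (2 * r) ^+ n.+1 * expR 4 * mol (2 * r) f x.
  move=> r0; have r20 : 0 < 2 * r by exact: mulr_gt0.
  have lm := l1_mol x r20 lf; rewrite -(integrZ _ lm).
  apply: integr_le; [exact: lI|exact: l1Z|apply: aeW => z].
  have [hz|nz] := pselect (eball x r z); last first.
    rewrite patch_out//; apply: mulr_ge0; last by rewrite mulr_ge0 ?rho_ge0.
    by rewrite mulr_ge0 ?exprn_ge0 ?expR_ge0// ltW.
  rewrite patch_in// mulrA ler_peMl// -ler_pdivrMl ?mulr_gt0 ?exprn_gt0 ?expR_gt0//.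
  rewrite mulr1 invfM -expRN; apply: rho_lb => //.
  rewrite eballE//= in hz; apply: (le_trans (ltW hz)); rewrite exprMn.
  by have := sqr_ge0 r; set a := r ^+ 2; lra.
split=> [pv|lp].
  have {}pv : fine (q r) @[r --> 0^'+] --> (0 : R) by exact: (fine_cvg pv).
  apply: (@rcvg0_le _ _ _ _ _ (fun t => 2 * 2 ^+ n.+1 * fine (q t))); last first.
    by apply: (rcvgZ pv); rewrite mulr0.
  near=> t; have t0 : 0 < t by near: t; exact: nbhs_right_gt.
  have td : t < d by near: t; exact: nbhs_right_lt.
  rewrite ger0_norm ?mol_ge0//; apply: (le_trans (mol_le_I t t0)).
  have [m [-> m1 m2]] := qE t t0 td; rewrite /=.
  have m0 : 0 < m by apply: lt_le_trans m1; rewrite exprn_gt0// mulr_gt0// divr_gt0.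
  have h : t ^- n.+1 <= 2 ^+ n.+1 / m.
    by rewrite ler_pdivlMr// mulrC ler_pdivrMr ?exprn_gt0// -exprMn.
  apply: (@le_trans _ _ (2 ^+ n.+1 / m * 2 * I t)); first by rewrite !ler_wpM2r.
  by rewrite le_eqVlt; apply/orP; left; apply/eqP; ring.
have near_q : \forall r \near 0^'+, exists m : R, [/\ q r = (I r / m)%:E,
    (2 * (r / n.+2%:R)) ^+ n.+1 <= m & 0 < r].
  near=> r; have r0 : 0 < r by near: r; exact: nbhs_right_gt.
  have rd : r < d by near: r; exact: nbhs_right_lt.
  by have [m [h1 h2 _]] := qE r r0 rd; exists m.
suff : q r @[r --> 0^'+] --> 0%E by [].
apply: cvg_EFin; first by apply: filterS near_q => r [m [-> _ _]].
have c1 : mol (2 * r) f x @[r --> 0^'+] --> (0 : R).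
  apply/cvgr0Pnorm_le => e e0; move/cvgr0Pnorm_le : lp => /(_ _ e0).
  exact: near_right_scale.
apply: (@rcvg0_le _ _ _ _ _ (fun r => n.+2%:R ^+ n.+1 * expR 4 * mol (2 * r) f x)); last first.
  by apply: (rcvgZ c1); rewrite mulr0.
apply: filterS near_q => r [m [E1 m1 r0]].
have r20 : 0 < 2 * r by exact: mulr_gt0.
have a0 : 0 < (2 * (r / n.+2%:R)) ^+ n.+1 by rewrite exprn_gt0// mulr_gt0// divr_gt0.
have m0 : 0 < m by exact: lt_le_trans m1.
rewrite /= -/(q r) E1 /= ger0_norm ?mulr_ge0 ?invr_ge0 ?(ltW m0)//.
rewrite ler_pdivrMr//; apply: (le_trans (I_le_mol r r0)).
have g0 : 0 <= n.+2%:R ^+ n.+1 * expR 4 * mol (2 * r) f x.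
  by rewrite !mulr_ge0 ?exprn_ge0 ?expR_ge0 ?mol_ge0.
apply: le_trans (ler_wpM2l g0 m1); rewrite le_eqVlt; apply/orP; left; apply/eqP.
have Er : (2 * (r / n.+2%:R)) ^+ n.+1 = (2 * r) ^+ n.+1 / n.+2%:R ^+ n.+1.
  by rewrite mulrA expr_div_n.
have : n.+2%:R ^+ n.+1 != 0 :> R by rewrite expf_neq0.
rewrite Er; set a := _%:R ^+ _; set b := (2 * r) ^+ _ => a_neq0; field.
Unshelve. all: by end_near. Qed.

Lemma pw_of_lebesgue_points u g : H0 D (u \_ O) g -> (forall x, O x -> lebesgue_point u x) ->
  exists h, pw (u \_ O) h.
Proof.
move=> hu lp; have lu := H0_loc hu.
have H x : exists c : R, O x -> lebpt (u \_ O) x c.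
  have [Ox|nO] := pselect (O x); last by exists 0.
  by have [c hc] := lp x Ox; exists c => _; apply/precise_valueP.
by exists (fun x => projT1 (cid (H x))) => x Ox; exact: (projT2 (cid (H x))).
Qed.

Lemma precise_value_pw u g (h : E -> R) x (c : R) : H0 D (u \_ O) g -> pw (u \_ O) h -> O x ->
  precise_value u x c <-> c = h x.
Proof.
move=> hu pu Ox; have lu := H0_loc hu; rewrite precise_valueP//; split=> [hc|->].
  exact: lebpt_unique lu hc (pu x Ox).
exact: pu.
Qed.

Lemma sopenP A : sopen D A <-> sobolev_open O A.
Proof.
split=> [[u [g [h [hu u0 pu ->]]]]|[xi [/W012_H0[g hg] _ lp ->]]].
  have uE := H0_patch hu; have hu' := hu; rewrite -uE in hu'.
  have pu' : pw (u \_ O) h by rewrite uE.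
  exists u; split.
  - exact: H0_W012 hu.
  - by apply: aeW => x _.
  - by move=> x Ox; exists (h x); apply/(precise_value_pw _ hu' pu' Ox).
  - apply/seteqP; split => x [Ox].
      by move=> hx; split => //; exists (h x) => //; apply/(precise_value_pw _ hu' pu' Ox).
    by move=> [c c0 /(precise_value_pw _ hu' pu' Ox) cE]; split => //; rewrite -cE.
(* [xi] is nonnegative only almost everywhere; its positive part is so at every point and its
   representative is positive at the same points. *)
have [h ph] := pw_of_lebesgue_points hg lp; have lu := H0_loc hg.
exists (fun x => Num.max ((xi \_ O) x) 0), (fun i x => (0 < (xi \_ O) x)%R%:R * g i x),
  (fun x => Num.max (h x) 0); split.
- exact: (H0_pos hg).1.
- by move=> x; rewrite le_max lexx orbT.
- by move=> x Ox; apply: lebpt_max0 => //; exact: ph.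
- apply/seteqP; split => x [Ox].
    by move=> [c c0 /(precise_value_pw _ hg ph Ox) cE]; split => //; rewrite lt_max -cE c0.
  rewrite lt_max ltxx orbF => hx; split => //; exists (h x) => //.
  exact/(precise_value_pw _ hg ph Ox).
Qed.

Lemma sdecompP A C : sdecomp D A C <-> sobolev_decomposition O A C.
Proof.
have E1 : sopen D = sobolev_open O by apply/funext => B; apply/propext; exact: sopenP.
by rewrite /sdecomp /sconn E1.
Qed.

(** [fine] sends [+oo] to [0]; the product [V w] is recovered as soon as [w] vanishes on the
    poles. *)
Definition finite_potential (V : E -> \bar R) : E -> R := (fine \o V) \_ O.

Definition poles (V : E -> \bar R) : set E := [set x | O x /\ V x = +oo%E].

Lemma finite_potential_ge0 V x : (forall x, O x -> (0 <= V x)%E) -> 0 <= finite_potential V x.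
Proof.
move=> V0; rewrite /finite_potential; have [Ox|nO] := pselect (O x); last by rewrite patch_out.
by rewrite patch_in//= fine_ge0// V0.
Qed.

Lemma measurable_finite_potential V : measurable_fun O V -> measurable_fun setT (finite_potential V).
Proof.
by move=> mV; apply/measurable_patch; exact: measurableT_comp.
Qed.

Lemma potential_mulE V x (a : R) : O x -> (0 <= V x)%E -> (V x = +oo%E -> a = 0) ->
  (V x * a%:E)%E = (finite_potential V x * a)%:E.
Proof.
move=> Ox V0 Va; rewrite /finite_potential patch_in//=.
case: (V x) V0 Va => [r| |]//= _ Va; first by rewrite Va// mule0 mulr0.
Qed.

Lemma potential_fin V x (a : R) : (V x * a%:E)%E \is a fin_num -> V x = +oo%E -> a = 0.
Proof.
move=> + VE; rewrite VE; case: (ltrgt0P a) => [a0|a0|//].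
  by rewrite gt0_mulye ?lte_fin.
by rewrite lt0_mulye ?lte_fin.
Qed.

Lemma integrable_ae_eq (F G : E -> \bar R) : measurable_fun setT G ->
  {ae mu, forall x, F x = G x} -> mu.-integrable setT F -> mu.-integrable setT G.
Proof.
move=> mG FG /integrableP[mF lF]; apply/integrableP; split => //.
rewrite (ae_eq_integral (fun x => `|F x|%E))//; [exact: measurableT_comp|exact: measurableT_comp|].
by apply: filterS FG => x ->.
Qed.

Lemma integr_laplacian u g phi : H0 D u g -> test phi ->
  l1 mu (fun x => - (u x * laplacian phi x)) /\
  \int[mu]_x (- (u x * laplacian phi x)) = dot g (fun i => partial i phi).
Proof.
move=> hu tphi; have lp i := test_l2 (test_partial i (test_partial i tphi)).
have E1 : (fun x => - (u x * laplacian phi x)) = (fun x => - \sum_i u x * partial i (partial i phi) x).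
  by apply/funext => x; rewrite /laplacian mulr_sumr.
have l1s i : l1 mu (fun x => u x * partial i (partial i phi) x) by apply: l2M; [exact: H0_l2 hu|].
have l1S := l1_sum (index_enum 'I_n.+1) l1s; rewrite E1; split; first exact: l1N.
rewrite integrN// integr_sum// -sumrN; apply: eq_bigr => i _.
by rewrite (H0_weak_gradient i hu (test_partial i tphi)) opprK.
Qed.

(** * From the extended potential to its finite part *)

Section schroedinger_solutions.
Variable V : E -> \bar R.
Local Notation v := (finite_potential V).
Local Notation P := (poles V).

Lemma integral_potential u phi : measurable_fun O V -> (forall x, O x -> (0 <= V x)%E) ->
  measurable_fun setT u -> {ae mu, forall x, P x -> u x = 0} -> l1 mu (fun x => v x * u x) ->
  test phi -> (\int[mu]_(x in O) (V x * (u x)%:E * (phi x)%:E) = (\int[mu]_x (v x * u x * phi x))%:E)%E.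
Proof.
move=> mV V0 mu_ Pu lvu tphi; have [C C0 hC] := test_bounded tphi; have mphi := test_meas tphi.
rewrite integrE; last exact: l1_mul_bd mphi hC lvu.
rewrite (integral_mkcond O); apply: ae_eq_integral => //.
- apply/(measurable_restrictT _ measurable_dom); apply: emeasurable_funM.
    by apply: emeasurable_funM => //; apply/measurable_EFinP; exact: measurable_funTS.
  by apply/measurable_EFinP; exact: measurable_funTS.
- by apply/measurable_EFinP; apply: measurable_funM => //; exact: l1_meas lvu.
- apply: filterS Pu => x Px _; have [Ox|nO] := pselect (O x).
    rewrite patchE mem_set// (@potential_mulE V x (u x))//; first exact: V0.
    by move=> Vx; apply: Px.
  rewrite epatch_indic /= indicE memNset// mule0 (test_out tphi nO) mulr0//.
Qed.

Lemma schroedinger_weak_sol f w : measurable_fun O V -> (forall x, O x -> (0 <= V x)%E) ->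
  Linfty O f -> ae_nonneg O f -> schroedinger_solution O V f w ->
  exists f' g, weak_sol D v f' (w \_ O) g /\ {ae mu, forall x, P x -> (w \_ O) x = 0}.
Proof.
move=> mV V0 [mf [A fA]] f0 [/W012_H0[g hg] [mw _] iw eqw].
have mv := measurable_finite_potential mV.
have mw' : measurable_fun setT (w \_ O) := H0_meas hg.
(* Integrability makes [V w] finite almost everywhere, which at a pole is possible only if [w] is
   [0]. *)
have Pw : {ae mu, forall x, P x -> (w \_ O) x = 0}.
  apply: filterS (integrable_ae measurable_dom iw) => x fx [Ox Vx].
  by rewrite patch_in//; apply: (potential_fin (fx Ox) Vx).
have mvw : measurable_fun setT (fun x => v x * (w \_ O) x) by exact: measurable_funM.
have lvw : l1 mu (fun x => v x * (w \_ O) x).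
  apply: (integrable_ae_eq _ _ ((integrable_mkcond _ measurable_dom).1 iw)).
    exact/measurable_EFinP.
  apply: filterS Pw => x Px; have [Ox|nO] := pselect (O x).
    rewrite patchE mem_set//= -(@potential_mulE V x)//; [by rewrite patch_in|exact: V0|].
    by move=> Vx; apply: Px.
  by rewrite epatch_indic /= indicE memNset// mule0 patch_out// mulr0.
(* Truncation turns the almost everywhere bounds on [f] into bounds at every point. *)
pose f' x := Num.min (Num.max ((f \_ O) x) 0) `|A|.
have mf' : measurable_fun setT f'.
  by apply: measurable_minr => //; apply: measurable_maxr => //; exact/measurable_patch.
have f'_ge0 x : 0 <= f' x by rewrite le_min le_max lexx orbT normr_ge0.
have ff' : {ae mu, forall x, O x -> f x = f' x}.
  apply: filterS2 fA f0 => x h1 h2 Ox; rewrite /f' patch_in// (max_idPl (h2 Ox)).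
  apply/esym/min_idPl; apply: (le_trans (ler_norm _)); apply: (le_trans (h1 Ox)); exact: ler_norm.
exists f', g; split => //; split => //.
  by split => //; exists `|A| => x; rewrite ge_min lexx orbT.
move=> phi tphi; have := eqw phi tphi.
have [l1l <-] := integr_laplacian hg tphi.
rewrite (integral_dom l1l); last 2 first.
- by move=> x nO; rewrite patch_out// mul0r oppr0.
- by move=> x Ox; rewrite patch_in.
have -> : (\int[mu]_(x in O) (V x * (w x)%:E * (phi x)%:E) =
    \int[mu]_(x in O) (V x * ((w \_ O) x)%:E * (phi x)%:E))%E.
  by apply: eq_integral => x; rewrite inE => Ox; rewrite patch_in.
rewrite (integral_potential mV V0 mw' Pw lvw tphi).
have lf' : l1 mu (fun x => f' x * phi x).
  under eq_fun do rewrite mulrC; apply: (@l1_mul_bd _ _ _ f' `|A|) (test_l1 tphi) => // x.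
  by rewrite ger0_norm// ge_min lexx orbT.
have -> : (\int[mu]_(x in O) (f x * phi x)%:E = (\int[mu]_x (f' x * phi x))%:E)%E.
  rewrite -(@integral_dom (fun x => (f' x * phi x)%:E) _ lf')//; last first.
    by move=> x nO; rewrite (test_out tphi nO) mulr0.
  have mphi : measurable_fun O phi by apply: measurable_funTS; exact: test_meas tphi.
  apply: ae_eq_integral; first exact: measurable_dom.
  - by apply/measurable_EFinP; exact: measurable_funM.
  - by apply/measurable_EFinP; apply: measurable_funM => //; exact: measurable_funTS.
  - by apply: filterS ff' => x h Ox; rewrite h.
by rewrite -EFinD; case.
Qed.

(** Sign and bound of [w] hold almost everywhere and are imposed at every point by truncation. The
    last clause keeps the original [w] at hand, since the theorem speaks of its own precise
    values. *)
Lemma schroedinger_sol f w : measurable_fun O V -> (forall x, O x -> (0 <= V x)%E) ->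
  Linfty O f -> ae_nonneg O f -> schroedinger_solution O V f w ->
  exists f' w' g, [/\ sol D v P f' w' g, {ae mu, forall x, (w \_ O) x = w' x} &
    exists g', H0 D (w \_ O) g'].
Proof.
move=> mV V0 hf f0 hs; have [f' [g [s Pw]]] := schroedinger_weak_sol mV V0 hf f0 hs.
have hg := sol_H0 s; have mw := H0_meas hg.
have w0 := weak_sol_ge0 (fun x => finite_potential_ge0 x V0) s.
have [_ [_ [C wC]] _ _] := hs.
pose w' x := Num.min (Num.max ((w \_ O) x) 0) `|C|.
have ww' : {ae mu, forall x, (w \_ O) x = w' x}.
  apply: filterS2 w0 wC => x h1 h2; rewrite /w' (max_idPl h1); apply/esym/min_idPl.
  have [Ox|nO] := pselect (O x); last by rewrite patch_out.
  rewrite patch_in//; apply: (le_trans (ler_norm _)); apply: (le_trans (h2 Ox)); exact: ler_norm.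
exists f', w', g; split => //; last by exists g.
split.
- apply: (weak_sol_ae_eq (measurable_finite_potential mV) s) => //.
    by apply: measurable_minr => //; exact: measurable_maxr.
  by move=> x nO; rewrite /w' patch_out// maxxx; apply/min_idPl.
- by move=> x; rewrite le_min le_max lexx orbT normr_ge0.
- by exists `|C| => x; rewrite ge_min lexx orbT.
- by apply: filterS2 Pw ww' => x h1 h2 Px; rewrite -h2 h1.
Qed.

Lemma sol_schroedinger f w g : measurable_fun O V -> (forall x, O x -> (0 <= V x)%E) ->
  sol D v P f w g -> [/\ Linfty O f, ae_nonneg O f & schroedinger_solution O V f w].
Proof.
move=> mV V0 s; have hw := sol_H0 s; have wE := H0_patch hw; have mw := H0_meas hw.
have [f0 [A fA]] := sol_rhs s; have mf := sol_meas s; have [C wC] := sol_bd s.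
split; first split; first exact: measurable_funTS.
- by exists A; apply: aeW => x _; rewrite ger0_norm.
- by apply: aeW => x _.
split.
- exact: H0_W012 hw.
- split; first exact: measurable_funTS.
  by exists C; apply: aeW => x _; rewrite ger0_norm// (sol_ge0 s).
- apply/(integrable_mkcond _ measurable_dom).
  apply: (@integrable_ae_eq (EFin \o (fun x => v x * w x))); last exact: sol_l1 s.
    apply/(measurable_restrictT _ measurable_dom); apply: emeasurable_funM => //.
    by apply/measurable_EFinP; exact: measurable_funTS.
  apply: filterS (sol_pole s) => x Px; have [Ox|nO] := pselect (O x).
    rewrite patchE mem_set// (@potential_mulE V x (w x))//; first exact: V0.
    by move=> Vx; apply: Px.
  by rewrite /= epatch_indic /= indicE memNset// mule0 (H0_out hw nO) mulr0.
- move=> phi tphi; have [l1l El] := integr_laplacian hw tphi.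
  rewrite (integral_dom l1l)//; last by move=> x nO; rewrite (H0_out hw nO) mul0r oppr0.
  rewrite (integral_potential mV V0 mw (sol_pole s) (sol_l1 s) tphi).
  have lf : l1 mu (fun x => f x * phi x).
    under eq_fun do rewrite mulrC; apply: (@l1_mul_bd _ _ _ f A) (test_l1 tphi) => // x.
    by rewrite ger0_norm.
  rewrite (@integral_dom _ (fun x => f x * phi x))//; last first.
    by move=> x nO; rewrite (test_out tphi nO) mulr0.
  by rewrite El -EFinD (sol_eq s tphi).
Qed.

End schroedinger_solutions.
End restriction.

Theorem theorem1p1 (R : realType) (n : nat) (Omega : set 'rV[R]_n.+1)
  (Omega_open : open Omega) (Omega_bounded : bounded_set Omega)
  (Omega_connected : connected Omega) (Omega_smooth : smooth_boundary Omega)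
  (V : 'rV[R]_n.+1 -> \bar R)
  (V_borel : measurable_fun Omega V)
  (V_ge0 : forall x, Omega x -> (0 <= V x)%E) :
  let Z := universal_zero_set Omega V in
  sobolev_open Omega (Omega `\` Z) /\
  exists C : set (set 'rV[R]_n.+1),
    unique (sobolev_decomposition Omega (Omega `\` Z)) C /\
    forall f w, Linfty Omega f -> ae_nonneg Omega f ->
      schroedinger_solution Omega V f w ->
      forall D, C D ->
        (forall x, D x -> precise_pos w x) \/
        (forall x, D x -> precise_value w x 0).
Proof.
move=> Z.
have [B hB] : exists B : R, Omega `<=` box B.
  have [M [_ hM]] := Omega_bounded; exists (M + 1) => x Ox i.
  apply: (le_trans (coord_le_norm x i)); apply: hM => //; by rewrite ltrDl.
pose D : bdomain R n.+1 := BDomain Omega_open hB.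
have mv := @measurable_finite_potential R n D V V_borel.
have v0 x := @finite_potential_ge0 R n D V x V_ge0.
have [f0 [w0 [g0 [s0 hmax]]]] := exists_sol_max_support D (poles D V) mv v0.
have [M M0 fM] := sol_bound s0.
have [g0' su0] := sol_subsol v0 M0 fM s0.
have [h0 p0] := subsol_pw M0 su0.
have hw0 := subsol_H0 su0.
have hats f w : Linfty Omega f -> ae_nonneg Omega f -> schroedinger_solution Omega V f w ->
    exists f' w' g h, [/\ sol D (finite_potential D V) (poles D V) f' w' g, pw D w' h &
      forall x (c : R), Omega x -> precise_value w x c <-> c = h x].
  move=> hf hf0 hs; have [f' [w' [g [s ww' [g' hg']]]]] := @schroedinger_sol R n D V f w V_borel V_ge0 hf hf0 hs.
  have [M' M'0 fM'] := sol_bound s; have [g'' su] := sol_subsol v0 M'0 fM' s.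
  have [h ph] := subsol_pw M'0 su; exists f', w', g, h; split => // x c Ox.
  apply: (@precise_value_pw R n D w g' h x c hg' _ Ox) => y Oy.
  apply: (lebpt_ae_eq (H0_loc (sol_H0 s)) (H0_loc hg') _ (ph y Oy)).
  by apply: filterS ww' => z ->.
have ZE : Omega `\` Z = [set x | dom D x /\ 0 < h0 x].
  apply/seteqP; split => x [Ox].
    move=> nZ; split => //; rewrite lt_neqAle (pw_ge0 hw0 (sol_ge0 s0) p0 Ox) andbT.
    apply/eqP => /esym hx0; apply: nZ; split => // w f hf hf0 hs.
    have [f' [w' [g [h [s ph hP]]]]] := hats f w hf hf0 hs; apply/(hP x 0 Ox).
    by rewrite (sol_max_hat v0 s0 s (hmax _ _ _ s) p0 ph Ox hx0).
  move=> hx; split => // -[_ /(_ w0 f0)].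
  have [hf hf0 hs] := @sol_schroedinger R n D V f0 w0 g0 V_borel V_ge0 s0.
  move=> /(_ hf hf0 hs).
  have w0E := H0_patch hw0; have hw0' := hw0; rewrite -w0E in hw0'.
  have p0' : pw D (w0 \_ (dom D)) h0 by rewrite w0E.
  by move=> /(precise_value_pw _ hw0' p0' Ox) hx0; rewrite -hx0 ltxx in hx.
rewrite ZE; split.
  apply/(@sopenP R n D); exists w0, g0', h0; split => //; exact: sol_ge0 s0.
have [C [dC uC]] := unique_decomposition M0 su0 p0.
exists C; split.
  split; first exact/(@sdecompP R n D).
  by move=> C' /(@sdecompP R n D); exact: uC.
move=> f w hf hf0 hs A CA.
have [f' [w' [g [h [s ph hP]]]]] := hats f w hf hf0 hs.
have [_ _ CG hC] := dC; have [_ sA [AO cA]] := hC A CA.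
have AG x : A x -> 0 < h0 x.
  move=> Ax; have : (\bigcup_(B in C) B) x by exists A.
  by rewrite CG => -[].
have h_ge0 x : Omega x -> 0 <= h x := pw_ge0 (sol_H0 s) (sol_ge0 s) ph.
(* [A] is covered by the set where [h] is positive and the part of the complement of [Z] where [h]
   vanishes. Both are Sobolev-open and they are disjoint, so connectedness of [A] selects one of
   them. *)
have [|||Apos|Azero] := cA [set x | Omega x /\ 0 < h x] _ _ (sopen_sol_zero v0 s0 s p0 ph).
- by exists w', g, h; split => //; [exact: sol_H0 s|exact: sol_ge0 s].
- by apply/seteqP; split => // x [[_ h1] [_ [_ h2]]]; rewrite h2 ltxx in h1.
- move=> x Ax; have Ox := AO x Ax; have := h_ge0 x Ox; rewrite le_eqVlt => /predU1P[hx0|hx].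
    by right; split => //; split => //; exact: AG.
  by left.
- by left => x /Apos[Ox hx]; exists (h x) => //; apply/hP.
- by right => x /Azero[Ox [_ hx0]]; apply/hP.
Qed.
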